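(* Let $\mathcal{G}_3$ be the set of germs $(M,p)\in\mathcal{G}$ such that $p$ is a timelike umbilic point of $M$ and is a non-Morse singularity of the $LPL$. For generic $(M,p)\in\mathcal{G}_3$ the following hold. (1) The $LPL$ has an $A_3^-$-singularity at $p$. (2) In a generic 1-parameter family of surfaces $M_t$ with $M_0=M$, the $LPL$ bifurcates near $p$ as follows: for $t\neq0$ small of one sign, $LPL_t$ consists of two regular curves crossing transversally at exactly two points (so it has exactly two singularities, both of type $A_1^-$); for $t\ne0$ small of the other sign, $LPL_t$ consists of two disjoint regular curves.
   Context: Minkowski space $\mathbb{R}^3_1$ is $\mathbb{R}^3$ with $\langle \mathbf{u},\mathbf{v}\rangle=u_0v_0+u_1v_1-u_2v_2$. The vector product is defined by $\langle \mathbf a\times \mathbf b,\mathbf c\rangle=\det(\mathbf a,\mathbf b,\mathbf c)$. For a smooth regular surface $M\subset\mathbb{R}^3_1$ with local parametrization $\mathbf{x}(u,v)$, put $E=\langle \mathbf{x}_u,\mathbf{x}_u\rangle$, $F=\langle \mathbf{x}_u,\mathbf{x}_v\rangle$, $G=\langle \mathbf{x}_v,\mathbf{x}_v\rangle$, $\bar l=\langle \mathbf{x}_u\times\mathbf{x}_v,\mathbf{x}_{uu}\rangle$, $\bar m=\langle \mathbf{x}_u\times\mathbf{x}_v,\mathbf{x}_{uv}\rangle$, $\bar n=\langle \mathbf{x}_u\times\mathbf{x}_v,\mathbf{x}_{vv}\rangle$, $\delta=F^2-EG$, $\tilde\delta=(E\bar n-G\bar l)^2-4(F\bar n-G\bar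 m)(E\bar m-F\bar l)$. The Lorentzian region is $\{\delta>0\}$. The $LPL$ (lightlike principal locus) is the zero set of $\tilde\delta$. A timelike umbilic point is a point of the Lorentzian region at which the shape operator $-d\mathbf{N}$ is a multiple of the identity, where $\mathbf N=\mathbf{x}_u\times\mathbf{x}_v/\|\mathbf{x}_u\times\mathbf{x}_v\|$. A singularity of the $LPL$ is a point of the $LPL$ where $d\tilde\delta=0$; it is Morse if the Hessian of $\tilde\delta$ there is nondegenerate. The $LPL$ has an $A_k^{-}$-singularity ($k=1,3$) if the germ of $\tilde\delta$ is, up to a diffeomorphism germ of the source, $\pm(x^2-y^{k+1})$. Genericity: $\mathcal{G}$ is the set of germs $(M,p)$ of smooth surfaces $M\subset\mathbb{R}^3_1$ at $p\in M$, identified with the set of germs of local parametrizations $(\mathbb{R}^2,0)\to(\mathbb{R}^3_1,p)$, $p\in \mathbb{R}^3_1$, with the Whitney topology, modulo diffeomorphism germs of the source $(\mathbb{R}^2,0)$ (quotient topology). A property holds for generic $(M,p)$ in a subset $\tilde{\mathcal{G}}\subset\mathcal{G}$ if the set of $(M,p)\in\tilde{\mathcal{G}}$ satisfying it is open and dense in $\tilde{\mathcal{G}}$ (induced topology). Families: a 1-parameter family $M_t$, $t\in(\mathbb{R},0)$, with $M_0=M$ is a family of surfaces given, when $M$ is the graph of $f$ over a coordinate plane (Monge form), by the graphs of $f+h(\cdot,\cdot,t)$ with $h$ smooth and $h(\cdot,\cdot,0)=0$; it is generic if $h$ satisfies suitable open and dense conditions. $LPL_t$ denotes the $LPL$ of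 $M_t$; all assertions are local, in a neighbourhood of $p$. *)

(* Defs.v *)
From HB Require Import structures.
From mathcomp Require Import all_boot all_order all_algebra.
From mathcomp Require Import all_classical all_reals all_analysis.
From mathcomp Require Import ring.

Set Implicit Arguments.
Unset Strict Implicit.
Unset Printing Implicit Defensive.
Import Order.TTheory GRing.Theory Num.Theory.
Import numFieldNormedType.Exports.
Local Open Scope classical_set_scope.
Local Open Scope ring_scope.

(** * Smooth maps and diffeomorphism germs *)

Section Smooth.
Context {R : realType} {n : nat} {W : normedModType R}.

Definition partial (i : 'I_n.+1) (f : 'rV[R]_n.+1 -> W) : 'rV[R]_n.+1 -> W :=
  fun p => 'D_(delta_mx 0 i) f p.

Definition partials (s : seq 'I_n.+1) (f : 'rV[R]_n.+1 -> W) :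
  'rV[R]_n.+1 -> W := foldr partial f s.

(* C^oo on a neighbourhood of p *)
Definition smooth_near (p : 'rV[R]_n.+1) (f : 'rV[R]_n.+1 -> W) : Prop :=
  \forall q \near p, forall s : seq 'I_n.+1,
    (forall i, derivable (partials s f) q (delta_mx 0 i)) /\
    {for q, continuous (partials s f)}.

End Smooth.

Definition diffeo_germ {R : realType} (p q : 'rV[R]_2)
    (phi : 'rV[R]_2 -> 'rV[R]_2) : Prop :=
  exists psi : 'rV[R]_2 -> 'rV[R]_2,
    [/\ smooth_near p phi, smooth_near q psi, phi p = q,
        \forall w \near p, psi (phi w) = w
      & \forall z \near q, phi (psi z) = z].

(** * Lorentzian geometry of surfaces in Minkowski 3-space *)

Section Minkowski.
Context {R : realType}.
Implicit Types a b c u v : 'rV[R]_3.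

Definition mink u v : R := u 0 0 * v 0 0 + u 0 1 * v 0 1 - u 0 2 * v 0 2.

Definition mnorm u : R := Num.sqrt `|mink u u|.

Definition det3 a b c : R := \det (col_mx a (col_mx b c) : 'M[R]_3).

(* the unique vector with <a x b, c> = det (a, b, c), see [mink_mcross] *)
Definition mcross a b : 'rV[R]_3 :=
  \row_k ((if k == 2 then - 1 else 1) * det3 a b (delta_mx 0 k)).

Lemma det3E a b c : det3 a b c =
  a 0 0 * (b 0 1 * c 0 2 - b 0 2 * c 0 1)
  - a 0 1 * (b 0 0 * c 0 2 - b 0 2 * c 0 0)
  + a 0 2 * (b 0 0 * c 0 1 - b 0 1 * c 0 0).
Proof.
have ord3 (j k : 'I_3) : val j = val k -> j = k by exact: val_inj.
pose M : 'M[R]_3 := col_mx a (col_mx b c).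
have Ma j : M 0 j = a 0 j.
  by rewrite -(col_mxEu a (col_mx b c)); congr (M _ _); exact: ord3.
have Mb j : M 1 j = b 0 j.
  rewrite -(col_mxEu b c) -(col_mxEd a (col_mx b c)).
  by congr (M _ _); exact: ord3.
have Mc j : M 2 j = c 0 j.
  rewrite -(col_mxEd b c) -(col_mxEd a (col_mx b c)).
  by congr (M _ _); exact: ord3.
rewrite /det3 -/M; clearbody M; rewrite (expand_det_row _ 0) !big_ord_recl big_ord0.
rewrite /cofactor !(expand_det_row _ ord0) !big_ord_recl !big_ord0.
rewrite /cofactor !det_mx11 !mxE /=.
pose m r k := M (inord r) (inord k).
have mE (j k : 'I_3) : M j k = m j k by rewrite /m !inord_val.
rewrite -!Ma -!Mb -!Mc !mE /= /bump /= !add0n ?addn0 ?modnn.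
rewrite -[(1 %% 3)%N]/1%N -[((1 + 1) %% 3)%N]/2%N.
by rewrite !expr0 !expr1 sqrrN expr1n; ring.
Qed.

Lemma mink_mcross a b c : mink (mcross a b) c = det3 a b c.
Proof. rewrite /mink !mxE !det3E !mxE /=; ring. Qed.

Implicit Types (x : 'rV[R]_2 -> 'rV[R]_3) (w : 'rV[R]_2).

Definition E_ x w := mink (partial 0 x w) (partial 0 x w).
Definition F_ x w := mink (partial 0 x w) (partial 1 x w).
Definition G_ x w := mink (partial 1 x w) (partial 1 x w).

Definition cross_uv x w := mcross (partial 0 x w) (partial 1 x w).
Definition lbar x w := mink (cross_uv x w) (partials [:: 0; 0] x w).
Definition mbar x w := mink (cross_uv x w) (partials [:: 0; 1] x w).
Definition nbar x w := mink (cross_uv x w) (partials [:: 1; 1] x w).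

Definition delta x w : R := F_ x w ^+ 2 - E_ x w * G_ x w.

Definition tdelta x w : R :=
  (E_ x w * nbar x w - G_ x w * lbar x w) ^+ 2
  - 4 * (F_ x w * nbar x w - G_ x w * mbar x w)
      * (E_ x w * mbar x w - F_ x w * lbar x w).

Definition LPL x : set 'rV[R]_2 := [set w | tdelta x w = 0].

Definition unit_normal x w : 'rV[R]_3 :=
  (mnorm (cross_uv x w))^-1 *: cross_uv x w.

(* the shape operator - dN is k times the identity *)
Definition timelike_umbilic x w : Prop :=
  0 < delta x w /\
  exists k : R, forall i, - partial i (unit_normal x) w = k *: partial i x w.

Definition LPL_singularity x w : Prop :=
  LPL x w /\ forall i, partial i (tdelta x) w = 0.

Definition hessian (g : 'rV[R]_2 -> R) w : 'M[R]_2 :=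
  \matrix_(i, j) partials [:: i; j] g w.

Definition morse_singularity x w : Prop :=
  LPL_singularity x w /\ \det (hessian (tdelta x) w) != 0.

(* The LPL has an A_k^- singularity at w (used for k odd). *)
Definition A_minus (k : nat) x w : Prop :=
  exists (phi : 'rV[R]_2 -> 'rV[R]_2) (b : bool),
    diffeo_germ 0 w phi /\
    \forall z \near (0 : 'rV[R]_2),
      tdelta x (phi z) = (-1) ^+ b * (z 0 0 ^+ 2 - z 0 1 ^+ k.+1).

End Minkowski.

(** * Germs of surfaces and their topology *)

Definition generic_in {T : topologicalType} (D P : set T) : Prop :=
  (exists2 O : set T, open O & D `&` P = D `&` O) /\
  D `<=` closure (D `&` P).

(* Representatives of germs of local parametrizations (R^2,0) -> (R^3_1,p),
   p = x 0 arbitrary.  Two representatives of the same germ are identified in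
   [surface_germ] below, by [reparam] with the identity. *)
Record param (R : realType) := Param {
  param_fun :> 'rV[R]_2 -> 'rV[R]_3 ;
  param_smooth : smooth_near 0 param_fun ;
  param_immersive :
    row_free (col_mx (partial 0 param_fun 0) (partial 1 param_fun 0)) }.

HB.instance Definition _ (R : realType) := gen_eqMixin (param R).
HB.instance Definition _ (R : realType) := gen_choiceMixin (param R).

(* The Whitney topology on germs at 0: it is generated by the sets
   {f | j^k f(0) \in U}, for k a natural number and U open in the k-jets, that
   is, it is the initial topology for the infinite jet at 0, the space of
   infinite jets having the product topology. *)
Definition jet {R : realType} {n : nat} {W : normedModType R}
    (f : 'rV[R]_n.+1 -> W) : prod_topology (fun _ : seq 'I_n.+1 => W) :=
  fun s => partials s f 0.

HB.instance Definition _ (R : realType) :=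
  Topological.copy (param R) (initial_topology (fun x : param R => jet x)).

Definition reparam {R : realType} (x y : param R) : Prop :=
  exists2 phi, diffeo_germ 0 0 phi &
    \forall w \near (0 : 'rV[R]_2), y w = x (phi w).

(* A germ (M,p) is the class of its local parametrizations modulo
   diffeomorphism germs of the source: [local_param M x] says that x is a local
   parametrization of M at p = x 0. *)
Record surface_germ (R : realType) := SurfaceGerm {
  local_param :> set (param R) ;
  surface_germP : exists x, local_param = reparam x }.

HB.instance Definition _ (R : realType) := gen_eqMixin (surface_germ R).
HB.instance Definition _ (R : realType) := gen_choiceMixin (surface_germ R).

Section QuotientTopology.
Context {R : realType}.

Definition germ_of (x : param R) : surface_germ R :=
  SurfaceGerm (ex_intro _ x erefl).

Definition surface_germ_open (U : set (surface_germ R)) : Prop :=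
  open (germ_of @^-1` U).

Let openT : surface_germ_open setT.
Proof. by rewrite /surface_germ_open preimage_setT; exact: openT. Qed.

Let openI : setI_closed surface_germ_open.
Proof. by move=> A B; exact: openI. Qed.

Let open_bigU (I : Type) (f : I -> set (surface_germ R)) :
  (forall i, surface_germ_open (f i)) -> surface_germ_open (\bigcup_i f i).
Proof. by move=> fo; apply: bigcup_open => i _; exact: fo. Qed.

HB.instance Definition _ :=
  isOpenTopological.Build (surface_germ R) openT openI open_bigU.

End QuotientTopology.

Definition G3 {R : realType} : set (surface_germ R) :=
  [set M | exists2 x, local_param M x &
     [/\ timelike_umbilic x 0, LPL_singularity x 0 & ~ morse_singularity x 0]].

(** * One-parameter families and the bifurcation of the LPL *)

(* The graph u_i = f over the coordinate plane of the other two coordinates, the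
   origin of R^3_1 being translated to p. *)
Definition monge {R : realType} (i : 'I_3) (p : 'rV[R]_3) (f : 'rV[R]_2 -> R) :
    'rV[R]_2 -> 'rV[R]_3 :=
  fun w => p + \row_k (if unlift i k is Some j then w 0 j else f w).

Definition monge_form {R : realType} (M : surface_germ R) i p f : Prop :=
  f 0 = 0 /\
  exists2 x, local_param M x &
    \forall w \near (0 : 'rV[R]_2), x w = monge i p f w.

Definition uvt {R : realType} (w : 'rV[R]_2) (t : R) : 'rV[R]_3 :=
  row_mx w (const_mx t : 'rV[R]_1).

(* representatives of germs of smooth functions h(u,v,t) with h(.,.,0) = 0 *)
Record deformation (R : realType) := Deformation {
  deform_fun :> 'rV[R]_3 -> R ;
  deform_smooth : smooth_near 0 deform_fun ;
  deform0 : \forall w \near (0 : 'rV[R]_2), deform_fun (uvt w 0) = 0 }.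

HB.instance Definition _ (R : realType) := gen_eqMixin (deformation R).
HB.instance Definition _ (R : realType) := gen_choiceMixin (deformation R).
HB.instance Definition _ (R : realType) :=
  Topological.copy (deformation R)
    (initial_topology (fun h : deformation R => jet h)).

Definition deform {R : realType} (f : 'rV[R]_2 -> R) (h : 'rV[R]_3 -> R)
    (t : R) : 'rV[R]_2 -> R :=
  fun w => f w + h (uvt w t).

Section Bifurcation.
Context {R : realType}.
Implicit Types (U V : set 'rV[R]_2) (x : 'rV[R]_2 -> 'rV[R]_3).

Local Notation I := (`]-1, 1[%classic : set R).

(* g restricted to ]-1, 1[ parametrizes a regular curve of U, i.e. it is a
   smooth embedding with closed image in U. *)
Definition regular_curve U (g : R -> 'rV[R]_2) : Prop :=
  [/\ forall n s, I s -> derivable (derive1n n g) s 1,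
      forall s, I s -> derive1 g s != 0,
      set_inj I g,
      forall s A, I s -> nbhs s A ->
        \forall w \near g s, (g @` I) w -> (g @` (A `&` I)) w
    & g @` I = U `&` closure (g @` I)].

Definition transversal (g1 g2 : R -> 'rV[R]_2) : Prop :=
  forall s1 s2, I s1 -> I s2 -> g1 s1 = g2 s2 ->
    row_free (col_mx (derive1 g1 s1) (derive1 g2 s2)).

Definition two_crossing_curves U x : Prop :=
  exists g1 g2 q1 q2,
    [/\ regular_curve U g1 /\ regular_curve U g2,
        U `&` LPL x = g1 @` I `|` g2 @` I,
        q1 != q2 /\ g1 @` I `&` g2 @` I = [set q1; q2],
        transversal g1 g2
      & [/\ U `&` LPL_singularity x = [set q1; q2],
            A_minus 1 x q1 & A_minus 1 x q2]].

Definition two_disjoint_curves U x : Prop :=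
  exists g1 g2,
    [/\ regular_curve U g1 /\ regular_curve U g2,
        U `&` LPL x = g1 @` I `|` g2 @` I,
        g1 @` I `&` g2 @` I = set0
      & U `&` LPL_singularity x = set0].

(* The sign b does not depend on the neighbourhood U, which is arbitrarily
   small, while the range of t depends on U. *)
Definition LPL_bifurcation (x_ : R -> 'rV[R]_2 -> 'rV[R]_3) : Prop :=
  exists b : bool, forall V, nbhs (0 : 'rV[R]_2) V ->
    exists U, [/\ open U, U 0, U `<=` V &
      \forall t \near (0 : R),
        (0 < (-1) ^+ b * t -> two_crossing_curves U (x_ t)) /\
        ((-1) ^+ b * t < 0 -> two_disjoint_curves U (x_ t))].

End Bifurcation.

(* Main.v *)
Require Import Defs.
From HB Require Import structures.
From mathcomp Require Import all_boot all_order all_algebra.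
From mathcomp Require Import all_classical all_reals all_analysis.
From mathcomp Require Import ring lra.

Set Implicit Arguments.
Unset Strict Implicit.
Unset Printing Implicit Defensive.
Import Order.TTheory GRing.Theory Num.Theory.
Import numFieldNormedType.Exports.
Local Open Scope classical_set_scope.
Local Open Scope ring_scope.

(** With D = F + s sqrt(delta), s = 1 or -1 chosen so that D is nonzero, the null
    vectors of the first fundamental form are (D, - E) and (- G, D), and tdelta,
    the resultant of the two fundamental forms, is P M / D^2, where P and M are
    the values of the second fundamental form on these vectors.  At a timelike
    umbilic point P = M = 0, and the singularity of P M is not Morse exactly when
    dP and dM are dependent.  The curves P = 0 and M = 0 are then generically
    regular with a contact of order exactly one, which is equivalent to tdelta
    being of type A_3^- and is an open condition on the 4-jet.  It is achieved by
    adding small multiples of cubic and quartic forms in the normal direction.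
    In a family, the restriction of M to the curves P = 0 is a function of one
    variable with a fold at 0 which depends on t; it is unfolded as soon as the
    two curves move apart with nonzero velocity, an open and dense condition on
    h.  Its zeros, two for one sign of t and none for the other, are the
    intersection points of the two curves. *)

(** [G3] is cut out by equations, so the open set witnessing genericity is supplied by the separate
    condition [contact], made of inequations on a finite jet. On [G3] the stated property must
    coincide with it; hence type A_3 is shown to force simple contact, not only to follow from it.
    The obstacle for density is that perturbations must stay in [G3], where the umbilic condition
    and the dependence of dP and dM are closed. Adding a function with vanishing 2-jet keeps the
    umbilic, and to leading order its second derivatives enter P and M only through their values on
    the two null vectors. For powers of linear forms these values are explicit: cubics are chosen to
    move dP and dM along one common direction, and quartics leave both fixed while changing the
    contact. The topology sees jets at one point only, so local statements are recovered from jets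
    by inverse functions and by division by coordinates. The inverse function theorem is obtained
    one coordinate at a time from the intermediate value theorem, and division from Taylor estimates
    without integrals. *)

(** * Mean value theorem along lines, and differentiability of C^1 functions *)

Section LineMVT.
Context {R : realType} {V : normedModType R}.

Lemma is_derive_line {W : normedModType R} (f : V -> W) (p v : V) (s : R) :
  derivable f (s *: v + p) v ->
  is_derive s 1 (fun t : R => f (t *: v + p)) ('D_v f (s *: v + p)).
Proof.
move=> df.
have e : (fun h : R => h^-1 *: (((fun t : R => f (t *: v + p)) \o shift s) (h *: 1)
            - f (s *: v + p))) =
         (fun h : R => h^-1 *: ((f \o shift (s *: v + p)) (h *: v) - f (s *: v + p))).
  apply/funext => h /=; congr (_ *: (f _ - _)).
  by rewrite [h *: 1]mulr1 scalerDl addrA.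
by apply: DeriveDef; rewrite /derivable /derive e.
Qed.

(** The step [a] may have either sign, so the proof splits on it; the intermediate parameter is
    controlled only in absolute value, which is all that later estimates need. *)
Lemma mvt_line (f : V -> R) (p v : V) (a : R) :
  (forall s : R, `|s| <= `|a| -> derivable f (s *: v + p) v) ->
  exists2 s : R, `|s| <= `|a| & f (a *: v + p) - f p = a * 'D_v f (s *: v + p).
Proof.
move=> df; pose g t := f (t *: v + p).
have dg (s : R) : `|s| <= `|a| -> is_derive s (1:R) g ('D_v f (s *: v + p)).
  by move=> sa; apply: is_derive_line; exact: df.
have cg (s : R) : `|s| <= `|a| -> {for s, continuous g}.
  move=> sa; apply/differentiable_continuous/derivable1_diffP.
  exact: (@ex_derive _ _ _ _ _ _ _ (dg _ sa)).
have g0 : f p = g 0 by rewrite /g scale0r add0r.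
have [a0|a0] := leP 0 a.
- have [||c] := @MVT_segment R g (fun s => 'D_v f (s *: v + p)) 0 a a0.
  + move=> x; rewrite in_itv /= => /andP[x0 xa]; apply: dg.
    by rewrite !ger0_norm// ltW.
  + apply: continuous_in_subspaceT => x; rewrite inE /= in_itv /= => /andP[x0 xa].
    by apply: cg; rewrite !ger0_norm.
  rewrite in_itv /= subr0 => /andP[c0 ca] gE; exists c; first by rewrite !ger0_norm.
  by rewrite g0 mulrC -gE.
- have [||c] := @MVT_segment R g (fun s => 'D_v f (s *: v + p)) a 0 (ltW a0).
  + move=> x; rewrite in_itv /= => /andP[xa x0]; apply: dg.
    by rewrite !ler0_norm ?lerN2 ltW.
  + apply: continuous_in_subspaceT => x; rewrite inE /= in_itv /= => /andP[xa x0].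
    by apply: cg; rewrite !ler0_norm ?lerN2 // ltW.
  rewrite in_itv /= sub0r => /andP[ca c0] gE; exists c.
    by rewrite !ler0_norm ?lerN2 // ltW.
  by rewrite g0 -opprB gE mulrN opprK mulrC.
Qed.

Lemma mvt_segment (f : V -> R) (p v : V) :
  (forall s : R, 0 <= s <= 1 -> derivable f (s *: v + p) v) ->
  exists2 s : R, 0 <= s <= 1 & f (v + p) - f p = 'D_v f (s *: v + p).
Proof.
move=> df; pose g t := f (t *: v + p).
have dg (s : R) : 0 <= s <= 1 -> is_derive s (1:R) g ('D_v f (s *: v + p)).
  by move=> sa; apply: is_derive_line; exact: df.
have [||c] := @MVT_segment R g (fun s => 'D_v f (s *: v + p)) 0 1 ler01.
- by move=> x; rewrite in_itv /= => /andP[x0 xa]; apply: dg; rewrite !ltW.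
- apply: continuous_in_subspaceT => x; rewrite inE /= in_itv /= => x01.
  apply/differentiable_continuous/derivable1_diffP.
  exact: (@ex_derive _ _ _ _ _ _ _ (dg _ x01)).
rewrite in_itv /= subr0 mulr1 /g scale1r scale0r add0r => c01 ->.
by exists c.
Qed.

End LineMVT.

Lemma differentiable_littleo {R : realType} {V W : normedModType R}
    (f : V -> W) (L : {linear V -> W}) (p : V) : continuous L ->
  (forall e : R, 0 < e ->
     \forall h \near 0, `|f (h + p) - (f p + L h)| <= e * `|h|) ->
  differentiable f p.
Proof.
move=> Lc small.
have step : f \o shift p = cst (f p) + L +o_ 0 id.
  by apply/eqaddoP => e e0; exact: small.
by apply/diff_locallyP; rewrite (diff_unique Lc step).
Qed.

Section C1.
Context {R : realType} {n : nat}.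
Implicit Types (f g : 'rV[R]_n.+1 -> R) (p q v : 'rV[R]_n.+1).

(** The increment is split into moves along the coordinate axes. On each of them the mean value
    theorem produces a partial derivative at a nearby point, within [e / n.+1] of its value at [p]
    by continuity. *)
Lemma C1_differentiable f p :
  (\forall q \near p, forall i, derivable f q (delta_mx 0 i)) ->
  (forall i, {for p, continuous (partial i f)}) ->
  differentiable f p.
Proof.
move=> df cf.
pose L v := \sum_i v 0 i * partial i f p.
have Ladd : linear L.
  move=> a u v; rewrite /L scaler_sumr -big_split /=; apply: eq_bigr => i _.
  by rewrite !mxE mulrDl -mulrA.
pose Llin : {linear 'rV[R]_n.+1 -> R^o} :=
  HB.pack L (GRing.isLinear.Build R 'rV[R]_n.+1 R^o *:%R L Ladd).
have Lc : continuous Llin.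
  rewrite /=; apply: continuous_big => [|i _ v]; first exact: add_continuous.
  apply: (@continuousM _ _ (fun v : 'rV[R]_n.+1 => v 0 i) (fun=> partial i f p)).
    exact: (@coord_continuous _ _ _ 0 i).
  exact: cst_continuous.
apply: (@differentiable_littleo R _ R^o f Llin p Lc) => _/posnumP[e].
  have e0 : 0 < e%:num / n.+1%:R by rewrite divr_gt0.
  have : \forall q \near p, forall i, derivable f q (delta_mx 0 i) /\
      `|partial i f p - partial i f q| < e%:num / n.+1%:R.
    near=> q => i; split; first by move: i; near: q.
    move: i; near: q; apply: filter_forall => i.
    by have /cvgrPdist_lt /(_ _ e0) := cf i.
  move/nbhs_ballP => [r r0 rP].
  near=> h.
  have hr : `|h| < r.
    near: h; apply/nbhs_ballP; exists r => //= h.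
    by rewrite -ball_normE /ball_ /= sub0r normrN.
  (* [c k] keeps the first [k] coordinates of [h], so consecutive points differ along one basis
     vector and the increment telescopes. *)
  pose c (k : nat) : 'rV[R]_n.+1 := \row_j (if (j < k)%N then h 0 j else 0).
  have ck (k : 'I_n.+1) : c k.+1 = h 0 k *: delta_mx 0 k + c k.
    apply/rowP => j; rewrite !mxE eqxx ltnS leq_eqVlt /=.
    rewrite -[(nat_of_ord j == k)]/(j == k).
    by have [->|jk] := eqVneq j k; rewrite ?ltnn ?mulr1 ?addr0 ?mulr0 ?add0r.
  have bnd (k : 'I_n.+1) (s : R) : `|s| <= `|h 0 k| ->
      ball p r (s *: delta_mx 0 k + (c k + p)).
    move=> sh; rewrite -ball_normE /ball_ /=; apply: le_lt_trans hr.
    rewrite addrA opprD addrCA subrr addr0 normrN.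
    rewrite [leRHS]/Num.Def.normr/= [leLHS]/Num.Def.normr/= !mx_normrE.
    apply: bigmax_le => [|[i j] _]; first by rewrite bigmax_idl le_max lexx.
    rewrite !mxE /= !ord1 eqxx.
    have hle m : `|h 0 m| <= \big[Num.max/0]_(i0 : 'I_1 * 'I_n.+1) `|h i0.1 i0.2|.
      exact: (le_bigmax _ (fun i0 : 'I_1 * 'I_n.+1 => `|h i0.1 i0.2|) (0, m)).
    have [->|jk] := eqVneq j k.
      by rewrite ltnn mulr1 addr0 (le_trans sh).
    rewrite mulr0 add0r; case: ifP => _; first exact: hle.
    by rewrite normr0 (le_trans _ (hle k)).
  have tele : f (h + p) - f p = \sum_(k < n.+1) (f (c k.+1 + p) - f (c k + p)).
    rewrite -(big_mkord xpredT (fun k => f (c k.+1 + p) - f (c k + p))).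
    rewrite telescope_sumr //; congr (f _ - f _).
      by congr (_ + _); apply/rowP => j; rewrite !mxE ltn_ord.
    by rewrite -[LHS]add0r; congr (_ + _); apply/rowP => j; rewrite !mxE.
  rewrite /= opprD addrA tele.
  rewrite /L -sumrB (le_trans (ler_norm_sum _ _ _)) //.
  have -> : e%:num * `|h| = \sum_(k < n.+1) (e%:num / n.+1%:R * `|h|).
    by rewrite sumr_const card_ord -mulr_natl; field.
  apply: ler_sum => k _; rewrite ck -[X in f X - _]addrA.
  have [s sh ->] := @mvt_line R _ f (c k + p) (delta_mx 0 k) (h 0 k)
    (fun s sh => (rP _ (bnd k s sh) k).1).
  rewrite -mulrBr normrM mulrC; apply: ler_pM => //.
    rewrite distrC; apply: ltW; exact: (rP _ (bnd k s sh) k).2.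
  rewrite [leRHS]/Num.Def.normr/= mx_normrE.
  exact: (le_bigmax _ (fun i0 : 'I_1 * 'I_n.+1 => `|h i0.1 i0.2|) (0, k)).
Unshelve. all: by end_near. Qed.

Lemma deriveE_partial f p v : differentiable f p ->
  'D_v f p = \sum_i v 0 i * partial i f p.
Proof.
move=> df; rewrite deriveE // [v in LHS]row_sum_delta linear_sum /=.
by apply: eq_bigr => i _; rewrite linearZ /= /partial deriveE.
Qed.

End C1.

Section Rows.
Context {R : realType} {n : nat}.

Lemma row_norm_le (v : 'rV[R]_n.+1) (e : R) :
  (`|v| <= e) = [forall i, `|v 0 i| <= e].
Proof.
rewrite [`|v|]/Num.Def.normr/= mx_normrE; apply/idP/forallP => [ve i|ve].
  apply: le_trans ve.
  exact: (le_bigmax _ (fun i0 : 'I_1 * 'I_n.+1 => `|v i0.1 i0.2|) (0, i)).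
apply: bigmax_le => [|[i j] _]; first exact: le_trans (ve 0).
by rewrite !ord1 /=; exact: ve.
Qed.

Lemma row_norm_lt (v : 'rV[R]_n.+1) (e : R) :
  (`|v| < e) = [forall i, `|v 0 i| < e].
Proof.
rewrite [`|v|]/Num.Def.normr/= mx_normrE; apply/idP/forallP => [ve i|ve].
  apply: le_lt_trans ve.
  exact: (le_bigmax _ (fun i0 : 'I_1 * 'I_n.+1 => `|v i0.1 i0.2|) (0, i)).
apply: bigmax_lt => [|[i j] _]; first exact: le_lt_trans (ve 0).
by rewrite !ord1 /=; exact: ve.
Qed.

Lemma row_cvgP (T : Type) (F : set_system T) (f : T -> 'rV[R]_n.+1) (l : 'rV[R]_n.+1) :
  Filter F -> f @ F --> l <-> forall i, f x 0 i @[x --> F] --> l 0 i.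
Proof.
move=> FF; split=> [fl i|fl].
  apply: (@cvg_comp _ _ _ f (fun v : 'rV[R]_n.+1 => v 0 i) F _ _ fl).
  exact: coord_continuous.
apply/cvgrPdist_lt => e e0; near=> x.
rewrite row_norm_lt; apply/forallP => i; rewrite !mxE.
move: i; near: x; apply: filter_forall => i.
by have /cvgrPdist_lt/(_ _ e0) := fl i.
Unshelve. all: by end_near. Qed.

Lemma row_continuous (T : topologicalType) (f : T -> 'rV[R]_n.+1) (x : T) :
  {for x, continuous f} <-> forall i, {for x, continuous (fun y => f y 0 i)}.
Proof. exact: row_cvgP. Qed.

Lemma row_differentiable (V : normedModType R) (f : V -> 'rV[R]_n.+1) x :
  (forall i, differentiable (fun y => f y 0 i) x) -> differentiable f x.
Proof.
move=> df; have -> : f = \sum_i (fun y => f y 0 i *: 'e_i).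
  by apply/funext => y; rewrite fct_sumE -row_sum_delta.
by apply: differentiable_sum => i; exact: differentiableZl.
Qed.

Lemma coord_differentiable (p : 'rV[R]_n.+1) i :
  differentiable (fun v : 'rV[R]_n.+1 => v 0 i) p.
Proof. exact: differentiable_coord. Qed.

End Rows.

(** * Rules for partial derivatives *)

Section PartialRules.
Context {R : realType} {n : nat}.
Implicit Types (f g : 'rV[R]_n.+1 -> R) (p q : 'rV[R]_n.+1).

Lemma near_openP (T : topologicalType) (p : T) (P : set T) :
  (\forall q \near p, P q) <-> exists U, [/\ open U, U p & U `<=` P].
Proof.
rewrite -[(\forall q \near p, P q)]/(nbhs p P) nbhsE.
by split=> [[U [oU Up] UP]|[U [oU Up UP]]]; exists U.
Qed.

Lemma near_eq_continuous (S T : topologicalType) (f g : S -> T) (p : S) :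
  (\near p, f p = g p) -> {for p, continuous f} -> {for p, continuous g}.
Proof.
move=> fg cf; rewrite /prop_for /continuous_at -(nbhs_singleton fg).
by apply: cvg_trans cf; exact: near_eq_cvg.
Qed.

Lemma near_eq_partial {W : normedModType R} (f g : 'rV[R]_n.+1 -> W) p i :
  (\near p, f p = g p) -> partial i f p = partial i g p.
Proof. exact: near_eq_derive. Qed.

Lemma near_eq_partials {W : normedModType R} (f g : 'rV[R]_n.+1 -> W) p s :
  (\near p, f p = g p) -> \near p, partials s f p = partials s g p.
Proof.
move=> fg; elim: s => [//|i s IH] /=; near=> q; apply: near_eq_partial.
by near: q; exact: nbhs_interior.
Unshelve. all: by end_near. Qed.

Lemma partialD f g p i : differentiable f p -> differentiable g p ->
  partial i (fun w => f w + g w) p = partial i f p + partial i g p.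
Proof. by move=> df dg; rewrite /partial -deriveD; first by []; exact: diff_derivable. Qed.

Lemma partialN f p i : differentiable f p ->
  partial i (fun w => - f w) p = - partial i f p.
Proof. by move=> df; rewrite /partial -deriveN; first by []; exact: diff_derivable. Qed.

Lemma partialB f g p i : differentiable f p -> differentiable g p ->
  partial i (fun w => f w - g w) p = partial i f p - partial i g p.
Proof. by move=> df dg; rewrite /partial -deriveB; first by []; exact: diff_derivable. Qed.

Lemma partialM f g p i : differentiable f p -> differentiable g p ->
  partial i (fun w => f w * g w) p = partial i f p * g p + f p * partial i g p.
Proof.
move=> df dg; rewrite /partial.
rewrite (_ : (fun w => _) = f * g) // deriveM; try exact: diff_derivable.
by rewrite addrC [X in X + _]mulrC.
Qed.

Lemma partial_cst (c : R) p i : partial i (fun=> c) p = 0.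
Proof. exact: derive_cst. Qed.

Lemma partialZ (c : R) f p i : differentiable f p ->
  partial i (fun w => c * f w) p = c * partial i f p.
Proof.
by move=> df; rewrite partialM ?partial_cst ?mul0r ?add0r //; exact: differentiable_cst.
Qed.

Lemma partial_coord p i j : partial i (fun w : 'rV[R]_n.+1 => w 0 j) p = (i == j)%:R.
Proof.
rewrite /partial deriveE; last exact: coord_differentiable.
have lin : linear (fun w : 'rV[R]_n.+1 => w 0 j : R^o) by move=> a u v; rewrite !mxE.
pose L : {linear 'rV[R]_n.+1 -> R^o} :=
  HB.pack (fun w : 'rV[R]_n.+1 => w 0 j : R^o)
    (GRing.isLinear.Build R 'rV[R]_n.+1 R^o *:%R _ lin).
rewrite (@diff_lin _ _ _ L) /=; last exact: coord_continuous.
by rewrite mxE eqxx eq_sym.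
Qed.

Lemma partialV f p i : differentiable f p -> f p != 0 ->
  partial i (fun w => (f w)^-1) p = - partial i f p * (f p)^-1 ^+ 2.
Proof.
move=> df f0; rewrite /partial.
rewrite deriveV //; last exact: diff_derivable.
by rewrite -[_ *: _]/(_ * _) exprVn mulNr mulrC mulNr.
Qed.

Lemma partial_sqrt f p i : differentiable f p -> 0 < f p ->
  partial i (fun w => Num.sqrt (f w)) p = partial i f p / (2 * Num.sqrt (f p)).
Proof.
move=> df f0; rewrite /partial.
have ds : derivable (@Num.sqrt R) (f p) 1.
  exact: (@ex_derive _ _ _ _ _ _ _ (is_derive1_sqrt f0)).
have ds' : differentiable (@Num.sqrt R) (f p) by exact/derivable1_diffP.
have dc : differentiable (Num.sqrt \o f) p by exact: differentiable_comp.
rewrite [LHS](deriveE _ dc) diff_comp //= -(deriveE _ df) (deriv1E ds) derive1E.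
by rewrite (@derive_val _ _ _ _ _ _ _ (is_derive1_sqrt f0)).
Qed.

End PartialRules.

Lemma partial_comp {R : realType} {m n : nat} (f : 'rV[R]_n.+1 -> R)
    (g : 'rV[R]_m.+1 -> 'rV[R]_n.+1) p i :
  differentiable f (g p) -> (forall j, differentiable (fun w => g w 0 j) p) ->
  partial i (fun w => f (g w)) p =
  \sum_j partial j f (g p) * partial i (fun w => g w 0 j) p.
Proof.
move=> df dg; have dg' : differentiable g p by exact: row_differentiable.
have dc : differentiable (f \o g) p by exact: differentiable_comp.
rewrite /partial [LHS](deriveE _ dc) diff_comp //= -(deriveE _ df) (deriveE_partial _ df).
apply: eq_bigr => j _; rewrite -deriveE // derive_mx; last exact: diff_derivable.
by rewrite mxE mulrC.
Qed.

(** * Functions of class C^k on a set, and smoothness near a point *)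

Section Cn.
Context {R : realType} {n : nat}.
Implicit Types (f g : 'rV[R]_n.+1 -> R) (p q : 'rV[R]_n.+1) (U V : set 'rV[R]_n.+1).

(** Recursion on one partial derivative at a time makes each closure property an induction on [k],
    whereas [smooth_near] quantifies over all lists of directions at once. *)
Fixpoint Cn k U f : Prop :=
  (forall q, U q -> {for q, continuous f}) /\
  if k is k'.+1 then
    (forall i q, U q -> derivable f q 'e_i) /\ (forall i, Cn k' U (partial i f))
  else True.

Lemma Cn_continuous k U f q : Cn k U f -> U q -> {for q, continuous f}.
Proof. by case: k => [|k] [cf _]; exact: cf. Qed.

Lemma CnS k U f : Cn k.+1 U f -> Cn k U f.
Proof.
elim: k f => [|k IH] f [cf [df pf]]; first by split.
by split => //; split => // i; apply: IH; exact: pf.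
Qed.

Lemma Cn_sub k U V f : V `<=` U -> Cn k U f -> Cn k V f.
Proof.
move=> VU; elim: k f => [|k IH] f [cf]; first by split => // q /VU; exact: cf.
move=> [df pf]; split => [q /VU|]; first exact: cf.
by split => [i q /VU|i]; [exact: df|apply: IH; exact: pf].
Qed.

Lemma Cn_eq k U f g : open U -> (forall q, U q -> f q = g q) -> Cn k U f -> Cn k U g.
Proof.
move=> oU.
have nearU (f' g' : 'rV[R]_n.+1 -> R) q : (forall q, U q -> f' q = g' q) -> U q -> \near q, f' q = g' q.
  by move=> fg Uq; near=> r; apply: fg; near: r; exact: open_nbhs_nbhs.
elim: k f g => [|k IH] f g fg [cf].
  by split=> // q Uq; apply: near_eq_continuous (nearU _ _ _ fg Uq) (cf q Uq).
move=> [df pf]; split => [q Uq|].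
  exact: near_eq_continuous (nearU _ _ _ fg Uq) (cf q Uq).
split => [i q Uq|i]; first exact: near_eq_derivable (nearU _ _ _ fg Uq) (df i q Uq).
apply: IH (pf i) => q Uq; apply: near_eq_partial; exact: nearU.
Unshelve. all: by end_near. Qed.

Lemma Cn_differentiable k U f q : open U -> Cn k.+1 U f -> U q -> differentiable f q.
Proof.
move=> oU [cf [df pf]] Uq; apply: C1_differentiable.
  by near=> r => i; apply: df; near: r; exact: open_nbhs_nbhs.
by move=> i; exact: Cn_continuous (pf i) Uq.
Unshelve. all: by end_near. Qed.

Lemma Cn_intro k U f : (forall q, U q -> differentiable f q) ->
  (forall i, Cn k U (partial i f)) -> Cn k.+1 U f.
Proof.
move=> df pf; split=> [q Uq|]; first exact/differentiable_continuous/df.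
by split=> // i q Uq; apply: diff_derivable; exact: df.
Qed.

Lemma Cn_cst k U (c : R) : Cn k U (fun=> c).
Proof.
elim: k c => [|k IH] c; first by split => // q _; exact: cst_continuous.
apply: Cn_intro => [q _|i]; first exact: differentiable_cst.
rewrite (_ : partial i _ = fun=> 0); first exact: IH.
by apply/funext => q; rewrite partial_cst.
Qed.

Lemma Cn_coord k U j : Cn k U (fun w => w 0 j).
Proof.
case: k => [|k]; first by split => // q _; exact: coord_continuous.
apply: Cn_intro => [q _|i]; first exact: coord_differentiable.
rewrite (_ : partial i _ = fun=> (i == j)%:R : R); first exact: Cn_cst.
by apply/funext => q; rewrite partial_coord.
Qed.

Lemma CnD k U f g : open U -> Cn k U f -> Cn k U g -> Cn k U (fun w => f w + g w).
Proof.
move=> oU; elim: k f g => [|k IH] f g cf cg.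
  by split=> // q Uq; apply: continuousD; [exact: cf.1|exact: cg.1].
have df q := Cn_differentiable oU cf (q := q).
have dg q := Cn_differentiable oU cg (q := q).
apply: Cn_intro => [q Uq|i]; first by apply: differentiableD; [exact: df|exact: dg].
apply: (Cn_eq oU (f := fun w => partial i f w + partial i g w)).
  by move=> q Uq; rewrite partialD //; [exact: df|exact: dg].
by apply: IH; [exact: cf.2.2|exact: cg.2.2].
Qed.

Lemma CnM k U f g : open U -> Cn k U f -> Cn k U g -> Cn k U (fun w => f w * g w).
Proof.
move=> oU; elim: k f g => [|k IH] f g cf cg.
  by split=> // q Uq; apply: continuousM; [exact: cf.1|exact: cg.1].
have df q := Cn_differentiable oU cf (q := q).
have dg q := Cn_differentiable oU cg (q := q).
apply: Cn_intro => [q Uq|i]; first by apply: differentiableM; [exact: df|exact: dg].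
apply: (Cn_eq oU (f := fun w => partial i f w * g w + f w * partial i g w)).
  by move=> q Uq; rewrite partialM //; [exact: df|exact: dg].
by apply: CnD => //; apply: IH => //; [exact: cf.2.2|exact: CnS|exact: CnS|exact: cg.2.2].
Qed.

Lemma Cn_sum k U (m : nat) (f : 'I_m -> 'rV[R]_n.+1 -> R) : open U ->
  (forall j, Cn k U (f j)) -> Cn k U (fun w => \sum_j f j w).
Proof.
move=> oU; elim: m f => [|m IH] f cf.
  by under eq_fun do rewrite big_ord0; exact: Cn_cst.
under eq_fun do rewrite big_ord_recl.
by apply: CnD => //; apply: IH.
Qed.

Lemma CnV k U f : open U -> (forall q, U q -> f q != 0) -> Cn k U f ->
  Cn k U (fun w => (f w)^-1).
Proof.
move=> oU f0; elim: k => [|k IH] cf.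
  by split=> // q Uq; apply: continuousV; [exact: f0|exact: cf.1].
have df q := Cn_differentiable oU cf (q := q).
apply: Cn_intro => [q Uq|i]; first by apply: differentiableV; [exact: df|exact: f0].
apply: (Cn_eq oU (f := fun w => -1 * (partial i f w * ((f w)^-1 * (f w)^-1)))).
  by move=> q Uq; rewrite partialV ?f0 ?mulN1r ?mulNr //; exact: df.
have IHf := IH (CnS cf).
by do 3 ?[apply: CnM => //]; [exact: Cn_cst|exact: cf.2.2].
Qed.

Lemma Cn_sqrt k U f : open U -> (forall q, U q -> 0 < f q) -> Cn k U f ->
  Cn k U (fun w => Num.sqrt (f w)).
Proof.
move=> oU f0; elim: k => [|k IH] cf.
  split=> // q Uq; apply: (@continuous_comp _ _ _ f (@Num.sqrt R)); first exact: cf.1.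
  exact: sqrt_continuous.
have df q := Cn_differentiable oU cf (q := q).
apply: Cn_intro => [q Uq|i].
  apply: (@differentiable_comp _ _ _ _ f (@Num.sqrt R)); first exact: df.
  apply/derivable1_diffP.
  exact: (@ex_derive _ _ _ _ _ _ _ (is_derive1_sqrt (f0 _ Uq))).
apply: (Cn_eq oU (f := fun w => partial i f w * (2 * Num.sqrt (f w))^-1)).
  by move=> q Uq; rewrite partial_sqrt ?f0 //; exact: df.
have IHf := IH (CnS cf).
apply: CnM => //; first exact: cf.2.2.
apply: CnV => //; last by apply: CnM => //; exact: Cn_cst.
by move=> q Uq; rewrite mulf_neq0 ?pnatr_eq0 // gt_eqF // sqrtr_gt0 f0.
Qed.

End Cn.

Lemma Cn_comp {R : realType} {m n : nat} k U V (f : 'rV[R]_n.+1 -> R)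
    (g : 'rV[R]_m.+1 -> 'rV[R]_n.+1) :
  open U -> open V -> (forall w, U w -> V (g w)) ->
  (forall j, Cn k U (fun w => g w 0 j)) -> Cn k V f -> Cn k U (fun w => f (g w)).
Proof.
move=> oU oV gV; elim: k f => [|k IH] f cg cf.
  split=> // q Uq; apply: continuous_comp; last by apply: cf.1; exact: gV.
  by apply/row_continuous => j; exact: (cg j).1.
have df q := Cn_differentiable oV cf (q := q).
have dg j q := Cn_differentiable oU (cg j) (q := q).
apply: Cn_intro => [q Uq|i].
  apply: differentiable_comp; last by apply: df; exact: gV.
  by apply: row_differentiable => j; exact: dg.
apply: (Cn_eq oU (f := fun w => \sum_j partial j f (g w) * partial i (fun w => g w 0 j) w)).
  move=> q Uq; rewrite partial_comp //; first by apply: df; exact: gV.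
  by move=> j; exact: dg.
apply: Cn_sum => // j; apply: CnM => //; last exact: (cg j).2.2.
by apply: IH; [move=> j'; exact: CnS|exact: cf.2.2].
Qed.

Section SmoothNear.
Context {R : realType} {n : nat}.
Implicit Types (f g : 'rV[R]_n.+1 -> R) (p q : 'rV[R]_n.+1) (U V : set 'rV[R]_n.+1).

Lemma Cn_partials k U f s : Cn (size s + k)%N U f -> Cn k U (partials s f).
Proof.
elim: s k => [//|i s IH] k cf.
have /IH[_ [_ pf]] : Cn (size s + k.+1) U f by rewrite addnS.
exact: pf.
Qed.

(** From left to right the induction is over all iterated partial derivatives of [f] together. From
    right to left, a list [s] requires only the order [size s + 1]. *)
Lemma smooth_nearP p f : smooth_near p f <->
  exists U, [/\ open U, U p & forall k, Cn k U f].
Proof.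
split=> [|[U [oU Up cU]]].
  move=> /near_openP[U [oU Up UP]]; exists U; split=> // k.
  suff : forall s, Cn k U (partials s f) by move=> /(_ [::]).
  elim: k => [|k IH] s; first by split=> // q /UP /(_ s)[].
  split=> [q /UP /(_ s)[]//|]; split => [i q /UP /(_ s)[]//|i].
  exact: (IH (i :: s)).
rewrite /smooth_near; near=> q => s.
have Uq : U q by near: q; exact: open_nbhs_nbhs.
have [cf [df _]] := Cn_partials (cU (size s + 1)%N).
by split=> [i|]; [exact: df|exact: cf].
Unshelve. all: by end_near. Qed.

Lemma smooth_near_near p f : smooth_near p f -> \near p, smooth_near p f.
Proof. exact: nbhs_interior. Qed.

Lemma smooth_near_eq p f g : (\near p, f p = g p) -> smooth_near p f -> smooth_near p g.
Proof.
move=> /near_openP[V [oV Vp VP]] /smooth_nearP[U [oU Up cU]].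
apply/smooth_nearP; exists (U `&` V); split=> // [|k]; first exact: openI.
apply: (Cn_eq (openI oU oV) (f := f)); first by move=> q [_ /VP].
by apply: Cn_sub (cU k) => q [].
Qed.

Lemma smooth_near_differentiable p f : smooth_near p f -> differentiable f p.
Proof.
by move=> /smooth_nearP[U [oU Up cU]]; exact: Cn_differentiable oU (cU 1%N) Up.
Qed.

Lemma smooth_near_continuous p f : smooth_near p f -> {for p, continuous f}.
Proof. by move/smooth_near_differentiable/differentiable_continuous. Qed.

Lemma smooth_near_partial p f i : smooth_near p f -> smooth_near p (partial i f).
Proof.
move=> /smooth_nearP[U [oU Up cU]]; apply/smooth_nearP; exists U; split=> // k.
exact: (cU k.+1).2.2.
Qed.

Lemma smooth_near_partials p f s : smooth_near p f -> smooth_near p (partials s f).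
Proof. by move=> sf; elim: s => [|i s IH]; [exact: sf|exact: smooth_near_partial IH]. Qed.

Lemma smooth_near_cst p (c : R) : smooth_near p (fun=> c).
Proof. by apply/smooth_nearP; exists setT; split=> // [|k]; [exact: openT|exact: Cn_cst]. Qed.

Lemma smooth_near_coord p j : smooth_near p (fun w => w 0 j).
Proof. by apply/smooth_nearP; exists setT; split=> // [|k]; [exact: openT|exact: Cn_coord]. Qed.

Let smooth_near2 p f g h : smooth_near p f -> smooth_near p g ->
  (forall k U, open U -> Cn k U f -> Cn k U g -> Cn k U h) -> smooth_near p h.
Proof.
move=> /smooth_nearP[U [oU Up cU]] /smooth_nearP[V [oV Vp cV]] H.
apply/smooth_nearP; exists (U `&` V); split=> // [|k]; first exact: openI.
by apply: H; [exact: openI|apply: Cn_sub (cU k) => q []|apply: Cn_sub (cV k) => q []].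
Qed.

Lemma smooth_nearD p f g : smooth_near p f -> smooth_near p g ->
  smooth_near p (fun w => f w + g w).
Proof. by move=> sf sg; apply: (smooth_near2 sf sg) => k U; exact: CnD. Qed.

Lemma smooth_nearM p f g : smooth_near p f -> smooth_near p g ->
  smooth_near p (fun w => f w * g w).
Proof. by move=> sf sg; apply: (smooth_near2 sf sg) => k U; exact: CnM. Qed.

Lemma smooth_nearN p f : smooth_near p f -> smooth_near p (fun w => - f w).
Proof.
move=> sf; under eq_fun do rewrite -mulN1r.
by apply: smooth_nearM sf; exact: smooth_near_cst.
Qed.

Lemma smooth_nearB p f g : smooth_near p f -> smooth_near p g ->
  smooth_near p (fun w => f w - g w).
Proof. by move=> sf sg; exact: smooth_nearD sf (smooth_nearN sg). Qed.

Lemma smooth_nearX p f k : smooth_near p f -> smooth_near p (fun w => f w ^+ k).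
Proof.
move=> sf; elim: k => [|k IH]; first exact: smooth_near_cst.
by under eq_fun do rewrite exprS; exact: smooth_nearM.
Qed.

Lemma near_neq0 (T : topologicalType) (p : T) (f : T -> R) : {for p, continuous f} -> f p != 0 -> \near p, f p != 0.
Proof.
move=> cf f0; have : \forall y \near f p, y != 0.
  by apply: open_nbhs_nbhs; split => //; exact: open_neq.
exact: cf.
Qed.

Lemma near_gt0 (T : topologicalType) (p : T) (f : T -> R) : {for p, continuous f} -> 0 < f p -> \near p, 0 < f p.
Proof.
move=> cf f0; have : \forall y \near f p, 0 < y.
  by apply: open_nbhs_nbhs; split => //; exact: open_gt.
exact: cf.
Qed.

Let smooth_near_cond p f (h : R -> R) (P : set R) : smooth_near p f ->
  (\near p, P (f p)) ->
  (forall k U, open U -> (forall q, U q -> P (f q)) -> Cn k U f ->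
    Cn k U (fun w => h (f w))) ->
  smooth_near p (fun w => h (f w)).
Proof.
move=> /smooth_nearP[U [oU Up cU]] /near_openP[V [oV Vp VP]] H.
apply/smooth_nearP; exists (U `&` V); split=> // [|k]; first exact: openI.
by apply: H; [exact: openI|move=> q [_ /VP]|apply: Cn_sub (cU k) => q []].
Qed.

Lemma smooth_nearV p f : smooth_near p f -> f p != 0 -> smooth_near p (fun w => (f w)^-1).
Proof.
move=> sf f0; apply: (@smooth_near_cond p f GRing.inv [set y | y != 0]) => //.
  by apply: near_neq0 f0; exact: smooth_near_continuous.
by move=> k U oU U0 cU; exact: CnV.
Qed.

Lemma smooth_near_sqrt p f : smooth_near p f -> 0 < f p ->
  smooth_near p (fun w => Num.sqrt (f w)).
Proof.
move=> sf f0; apply: (@smooth_near_cond p f Num.sqrt [set y | 0 < y]) => //.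
  by apply: near_gt0 f0; exact: smooth_near_continuous.
by move=> k U oU U0 cU; exact: Cn_sqrt.
Qed.

End SmoothNear.

Lemma smooth_near_comp {R : realType} {m n : nat} p (f : 'rV[R]_n.+1 -> R)
    (g : 'rV[R]_m.+1 -> 'rV[R]_n.+1) :
  (forall j, smooth_near p (fun w => g w 0 j)) -> smooth_near (g p) f ->
  smooth_near p (fun w => f (g w)).
Proof.
move=> sg /smooth_nearP[V [oV Vp cV]].
have : exists U, [/\ open U, U p & forall j k, Cn k U (fun w => g w 0 j)].
  have /= := fun j => (smooth_nearP p (fun w => g w 0 j)).1 (sg j).
  move=> /choice[W WP].
  have /near_openP[U [oU Up UW]] : \forall q \near p, forall j, W j q.
    near=> q => j; move: j; near: q; apply: filter_forall => j.
    by have [oW Wp _] := WP j; exact: open_nbhs_nbhs.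
  exists U; split => // j k; have [_ _ /(_ k)] := WP j.
  by apply: Cn_sub => q /UW.
move=> [U [oU Up cU]].
have cg : {for p, continuous g}.
  by apply/row_continuous => j; apply: smooth_near_continuous.
have : nbhs p (g @^-1` V) by apply: cg; exact: open_nbhs_nbhs.
rewrite nbhsE => -[U' [oU' U'p] U'V].
apply/smooth_nearP; exists (U `&` U'); split=> // [|k]; first exact: openI.
apply: (Cn_comp (openI oU oU') oV) => [w [_ /U'V]//|j|]; last exact: cV.
by apply: Cn_sub (cU j k) => q [].
Unshelve. all: by end_near. Qed.

Lemma differentiable_bound {R : realType} {V W : normedModType R} (f : V -> W)
    (p : V) (e : R) : differentiable f p -> 0 < e ->
  \forall h \near 0, `|f (h + p) - (f p + 'd f p h)| <= e * `|h|.
Proof. by move=> /diff_locally /eqaddoP H e0; exact: H. Qed.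

Lemma continuous_eps {R : realType} {T : topologicalType} (f : T -> R) (p : T) :
  (forall e, 0 < e -> \forall q \near p, `|f p - f q| < e) -> {for p, continuous f}.
Proof. by move=> H; apply/cvgrPdist_lt. Qed.

Lemma continuous_dist {R : realType} {T : topologicalType} (f : T -> R) (p : T) (e : R) :
  {for p, continuous f} -> 0 < e -> \forall q \near p, `|f p - f q| < e.
Proof. by move=> /cvgrPdist_lt /[apply]. Qed.

Lemma delta_norm_le {R : realType} {n : nat} (i : 'I_n.+1) :
  `|'e_i : 'rV[R]_n.+1| <= 1.
Proof.
rewrite row_norm_le; apply/forallP => j; rewrite !mxE.
by case: (_ && _); rewrite ?normr1 ?normr0.
Qed.

Section RowValued.
Context {R : realType} {n m : nat}.
Implicit Types (x : 'rV[R]_n.+1 -> 'rV[R]_m.+1) (p : 'rV[R]_n.+1).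

Lemma partials_row_near p x j s : smooth_near p x ->
  \near p, partials s x p 0 j = partials s (fun w => x w 0 j) p.
Proof.
move=> /near_openP[U [oU Up UP]].
suff H : forall q, U q -> partials s x q 0 j = partials s (fun w => x w 0 j) q.
  by near=> q; apply: H; near: q; exact: open_nbhs_nbhs.
elim: s => [//|i s IH] q Uq /=.
rewrite /partial derive_mx; last by have [] := UP q Uq s.
rewrite mxE; apply: near_eq_derive; near=> r; apply: IH.
by near: r; exact: open_nbhs_nbhs.
Unshelve. all: by end_near. Qed.

Lemma partials_row p x j s : smooth_near p x ->
  partials s x p 0 j = partials s (fun w => x w 0 j) p.
Proof. by move=> /(partials_row_near j s)/nbhs_singleton. Qed.

Lemma partial_row p x j i : smooth_near p x ->
  partial i x p 0 j = partial i (fun w => x w 0 j) p.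
Proof. exact: (partials_row _ [:: i]). Qed.

Lemma smooth_near_row p x :
  smooth_near p x <-> forall j, smooth_near p (fun w => x w 0 j).
Proof.
split=> [sx j|sx].
  have /near_openP[U [oU Up UP]] := sx; apply/near_openP; exists U; split=> // q Uq s.
  have Usx r : U r -> smooth_near r x.
    by move=> Ur; apply/near_openP; exists U.
  have [ds cs] := UP q Uq s.
  have e := partials_row_near j s (Usx _ Uq); split.
    by move=> i; apply: near_eq_derivable e _; move/derivable_mxP: (ds i) => /(_ 0 j).
  by apply: near_eq_continuous e _; move/row_continuous : cs => /(_ j).
have /near_openP[U [oU Up UP]] : \forall q \near p, forall j,
    smooth_near q (fun w => x w 0 j).
  near=> q => j; move: j; near: q; apply: filter_forall => j.
  exact: smooth_near_near.
have xE s q : U q -> partials s x q = \row_j partials s (fun w => x w 0 j) q.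
  elim: s q => [|i s IH] q Uq /=; first by apply/rowP => j; rewrite mxE.
  have e : \near q, partials s x q = \row_j partials s (fun w => x w 0 j) q.
    by near=> r; apply: IH; near: r; exact: open_nbhs_nbhs.
  rewrite (near_eq_partial i e) /partial derive_mx; last first.
    apply/derivable_mxP => k j.
    rewrite (_ : (fun y => _) = partials s (fun w => x w 0 j)); last first.
      by apply/funext => r; rewrite mxE.
    exact/diff_derivable/smooth_near_differentiable/smooth_near_partials/UP.
  by apply/rowP => j; rewrite !mxE; congr ('D_('e_i) _ _); apply/funext => r; rewrite mxE.
apply/near_openP; exists U; split => // q Uq s.
have e : \near q, \row_j partials s (fun w => x w 0 j) q = partials s x q.
  by near=> r; rewrite xE //; near: r; exact: open_nbhs_nbhs.
split.
  move=> i; apply: near_eq_derivable e _.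
  apply/derivable_mxP => k j.
  rewrite (_ : (fun y => _) = partials s (fun w => x w 0 j)); last first.
    by apply/funext => r; rewrite mxE.
  exact/diff_derivable/smooth_near_differentiable/smooth_near_partials/UP.
apply: near_eq_continuous e _; apply/row_continuous => j.
rewrite (_ : (fun y => _) = partials s (fun w => x w 0 j)).
  exact/smooth_near_continuous/smooth_near_partials/UP.
by apply/funext => r; rewrite mxE.
Unshelve. all: by end_near. Qed.

End RowValued.

(** * Symmetry of second derivatives *)

Section Schwarz.
Context {R : realType} {n : nat}.
Implicit Types (f g : 'rV[R]_n.+1 -> R) (p q : 'rV[R]_n.+1).

Lemma partial_shift f p i v : partial i (fun w => f (w + v)) p = partial i f (p + v).
Proof.
rewrite /partial /derive.
have -> : (fun h : R => h^-1 *: (((fun w => f (w + v)) \o shift p) (h *: 'e_i) - f (p + v)))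
  = (fun h : R => h^-1 *: ((f \o shift (p + v)) (h *: 'e_i) - f (p + v))).
  by apply/funext => h /=; rewrite addrA.
by [].
Qed.

Lemma second_difference f p i j (r h : R) : 0 < h -> 2 * h < r ->
  (forall q, ball p r q -> smooth_near q f) ->
  exists2 q, ball p r q & f (p + h *: 'e_i + h *: 'e_j) - f (p + h *: 'e_i)
    - f (p + h *: 'e_j) + f p = h ^+ 2 * partial j (partial i f) q.
Proof.
move=> h0 hr sf; have nh : `|h| = h by rewrite gtr0_norm.
have inb (s t : R) : `|s| <= h -> `|t| <= h -> ball p r (p + s *: 'e_i + t *: 'e_j).
  move=> sh th; rewrite -ball_normE /ball_ /= -addrA opprD addrA subrr add0r normrN.
  apply: le_lt_trans hr; apply: (le_trans (ler_normD _ _)).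
  rewrite mulr_natl mulr2n !normrZ; apply: lerD.
    by rewrite -[h]mulr1 ler_pM // delta_norm_le.
  by rewrite -[h]mulr1 ler_pM // delta_norm_le.
have inb0 (s : R) : `|s| <= h -> ball p r (p + s *: 'e_i).
  by move=> sh; have := inb s 0 sh; rewrite scale0r addr0 normr0; apply; exact: ltW.
pose g w := f (w + h *: 'e_j) - f w.
have dsh (s : R) : `|s| <= h -> differentiable (fun w => f (w + h *: 'e_j)) (p + s *: 'e_i).
  move=> sh; apply: (@differentiable_comp _ _ _ _ (fun w => w + h *: 'e_j) f).
    by apply: differentiableD => //; exact: differentiable_cst.
  by apply: smooth_near_differentiable; apply: sf; apply: inb; rewrite ?nh.
have df (s : R) : `|s| <= h -> differentiable f (p + s *: 'e_i).
  by move=> sh; apply: smooth_near_differentiable; apply: sf; exact: inb0.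
have [s] : exists2 s : R, `|s| <= `|h| &
    g (h *: 'e_i + p) - g p = h * 'D_('e_i) g (s *: 'e_i + p).
  apply: mvt_line => s; rewrite nh => sh; rewrite addrC; apply: diff_derivable.
  by apply: differentiableB; [exact: dsh|exact: df].
rewrite nh => sh.
rewrite [s *: _ + p]addrC -[X in h * X]/(partial i g (p + s *: 'e_i)).
rewrite /g (partialB _ (dsh _ sh) (df _ sh)) partial_shift => gE.
have [t] : exists2 t : R, `|t| <= `|h| &
    partial i f (h *: 'e_j + (p + s *: 'e_i)) - partial i f (p + s *: 'e_i) =
    h * 'D_('e_j) (partial i f) (t *: 'e_j + (p + s *: 'e_i)).
  apply: mvt_line => t; rewrite nh => th; rewrite addrC; apply: diff_derivable.
  apply: smooth_near_differentiable; apply: smooth_near_partial; apply: sf; exact: inb.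
rewrite nh => th pE; exists (p + s *: 'e_i + t *: 'e_j); first exact: inb.
rewrite expr2 -mulrA.
have {}pE : partial i f (h *: 'e_j + (p + s *: 'e_i)) - partial i f (p + s *: 'e_i) =
    h * partial j (partial i f) (p + s *: 'e_i + t *: 'e_j).
  by rewrite [X in partial j _ X]addrC; exact: pE.
rewrite -pE [h *: 'e_j + _]addrC -gE [h *: 'e_i + p]addrC.
by rewrite /g; ring.
Qed.

(** The symmetric second difference gives the two mixed derivatives equal values at two points near
    [p]; continuity of both brings the points back to [p]. *)
Lemma partialC f p i j : smooth_near p f ->
  partial i (partial j f) p = partial j (partial i f) p.
Proof.
move=> sf; apply/eqP; rewrite -subr_eq0 -normr_le0; apply/ler_addgt0Pl => e e0.
rewrite addr0.
have e2 : 0 < e / 2 by rewrite divr_gt0.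
have tri (a b c d : R) : `|a - c| < e / 2 -> `|b - d| < e / 2 -> d = c -> `|a - b| <= e.
  move=> ac bd dc; rewrite -{}dc in ac; rewrite -(subrKA d) [e]splitr.
  by apply: (le_trans (ler_normD _ _)); apply: lerD; rewrite ltW // distrC.
have c1 := smooth_near_continuous (smooth_near_partial i (smooth_near_partial j sf)).
have c2 := smooth_near_continuous (smooth_near_partial j (smooth_near_partial i sf)).
have : \forall q \near p, [/\ smooth_near q f,
   `|partial i (partial j f) p - partial i (partial j f) q| < e / 2 &
   `|partial j (partial i f) p - partial j (partial i f) q| < e / 2].
  have n1 : \forall q \near p,
      `|partial i (partial j f) p - partial i (partial j f) q| < e / 2.
    by have /cvgrPdist_lt /(_ _ e2) := c1.
  have n2 : \forall q \near p,
      `|partial j (partial i f) p - partial j (partial i f) q| < e / 2.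
    by have /cvgrPdist_lt /(_ _ e2) := c2.
  by apply: filterS3 (smooth_near_near sf) n1 n2 => q; split.
move=> /nbhs_ballP[r r0 rP].
have sfr q : ball p r q -> smooth_near q f by move=> /rP[].
have h0 : 0 < r / 3 by rewrite divr_gt0.
have hr : 2 * (r / 3) < r by rewrite mulrCA gtr_pMr // ltr_pdivrMr // mul1r ltr_nat.
have [q /rP[_ _ q2] qE] := second_difference i j h0 hr sfr.
have [q' /rP[_ q1 _] qE'] := second_difference j i h0 hr sfr.
have eqq : partial j (partial i f) q = partial i (partial j f) q'.
  apply: (@mulfI _ ((r / 3) ^+ 2)); first by rewrite expf_neq0 // gt_eqF.
  apply: etrans (esym qE) (etrans _ qE'); rewrite (addrAC p (r / 3 *: 'e_i)).
  by have sw (a b c d : R) : a - b - c + d = a - c - b + d; [rewrite (addrAC a)|exact: sw].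
exact: tri q1 q2 eqq.
Qed.

End Schwarz.

(** * Inverting a chart that changes a single coordinate *)

Section CoordinateInverse.
Context {R : realType} {n : nat}.
Implicit Types (f g : 'rV[R]_n.+1 -> R) (p q w z : 'rV[R]_n.+1).

(** The map [w |-> upd i (f w) w] is the elementary chart that takes [f] as its i-th coordinate; the
    inverse function theorem in the plane is composed of two such charts. *)
Definition upd (i : 'I_n.+1) (a : R) w : 'rV[R]_n.+1 :=
  \row_k (if k == i then a else w 0 k).

Lemma upd_same i a w : upd i a w 0 i = a.
Proof. by rewrite mxE eqxx. Qed.

Lemma upd_other i j a w : j != i -> upd i a w 0 j = w 0 j.
Proof. by rewrite mxE => /negbTE ->. Qed.

Lemma upd_id i w : upd i (w 0 i) w = w.
Proof. by apply/rowP => k; rewrite mxE; case: eqVneq => [->|]. Qed.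

Lemma upd_upd i a b w : upd i a (upd i b w) = upd i a w.
Proof. by apply/rowP => k; rewrite !mxE; case: eqVneq. Qed.

Lemma updE i a w : upd i a w = (a - w 0 i) *: 'e_i + w.
Proof.
apply/rowP => k; rewrite !mxE eqxx /=; case: eqVneq => [->|_].
  by rewrite mulr1 subrK.
by rewrite mulr0 add0r.
Qed.

Lemma ball_rowP p (r : R) q : 0 < r ->
  ball p r q <-> forall k, `|p 0 k - q 0 k| < r.
Proof.
move=> r0; rewrite -ball_normE /ball_ /= row_norm_lt; split.
  by move/forallP => H k; have := H k; rewrite !mxE.
by move=> H; apply/forallP => k; rewrite !mxE.
Qed.

Lemma smooth_near_upd i (u : 'rV[R]_n.+1 -> R) p : smooth_near p u ->
  forall j, smooth_near p (fun w => upd i (u w) w 0 j).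
Proof.
move=> su j; under eq_fun do rewrite mxE.
by case: eqVneq => _; [exact: su|exact: smooth_near_coord].
Qed.

Lemma continuous_upd i (u : 'rV[R]_n.+1 -> R) p : {for p, continuous u} ->
  {for p, continuous (fun w => upd i (u w) w)}.
Proof.
move=> cu; apply/row_continuous => j.
rewrite (_ : (fun y => _) = fun y => if j == i then u y else y 0 j).
  by case: eqVneq => // _; exact: coord_continuous.
by apply/funext => y; rewrite mxE.
Qed.

Lemma lt_coord f i z (a b : R) : a < b ->
  (forall c, a <= c <= b -> differentiable f (upd i c z) /\ 0 < partial i f (upd i c z)) ->
  f (upd i a z) < f (upd i b z).
Proof.
move=> ab H; pose v : 'rV[R]_n.+1 := (b - a) *: 'e_i.
have pE (s : R) : s *: v + upd i a z = upd i (a + s * (b - a)) z.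
  by rewrite [upd i a z]updE [RHS]updE /v scalerA addrA -scalerDl; congr (_ *: _ + _); ring.
have bE : v + upd i a z = upd i b z by rewrite -[v]scale1r pE; congr upd; ring.
have s01 (s : R) : 0 <= s <= 1 -> a <= a + s * (b - a) <= b.
  move=> /andP[s0 s1]; have ba : 0 <= b - a by rewrite subr_ge0 ltW.
  by rewrite lerDl mulr_ge0 //= -lerBrDl ler_piMl.
have [s|s s0] := @mvt_segment R _ f (upd i a z) v.
  by move/s01/H => -[df _]; rewrite pE; exact: diff_derivable.
rewrite bE pE => fE; rewrite -subr_gt0 fE.
have [df d0] := H _ (s01 _ s0).
by rewrite deriveE // /v linearZ /= -deriveE // mulr_gt0 // subr_gt0.
Qed.

(* f is strictly increasing in the i-th coordinate on a box, so the equation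
   f (upd i a z) = z_i can be solved for a by the intermediate value theorem. *)
Lemma increasing_inverse f i p : smooth_near p f -> 0 < partial i f p ->
  exists W V (u : 'rV[R]_n.+1 -> R) (r : R),
   [/\ [/\ open V, V (upd i (f p) p), 0 < r, open W & W p],
       (forall q, W q -> 0 < partial i f q) /\ (forall k, Cn k W f),
       forall z (a : R), V z -> `|a - p 0 i| < r -> W (upd i a z),
       forall z, V z -> `|u z - p 0 i| < r /\ f (upd i (u z) z) = z 0 i
     & forall z (a : R), V z -> `|a - p 0 i| < r ->
          (u z < a -> z 0 i < f (upd i a z)) /\ (a < u z -> f (upd i a z) < z 0 i)].
Proof.
move=> sf fi0; have [U [oU Up cU]] := (smooth_nearP _ _).1 sf.
have /nbhs_ballP[r0 /= r00 rP] : \forall q \near p, U q /\ 0 < partial i f q.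
  near=> q; split; near: q; first exact: open_nbhs_nbhs.
  by apply: near_gt0 fi0; exact/smooth_near_continuous/smooth_near_partial.
pose W := ball p r0; pose r := r0 / 2.
have rgt0 : 0 < r by rewrite divr_gt0.
have rr0 : r < r0 by rewrite ltr_pdivrMr // ltr_pMr // ltr1n.
have oW : open W by exact: ball_open.
have Wp : W p by exact: ballxx.
have cW k : Cn k W f by apply: Cn_sub (cU k) => q /rP[].
have dW q : W q -> differentiable f q by move=> Wq; exact: Cn_differentiable oW (cW 1%N) Wq.
have pW q : W q -> 0 < partial i f q by move=> /rP[].
(* The i-th coordinate of [z] is exempt: it carries the value that [f] has to attain, not a
   position. *)
pose good z := forall k, k != i -> `|p 0 k - z 0 k| < r0.
have goodW z a : good z -> `|a - p 0 i| <= r -> W (upd i a z).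
  move=> gz ar; apply/ball_rowP => // k; rewrite mxE; case: eqVneq => [->|ki].
    by rewrite distrC (le_lt_trans ar).
  exact: gz.
have gp a : good (upd i a p) by move=> k ki; rewrite upd_other // subrr normr0.
have mono z (a b : R) : good z -> `|a - p 0 i| <= r -> `|b - p 0 i| <= r -> a < b ->
    f (upd i a z) < f (upd i b z).
  move=> gz ar br ab; apply: lt_coord => // c /andP[ac cb].
  have Wc : W (upd i c z).
    apply: goodW => //; move: ar br; rewrite !ler_norml => /andP[a1 a2] /andP[b1 b2].
    by rewrite (le_trans a1) ?lerB //= (le_trans _ b2) ?lerB.
  by split; [exact: dW|exact: pW].
have rabs : `|r| = r by rewrite gtr0_norm.
have top : f p < f (upd i (p 0 i + r) p).
  rewrite -[p in f p](upd_id i p); apply: mono; rewrite ?subrr ?normr0 ?(ltW rgt0) //.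
  - by rewrite -[p](upd_id i p); exact: gp.
  - by rewrite addrAC subrr add0r rabs.
  - by rewrite ltrDl.
have bot : f (upd i (p 0 i - r) p) < f p.
  rewrite -[p in _ < f p](upd_id i p); apply: mono; rewrite ?subrr ?normr0 ?(ltW rgt0) //.
  - by rewrite -[p](upd_id i p); exact: gp.
  - by rewrite addrAC subrr add0r normrN rabs.
  - by rewrite ltrBlDr ltrDl.
have cfu (a : R) z : W (upd i a z) -> {for z, continuous (fun z => f (upd i a z))}.
  move=> Wa; apply: continuous_comp.
    by apply: continuous_upd; exact: cst_continuous.
  by apply/differentiable_continuous/dW.
set z0 := upd i (f p) p.
have Wz0 (a : R) : `|a - p 0 i| <= r -> W (upd i a z0).
  by move=> ar; apply: goodW => //; exact: gp.
have nearlt (g h : 'rV[R]_n.+1 -> R) z : {for z, continuous g} -> {for z, continuous h} ->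
    g z < h z -> \near z, g z < h z.
  move=> cg ch gh; have : \near z, 0 < h z - g z.
    by apply: near_gt0; [exact: continuousB|rewrite subr_gt0].
  by apply: filterS => q; rewrite subr_gt0.
have cc : {for z0, continuous (fun z : 'rV[R]_n.+1 => z 0 i)} by exact: coord_continuous.
have /near_openP[V [oV Vz0 VP]] : \forall z \near z0, [/\ good z,
    z 0 i < f (upd i (p 0 i + r) z) & f (upd i (p 0 i - r) z) < z 0 i].
  near=> z; split.
  - suff Wz : ball z0 r0 z.
      move=> k ki; move/ball_rowP : Wz => /(_ r00 k).
      by rewrite /z0 upd_other.
    by near: z; exact: nbhsx_ballx.
  - near: z; apply: nearlt => //; last by rewrite upd_same upd_upd.
    by apply: cfu; apply: Wz0; rewrite addrAC subrr add0r rabs.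
  - near: z; apply: nearlt => //; last by rewrite upd_same upd_upd.
    by apply: cfu; apply: Wz0; rewrite addrAC subrr add0r normrN rabs.
have : forall z, exists a : R, V z -> `|a - p 0 i| < r /\ f (upd i a z) = z 0 i.
  move=> z; have [Vz|nVz] := pselect (V z); last by exists 0.
  have [gz zt zb] := VP _ Vz.
  have ab : p 0 i - r <= p 0 i + r by move: rgt0; clear; lra.
  have rng a : (p 0 i - r <= a <= p 0 i + r) = (`|a - p 0 i| <= r).
    by rewrite ler_distl.
  have [||a] := @IVT R (fun a => f (upd i a z)) (p 0 i - r) (p 0 i + r) (z 0 i) ab.
  - apply: continuous_in_subspaceT => a; rewrite inE /= in_itv /= rng => ar.
    apply: (@continuous_comp _ _ _ (fun a => upd i a z) f); last first.
      by apply/differentiable_continuous/dW/goodW.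
    apply/row_continuous => k.
    rewrite (_ : (fun y => _) = fun y : R => if k == i then y else z 0 k).
      by case: eqVneq => // _; [exact: cvg_id|exact: cvg_cst].
    by apply/funext => y; rewrite mxE.
  - by rewrite ge_min le_max (ltW zt) (ltW zb) orbT.
  rewrite in_itv /= rng => ar fa; exists a => _; split=> //.
  rewrite lt_neqAle ar andbT; apply/negP => /eqP.
  have [a0|a0] := leP 0 (a - p 0 i).
    rewrite ger0_norm // => aE; move: zt; rewrite -fa.
    by rewrite (_ : p 0 i + r = a) ?ltxx // -aE; ring.
  rewrite ltr0_norm // => aE; move: zb; rewrite -fa.
  by rewrite (_ : p 0 i - r = a) ?ltxx // -aE; ring.
move=> /choice[u uP]; exists W, V, u, r; split.
- by [].
- by split.
- by move=> z a Vz ar; have [gz _ _] := VP _ Vz; apply: goodW => //; exact: ltW.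
- by move=> z /uP.
- move=> z a Vz ar; have [ur uE] := uP _ Vz; have [gz _ _] := VP _ Vz.
  by rewrite -uE; split => ua; apply: mono => //; exact: ltW.
Unshelve. all: by end_near. Qed.

End CoordinateInverse.

Lemma near_continuous {S T : topologicalType} (g : S -> T) (p : S) (P : set T) :
  {for p, continuous g} -> (\forall y \near g p, P y) -> \forall x \near p, P (g x).
Proof. by move=> cg /cg. Qed.

Lemma near_shift0 {R : realType} {V : normedModType R} (P : set V) (z : V) :
  (\forall y \near z, P y) <-> \forall h \near 0, P (h + z).
Proof. by rewrite (near_shift 0 z) subr0. Qed.

Lemma differentiable_littleo_at {R : realType} {V W : normedModType R}
    (f : V -> W) (L : {linear V -> W}) (p : V) : continuous L ->
  (forall e : R, 0 < e ->
     \forall q \near p, `|f q - (f p + L (q - p))| <= e * `|q - p|) ->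
  differentiable f p.
Proof.
move=> Lc H; apply: (differentiable_littleo Lc) => e /H /near_shift0.
by apply: filterS => h; rewrite addrK.
Qed.

Lemma differentiable_bound_at {R : realType} {V W : normedModType R} (f : V -> W)
    (p : V) (e : R) : differentiable f p -> 0 < e ->
  \forall q \near p, `|f q - (f p + 'd f p (q - p))| <= e * `|q - p|.
Proof.
move=> df e0; apply/near_shift0; apply: filterS (differentiable_bound df e0) => h.
by rewrite addrK.
Qed.

Section CoordinateInverse.
Context {R : realType} {n : nat}.
Implicit Types (f g : 'rV[R]_n.+1 -> R) (p q w z : 'rV[R]_n.+1).

(** Regularity of [u] is bootstrapped. Monotonicity in the i-th coordinate traps [u z] between
    arguments where [f] lies below and above the target, which gives continuity; the first order
    expansion of [f] gives differentiability; finally the partial derivatives of [u] are rational in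
    those of [f] along the inverse chart, so each order of smoothness yields the next. *)
Lemma positive_inverse f i p : smooth_near p f -> 0 < partial i f p ->
  exists u, [/\ smooth_near (upd i (f p) p) u,
    \forall z \near upd i (f p) p, f (upd i (u z) z) = z 0 i
    & \forall w \near p, u (upd i (f w) w) = w 0 i].
Proof.
move=> sf fi0.
have [W [V [u [r [[oV Vz0 r0 oW Wp] [pW cW] WV uP uC]]]]] := increasing_inverse sf fi0.
have Wu z : V z -> W (upd i (u z) z) by move=> Vz; apply: WV => //; have [] := uP z Vz.
have dW q : W q -> differentiable f q by move=> Wq; exact: Cn_differentiable oW (cW 1%N) Wq.
have cont z0 : V z0 -> {for z0, continuous u}.
  move=> Vz; apply: continuous_eps => e e0; have [ur uE] := uP _ Vz.
  have [d [d0 de dr]] : exists d, [/\ 0 < d, d < e & `|u z0 - p 0 i| + d < r].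
    pose d := Num.min e (r - `|u z0 - p 0 i|); exists (d / 2).
    have d0 : 0 < d by rewrite lt_min e0 subr_gt0.
    have de : d <= e by rewrite ge_min lexx.
    have dr : d <= r - `|u z0 - p 0 i| by rewrite ge_min lexx orbT.
    by split; move: d0 de dr ur; clearbody d; lra.
  have ab (s : R) : `|s| = d -> `|u z0 + s - p 0 i| < r.
    by move=> sd; rewrite addrAC; apply: le_lt_trans dr; rewrite -sd ler_normD.
  have dp : `|d| = d by rewrite gtr0_norm.
  have dn : `|- d| = d by rewrite normrN.
  have cfu (a : R) : `|a - p 0 i| < r -> {for z0, continuous (fun z => f (upd i a z))}.
    move=> ar; apply: continuous_comp.
      by apply: continuous_upd; exact: cst_continuous.
    by apply/differentiable_continuous/dW/WV.
  have cc : {for z0, continuous (fun z : 'rV[R]_n.+1 => z 0 i)} by exact: coord_continuous.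
  have n1 : \forall z \near z0, 0 < f (upd i (u z0 + d) z) - z 0 i.
    apply: near_gt0; first by apply: continuousB => //; apply/cfu/ab.
    rewrite subr_gt0; apply: (uC _ _ Vz (ab _ dp)).1; by rewrite ltrDl.
  have n2 : \forall z \near z0, 0 < (z : 'rV[R]_n.+1) 0 i - f (upd i (u z0 - d) z).
    apply: near_gt0; first by apply: continuousB => //; apply/cfu/ab.
    by rewrite subr_gt0; apply: (uC _ _ Vz (ab _ dn)).2; rewrite ltrBlDr ltrDl.
  have n3 : \forall z \near z0, V z by exact: open_nbhs_nbhs.
  apply: filterS3 n1 n2 n3 => z h1 h2 Vz'; rewrite distrC.
  apply: le_lt_trans de; rewrite ler_distl; apply/andP; split.
    rewrite leNgt; apply/negP => /(uC _ _ Vz' (ab _ dn)).1.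
    by move=> h; move: h2; rewrite subr_gt0 => /(lt_trans h); rewrite ltxx.
  rewrite leNgt; apply/negP => /(uC _ _ Vz' (ab _ dp)).2.
  by move=> h; move: h1; rewrite subr_gt0 => /(lt_trans h); rewrite ltxx.
have cg z0 : V z0 -> {for z0, continuous (fun z => upd i (u z) z)}.
  by move=> Vz; apply: continuous_upd; exact: cont.
have du z0 : V z0 -> differentiable u z0.
  move=> Vz; set y0 := upd i (u z0) z0; pose c := partial i f y0.
  have c0 : 0 < c by apply: pW; exact: Wu.
  have dfy : differentiable f y0 by apply: dW; exact: Wu.
  (* The candidate differential of [u]: differentiate [f (upd i (u z) z) = z 0 i] and solve for the
     increment of [u]. *)
  pose L := fun v : 'rV[R]_n.+1 =>
    c^-1 * (v 0 i - \sum_(k | k != i) v 0 k * partial k f y0).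
  have Lc : continuous L.
    move=> v; apply: (@continuousM _ _ (fun=> c^-1)
      (fun v : 'rV[R]_n.+1 => v 0 i - \sum_(k | k != i) v 0 k * partial k f y0)).
      exact: cst_continuous.
    apply: (@continuousB _ _ _ (fun v : 'rV[R]_n.+1 => v 0 i)); first exact: coord_continuous.
    have := @continuous_big R _ +%R 0 (fun k : 'I_n.+1 => k != i) _ _ (index_enum 'I_n.+1)
      (fun k (v : 'rV[R]_n.+1) => v 0 k * partial k f y0).
    apply; first exact: add_continuous.
    move=> k _ w; apply: (@continuousM _ _ (fun v : 'rV[R]_n.+1 => v 0 k) (fun=> partial k f y0)).
      exact: coord_continuous.
    exact: cst_continuous.
  have Ll : linear (L : _ -> R^o).
    move=> a v w; rewrite /L /= -[a *: (c^-1 * _)]/(a * (c^-1 * _)) !mxE.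
    rewrite (eq_bigr (fun k => a * (v 0 k * partial k f y0) + w 0 k * partial k f y0)).
      by rewrite big_split /= -mulr_sumr; ring.
    by move=> k _; rewrite !mxE mulrDl mulrA.
  pose Llin : {linear 'rV[R]_n.+1 -> R^o} :=
    HB.pack (L : _ -> R^o) (GRing.isLinear.Build R 'rV[R]_n.+1 R^o *:%R L Ll).
  pose K := 1 + \sum_(k | k != i) `|partial k f y0|.
  have K1 : 1 <= K by rewrite lerDl sumr_ge0.
  have LK v : `|L v| <= c^-1 * (K * `|v|).
    rewrite /L normrM gtr0_norm ?invr_gt0 // ler_pM2l ?invr_gt0 //.
    have vk k : `|v 0 k| <= `|v|.
      by have : `|v| <= `|v| by []; rewrite row_norm_le => /forallP; apply.
    apply: (le_trans (ler_normB _ _)); rewrite /K mulrDl mul1r; apply: lerD => //.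
    rewrite mulr_suml; apply: (le_trans (ler_norm_sum _ _ _)); apply: ler_sum => k _.
    by rewrite normrM mulrC ler_wpM2l.
  apply: (@differentiable_littleo_at R _ R^o u Llin z0 Lc) => e e0.
  (* [e'] absorbs the error c (u z - u z0 - L (z - z0)) = o(|z - z0| + |u z - u z0|) *)
  pose e' := Num.min (c / 2) (e * c / (2 + 2 * (K / c))).
  have D0 : 0 < 2 + 2 * (K / c).
    by rewrite addr_gt0 // mulr_gt0 // divr_gt0 // (lt_le_trans ltr01).
  have e'0 : 0 < e' by rewrite lt_min !divr_gt0 ?mulr_gt0.
  have e'c : e' <= c / 2 by rewrite ge_min lexx.
  have e'e : e' * (2 + 2 * (K / c)) <= e * c.
    by rewrite -ler_pdivlMr // ge_min lexx orbT.
  have B := @differentiable_bound_at R _ R^o f y0 e' dfy e'0.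
  have n1 : \near z0, V z0 by exact: open_nbhs_nbhs.
  have n2 := cg _ Vz _ B.
  apply: filterS2 n1 n2 => z Vz' /=.
  rewrite (uP _ Vz').2 (uP _ Vz).2.
  set v := _ - y0.
  set h := z - z0; have zE : z = h + z0 by rewrite subrK.
  have -> : 'd (f : _ -> R^o) y0 v = \sum_k v 0 k * partial k f y0.
    by rewrite -deriveE_partial // deriveE.
  rewrite (bigD1 i) //= {1}/v !mxE eqxx.
  have zk k : z 0 k = h 0 k + z0 0 k by rewrite {1}zE mxE.
  have -> : \sum_(k | k != i) v 0 k * partial k f y0 =
            \sum_(k | k != i) h 0 k * partial k f y0.
    by apply: eq_bigr => k ki; rewrite /v !mxE (negbTE ki).
  rewrite -[partial i f y0]/c.
  set S := \sum_(k | _) _.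
  have cL : c * L h = h 0 i - S by rewrite /L mulrA divff ?mul1r ?gt_eqF.
  set d := u z - u z0.
  have vn : `|v| <= `|h| + `|d|.
    rewrite row_norm_le; apply/forallP => k; rewrite /v !mxE.
    have hk : `|h 0 k| <= `|h|.
      by have : `|h| <= `|h| by []; rewrite row_norm_le => /forallP; apply.
    case: eqVneq => _; first by rewrite lerDr.
    by rewrite zk addrK (le_trans hk) // lerDl.
  rewrite zk; have -> : h 0 i + z0 0 i - (z0 0 i + (d * c + S)) = c * L h - d * c by rewrite cL; ring.
  move=> Bh; have {}Bh := le_trans Bh (ler_wpM2l (ltW e'0) vn).
  have -> : u z - (u z0 + L h) = d - L h by rewrite /d; ring.
  have cd : c * `|d - L h| <= e' * (`|h| + `|d|).
    by rewrite -{1}(gtr0_norm c0) -normrM mulrBr distrC [c * d]mulrC.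
  have dK : `|d| <= (1 + 2 * (K / c)) * `|h|.
    have d1 : `|d| <= `|d - L h| + `|L h| by rewrite -{1}(subrK (L h) d) ler_normD.
    have d2 := LK h.
    have d3 : e' * (`|h| + `|d|) <= c / 2 * (`|h| + `|d|).
      by apply: ler_wpM2r e'c; exact: addr_ge0.
    have d4 : `|d - L h| <= 2^-1 * (`|h| + `|d|).
      rewrite -(ler_pM2l c0); apply: (le_trans cd); apply: (le_trans d3).
      by rewrite le_eqVlt; apply/orP; left; apply/eqP; ring.
    have -> : (1 + 2 * (K / c)) * `|h| = `|h| + 2 * (c^-1 * (K * `|h|)) by ring.
    by move: d1 d2 d4; move: (c^-1 * _) => x; lra.
  rewrite -(ler_pM2l c0); apply: (le_trans cd).
  have -> : c * (e * `|h|) = (e * c) * `|h| by ring.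
  apply: (le_trans _ (ler_wpM2r _ e'e)) => //.
  rewrite -mulrA; apply: ler_wpM2l; first exact: ltW.
  by move: dK; move: (K / c) => x; lra.
(* The chain rule on the same identity. Besides the term with [partial k u], only the coordinate [k]
   itself contributes, and nothing does when [k = i]. *)
have pk z k : V z -> partial k u z =
    ((k == i)%:R - (if k == i then 0 else partial k f (upd i (u z) z))) /
    partial i f (upd i (u z) z).
  move=> Vz; have dfz : differentiable f (upd i (u z) z) by exact/dW/Wu.
  have dg j : differentiable (fun w : 'rV[R]_n.+1 => upd i (u w) w 0 j) z.
    rewrite (_ : (fun w => _) = if j == i then u else fun w => w 0 j).
      by case: ifP => _; [exact: du|exact: coord_differentiable].
    by apply/funext => w; rewrite mxE; case: ifP.
  have : partial k (fun w => f (upd i (u w) w)) z = (k == i)%:R.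
    rewrite -(partial_coord z k i); apply: near_eq_partial.
    have : \near z, V z by exact: open_nbhs_nbhs.
    by apply: filterS => w /uP[].
  rewrite partial_comp // (bigD1 i) //=.
  rewrite (_ : (fun w => upd i (u w) w 0 i) = u); last first.
    by apply/funext => w; rewrite upd_same.
  have -> : \sum_(j | j != i) partial j f (upd i (u z) z) *
       partial k (fun w => upd i (u w) w 0 j) z =
     if k == i then 0 else partial k f (upd i (u z) z).
    rewrite (eq_bigr (fun j => partial j f (upd i (u z) z) * (k == j)%:R)); last first.
      move=> j ji; rewrite (_ : (fun w => _) = fun w => w 0 j) ?partial_coord //.
      by apply/funext => w; rewrite upd_other.
    case: ifP => [/eqP ->|ki].
      by rewrite big1 // => j ji; rewrite eq_sym (negbTE ji) mulr0.
    rewrite (bigD1 k) ?ki //= eqxx mulr1 big1 ?addr0 // => j /andP[_ jk].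
    by rewrite eq_sym (negbTE jk) mulr0.
  move=> <-; rewrite addrK mulrAC divff ?mul1r //.
  by rewrite gt_eqF // pW //; exact: Wu.
have cgj k j : Cn k V u -> Cn k V (fun w => upd i (u w) w 0 j).
  move=> cu; rewrite (_ : (fun w => _) = if j == i then u else fun w => w 0 j).
    by case: ifP => _; [exact: cu|exact: Cn_coord].
  by apply/funext => w; rewrite mxE; case: ifP.
have cu k : Cn k V u.
  elim: k => [|k IH]; first by split.
  apply: Cn_intro => // j.
  apply: (Cn_eq oV (fun q Vq => esym (pk q j Vq))).
  have cfj j' : Cn k V (fun w => partial j' f (upd i (u w) w)).
    apply: (@Cn_comp _ _ _ k V W (partial j' f) _ oV oW Wu); last exact: (cW k.+1).2.2.
    by move=> j''; exact: cgj.
  apply: CnM => //; last first.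
    apply: CnV => // q Vq; by rewrite gt_eqF // pW //; exact: Wu.
  case: (j == i).
    by under eq_fun do rewrite subr0; exact: Cn_cst.
  under eq_fun do rewrite sub0r -mulN1r.
  by apply: CnM => //; exact: Cn_cst.
exists u; split.
- by apply/smooth_nearP; exists V.
- have : \forall z \near upd i (f p) p, V z by exact: open_nbhs_nbhs.
  by apply: filterS => w /uP[].
- have cfp : {for p, continuous f} by exact/smooth_near_continuous.
  have n1 := near_continuous (continuous_upd (i := i) cfp) (open_nbhs_nbhs (conj oV Vz0)).
  have cc : {for p, continuous (fun q : 'rV[R]_n.+1 => q 0 i)} by exact: coord_continuous.
  have n2 := continuous_dist cc r0.
  apply: filterS2 n1 n2 => w Vw wr; have [uw uE] := uP _ Vw.
  rewrite distrC in wr; have [lt gt] := uC _ (w 0 i) Vw wr.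
  move: lt gt; rewrite upd_upd upd_id upd_same.
  rewrite ltxx => lt' gt'; apply/eqP; rewrite eq_le !leNgt.
  by apply/andP; split; apply/negP; [move/gt'|move/lt'].
Qed.

(** A negative derivative is treated by inverting [- f] and precomposing with the reflection of the
    i-th coordinate. *)
Lemma coordinate_inverse f i p : smooth_near p f -> partial i f p != 0 ->
  exists u, [/\ smooth_near (upd i (f p) p) u,
    \forall z \near upd i (f p) p, f (upd i (u z) z) = z 0 i
    & \forall w \near p, u (upd i (f w) w) = w 0 i].
Proof.
move=> sf fi0; have [fi|fi] := ltP 0 (partial i f p); first exact: positive_inverse.
have sNf : smooth_near p (fun w => - f w) by exact: smooth_nearN.
have [|u [su uE Eu]] := positive_inverse (i := i) sNf.
  rewrite partialN; last exact: smooth_near_differentiable.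
  by rewrite oppr_gt0 lt_neqAle fi0.
pose g w : 'rV[R]_n.+1 := upd i (- w 0 i) w.
have gE : g (upd i (f p) p) = upd i (- f p) p by rewrite /g upd_same upd_upd.
have cN : smooth_near (upd i (f p) p) (fun w => - w 0 i).
  by apply: smooth_nearN; exact: smooth_near_coord.
have cg : {for upd i (f p) p, continuous g}.
  by apply: continuous_upd; exact: smooth_near_continuous.
exists (fun w => u (g w)); split.
- by apply: smooth_near_comp; [exact: smooth_near_upd|rewrite gE].
- have n1 : \forall z \near g (upd i (f p) p), - f (upd i (u z) z) = z 0 i by rewrite gE.
  apply: filterS (near_continuous cg n1) => z /=.
  by rewrite {2}/g upd_upd /g upd_same => /oppr_inj.
- by apply: filterS Eu => w; rewrite /g upd_same upd_upd.
Qed.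

End CoordinateInverse.

Lemma derive_line_eq {R : realType} {V : normedModType R} (f g : V -> R) (p v : V) (d : R) :
  (forall h : R, f (h *: v + p) = g (h *: v + p)) -> is_derive p v g d -> is_derive p v f d.
Proof.
move=> fg [dg <-]; have fgp : f p = g p by have := fg 0; rewrite scale0r add0r.
have e : (fun h : R => h^-1 *: ((f \o shift p) (h *: v) - f p)) =
         (fun h : R => h^-1 *: ((g \o shift p) (h *: v) - g p)).
  by apply/funext => h /=; rewrite fg fgp.
by apply: DeriveDef; rewrite /derivable /derive e.
Qed.

Lemma is_derive_limit {R : realType} {V : normedModType R} (f : V -> R) (p v : V) (d : R) :
  (forall e : R, 0 < e -> exists2 r : R, 0 < r &
     forall h, h != 0 -> `|h| < r -> `|f (h *: v + p) - f p - d * h| <= e * `|h|) ->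
  is_derive p v f d.
Proof.
move=> H; have lim : h^-1 *: ((f \o shift p) (h *: v) - f p) @[h --> 0^'] --> d.
  apply/cvgrPdist_le => e e0; have [r r0 rP] := H e e0.
  near=> h; have h0 : h != 0 by near: h; exact: nbhs_dnbhs_neq.
  have hr : `|h| < r by near: h; exact: dnbhs0_lt.
  have hgt0 : 0 < `|h| by rewrite normr_gt0.
  rewrite /= -[_ *: _]/(h^-1 * _) -(ler_pM2r hgt0) -normrM mulrBl.
  by rewrite mulrAC mulVf // mul1r distrC; exact: rP.
by apply: DeriveDef; [apply/cvg_ex; exists d|exact/cvg_lim].
Unshelve. all: by end_near. Qed.

Lemma differentiable_exp {R : realType} {V : normedModType R} (f : V -> R) p k :
  differentiable f p -> differentiable (fun w => f w ^+ k) p.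
Proof.
move=> df; elim: k => [|k IH].
  rewrite (_ : (fun w => _) = fun=> 1); first exact: differentiable_cst.
  by apply/funext => w; rewrite expr0.
rewrite (_ : (fun w => _) = fun w => f w * f w ^+ k); first exact: differentiableM.
by apply/funext => w; rewrite exprS.
Qed.

Lemma partialX {R : realType} {n : nat} (f : 'rV[R]_n.+1 -> R) p i k : differentiable f p ->
  partial i (fun w => f w ^+ k.+1) p = k.+1%:R * f p ^+ k * partial i f p.
Proof.
move=> df; have dX m : differentiable (fun w => f w ^+ m) p by exact: differentiable_exp.
elim: k => [|k IH].
  rewrite expr0 !mul1r; congr (partial i _ p); by apply/funext => w; rewrite expr1.
rewrite (_ : (fun w => _) = fun w => f w * f w ^+ k.+1); last first.
  by apply/funext => w; rewrite exprS.
rewrite partialM // IH [k.+2%:R]mulrSr [f p ^+ k.+1]exprS; ring.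
Qed.

(** * Hadamard's lemma: dividing a smooth function by a coordinate *)

Section Hadamard.
Context {R : realType} {n : nat} (i : 'I_n.+1) (B : set 'rV[R]_n.+1).
Hypothesis oB : open B.
Hypothesis starB : forall w (s : R), B w -> 0 <= s <= 1 -> B (upd i (s * w 0 i) w).
Implicit Types (f g : 'rV[R]_n.+1 -> R) (w q : 'rV[R]_n.+1).

Let S f := forall q, B q -> smooth_near q f.
Let dd m f := iter m (partial i) f.

Let dS m f : S f -> S (dd m f).
Proof.
by move=> sf q Bq; elim: m => [|m IH]; [exact: sf|exact: smooth_near_partial].
Qed.

Let nearB w : B w -> \forall q \near w, B q.
Proof. by move=> Bw; exact: open_nbhs_nbhs. Qed.

Let dd_partialC m j f q : S f -> B q -> dd m (partial j f) q = partial j (dd m f) q.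
Proof.
move=> sf; elim: m q => [//|m IH] q Bq /=.
rewrite [RHS]partialC; last exact: dS.
by apply: near_eq_partial; apply: filterS (nearB Bq) => w; exact: IH.
Qed.

Let taylor k f w (c0 c1 e : R) : S f -> B w ->
  (forall m, (m < k)%N -> dd m f (upd i 0 w) = 0) -> dd k f (upd i 0 w) = c0 ->
  (forall s : R, 0 <= s <= 1 -> `|dd k.+1 f (upd i (s * w 0 i) w) - c1| <= e) ->
  `|f w - c0 * w 0 i ^+ k / k`!%:R - c1 * w 0 i ^+ k.+1 / k.+1`!%:R| <= e * `|w 0 i| ^+ k.+1.
Proof.
have seg g w' (v := w' 0 i *: 'e_i : 'rV[R]_n.+1) (s : R) :
    s *: v + upd i 0 w' = upd i (s * w' 0 i) w'.
  by rewrite [upd i 0 _]updE [RHS]updE /v scalerA addrA -scalerDl; congr (_ *: _ + _); ring.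
have mv g w' : B w' -> (forall q, B q -> differentiable g q) -> exists2 s : R, 0 <= s <= 1 &
    g w' - g (upd i 0 w') = w' 0 i * partial i g (upd i (s * w' 0 i) w').
  move=> Bw' dg; have dgs s : 0 <= s <= 1 -> differentiable g (upd i (s * w' 0 i) w').
    by move=> s01; apply/dg/starB.
  have [|s s01] := @mvt_segment R _ g (upd i 0 w') (w' 0 i *: 'e_i).
    by move=> s s01; rewrite seg //; exact/diff_derivable/dgs.
  rewrite seg // -[_ *: 'e_i]scale1r seg // mul1r upd_id scale1r => ->; exists s => //.
  by rewrite deriveE ?linearZ /= -?deriveE //; exact: dgs.
have dco q : differentiable (fun w : 'rV[R]_n.+1 => w 0 i) q by exact: coord_differentiable.
elim: k f w => [|k IH] f w sf Bw f0 fc fe.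
  rewrite expr0 !expr1 fact0 factS fact0 muln1 !divr1 mulr1 -fc.
  have [s s01 /= ->] := mv f w Bw (fun q Bq => smooth_near_differentiable (sf q Bq)).
  rewrite mulrC -mulrBl normrM; apply: ler_wpM2r => //; exact: fe.
pose h q := f q - c0 * q 0 i ^+ k.+1 / k.+1`!%:R - c1 * q 0 i ^+ k.+2 / k.+2`!%:R.
have dX m (c d : R) q : differentiable (fun w : 'rV[R]_n.+1 => c * w 0 i ^+ m / d) q.
  apply: differentiableM; last exact: differentiable_cst.
  by apply: differentiableM; [exact: differentiable_cst|exact: differentiable_exp].
have dh q : B q -> differentiable h q.
  move=> Bq; do 2 ?[apply: differentiableB => //].
  exact/smooth_near_differentiable/sf.
have pX m (c : R) q : partial i (fun w => c * w 0 i ^+ m.+1 / m.+1`!%:R) q =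
    c * q 0 i ^+ m / m`!%:R.
  rewrite (_ : (fun w => _) = fun w => c / m.+1`!%:R * w 0 i ^+ m.+1); last first.
    by apply/funext => w'; rewrite mulrAC.
  rewrite partialZ; last exact: differentiable_exp.
  rewrite partialX // partial_coord eqxx mulr1 factS natrM.
  have a0 : m.+1%:R != 0 :> R by rewrite pnatr_eq0.
  have b0 : m`!%:R != 0 :> R by rewrite pnatr_eq0 -lt0n fact_gt0.
  by move: (m.+1%:R) (m`!%:R) a0 b0 => a b a0 b0; field; rewrite a0 b0.
have ph q : B q -> partial i h q =
   partial i f q - c0 * q 0 i ^+ k / k`!%:R - c1 * q 0 i ^+ k.+1 / k.+1`!%:R.
  move=> Bq; have dfq := smooth_near_differentiable (sf q Bq).
  by rewrite /h !partialB ?pX //; exact: differentiableB.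
have h0 : h (upd i 0 w) = 0.
  have f00 : f (upd i 0 w) = 0 := f0 0%N isT.
  by rewrite /h f00 upd_same !expr0n /= !mulr0 !mul0r !subr0.
have [s s01] := mv h w Bw dh; rewrite h0 subr0 -/(h w) => ->.
set w' := upd i _ w; have Bw' : B w' by exact: starB.
have w'i : w' 0 i = s * w 0 i by rewrite upd_same.
have e0 : 0 <= e by apply: le_trans (fe 0 _) => //; rewrite lexx ler01.
rewrite normrM exprS mulrCA; apply: ler_wpM2l => //; rewrite ph //.
have /= := IH (partial i f) w' (fun q Bq => smooth_near_partial i (sf q Bq)) Bw'.
rewrite {1 2}/w' !upd_upd => /(_ _) H; apply: (le_trans (H _ _ _)).
- by move=> m mk; have := f0 m.+1 mk; rewrite /dd iterSr.
- by move: fc; rewrite /dd iterSr.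
- move=> t t01; rewrite w'i /w' upd_upd mulrA.
  have := fe (t * s); rewrite /dd iterSr; apply; case/andP: t01 => t0 t1; case/andP: s01 => s0 s1.
  by rewrite mulr_ge0 //= mulr_ile1.
apply: ler_wpM2l => //; rewrite w'i normrM exprMn ler_piMl ?exprn_ge0 //.
by case/andP: s01 => s0 s1; rewrite exprn_ile1 // ger0_norm.
Qed.

(** The quotient by the [k]-th power of the i-th coordinate, extended to the hyperplane by the
    Taylor coefficient. All powers are considered because differentiating a quotient raises the
    exponent. *)
Let Q k f w := if w 0 i == 0 then dd k f w / k`!%:R else f w / w 0 i ^+ k.
Let Z k f := S f /\ forall m q, (m < k)%N -> B q -> q 0 i = 0 -> dd m f q = 0.

Let Bupd0 w : B w -> B (upd i 0 w).
Proof. by move=> Bw; rewrite -(mul0r (w 0 i)); apply: starB; rewrite // lexx ler01. Qed.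

Let near_axis k f (c e : R) w : Z k f -> B w -> w 0 i = 0 -> dd k f w = c -> 0 < e ->
  \forall q \near w, `|Q k f q - c / k`!%:R| <= e.
Proof.
move=> [sf f0] Bw w0 fc e0.
have cf : {for w, continuous (dd k f)} by exact/smooth_near_continuous/dS.
have [r r0 rP] : exists2 r : R, 0 < r & forall q, ball w r q -> B q /\ `|dd k f q - c| <= e.
  have /nbhs_ballP[r /= r0 rP] : \forall q \near w, B q /\ `|dd k f q - c| <= e.
    apply: filterS2 (nearB Bw) (continuous_dist cf e0) => q Bq.
    by rewrite fc distrC => /ltW.
  by exists r => // q /rP.
apply/nbhs_ballP; exists r => //= q qr.
have [Bq qe] := rP _ qr; rewrite /Q; case: eqVneq => q0.
  rewrite -mulrBl normrM; apply: le_trans qe; rewrite ler_piMr // normfV invf_le1.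
    by rewrite ger0_norm // ler1n fact_gt0.
  by rewrite normr_gt0 pnatr_eq0 -lt0n fact_gt0.
have seg s : 0 <= s <= 1 -> `|dd k f (upd i (s * q 0 i) q) - c| <= e.
  move=> /andP[s0 s1]; apply: (rP _ _).2; apply/ball_rowP => // j.
  move/ball_rowP : qr => /(_ r0 j); apply: le_lt_trans; rewrite mxE.
  case: eqVneq => // ->; rewrite w0 !sub0r !normrN normrM ler_piMl //.
  by rewrite ger0_norm.
case: k f0 fc cf rP qe seg => [|k] f0 fc cf rP qe seg.
  by rewrite expr0 fact0 !divr1; have := seg 1; rewrite mul1r upd_id; apply; rewrite ler01 lexx.
have fq : forall m, (m < k.+1)%N -> dd m f (upd i 0 q) = 0.
  by move=> m mk; apply: f0 => //; [exact: Bupd0|rewrite upd_same].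
have := taylor sf Bq (fun m mk => fq m (ltnW mk)) (fq k (ltnSn k)) seg.
rewrite mul0r mul0r subr0 => H.
have qk : 0 < `|q 0 i| ^+ k.+1 by rewrite exprn_gt0 // normr_gt0.
rewrite -(ler_pM2r qk) -normrX -normrM normrX mulrBl mulfVK ?expf_neq0 //.
by rewrite mulrAC.
Qed.

Let Q_continuous k f w : Z k f -> B w -> {for w, continuous (Q k f)}.
Proof.
move=> Zf Bw; have [w0|w0] := eqVneq (w 0 i) 0.
  apply: continuous_eps => e e0; have e2 : 0 < e / 2 by rewrite divr_gt0.
  apply: filterS (near_axis Zf Bw w0 erefl e2) => q; rewrite {2}/Q w0 eqxx distrC.
  by move=> H; apply: (le_lt_trans H); rewrite ltr_pdivrMr // ltr_pMr // ltr1n.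
have cc : {for w, continuous (fun q : 'rV[R]_n.+1 => q 0 i)} by exact: coord_continuous.
apply: (@near_eq_continuous _ _ (fun q => f q / q 0 i ^+ k)).
  by apply: filterS (near_neq0 cc w0) => q q0; rewrite /Q (negbTE q0).
apply/smooth_near_continuous/smooth_nearM; first exact: Zf.1.
apply: smooth_nearV; last by rewrite expf_neq0.
by apply: smooth_nearX; exact: smooth_near_coord.
Qed.

(** The numerator of the derivative of [f / w_i^k] in direction [i] over the denominator
    [w_i^(k+1)]. This operator raises the order of vanishing on the hyperplane by one, so the new
    quotient is again of the admissible kind. *)
Let euler k f q := q 0 i * partial i f q - k%:R * f q.

Let euler_smooth k f : S f -> S (euler k f).
Proof.
move=> sf q Bq; apply: smooth_nearB.
  by apply: smooth_nearM; [exact: smooth_near_coord|exact/smooth_near_partial/sf].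
by apply: smooth_nearM; [exact: smooth_near_cst|exact: sf].
Qed.

Let dd_euler k m f q : S f -> B q ->
  dd m (euler k f) q = q 0 i * dd m.+1 f q + (m%:R - k%:R) * dd m f q.
Proof.
move=> sf; elim: m q => [|m IH] q Bq; first by rewrite /= /euler sub0r mulNr.
rewrite [LHS](@near_eq_partial _ _ _ _
  (fun q => q 0 i * dd m.+1 f q + (m%:R - k%:R) * dd m f q)); last first.
  by apply: filterS (nearB Bq) => w; exact: IH.
have d1 : differentiable (dd m f) q by exact/smooth_near_differentiable/dS.
have d2 : differentiable (dd m.+1 f) q by exact/smooth_near_differentiable/dS.
have d3 : differentiable (fun q : 'rV[R]_n.+1 => q 0 i) q by exact: coord_differentiable.
rewrite partialD; [|exact: differentiableM|].
  rewrite partialM // partial_coord eqxx mul1r partialZ // -[m.+1%:R]natr1 /=; ring.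
by apply: differentiableM => //; exact: differentiable_cst.
Qed.

Let euler_Z k f : Z k f -> Z k.+1 (euler k f).
Proof.
move=> [sf f0]; split=> [|m q mk Bq q0]; first exact: euler_smooth.
rewrite dd_euler // q0 mul0r add0r; move: mk; rewrite ltnS leq_eqVlt => /orP[/eqP ->|mk].
  by rewrite subrr mul0r.
by rewrite f0 // mulr0.
Qed.

Let partial_Z k j f : j != i -> Z k f -> Z k (partial j f).
Proof.
move=> ji [sf f0]; split=> [q Bq|m q mk Bq q0]; first exact/smooth_near_partial/sf.
rewrite dd_partialC //; apply: (@derive_val _ _ _ _ _ _ _); apply: is_derive_limit => e e0.
have /nbhs_ballP[r /= r0 rP] := nearB Bq.
exists r => // h _ hr; rewrite (f0 _ q) // mul0r !subr0 f0 //; last first.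
- by rewrite !mxE eqxx /= eq_sym (negbTE ji) mulr0 add0r.
- apply: rP; apply/ball_rowP => // l; rewrite !mxE eqxx /= opprD addrCA subrr addr0.
  rewrite normrN normrM; apply: le_lt_trans hr; rewrite ler_piMr //.
  by case: (l == j); rewrite ?normr1 ?normr0.
by rewrite normr0 mulr_ge0 // ltW.
Qed.

Let partial_expcoord k j q :
  partial j (fun q : 'rV[R]_n.+1 => q 0 i ^+ k) q = k%:R * q 0 i ^+ k.-1 * (j == i)%:R.
Proof.
case: k => [|k].
  by rewrite mul0r mul0r -(partial_cst 1 q j); congr (partial j _ q).
by rewrite partialX ?partial_coord //; exact: coord_differentiable.
Qed.

(** Off the hyperplane this is the quotient rule. On it, direction [i] is settled by the estimate
    [taylor], which identifies the next Taylor coefficient; in the other directions the line stays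
    in the hyperplane, where [Q k f] is a multiple of [dd k f]. *)
Let Q_derive k f w j : Z k f -> B w ->
  is_derive w 'e_j (Q k f) (if j == i then Q k.+1 (euler k f) w else Q k (partial j f) w).
Proof.
move=> Zf Bw; have [sf f0] := Zf; have [w0|w0] := eqVneq (w 0 i) 0; last first.
  have cc : {for w, continuous (fun q : 'rV[R]_n.+1 => q 0 i)} by exact: coord_continuous.
  apply: (@near_eq_is_derive _ _ _ (fun q => f q * (q 0 i ^+ k)^-1)).
    by apply: filterS (near_neq0 cc w0) => q q0; rewrite /Q (negbTE q0).
  have dX : differentiable (fun q : 'rV[R]_n.+1 => q 0 i ^+ k) w.
    by apply: differentiable_exp; exact: coord_differentiable.
  have df : differentiable f w by exact/smooth_near_differentiable/sf.
  have X0 : w 0 i ^+ k != 0 by rewrite expf_neq0.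
  have dV : differentiable (fun q : 'rV[R]_n.+1 => (q 0 i ^+ k)^-1) w.
    exact: differentiableV.
  apply: DeriveDef; first by apply/diff_derivable/differentiableM.
  rewrite -[LHS]/(partial j (fun q => f q * (q 0 i ^+ k)^-1) w).
  rewrite partialM // partialV // partial_expcoord /Q (negbTE w0) /euler.
  case: eqVneq => [->|_] /=; last by rewrite mulr0 oppr0 mul0r mulr0 addr0.
  have kk : k%:R * w 0 i ^+ k.-1 = k%:R * w 0 i ^+ k / w 0 i.
    by case: (k) => [|m]; rewrite ?mul0r //= exprSr mulrA mulfK.
  rewrite mulr1 [w 0 i ^+ k.+1]exprS kk; move: (w 0 i ^+ k) X0 w0 => X X0 w0.
  by field; rewrite X0 w0.
case: eqVneq => [->|ji].
  apply: is_derive_limit => e e0; rewrite /Q w0 eqxx.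
  rewrite dd_euler // w0 mul0r add0r -natrB // subSnn mul1r.
  set c0 := dd k f w; set c1 := dd k.+1 f w.
  have cf : {for w, continuous (dd k.+1 f)} by exact/smooth_near_continuous/dS.
  have /nbhs_ballP[r /= r0 rP] : \forall q \near w, B q /\ `|dd k.+1 f q - c1| <= e.
    apply: filterS2 (nearB Bw) (continuous_dist cf e0) => q Bq.
    by rewrite distrC => /ltW.
  exists r => // h h0 hr.
  have qE : h *: 'e_i + w = upd i h w by rewrite updE w0 subr0.
  have inb s : 0 <= s <= 1 -> ball w r (upd i (s * h) w).
    move=> /andP[s0 s1]; apply/ball_rowP => // l; rewrite mxE; case: eqVneq => [->|_].
      rewrite w0 sub0r normrN normrM; apply: le_lt_trans hr; rewrite ler_piMl //.
      by rewrite ger0_norm.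
    by rewrite subrr normr0.
  have Bq : B (upd i h w) by have [] := rP _ (inb 1 _); rewrite ?mul1r ?ler01 ?lexx.
  rewrite qE upd_same (negbTE h0).
  have w0E : upd i 0 (upd i h w) = w by rewrite upd_upd -w0 upd_id.
  have := @taylor k f (upd i h w) c0 c1 e sf Bq; rewrite w0E upd_same => H.
  have {}H := H (fun m mk => f0 m w mk Bw w0) erefl.
  have {}H : `|f (upd i h w) - c0 * h ^+ k / k`!%:R - c1 * h ^+ k.+1 / k.+1`!%:R|
       <= e * `|h| ^+ k.+1.
    by apply: H => s s01; rewrite upd_upd; exact: (rP _ (inb s s01)).2.
  have hk : 0 < `|h| ^+ k by rewrite exprn_gt0 // normr_gt0.
  rewrite -(ler_pM2r hk) -[e * _ * _]mulrA -exprS -normrX -normrM.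
  apply: le_trans H; rewrite le_eqVlt; apply/orP; left; apply/eqP; congr (`|_|).
  rewrite !mulrBl mulfVK ?expf_neq0 // exprS; ring.
apply: (@derive_line_eq _ _ _ (fun q => dd k f q * (k`!%:R)^-1)) => [h|].
  have qi : (h *: 'e_j + w) 0 i = 0.
    by rewrite !mxE eqxx /= [i == j]eq_sym (negbTE ji) mulr0 add0r.
  by rewrite /Q qi eqxx.
have ddf : differentiable (dd k f) w by exact/smooth_near_differentiable/dS.
have dc : differentiable (fun q => dd k f q * (k`!%:R)^-1) w.
  by apply: differentiableM => //; exact: differentiable_cst.
apply: DeriveDef; first exact: diff_derivable.
rewrite /Q w0 eqxx dd_partialC //.
rewrite -[LHS]/(partial j (fun q => dd k f q * (k`!%:R)^-1) w).
by rewrite partialM // ?partial_cst ?mulr0 ?addr0 //; exact: differentiable_cst.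
Qed.

(** Every partial derivative of a quotient [Q k f] is a quotient of the same family, so the
    induction on [m] has to range over all [k] and [f]. *)
Let Q_Cn m k f : Z k f -> Cn m B (Q k f).
Proof.
elim: m k f => [|m IH] k f Zf; first by split=> // q; exact: Q_continuous.
split=> [q|]; first exact: Q_continuous.
split=> [j q Bq|j]; first exact: (@ex_derive _ _ _ _ _ _ _ (Q_derive j Zf Bq)).
have pE q : B q -> (if j == i then Q k.+1 (euler k f) q else Q k (partial j f) q) =
    partial j (Q k f) q.
  by move=> Bq; rewrite /partial (@derive_val _ _ _ _ _ _ _ (Q_derive j Zf Bq)).
apply: (Cn_eq oB pE); case: eqVneq => [_|ji]; first exact/IH/euler_Z.
exact/IH/partial_Z.
Qed.

Lemma hadamard_star f : (forall q, B q -> smooth_near q f) ->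
  (forall q, B q -> q 0 i = 0 -> f q = 0) ->
  exists g, [/\ forall q, B q -> smooth_near q g,
    forall q, B q -> f q = q 0 i * g q
    & forall q, q 0 i = 0 -> g q = partial i f q].
Proof.
move=> sf f0; have Z1 : Z 1 f by split=> // -[|//] q _; exact: f0.
exists (Q 1 f); split=> [q Bq|q Bq|q q0].
- by apply/smooth_nearP; exists B; split=> // k; exact: Q_Cn.
- rewrite /Q; case: eqVneq => q0; first by rewrite q0 mul0r f0.
  by rewrite expr1 mulrC divfK.
- by rewrite /Q q0 eqxx divr1.
Qed.

End Hadamard.

(** [hadamard_star] applies to [f] minus its value at the projection onto the hyperplane, over a
    ball for the max norm, which is stable under shrinking one coordinate. *)
Lemma hadamard {R : realType} {n : nat} (i : 'I_n.+1) (f : 'rV[R]_n.+1 -> R) :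
  smooth_near 0 f ->
  exists g, [/\ smooth_near 0 g,
    \forall q \near (0 : 'rV[R]_n.+1), f q = f (upd i 0 q) + (q : 'rV[R]_n.+1) 0 i * g q
    & \forall q \near (0 : 'rV[R]_n.+1), (q : 'rV[R]_n.+1) 0 i = 0 -> g q = partial i f q].
Proof.
move=> sf; have /nbhs_ballP[r /= r0 rP] := smooth_near_near sf.
pose B := ball (0 : 'rV[R]_n.+1) r.
have oB : open B by exact: ball_open.
have B0 : B 0 by exact: ballxx.
have starB w (s : R) : B w -> 0 <= s <= 1 -> B (upd i (s * w 0 i) w).
  move=> Bw /andP[s0 s1]; apply/ball_rowP => // j; move/ball_rowP : Bw => /(_ r0 j).
  apply: le_lt_trans; rewrite !mxE !sub0r !normrN; case: eqVneq => [->|//].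
  by rewrite normrM ler_piMl // ger0_norm.
have Bupd w : B w -> B (upd i 0 w).
  by move=> Bw; rewrite -(mul0r (w 0 i)); apply: starB; rewrite // lexx ler01.
have cupd (q : 'rV[R]_n.+1) j : smooth_near q (fun w => upd i 0 w 0 j).
  by apply: (@smooth_near_upd _ _ i (fun=> 0) q); exact: smooth_near_cst.
have sfu q : B q -> smooth_near q (fun w => f (upd i 0 w)).
  by move=> Bq; exact: smooth_near_comp (cupd q) (rP _ (Bupd _ Bq)).
pose F w := f w - f (upd i 0 w).
have sF q : B q -> smooth_near q F by move=> Bq; apply: smooth_nearB; [exact: rP|exact: sfu].
have [|g [sg gE g0]] := hadamard_star oB starB sF.
  move=> q Bq q0; have qE : upd i 0 q = q by rewrite -{1}q0 upd_id.
  by rewrite /F qE subrr.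
have nB : \forall q \near (0 : 'rV[R]_n.+1), B q by exact: open_nbhs_nbhs.
exists g; split; first exact: sg.
  by apply: filterS nB => q Bq; rewrite -gE // /F addrC subrK.
apply: filterS nB => q Bq q0; rewrite g0 // /F partialB; last 2 first.
- exact/smooth_near_differentiable/rP.
- exact/smooth_near_differentiable/sfu.
rewrite (_ : partial i (fun w => f (upd i 0 w)) q = 0) ?subr0 //.
have dc : is_derive q 'e_i (fun=> f (upd i 0 q)) 0 by exact: is_derive_cst.
have le (h : R) : f (upd i 0 (h *: 'e_i + q)) = f (upd i 0 q).
  congr f; apply/rowP => k; rewrite !mxE; case: eqVneq => // ki.
  by rewrite mulr0 add0r.
exact: (@derive_val _ _ _ _ _ _ _ (derive_line_eq le dc)).
Qed.

(* Unfolding [partial] makes unification diverge on goals with several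
   derivatives, hence this sealed copy for real-valued functions. *)
Fact pd_key : {D : forall (R : realType) n, 'I_n.+1 -> ('rV[R]_n.+1 -> R) -> 'rV[R]_n.+1 -> R
  | forall R n i f p, D R n i f p = partial i f p}.
Proof. by exists (fun R n i f p => partial i f p). Qed.

Definition pd {R : realType} {n : nat} := sval pd_key R n.

Section Pd.
Context {R : realType} {n : nat}.
Implicit Types (f g : 'rV[R]_n.+1 -> R) (p q : 'rV[R]_n.+1).

Lemma pdE i f p : pd i f p = partial i f p.
Proof. exact: (svalP pd_key). Qed.

Lemma pdE_fun i f : pd i f = partial i f.
Proof. by apply/funext => p; exact: pdE. Qed.

Lemma near_eq_pd i f g p : (\near p, f p = g p) -> pd i f p = pd i g p.
Proof. by move=> fg; rewrite !pdE; exact: near_eq_partial. Qed.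

Lemma near_eq_pd_near i f g p : (\near p, f p = g p) -> \near p, pd i f p = pd i g p.
Proof. by move=> fg; rewrite !pdE_fun; exact: (near_eq_partials [:: i] fg). Qed.

Lemma pdD f g p i : differentiable f p -> differentiable g p ->
  pd i (fun w => f w + g w) p = pd i f p + pd i g p.
Proof. by rewrite !pdE; exact: partialD. Qed.

Lemma pdN f p i : differentiable f p -> pd i (fun w => - f w) p = - pd i f p.
Proof. by rewrite !pdE; exact: partialN. Qed.

Lemma pdB f g p i : differentiable f p -> differentiable g p ->
  pd i (fun w => f w - g w) p = pd i f p - pd i g p.
Proof. by rewrite !pdE; exact: partialB. Qed.

Lemma pdM f g p i : differentiable f p -> differentiable g p ->
  pd i (fun w => f w * g w) p = pd i f p * g p + f p * pd i g p.
Proof. by rewrite !pdE; exact: partialM. Qed.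

Lemma pd_cst (c : R) p i : pd i (fun=> c) p = 0.
Proof. by rewrite !pdE; exact: partial_cst. Qed.

Lemma pdZ (c : R) f p i : differentiable f p -> pd i (fun w => c * f w) p = c * pd i f p.
Proof. by rewrite !pdE; exact: partialZ. Qed.

Lemma pd_coord p i j : pd i (fun w : 'rV[R]_n.+1 => w 0 j) p = (i == j)%:R.
Proof. by rewrite !pdE; exact: partial_coord. Qed.

Lemma pdV f p i : differentiable f p -> f p != 0 ->
  pd i (fun w => (f w)^-1) p = - pd i f p * (f p)^-1 ^+ 2.
Proof. by rewrite !pdE; exact: partialV. Qed.

Lemma pd_sqrt f p i : differentiable f p -> 0 < f p ->
  pd i (fun w => Num.sqrt (f w)) p = pd i f p / (2 * Num.sqrt (f p)).
Proof. by rewrite !pdE; exact: partial_sqrt. Qed.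

Lemma pdX f p i k : differentiable f p ->
  pd i (fun w => f w ^+ k.+1) p = k.+1%:R * f p ^+ k * pd i f p.
Proof. by rewrite !pdE; exact: partialX. Qed.

Lemma pdC f p i j : smooth_near p f -> pd i (pd j f) p = pd j (pd i f) p.
Proof. by rewrite !pdE !pdE_fun; exact: partialC. Qed.

Lemma smooth_near_pd p f i : smooth_near p f -> smooth_near p (pd i f).
Proof. by rewrite pdE_fun; exact: smooth_near_partial. Qed.

Lemma pd_coordinate_inverse f i p : smooth_near p f -> pd i f p != 0 ->
  exists u, [/\ smooth_near (upd i (f p) p) u,
    \forall z \near upd i (f p) p, f (upd i (u z) z) = z 0 i
    & \forall w \near p, u (upd i (f w) w) = w 0 i].
Proof. by rewrite pdE; exact: coordinate_inverse. Qed.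

Lemma pd_hadamard (i : 'I_n.+1) (f : 'rV[R]_n.+1 -> R) : smooth_near 0 f ->
  exists g, [/\ smooth_near 0 g,
    \forall q \near (0 : 'rV[R]_n.+1), f q = f (upd i 0 q) + (q : 'rV[R]_n.+1) 0 i * g q
    & \forall q \near (0 : 'rV[R]_n.+1), (q : 'rV[R]_n.+1) 0 i = 0 -> g q = pd i f q].
Proof. by rewrite pdE_fun; exact: hadamard. Qed.

End Pd.

Lemma pd_comp {R : realType} {m n : nat} (f : 'rV[R]_n.+1 -> R)
    (g : 'rV[R]_m.+1 -> 'rV[R]_n.+1) p i :
  differentiable f (g p) -> (forall j, differentiable (fun w => g w 0 j) p) ->
  pd i (fun w => f (g w)) p = \sum_j pd j f (g p) * pd i (fun w => g w 0 j) p.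
Proof.
move=> df dg; rewrite pdE partial_comp //.
by apply: eq_bigr => j _; rewrite !pdE.
Qed.

Ltac smooth_hyp :=
  match goal with
  | H : smooth_near ?p ?f |- smooth_near ?p ?f => exact H
  | H : smooth_near ?p ?f |- smooth_near ?p (fun w => ?f w) => exact H
  | H : forall j, smooth_near ?p (fun w => @fun_of_matrix _ _ _ (?g w) _ j)
    |- smooth_near ?p (fun w => @fun_of_matrix _ _ _ (?g w) _ ?j) => exact (H j)
  end.

(* Goal-directed: a plain [done] would compare unrelated functions up to
   conversion, which is very slow. *)
Ltac smooth :=
  lazymatch goal with
  | |- differentiable _ _ => apply: smooth_near_differentiable; smooth
  | |- smooth_near _ _ =>
    first
    [ smooth_hyp
    | lazymatch goal with
      | |- smooth_near _ (fun _ => ?c) => exact: smooth_near_cst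
      | |- smooth_near _ (fun w => @GRing.add _ (@?f w) (@?g w)) => apply: smooth_nearD; smooth
      | |- smooth_near _ (fun w => @GRing.opp _ (@?f w)) => apply: smooth_nearN; smooth
      | |- smooth_near _ (fun w => @GRing.mul _ (@?f w) (@?g w)) => apply: smooth_nearM; smooth
      | |- smooth_near _ (fun w => @GRing.exp _ (@?f w) _) => apply: smooth_nearX; smooth
      | |- smooth_near _ (fun w => @fun_of_matrix _ _ _ w _ _) => exact: smooth_near_coord
      | |- smooth_near _ (pd _ _) => apply: smooth_near_pd; smooth
      | |- smooth_near _ (fun w => pd _ ?f w) => apply: (@smooth_near_pd _ _ _ f); smooth
      end ]
  | _ => idtac
  end.

Lemma row_smooth_continuous {R : realType} {n m : nat} (g : 'rV[R]_n.+1 -> 'rV[R]_m.+1) p :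
  (forall j, smooth_near p (fun w => g w 0 j)) -> {for p, continuous g}.
Proof. by move=> sg; apply/row_continuous => j; apply: smooth_near_continuous. Qed.

Lemma differentiable_sum_fun {R : realType} {V : normedModType R} m (F : 'I_m -> V -> R) p :
  (forall j, differentiable (F j) p) -> differentiable (fun w => \sum_j F j w) p.
Proof.
move=> dF; rewrite (_ : (fun w => _) = \sum_j F j); first exact: differentiable_sum.
by apply/funext => w; rewrite fct_sumE.
Qed.

Lemma pd_sum {R : realType} {n m : nat} (F : 'I_m -> 'rV[R]_n.+1 -> R) p i :
  (forall j, differentiable (F j) p) ->
  pd i (fun w => \sum_j F j w) p = \sum_j pd i (F j) p.
Proof.
elim: m F => [|m IH] F dF.
  transitivity (pd i (fun=> 0 : R) p); last by rewrite pd_cst big_ord0.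
  by congr (pd i _ p); apply/funext => w; rewrite big_ord0.
rewrite big_ord_recl -IH // -pdD //; last exact: differentiable_sum_fun.
by congr (pd i _ p); apply/funext => w; rewrite big_ord_recl.
Qed.

(** * Second order chain and product rules *)

Section SecondOrder.
Context {R : realType}.

Lemma pd_comp_near {m n : nat} (f : 'rV[R]_n.+1 -> R)
    (g : 'rV[R]_m.+1 -> 'rV[R]_n.+1) p i :
  (forall j, smooth_near p (fun w => g w 0 j)) -> smooth_near (g p) f ->
  \forall w \near p, pd i (fun w => f (g w)) w =
  \sum_j pd j f (g w) * pd i (fun w => g w 0 j) w.
Proof.
move=> sg sf.
have cg := row_smooth_continuous sg.
have n1 := near_continuous cg (smooth_near_near sf).
have n2 : \forall w \near p, forall j, smooth_near w (fun w => g w 0 j).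
  near=> w => j; move: j; near: w; apply: filter_forall => j.
  exact: smooth_near_near.
apply: filterS2 n1 n2 => w sfw sgw; apply: pd_comp.
  exact: smooth_near_differentiable.
by move=> j; exact: smooth_near_differentiable.
Unshelve. all: by end_near. Qed.

(** At a critical point the second derivatives of the inner map are multiplied by zero, so the
    Hessian transforms as a quadratic form. *)
Lemma pd2_comp_critical {m n : nat} (f : 'rV[R]_n.+1 -> R)
    (g : 'rV[R]_m.+1 -> 'rV[R]_n.+1) p i j :
  (forall j, smooth_near p (fun w => g w 0 j)) -> smooth_near (g p) f ->
  (forall a, pd a f (g p) = 0) ->
  pd i (pd j (fun w => f (g w))) p =
  \sum_b (\sum_a pd a (pd b f) (g p) * pd i (fun w => g w 0 a) p)
     * pd j (fun w => g w 0 b) p.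
Proof.
move=> sg sf f0; rewrite (near_eq_pd i (pd_comp_near j sg sf)).
have dfg b : differentiable (fun w => pd b f (g w)) p.
  exact: smooth_near_differentiable (smooth_near_comp sg (smooth_near_pd b sf)).
have dgj b : differentiable (pd j (fun w => g w 0 b)) p.
  exact/smooth_near_differentiable/smooth_near_pd.
rewrite pd_sum; last by move=> b; exact: differentiableM.
apply: eq_bigr => b _; rewrite pdM // f0 mul0r addr0; congr (_ * _).
apply: pd_comp; last by move=> a; exact: smooth_near_differentiable.
exact/smooth_near_differentiable/smooth_near_pd.
Qed.

Lemma pdM_near {n} (f g : 'rV[R]_n.+1 -> R) p i : smooth_near p f -> smooth_near p g ->
  \forall w \near p, pd i (fun w => f w * g w) w =
    pd i f w * g w + f w * pd i g w.
Proof.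
move=> /smooth_near_near sf /smooth_near_near sg; apply: filterS2 sf sg => w sf sg.
by rewrite pdM //; exact: smooth_near_differentiable.
Qed.

Lemma pdD_near {n} (f g : 'rV[R]_n.+1 -> R) p i : smooth_near p f -> smooth_near p g ->
  \forall w \near p, pd i (fun w => f w + g w) w = pd i f w + pd i g w.
Proof.
move=> /smooth_near_near sf /smooth_near_near sg; apply: filterS2 sf sg => w sf sg.
by rewrite pdD //; exact: smooth_near_differentiable.
Qed.

Lemma pd2D {n} (f g : 'rV[R]_n.+1 -> R) p i j : smooth_near p f -> smooth_near p g ->
  pd i (pd j (fun w => f w + g w)) p = pd i (pd j f) p + pd i (pd j g) p.
Proof. by move=> sf sg; rewrite (near_eq_pd i (pdD_near j sf sg)) pdD; smooth. Qed.

Lemma pd2M {n} (f g : 'rV[R]_n.+1 -> R) p i j : smooth_near p f -> smooth_near p g ->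
  pd i (pd j (fun w => f w * g w)) p =
  pd i (pd j f) p * g p + pd j f p * pd i g p
  + (pd i f p * pd j g p + f p * pd i (pd j g) p).
Proof.
move=> sf sg; rewrite (near_eq_pd i (pdM_near j sf sg)).
have df := smooth_near_differentiable sf; have dg := smooth_near_differentiable sg.
have dfj := smooth_near_differentiable (smooth_near_pd j sf).
have dgj := smooth_near_differentiable (smooth_near_pd j sg).
by rewrite pdD ?pdM //; apply: differentiableM.
Qed.

End SecondOrder.

(** * Charts of the plane and normal forms of products of two functions *)

Section Plane.
Context {R : realType}.
Implicit Types (f g : 'rV[R]_2 -> R) (p q w z : 'rV[R]_2) (i j : 'I_2).

Lemma ord2_neq i j k : i != j -> (k == i) || (k == j).
Proof. by case: i j k => [[|[|//]] ?] [[|[|//]] ?] [[|[|//]] ?]. Qed.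

Lemma ord2_cases i j : i != j -> (i = 0 /\ j = 1) \/ (i = 1 /\ j = 0).
Proof.
by case: i j => [[|[|//]] ?] [[|[|//]] ?] //= _; [left|right]; split; exact: val_inj.
Qed.

Lemma sum_ord2 i j (F : 'I_2 -> R) : i != j -> \sum_k F k = F i + F j.
Proof.
move=> ij; rewrite (bigD1 i) //= (bigD1 j) ?(eq_sym j) //= big1 ?addr0 // => k.
by case/andP => ki kj; have := ord2_neq k ij; rewrite (negbTE ki) (negbTE kj).
Qed.

Lemma upd2 i j (a b : R) w : i != j -> upd i a (upd j b w) = \row_k (if k == i then a else b).
Proof.
move=> ij; apply/rowP => k; rewrite !mxE; case: (eqVneq k i) => // ki.
by have := ord2_neq k ij; rewrite (negbTE ki) /= => ->.
Qed.

Definition jac (X Y : 'rV[R]_2 -> R) p : R :=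
  pd 0 X p * pd 1 Y p - pd 1 X p * pd 0 Y p.

(** Two elementary charts in succession: [X] becomes the i-th coordinate, then [Y], read in the
    first chart, becomes the j-th. The Jacobian condition says precisely that the second chart has a
    nonzero derivative in its own direction. *)
Lemma chart_inverse (i j : 'I_2) q (X Y : 'rV[R]_2 -> R) : i != j ->
  smooth_near q X -> smooth_near q Y -> X q = 0 -> Y q = 0 -> pd i X q != 0 ->
  pd i X q * pd j Y q - pd j X q * pd i Y q != 0 ->
  exists2 phi, diffeo_germ 0 q phi &
    \forall z \near (0 : 'rV[R]_2), X (phi z) = (z : 'rV[R]_2) 0 0 /\ Y (phi z) = (z : 'rV[R]_2) 0 1.
Proof.
move=> ij sX sY X0 Y0 Xi J0.
have [u [su uE Eu]] := pd_coordinate_inverse sX Xi; rewrite X0 in su uE.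
set p1 := upd i 0 q in su uE.
pose d1 z := upd i (u z) z; pose c1 w := upd i (X w) w.
have c1q : c1 q = p1 by rewrite /c1 X0.
have dc1 : \forall w \near q, d1 (c1 w) = w.
  by apply: filterS Eu => w uw; rewrite /d1 /c1 uw upd_upd upd_id.
have d1p1 : d1 p1 = q by rewrite -{1}c1q (nbhs_singleton dc1).
have sd1 k : smooth_near p1 (fun z => d1 z 0 k) by exact: smooth_near_upd.
have cd1 := row_smooth_continuous sd1.
have cc1 : {for q, continuous c1} by apply: continuous_upd; exact: smooth_near_continuous.
pose Y1 z := Y (d1 z).
have sY1 : smooth_near p1 Y1 by apply: (smooth_near_comp sd1); rewrite d1p1; exact: sY.
have ud k : pd k (fun z => d1 z 0 i) p1 = pd k u p1.
  by congr (pd k _ p1); apply/funext => z; rewrite upd_same.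
have jd : pd j (fun z => d1 z 0 j) p1 = 1.
  rewrite (_ : (fun z => _) = fun z => z 0 j) ?pd_coord ?eqxx //.
  by apply/funext => z; rewrite upd_other // eq_sym.
have dd1 k : differentiable (fun z => d1 z 0 k) p1 by exact/smooth_near_differentiable/sd1.
have dX : differentiable X (d1 p1) by rewrite d1p1; exact: smooth_near_differentiable.
have dY : differentiable Y (d1 p1) by rewrite d1p1; exact: smooth_near_differentiable.
have eX : pd i X q * pd j u p1 + pd j X q = 0.
  have : pd j (fun z => X (d1 z)) p1 = 0.
    by rewrite (near_eq_pd j uE) pd_coord eq_sym (negbTE ij).
  by rewrite (pd_comp j dX dd1) d1p1 (sum_ord2 _ ij) ud jd mulr1.
have Y1j : pd j Y1 p1 != 0.
  rewrite /Y1 (pd_comp j dY dd1) d1p1 (sum_ord2 _ ij) ud jd mulr1; apply: contra J0 => /eqP H.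
  have -> : pd i X q * pd j Y q - pd j X q * pd i Y q =
    pd i X q * (pd i Y q * pd j u p1 + pd j Y q)
    - pd i Y q * (pd i X q * pd j u p1 + pd j X q) by ring.
  by rewrite H eX !mulr0 subrr.
have Y1p1 : Y1 p1 = 0 by rewrite /Y1 d1p1.
have [v [sv vE Ev]] := pd_coordinate_inverse sY1 Y1j; rewrite Y1p1 in sv vE.
have p2E : upd j 0 p1 = 0.
  rewrite /p1 upd2; last by rewrite eq_sym.
  by apply/rowP => k; rewrite !mxE; case: ifP.
rewrite p2E in sv vE.
pose d2 z := upd j (v z) z; pose c2 w := upd j (Y1 w) w.
have c2p1 : c2 p1 = 0 by rewrite /c2 Y1p1.
have dc2 : \forall w \near p1, d2 (c2 w) = w.
  by apply: filterS Ev => w vw; rewrite /d2 /c2 vw upd_upd upd_id.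
have d20 : d2 0 = p1 by rewrite -{1}c2p1 (nbhs_singleton dc2).
have sd2 k : smooth_near 0 (fun z => d2 z 0 k) by exact: smooth_near_upd.
have cd2 := row_smooth_continuous sd2.
(* The composed chart stores [X] in place [i] and [Y] in place [j]; [P] reorders them when
   [i = 1]. *)
pose P z : 'rV[R]_2 := \row_k (if k == i then z 0 0 else z 0 1).
have P0 : P 0 = 0 by apply/rowP => k; rewrite !mxE; case: ifP.
have sP p k : smooth_near p (fun z => P z 0 k).
  rewrite (_ : (fun z => _) = fun z => z 0 (if k == i then 0 else 1)).
    exact: smooth_near_coord.
  by apply/funext => z; rewrite mxE; case: ifP.
have cP := row_smooth_continuous (sP 0).
pose phi z := d1 (d2 (P z)).
pose psi w : 'rV[R]_2 := \row_k (if k == 0 then X w else Y w).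
have sphi : smooth_near 0 phi.
  apply/smooth_near_row => k.
  apply: (@smooth_near_comp _ _ _ 0 (fun z => d1 z 0 k) (fun z => d2 (P z))).
    move=> l; apply: (@smooth_near_comp _ _ _ 0 (fun z => d2 z 0 l) P) => [k'|].
      exact: sP.
    by rewrite P0; exact: sd2.
  by rewrite P0 d20; exact: sd1.
have spsi : smooth_near q psi.
  apply/smooth_near_row => k.
  rewrite (_ : (fun w => _) = if k == 0 then X else Y); first by case: ifP.
  by apply/funext => w; rewrite mxE; case: ifP.
have phi0 : phi 0 = q by rewrite /phi P0 d20 d1p1.
have solve : \forall z \near (0 : 'rV[R]_2), X (phi z) = (z : 'rV[R]_2) 0 0 /\
    Y (phi z) = (z : 'rV[R]_2) 0 1.
  have n1 : \forall z \near P 0, Y1 (d2 z) = (z : 'rV[R]_2) 0 j by rewrite P0.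
  have n2 : \forall z \near P 0, X (d1 (d2 z)) = (d2 z) 0 i.
    rewrite P0; apply: (@near_continuous _ _ d2 0 (fun y => X (d1 y) = y 0 i) cd2); rewrite d20.
    by apply: filterS uE => z.
  apply: filterS2 (near_continuous cP n1) (near_continuous cP n2) => z h1 h2.
  rewrite /phi h2 -/(Y1 _) h1 /d2 upd_other // !mxE eqxx.
  by rewrite eq_sym (negbTE ij).
exists phi => //; exists psi; split => //.
  apply: filterS solve => z [h1 h2]; apply/rowP => k; rewrite mxE h1 h2.
  by case: eqVneq => [->//|k0]; congr (z 0 _); case: k k0 => [[|[|//]]] //= ? _; exact: val_inj.
have n1 : \forall w \near q, d2 (c2 (c1 w)) = c1 w.
  apply: (@near_continuous _ _ c1 q (fun y => d2 (c2 y) = y) cc1).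
  by rewrite c1q.
apply: filterS2 n1 dc1 => w h1 h2; rewrite /phi -[in RHS]h2 -h1; congr (d1 (d2 _)).
rewrite /c2 /Y1 h2 /c1 upd2; last by rewrite eq_sym.
apply/rowP => k; rewrite !mxE /=; have := ord2_neq k ij.
case: (eqVneq k i) => [->|ki] /=; first by rewrite (negbTE ij).
by move=> ->.
Qed.

Lemma inverse_function2 q (X Y : 'rV[R]_2 -> R) :
  smooth_near q X -> smooth_near q Y -> X q = 0 -> Y q = 0 -> jac X Y q != 0 ->
  exists2 phi, diffeo_germ 0 q phi &
    \forall z \near (0 : 'rV[R]_2), X (phi z) = (z : 'rV[R]_2) 0 0 /\ Y (phi z) = (z : 'rV[R]_2) 0 1.
Proof.
move=> sX sY X0 Y0 J; have [X1|X1] := eqVneq (pd 0 X q) 0; last exact: (@chart_inverse 0 1).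
apply: (@chart_inverse 1 0) => //.
  by apply: contra J => /eqP H; rewrite /jac X1 H !mul0r subrr.
by rewrite -oppr_eq0 opprB.
Qed.

Lemma diffeo_germ_comp p q r (phi phi' : 'rV[R]_2 -> 'rV[R]_2) :
  diffeo_germ p q phi -> diffeo_germ q r phi' -> diffeo_germ p r (phi' \o phi).
Proof.
move=> [psi [/smooth_near_row sphi /smooth_near_row spsi e1 h1 h2]].
move=> [psi' [/smooth_near_row sphi' /smooth_near_row spsi' e1' h1' h2']].
have e2 : psi q = p by rewrite -e1 (nbhs_singleton h1).
have e2' : psi' r = q by rewrite -e1' (nbhs_singleton h1').
exists (psi \o psi'); split.
- apply/smooth_near_row => j.
  by apply: (@smooth_near_comp _ _ _ p (fun w => phi' w 0 j)) => //; rewrite e1.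
- apply/smooth_near_row => j.
  by apply: (@smooth_near_comp _ _ _ r (fun w => psi w 0 j)) => //; rewrite e2'.
- by rewrite /= e1.
- have n1 : \forall w \near p, psi' (phi' (phi w)) = phi w.
    by apply: (@near_continuous _ _ phi p (fun y => psi' (phi' y) = y)); [exact: row_smooth_continuous|rewrite e1].
  by apply: filterS2 n1 h1 => w /= -> ->.
- have n1 : \forall w \near r, phi (psi (psi' w)) = psi' w.
    by apply: (@near_continuous _ _ psi' r (fun y => phi (psi y) = y)); [exact: row_smooth_continuous|rewrite e2'].
  by apply: filterS2 n1 h2' => w /= -> ->.
Qed.

Lemma diffeo_germ_inv p q (phi : 'rV[R]_2 -> 'rV[R]_2) : diffeo_germ p q phi ->
  exists psi, [/\ diffeo_germ q p psi, \forall w \near p, psi (phi w) = w &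
    \forall z \near q, phi (psi z) = z].
Proof.
move=> [psi [sphi spsi e1 h1 h2]]; exists psi; split=> //; exists phi; split=> //.
by rewrite -e1 (nbhs_singleton h1).
Qed.

Lemma diffeo_germ_id p : diffeo_germ p p (@idfun 'rV[R]_2).
Proof.
by exists idfun; split => //; try (apply/smooth_near_row => j; exact: smooth_near_coord);
  near=> w.
Unshelve. all: by end_near. Qed.

Lemma diffeo_germ_smooth p q (phi : 'rV[R]_2 -> 'rV[R]_2) j :
  diffeo_germ p q phi -> smooth_near p (fun w => phi w 0 j).
Proof. by move=> [psi [/smooth_near_row]]. Qed.

Lemma diffeo_germ_continuous p q (phi : 'rV[R]_2 -> 'rV[R]_2) :
  diffeo_germ p q phi -> {for p, continuous phi}.
Proof.
by move=> dphi; apply: row_smooth_continuous => j; exact: diffeo_germ_smooth dphi.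
Qed.

Lemma diffeo_germ_jac p q (phi : 'rV[R]_2 -> 'rV[R]_2) : diffeo_germ p q phi ->
  jac (fun w => phi w 0 0) (fun w => phi w 0 1) p != 0.
Proof.
move=> [psi [/smooth_near_row sphi /smooth_near_row spsi e1 h1 h2]].
have E a b : pd b (fun w => psi (phi w) 0 a) p = (b == a)%:R.
  rewrite -(pd_coord p b a); apply: near_eq_pd.
  by apply: filterS h1 => w ->.
have E' a b : \sum_k pd k (fun w => psi w 0 a) q * pd b (fun w => phi w 0 k) p = (b == a)%:R.
  rewrite -E (pd_comp (f := fun w => psi w 0 a)) ?e1 //.
    exact: smooth_near_differentiable.
  by move=> k; exact: smooth_near_differentiable.
have n01 : (0 : 'I_2) != 1 by [].
have := E' 0 0; have := E' 0 1; have := E' 1 0; have := E' 1 1.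
rewrite !(sum_ord2 _ n01) !eqxx !(negbTE n01) eq_sym (negbTE n01) /jac.
set a := pd 0 (fun w => phi w 0 0) p; set b := pd 1 (fun w => phi w 0 1) p.
set c := pd 1 (fun w => phi w 0 0) p; set d := pd 0 (fun w => phi w 0 1) p.
set a' := pd 0 (fun w => psi w 0 0) q; set b' := pd 1 (fun w => psi w 0 1) q.
set c' := pd 1 (fun w => psi w 0 0) q; set d' := pd 0 (fun w => psi w 0 1) q.
move=> e11 e10 e01 e00; apply/eqP => J.
have : (a' * a + c' * d) * (d' * c + b' * b) - (a' * c + c' * b) * (d' * a + b' * d) =
  (a' * b' - c' * d') * (a * b - c * d) by ring.
by rewrite e11 e10 e01 e00 J mulr0 !mulr1 mulr0 subr0 => /eqP; rewrite oner_eq0.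
Qed.


(** The gradient turned by a right angle; if it is nonzero it spans the tangent line of the level
    curve of [f] through [p]. *)
Definition kerv f p : 'rV[R]_2 := \row_b (if b == 0 then - pd 1 f p else pd 0 f p).

Definition hess2 f (k : 'rV[R]_2) p : R :=
  \sum_b (\sum_a pd a (pd b f) p * k 0 a) * k 0 b.

(** The coefficients are frozen at [p]. When the gradients of [f] and [g] at [p] are dependent, [p]
    is a critical point of this combination, and its Hessian there no longer depends on the
    chart. *)
Definition theta i f g p : 'rV[R]_2 -> R :=
  fun w => pd i f p * g w - pd i g p * f w.

(* first order contact, but no more, of the curves f = 0 and g = 0 at p *)
Definition simple_contact i f g p : Prop :=
  [/\ pd i f p != 0, pd i g p != 0 & hess2 (theta i f g p) (kerv f p) p != 0].

(** The identity 4 a f h = (a f + h)^2 - (a f - h)^2 suggests half the sum and half the difference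
    of [a f] and [h] as coordinates; their Jacobian at [q] is - (a/2) times that of [f] and [h]. *)
Lemma A1_normal_form q (g a f h : 'rV[R]_2 -> R) :
  smooth_near q a -> smooth_near q f -> smooth_near q h ->
  a q != 0 -> f q = 0 -> h q = 0 -> jac f h q != 0 ->
  (\forall w \near q, g w = a w * (f w * h w)) ->
  exists2 phi, diffeo_germ 0 q phi &
    \forall z \near (0 : 'rV[R]_2), g (phi z) =
      (z : 'rV[R]_2) 0 0 ^+ 2 - (z : 'rV[R]_2) 0 1 ^+ 2.
Proof.
move=> sa sf sh a0 f0 h0 J gE.
pose X w := 2^-1 * (a w * f w + h w); pose Y w := 2^-1 * (a w * f w - h w).
have saf : smooth_near q (fun w => a w * f w) by smooth.
have sX : smooth_near q X by rewrite /X; smooth.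
have sY : smooth_near q Y by rewrite /Y; smooth.
have pX i : pd i X q = 2^-1 * (a q * pd i f q + pd i h q).
  rewrite /X pdZ; last by smooth.
  by rewrite pdD ?pdM ?f0 ?mulr0 ?add0r; smooth.
have pY i : pd i Y q = 2^-1 * (a q * pd i f q - pd i h q).
  rewrite /Y pdZ; last by smooth.
  by rewrite pdB ?pdM ?f0 ?mulr0 ?add0r; smooth.
have [|||phi dphi H] := inverse_function2 sX sY.
- by rewrite /X f0 h0 mulr0 addr0 mulr0.
- by rewrite /Y f0 h0 mulr0 subr0 mulr0.
- rewrite /jac !pX !pY.
  rewrite (_ : _ - _ = - (2^-1 * a q) * jac f h q); last by rewrite /jac; field.
  by rewrite mulf_neq0 // oppr_eq0 mulf_neq0 // invr_eq0 pnatr_eq0.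
exists phi => //; have [_ [_ _ phi0 _ _]] := dphi.
have n1 : \forall z \near (0 : 'rV[R]_2), g (phi z) = a (phi z) * (f (phi z) * h (phi z)).
  apply: (@near_continuous _ _ phi 0 (fun w => g w = a w * (f w * h w))).
    exact: diffeo_germ_continuous dphi.
  by rewrite phi0.
apply: filterS2 n1 H => z -> [<- <-]; rewrite /X /Y; by field.
Qed.

Lemma sgr_near_pos p f : smooth_near p f -> f p != 0 -> exists b : bool,
  \forall w \near p, 0 < (-1) ^+ b * f w.
Proof.
move=> sf f0; have [fp|fp] := ltP (f p) 0; [exists true|exists false];
  (apply: near_gt0; first by apply: smooth_near_continuous; smooth).
  by rewrite -[(-1) ^+ _]/(-1 : R) mulN1r oppr_gt0.
by rewrite -[(-1) ^+ _]/(1 : R) mul1r lt_neqAle eq_sym f0.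
Qed.

(** Completing the square: A x (x + y^2 h) = A ((x + y^2 h/2)^2 - y^4 h^2/4). With r the square root
    of |A|, the new coordinates are X = r (x + y^2 h/2) and Y = y sqrt(r |h|/2), so that Y^4 = A y^4
    h^2/4 up to the sign of A. The sign of h disappears in its square. *)
Lemma shear_normal_form i j (A h : 'rV[R]_2 -> R) : i != j ->
  smooth_near 0 A -> smooth_near 0 h -> A 0 != 0 -> h 0 != 0 ->
  exists (phi : 'rV[R]_2 -> 'rV[R]_2) (b : bool), diffeo_germ 0 0 phi /\
    \forall z \near (0 : 'rV[R]_2),
      A (phi z) * (phi z 0 i * (phi z 0 i + phi z 0 j ^+ 2 * h (phi z))) =
      (-1) ^+ b * ((z : 'rV[R]_2) 0 0 ^+ 2 - (z : 'rV[R]_2) 0 1 ^+ 4).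
Proof.
move=> ij sA sh A0 h0; have [b bA] := sgr_near_pos sA A0; have [c ch] := sgr_near_pos sh h0.
have sS (d : bool) f : smooth_near 0 f -> smooth_near 0 (fun w => (-1) ^+ d * f w).
  by move=> sf; smooth.
pose r w := Num.sqrt ((-1) ^+ b * A w).
have sr : smooth_near 0 r.
  by apply: smooth_near_sqrt (sS _ _ sA) _; exact: (nbhs_singleton bA).
have r0 : 0 < r 0 by rewrite sqrtr_gt0; exact: (nbhs_singleton bA).
pose t w := r w * ((-1) ^+ c * h w) / 2.
have st : smooth_near 0 t by rewrite /t; smooth.
have t0 : 0 < t 0.
  by rewrite /t divr_gt0 // mulr_gt0 //; exact: (nbhs_singleton ch).
pose X w := r w * (w 0 i + w 0 j ^+ 2 * h w / 2).
pose y w := Num.sqrt (t w); pose Y w := w 0 j * y w.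
have sX : smooth_near 0 X by rewrite /X; smooth.
have sy : smooth_near 0 y by exact: smooth_near_sqrt st t0.
have sY : smooth_near 0 Y by rewrite /Y; smooth.
have y0 : 0 < y 0 by rewrite sqrtr_gt0.
have z0 k : (0 : 'rV[R]_2) 0 k = 0 by rewrite mxE.
have pX k : pd k X 0 = r 0 * (k == i)%:R.
  rewrite /X pdM; [|smooth|smooth].
  rewrite !z0 expr0n /= !mul0r addr0 mulr0 add0r; congr (_ * _).
  rewrite pdD; [|smooth|smooth]; rewrite pd_coord.
  rewrite pdM; [|smooth|smooth].
  rewrite pdM; [|smooth|smooth].
  rewrite (@pdX _ _ (fun w : 'rV[R]_2 => w 0 j) 0 k 1); last by smooth.
  by rewrite !z0 expr0n /=; ring.
have pY k : pd k Y 0 = (k == j)%:R * y 0.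
  rewrite /Y pdM; [|smooth|smooth].
  by rewrite z0 mul0r addr0 pd_coord.
have X0 : X 0 = 0 by rewrite /X !z0 expr0n /= !mul0r addr0 mulr0.
have Y0 : Y 0 = 0 by rewrite /Y z0 mul0r.
have [|phi dphi H] := inverse_function2 sX sY X0 Y0.
  rewrite /jac !pX !pY; case: i j ij {sX sY pX pY X X0 Y Y0} =>
    [[|[|//]] ?] [[|[|//]] ?] //= _; rewrite ?mulr1 ?mulr0 ?mul0r ?mul1r ?subr0 ?sub0r ?oppr_eq0.
    by rewrite mulf_neq0 // gt_eqF.
  by rewrite mulf_neq0 // gt_eqF.
exists phi, b; split => //; have [_ [_ _ phi0 _ _]] := dphi.
have np (P : set 'rV[R]_2) : (\forall w \near (0 : 'rV[R]_2), P w) ->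
    \forall z \near (0 : 'rV[R]_2), P (phi z).
  move=> nP; apply: near_continuous; first exact: diffeo_germ_continuous dphi.
  by rewrite phi0.
apply: filterS3 (np _ bA) (np _ ch) H => z; move: (phi z) => w bw cw [<- <-].
have rE : r w ^+ 2 = (-1) ^+ b * A w by rewrite sqr_sqrtr // ltW.
have tw : 0 < t w by rewrite /t divr_gt0 // mulr_gt0 // sqrtr_gt0.
have yE : y w ^+ 4 = t w ^+ 2.
  by rewrite (exprM (y w) 2 2) sqr_sqrtr // ltW.
rewrite /X /Y !exprMn yE rE /t exprMn exprMn rE exprMn sqrr_sign mul1r.
have bb : A w = (-1) ^+ b * ((-1) ^+ b * A w) by rewrite mulrA -expr2 sqrr_sign mul1r.
rewrite {1}bb; move: ((-1) ^+ b) => B; by field.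
Qed.

End Plane.

(** * Contact of order one of two plane curves, and type A_3 *)

Section Tacnode.
Context {R : realType}.
Implicit Types (f g h a : 'rV[R]_2 -> R) (p q w z : 'rV[R]_2) (i j : 'I_2).

Lemma ord2_other i : exists j, i != j.
Proof. by case: i => [[|[|//]] ?]; [exists 1|exists 0]. Qed.

Lemma hess2_kerv i j F f p : i != j -> hess2 F (kerv f p) p =
  pd i (pd i F) p * pd j f p ^+ 2
  - (pd i (pd j F) p + pd j (pd i F) p) * (pd i f p * pd j f p)
  + pd j (pd j F) p * pd i f p ^+ 2.
Proof.
have n01 : (0 : 'I_2) != 1 by [].
have k0 : kerv f p 0 0 = - pd 1 f p by rewrite mxE.
have k1 : kerv f p 0 1 = pd 0 f p by rewrite mxE.
move=> ij; rewrite /hess2 !(sum_ord2 _ n01) k0 k1.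
have [[-> ->]|[-> ->]] := ord2_cases ij.
  by ring.
by ring.
Qed.

Lemma jac_eq0 i j f h p : i != j -> jac f h p = 0 ->
  pd i f p * pd j h p = pd j f p * pd i h p.
Proof.
move=> ij /eqP; rewrite subr_eq0 => /eqP H.
have [[-> ->]|[-> ->]] := ord2_cases ij.
  by [].
by rewrite H.
Qed.

Lemma pd_theta i k f h p : smooth_near p f -> smooth_near p h ->
  pd k (theta i f h p) p = pd i f p * pd k h p - pd i h p * pd k f p.
Proof. by move=> sf sh; rewrite /theta pdB ?pdZ; smooth. Qed.

Lemma theta_critical i k f h p : smooth_near p f -> smooth_near p h -> jac f h p = 0 ->
  pd k (theta i f h p) p = 0.
Proof.
move=> sf sh J; rewrite pd_theta //; have [j ij] := ord2_other i.
have /orP[/eqP ->|/eqP ->] := ord2_neq k ij; first by rewrite mulrC subrr.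
by rewrite (jac_eq0 ij J) mulrC subrr.
Qed.

(* In the chart (f, w_j) the curve h = 0 becomes z_i al(z) + z_j^2 ga(z) = 0,
   where 2 ga(0) is the second derivative of h along the curve f = 0. *)
Lemma A3_normal_form i g a f h :
  smooth_near 0 a -> smooth_near 0 f -> smooth_near 0 h ->
  a 0 != 0 -> f 0 = 0 -> h 0 = 0 -> jac f h 0 = 0 -> simple_contact i f h 0 ->
  (\forall w \near (0 : 'rV[R]_2), g w = a w * (f w * h w)) ->
  exists (phi : 'rV[R]_2 -> 'rV[R]_2) (b : bool), diffeo_germ 0 0 phi /\
    \forall z \near (0 : 'rV[R]_2), g (phi z) =
      (-1) ^+ b * ((z : 'rV[R]_2) 0 0 ^+ 2 - (z : 'rV[R]_2) 0 1 ^+ 4).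
Proof.
move=> sa sf sh a0 f0 h0 J [fi hi T] gE; have [j ij] := ord2_other i.
have [u [su uE Eu]] := pd_coordinate_inverse sf fi.
have p10 : upd i (f 0) 0 = 0 :> 'rV[R]_2.
  by rewrite f0; apply/rowP => k; rewrite !mxE; case: ifP.
rewrite p10 in su uE.
pose d z := upd i (u z) z; pose c w := upd i (f w) w.
have dc : \forall w \near (0 : 'rV[R]_2), d (c w) = w.
  by apply: filterS Eu => w uw; rewrite /d /c uw upd_upd upd_id.
have d0 : d 0 = 0 by have := nbhs_singleton dc; rewrite /c p10.
have u0 : u 0 = 0 by have := congr1 (fun v : 'rV[R]_2 => v 0 i) d0; rewrite /d upd_same mxE.
have sd k : smooth_near 0 (fun z => d z 0 k) by exact: smooth_near_upd.
have ddk k : differentiable (fun z => d z 0 k) 0 by exact/smooth_near_differentiable/sd.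
have sc k : smooth_near 0 (fun z => c z 0 k) by exact: smooth_near_upd.
have cd := row_smooth_continuous sd.
have cc := row_smooth_continuous sc.
have fd : \forall z \near (0 : 'rV[R]_2), f (d z) = (z : 'rV[R]_2) 0 i by exact: uE.
have cdE : \forall z \near (0 : 'rV[R]_2), c (d z) = z.
  by apply: filterS fd => z fz; rewrite /c fz /d upd_upd upd_id.
have dd : diffeo_germ 0 0 d.
  by exists c; split => //; apply/smooth_near_row.
have di k : pd k (fun z => d z 0 i) 0 = pd k u 0.
  by congr (pd k _ 0); apply/funext => z; rewrite upd_same.
have dj k : pd k (fun z => d z 0 j) 0 = (k == j)%:R.
  rewrite (_ : (fun z => _) = fun z => z 0 j) ?pd_coord //.
  by apply/funext => z; rewrite upd_other // eq_sym.
have chain k (F : 'rV[R]_2 -> R) : smooth_near 0 F -> pd k (fun z => F (d z)) 0 =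
    pd i F 0 * pd k u 0 + pd j F 0 * (k == j)%:R.
  move=> sF; have dF : differentiable F (d 0) by rewrite d0; smooth.
  by rewrite (pd_comp k dF ddk) d0 (sum_ord2 _ ij) di dj.
have uk k : pd i f 0 * pd k u 0 + pd j f 0 * (k == j)%:R = (k == i)%:R.
  by rewrite -chain // (near_eq_pd k fd) pd_coord.
have ui : pd i f 0 * pd i u 0 = 1.
  by have := uk i; rewrite (negbTE ij) mulr0 addr0 eqxx.
have uj : pd i f 0 * pd j u 0 = - pd j f 0.
  have := uk j; rewrite eq_sym (negbTE ij) eqxx mulr1 => /eqP.
  by rewrite addr_eq0 => /eqP.
pose h1 z := h (d z).
have sh1 : smooth_near 0 h1.
  by apply: (@smooth_near_comp _ _ _ 0 h d sd); rewrite d0; exact: sh.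
have h1i : pd i h1 0 != 0.
  rewrite chain // (negbTE ij) mulr0 addr0 mulf_neq0 //.
  by apply: contra_eq_neq ui => ->; rewrite mulr0 eq_sym oner_neq0.
have h1j : pd j h1 0 = 0.
  rewrite chain // eqxx mulr1; apply: (mulfI fi); rewrite mulr0 mulrDr mulrCA uj.
  by rewrite (jac_eq0 ij J); ring.
(* In the chart [d], [theta] becomes a multiple of [h1] minus a linear term in the i-th coordinate,
   which second derivatives along [j] do not see. The j-th column of the derivative of [d] is
   proportional to [kerv f 0], so a zero here would contradict the contact hypothesis. *)
have h1jj : pd j (pd j h1) 0 != 0.
  pose Th := theta i f h 0.
  have sTh : smooth_near 0 Th by rewrite /Th /theta; smooth.
  have sTh0 : smooth_near (d 0) Th by rewrite d0.
  have Th0 k : pd k Th (d 0) = 0 by rewrite d0; exact: theta_critical.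
  have eTh : \forall z \near (0 : 'rV[R]_2), Th (d z) =
     pd i f 0 * h1 z - pd i h 0 * (z : 'rV[R]_2) 0 i.
    by apply: filterS fd => z fz; rewrite /Th /theta fz.
  have e1 : \forall z \near (0 : 'rV[R]_2), pd j (fun z => Th (d z)) z =
     pd i f 0 * pd j h1 z.
    have := near_eq_pd_near j eTh; apply: filterS2 (smooth_near_near sh1) => z s1z /= ->.
    rewrite pdB ?pdZ ?pd_coord; [|smooth|smooth|smooth|smooth].
    by rewrite eq_sym (negbTE ij) mulr0 subr0.
  have := pd2_comp_critical j j sd sTh0 Th0.
  rewrite (near_eq_pd j e1) pdZ; last by smooth.
  rewrite d0 !(sum_ord2 _ ij) !di !dj eqxx !mulr1 => e2.
  apply: contra T => /eqP e3; rewrite e3 mulr0 in e2.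
  rewrite (hess2_kerv _ _ _ ij) -/Th -[pd j f 0]opprK -uj; apply/eqP.
  rewrite -[RHS](mulr0 (pd i f 0 ^+ 2)) [in RHS]e2; ring.
(* One division by the i-th coordinate yields [al]. The remainder [bf], which depends on the j-th
   coordinate alone, vanishes at 0 to second order and admits two divisions by that coordinate,
   which yield [ga]. *)
have [al [sal alE al0]] := pd_hadamard i sh1.
have alpha0 : al 0 = pd i h1 0 by apply: (nbhs_singleton al0); rewrite mxE.
pose bf z := h1 (upd i 0 z).
have supd k (q : 'rV[R]_2) l : smooth_near q (fun w => upd k 0 w 0 l).
  by apply: (@smooth_near_upd _ _ k (fun=> 0) q); exact: smooth_near_cst.
have cupd k (q : 'rV[R]_2) := row_smooth_continuous (supd k q).
have upd00 k : upd k 0 0 = 0 :> 'rV[R]_2 by apply/rowP => l; rewrite !mxE; case: ifP.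
have sbf : smooth_near 0 bf.
  apply: (@smooth_near_comp _ _ _ 0 h1 (upd i 0)); first exact: supd.
  by rewrite upd00; exact: sh1.
have [b1 [sb1 b1E b10]] := pd_hadamard j sbf.
have [ga [sga gaE _]] := pd_hadamard j sb1.
have updij (q : 'rV[R]_2) : upd i 0 (upd j 0 q) = 0.
  by rewrite upd2 //; apply/rowP => k; rewrite !mxE; case: ifP.
have pbf : \forall w \near (0 : 'rV[R]_2), pd j bf w = pd j h1 (upd i 0 w).
  have sh10 : smooth_near (upd i 0 0) h1 by rewrite upd00.
  apply: filterS (pd_comp_near j (supd i 0) sh10) => w ->.
  rewrite (sum_ord2 _ ij).
  rewrite (_ : (fun w => upd i 0 w 0 i) = fun=> 0 : R); last first.
    by apply/funext => z; rewrite upd_same.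
  rewrite pd_cst mulr0 add0r (_ : (fun w => upd i 0 w 0 j) = fun w => w 0 j).
    by rewrite pd_coord eqxx mulr1.
  by apply/funext => z; rewrite upd_other // eq_sym.
have nu k (P : set 'rV[R]_2) : (\forall w \near (0 : 'rV[R]_2), P w) ->
    \forall z \near (0 : 'rV[R]_2), P (upd k 0 z).
  by move=> nP; apply: (@near_continuous _ _ (upd k 0) 0 P (cupd k 0)); rewrite upd00.
have h1E : \forall z \near (0 : 'rV[R]_2), h1 z =
    (z : 'rV[R]_2) 0 i * al z + (z : 'rV[R]_2) 0 j ^+ 2 * ga z.
  have n0 : \forall z \near (0 : 'rV[R]_2), b1 (upd j 0 z) = 0.
    apply: filterS2 (nu j _ pbf) (nu j _ b10) => z e1 e2.
    by rewrite e2 ?upd_same // e1 updij h1j.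
  have n1 : \forall z \near (0 : 'rV[R]_2), bf z = (z : 'rV[R]_2) 0 j ^+ 2 * ga z.
    apply: filterS3 n0 b1E gaE => z e0 -> e2.
    by rewrite {1}/bf updij /h1 d0 h0 e2 e0; ring.
  by apply: filterS2 n1 alE => z e1 ->; rewrite -/(bf z) e1 addrC.
have ga0 : ga 0 != 0.
  apply: contra h1jj => /eqP e0.
  rewrite (near_eq_pd j (near_eq_pd_near j h1E)) /=.
  have s1 : smooth_near 0 (fun z : 'rV[R]_2 => z 0 i * al z) by smooth.
  have s2 : smooth_near 0 (fun z : 'rV[R]_2 => z 0 j ^+ 2 * ga z) by smooth.
  have e1 : \forall z \near (0 : 'rV[R]_2), pd j
     (fun z : 'rV[R]_2 => z 0 i * al z + z 0 j ^+ 2 * ga z) z =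
     pd j (fun z : 'rV[R]_2 => z 0 i * al z) z
     + pd j (fun z : 'rV[R]_2 => z 0 j ^+ 2 * ga z) z.
    apply: filterS2 (smooth_near_near s1) (smooth_near_near s2) => z t1 t2.
    by rewrite pdD //; smooth.
  rewrite (near_eq_pd j e1) pdD; [|smooth|smooth].
  rewrite !pd2M; [|smooth..].
  have -> : pd j (fun w : 'rV[R]_2 => w 0 i) = fun=> 0.
    by apply/funext => w; rewrite pd_coord eq_sym (negbTE ij).
  have z0 k : (0 : 'rV[R]_2) 0 k = 0 by rewrite mxE.
  have sq : pd j (fun w : 'rV[R]_2 => w 0 j ^+ 2) 0 = 0.
    by rewrite (@pdX _ _ (fun w : 'rV[R]_2 => w 0 j) 0 j 1) ?z0 ?expr1 ?mulr0 ?mul0r; smooth.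
  by rewrite e0 !z0 sq pd_cst; apply/eqP; ring.
have al00 : al 0 != 0 by rewrite alpha0.
have sad : smooth_near 0 (fun z => a (d z)).
  by apply: (@smooth_near_comp _ _ _ 0 a d sd); rewrite d0; exact: sa.
have [||||phi [b [dphi phiE]]] := @shear_normal_form R i j
    (fun z => a (d z) * al z) (fun z => ga z * (al z)^-1) ij.
- by smooth.
- by apply: smooth_nearM; [exact: sga|exact: smooth_nearV sal al00].
- by rewrite d0 mulf_neq0.
- by apply: mulf_neq0; [exact: ga0|exact: invr_neq0].
exists (d \o phi), b; split; first exact: diffeo_germ_comp dphi dd.
have [_ [_ _ phi0 _ _]] := dphi.
have np (P : set 'rV[R]_2) : (\forall w \near (0 : 'rV[R]_2), P w) ->
    \forall z \near (0 : 'rV[R]_2), P (phi z).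
  move=> nP; apply: near_continuous; first exact: diffeo_germ_continuous dphi.
  by rewrite phi0.
have gd : \forall z \near (0 : 'rV[R]_2), g (d z) = a (d z) * (f (d z) * h (d z)).
  apply: (@near_continuous _ _ d 0 (fun w => g w = a w * (f w * h w)) cd).
  by rewrite d0.
have e1 : \forall z \near (0 : 'rV[R]_2), g (d z) = a (d z) * al z *
    ((z : 'rV[R]_2) 0 i * ((z : 'rV[R]_2) 0 i + (z : 'rV[R]_2) 0 j ^+ 2 * (ga z * (al z)^-1))).
  have n1 := near_neq0 (smooth_near_continuous sal) al00.
  apply: filterS2 gd (filterI fd (filterI h1E n1)) => z -> [-> [e1 a1]].
  by rewrite -/(h1 z) e1; field.
by apply: filterS2 phiE (np _ e1) => z <- /= ->.
Qed.

Lemma pd2_linear (c d : R) f g p i j : smooth_near p f -> smooth_near p g ->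
  pd i (pd j (fun w => c * f w - d * g w)) p = c * pd i (pd j f) p - d * pd i (pd j g) p.
Proof.
move=> sf sg.
have e : \forall w \near p, pd j (fun w => c * f w - d * g w) w = c * pd j f w - d * pd j g w.
  apply: filterS2 (smooth_near_near sf) (smooth_near_near sg) => w sfw sgw.
  by rewrite pdB ?pdZ; smooth.
by rewrite (near_eq_pd i e) pdB ?pdZ; smooth.
Qed.

Lemma pd2M_near f g p i j : smooth_near p f -> smooth_near p g ->
  \forall w \near p, pd i (pd j (fun w => f w * g w)) w =
  (pd i (pd j f) w * g w + pd j f w * pd i g w)
  + (pd i f w * pd j g w + f w * pd i (pd j g) w).
Proof.
by move=> /smooth_near_near sf /smooth_near_near sg; apply: filterS2 sf sg => w; exact: pd2M.
Qed.

(** Derivatives of both sides at 0 are compared: ii gives P_i Q_i = s, jj and ij give P_j = Q_j = 0,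
    ijj gives P_i Q_jj + Q_i P_jj = 0, and jjjj gives P_jj Q_jj = - 4 s. By the fourth relation the
    contact number equals 2 P_i Q_jj, nonzero by the first and the last. *)
Lemma A3_factor_jet (i j : 'I_2) (s : R) (P Q : 'rV[R]_2 -> R) : i != j -> s != 0 ->
  smooth_near 0 P -> smooth_near 0 Q -> P 0 = 0 -> Q 0 = 0 ->
  (\forall z \near (0 : 'rV[R]_2),
    P z * Q z = s * ((z : 'rV[R]_2) 0 i ^+ 2 - (z : 'rV[R]_2) 0 j ^+ 4)) ->
  [/\ pd i P 0 != 0, pd i Q 0 != 0, pd j P 0 = 0, pd j Q 0 = 0 &
    pd i P 0 * pd j (pd j Q) 0 - pd i Q 0 * pd j (pd j P) 0 != 0].
Proof.
move=> ij s0 sP sQ P0 Q0 e0.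
have nij : (i == j) = false by exact: negbTE.
have nji : (j == i) = false by rewrite eq_sym.
pose N (z : 'rV[R]_2) := s * (z 0 i ^+ 2 - z 0 j ^+ 4).
have pN k : pd k N = fun z => s * (2 * z 0 i * (k == i)%:R - 4 * z 0 j ^+ 3 * (k == j)%:R).
  apply/funext => z; rewrite /N pdZ ?pdB; [|smooth|smooth|smooth].
  rewrite (@pdX _ _ (fun z : 'rV[R]_2 => z 0 i) z k 1) ?(@pdX _ _ (fun z : 'rV[R]_2 => z 0 j) z k 3);
    [|smooth|smooth].
  by rewrite !pd_coord expr1.
have pjN : pd j N = fun z => - (4 * s) * z 0 j ^+ 3.
  by rewrite pN; apply/funext => z; rewrite eqxx nji /=; ring.
have pjjN k : pd k (pd j N) = fun z => - (12 * s) * z 0 j ^+ 2 * (k == j)%:R.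
  apply/funext => z; rewrite pjN pdZ; last by smooth.
  rewrite (@pdX _ _ (fun z : 'rV[R]_2 => z 0 j) z k 2); last by smooth.
  by rewrite pd_coord; ring.
have piN : pd i N = fun z => 2 * s * z 0 i.
  by rewrite pN; apply/funext => z; rewrite eqxx nij /=; ring.
have eN k l : pd k (pd l (fun z => P z * Q z)) 0 = pd k (pd l N) 0.
  exact: near_eq_pd (near_eq_pd_near l e0).
have z0 k : (0 : 'rV[R]_2) 0 k = 0 by rewrite mxE.
have ii : 2 * (pd i P 0 * pd i Q 0) = 2 * s.
  have := eN i i; rewrite pd2M // P0 Q0 piN pdZ ?pd_coord ?eqxx; last by smooth.
  by move=> e; rewrite -[RHS]mulr1 -e; ring.
have jj : pd j P 0 * pd j Q 0 = 0.
  have := eN j j; rewrite pd2M // P0 Q0 pjjN z0 => e.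
  by apply: (@mulfI _ (2 : R)); rewrite ?pnatr_eq0 // mulr0 -[LHS]addr0; move: e; lra.
have ij0 : pd i P 0 * pd j Q 0 + pd j P 0 * pd i Q 0 = 0.
  by have := eN i j; rewrite pd2M // P0 Q0 pjjN nij mulr0n; lra.
have PQ : pd i P 0 * pd i Q 0 = s by move: ii; lra.
have [Pi Qi] : pd i P 0 != 0 /\ pd i Q 0 != 0.
  by move: s0; rewrite -PQ mulf_eq0 negb_or => /andP.
have [Pj Qj] : pd j P 0 = 0 /\ pd j Q 0 = 0.
  move/eqP : jj; rewrite mulf_eq0 => /orP[] /eqP e; move/eqP: ij0; rewrite e.
    by rewrite mul0r addr0 mulf_eq0 (negbTE Pi) => /eqP.
  by rewrite mulr0 add0r mulf_eq0 (negbTE Qi) orbF => /eqP.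
have eNN : \forall z \near (0 : 'rV[R]_2),
    (pd j (pd j P) z * Q z + pd j P z * pd j Q z)
    + (pd j P z * pd j Q z + P z * pd j (pd j Q) z) = pd j (pd j N) z.
  apply: filterS2 (pd2M_near j j sP sQ) (near_eq_pd_near j (near_eq_pd_near j e0)) => z <- //.
have pjj2 : pd j (pd j N) = fun z => - (12 * s) * z 0 j ^+ 2.
  by rewrite pjjN; apply/funext => z; rewrite eqxx mulr1.
have pkjj k : pd k (pd j (pd j N)) = fun z => - (24 * s) * z 0 j * (k == j)%:R.
  apply/funext => z; rewrite pjj2 pdZ; last by smooth.
  rewrite (@pdX _ _ (fun w : 'rV[R]_2 => w 0 j) z k 1); last by smooth.
  by rewrite pd_coord expr1; ring.
have ijj : pd i Q 0 * pd j (pd j P) 0 + pd i P 0 * pd j (pd j Q) 0 = 0.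
  have := near_eq_pd i eNN.
  rewrite pkjj nij mulr0n mulr0 !pdD; [|smooth..].
  by rewrite !pdM; [|smooth..]; rewrite P0 Q0 Pj Qj; lra.
have jjjj : 6 * (pd j (pd j P) 0 * pd j (pd j Q) 0) = - (24 * s).
  have := near_eq_pd j (near_eq_pd_near j eNN).
  have -> : pd j (pd j (pd j N)) = fun z => - (24 * s) * z 0 j.
    by rewrite pkjj; apply/funext => z; rewrite eqxx mulr1.
  rewrite pdZ ?pd_coord ?eqxx ?mulr1; last by smooth.
  rewrite !pd2D; [|smooth..]; rewrite !pd2M; [|smooth..].
  by rewrite P0 Q0 Pj Qj; lra.
split => //; have e : pd i P 0 * pd j (pd j Q) 0 - pd i Q 0 * pd j (pd j P) 0 =
   2 * (pd i P 0 * pd j (pd j Q) 0) by move: ijj; lra.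
rewrite e !mulf_neq0 ?pnatr_eq0 //; apply/eqP => q0.
by move: jjjj; rewrite q0 !mulr0 => /esym/eqP; rewrite oppr_eq0 mulf_eq0 pnatr_eq0 (negbTE s0).
Qed.

(* k spans the tangent line of f = 0 and h = 0, whose first derivatives are
   dependent; the chain rule at the critical point 0 of theta compares second
   derivatives along it. *)
Lemma simple_contact_chart (i j : 'I_2) (phi : 'rV[R]_2 -> 'rV[R]_2) f h : i != j ->
  diffeo_germ 0 0 phi -> smooth_near 0 f -> smooth_near 0 h ->
  (let p z := f (phi z) in let q z := h (phi z) in
   [/\ pd i p 0 != 0, pd i q 0 != 0, pd j p 0 = 0, pd j q 0 = 0 &
    pd i p 0 * pd j (pd j q) 0 - pd i q 0 * pd j (pd j p) 0 != 0]) ->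
  jac f h 0 = 0 /\ exists l, simple_contact l f h 0.
Proof.
move=> ij dphi sf sh /= [pi0 qi0 pj0 qj0 contact].
have [_ [_ _ phi0 _ _]] := dphi.
have sphi k : smooth_near 0 (fun z => phi z 0 k) by exact: diffeo_germ_smooth dphi.
have dphik k : differentiable (fun z => phi z 0 k) 0 by smooth.
pose M l k := pd k (fun z => phi z 0 l) 0.
have chain l m k (F : 'rV[R]_2 -> R) : l != m -> smooth_near 0 F ->
    pd k (fun z => F (phi z)) 0 = pd l F 0 * M l k + pd m F 0 * M m k.
  move=> lm sF; have dF : differentiable F (phi 0) by rewrite phi0; smooth.
  by rewrite (pd_comp k dF dphik) phi0 (sum_ord2 _ lm).
have sp : smooth_near 0 (fun z => f (phi z)).
  by apply: (@smooth_near_comp _ _ _ 0 f phi sphi); rewrite phi0; exact: sf.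
have sq : smooth_near 0 (fun z => h (phi z)).
  by apply: (@smooth_near_comp _ _ _ 0 h phi sphi); rewrite phi0; exact: sh.
have Mdet : M i i * M j j - M i j * M j i != 0.
  have := diffeo_germ_jac dphi; rewrite /jac -![pd _ _ 0]/(M _ _).
  by have [[-> ->]|[-> ->]] := ord2_cases ij; [|rewrite [M 1 1 * _]mulrC [M 1 0 * _]mulrC].
have v0 l m : l != m -> M l j = 0 -> M m j != 0.
  move=> lm e; apply: contra Mdet => /eqP e'.
  have ev k : M k j = 0 by have /orP[] := ord2_neq k lm => /eqP ->.
  by rewrite !ev mulr0 mul0r subrr.
have fv l m : l != m -> pd l f 0 * M l j = - (pd m f 0 * M m j).
  by move=> lm; apply/eqP; rewrite -addr_eq0 -chain // pj0.
have hv l m : l != m -> pd l h 0 * M l j = - (pd m h 0 * M m j).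
  by move=> lm; apply/eqP; rewrite -addr_eq0 -chain // qj0.
have par l m : l != m -> pd l f 0 * pd m h 0 = pd m f 0 * pd l h 0.
  move=> lm; have ml : m != l by rewrite eq_sym.
  have [e|e] := eqVneq (M l j) 0.
    apply: (mulIf (v0 _ _ lm e)).
    by rewrite -mulrA (hv _ _ ml) [RHS]mulrAC (fv _ _ ml) e; ring.
  apply: (mulIf e); rewrite mulrAC (fv _ _ lm) -[RHS]mulrA (hv _ _ lm); ring.
split.
  by apply/eqP; rewrite subr_eq0 par.
have [l [m [lm fl]]] : exists l m, l != m /\ pd l f 0 != 0.
  have [fi|fi] := eqVneq (pd i f 0) 0; last by exists i, j.
  exists j, i; split; first by rewrite eq_sym.
  by apply: contra pi0 => /eqP fj; rewrite (chain i j) // fi fj !mul0r addr0.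
have hl : pd l h 0 != 0.
  apply: contra qi0 => /eqP e; rewrite (chain l m) // e mul0r add0r.
  by have /eqP := par _ _ lm; rewrite e mulr0 mulf_eq0 (negbTE fl) /= => /eqP ->; rewrite mul0r.
have vm : M m j != 0.
  apply/eqP => e; have ml : m != l by rewrite eq_sym.
  have := fv _ _ lm; rewrite e mulr0 oppr0 => /eqP; rewrite mulf_eq0 (negbTE fl) /=.
  by rewrite (negbTE (v0 _ _ ml e)).
exists l; split => //.
pose Th := theta l f h 0.
have sTh : smooth_near 0 Th by rewrite /Th /theta; smooth.
have sTh0 : smooth_near (phi 0) Th by rewrite phi0.
have jac0 : jac f h 0 = 0 by apply/eqP; rewrite subr_eq0 par.
have Th0 k : pd k Th (phi 0) = 0 by rewrite phi0; exact: theta_critical.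
have := pd2_comp_critical j j sphi sTh0 Th0.
rewrite {1}/Th /theta pd2_linear // phi0 !(sum_ord2 _ lm) -/(M l j) -/(M m j) => D2.
have fM := fv _ _ lm.
(* The j-th column of the derivative of [phi] is tangent to f = 0, hence [M m j / pd l f 0] times
   [kerv f 0] up to sign; the square of [pd l f 0] clears the denominator. *)
have key : pd l f 0 ^+ 2 * (pd l f 0 * pd j (pd j (fun z => h (phi z))) 0
    - pd l h 0 * pd j (pd j (fun z => f (phi z))) 0) = M m j ^+ 2 * hess2 Th (kerv f 0) 0.
  rewrite D2 (hess2_kerv _ _ _ lm).
  have e1 : M l j = - (pd m f 0 * M m j) / pd l f 0.
    by rewrite -fM mulrC mulKf.
  rewrite e1; move: (pd l f 0) fl => a a0; by field.
apply/eqP => T0; move: key; rewrite T0 mulr0 => /eqP; rewrite mulf_eq0 expf_eq0 (negbTE fl) /=.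
move=> /eqP key; case/negP: contact; apply/eqP; apply: (mulfI fl); rewrite mulr0.
have -> : pd i (fun z => h (phi z)) 0 = pd l h 0 / pd l f 0 * pd i (fun z => f (phi z)) 0.
  rewrite !(chain l m) //; have -> : pd m h 0 = pd m f 0 * pd l h 0 / pd l f 0.
    by rewrite -(par _ _ lm) mulrC mulKf.
  by move: (pd l f 0) fl => a a0; field.
have -> (a b c d e : R) : a != 0 -> a * (b * c - d / a * b * e) = b * (a * c - d * e).
  by move=> a0; field.
  by rewrite key mulr0.
exact: fl.
Qed.

(** The unit [a] is merged with [f], so that [A3_factor_jet] applies to two factors read in the
    normalizing chart. Since the j-derivative of [f] vanishes there, passing from [a f] back to [f]
    multiplies the contact number by [a 0] only. *)
Lemma A3_converse g a f h (phi : 'rV[R]_2 -> 'rV[R]_2) (b : bool) :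
  smooth_near 0 a -> smooth_near 0 f -> smooth_near 0 h ->
  a 0 != 0 -> f 0 = 0 -> h 0 = 0 -> diffeo_germ 0 0 phi ->
  (\forall w \near (0 : 'rV[R]_2), g w = a w * (f w * h w)) ->
  (\forall z \near (0 : 'rV[R]_2), g (phi z) =
      (-1) ^+ b * ((z : 'rV[R]_2) 0 0 ^+ 2 - (z : 'rV[R]_2) 0 1 ^+ 4)) ->
  jac f h 0 = 0 /\ exists i, simple_contact i f h 0.
Proof.
move=> sa sf sh a0 f0 h0 dphi gE A3.
have [_ [_ _ phi0 _ _]] := dphi.
have sphi k : smooth_near 0 (fun z => phi z 0 k) by exact: diffeo_germ_smooth dphi.
have comp (F : 'rV[R]_2 -> R) : smooth_near 0 F -> smooth_near 0 (fun z => F (phi z)).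
  by move=> sF; apply: (@smooth_near_comp _ _ _ 0 F phi sphi); rewrite phi0; exact: sF.
have sA := comp _ sa; have sF := comp _ sf; have sH := comp _ sh.
have e0 : \forall z \near (0 : 'rV[R]_2), a (phi z) * f (phi z) * h (phi z) =
   (-1) ^+ b * ((z : 'rV[R]_2) 0 0 ^+ 2 - (z : 'rV[R]_2) 0 1 ^+ 4).
  have n1 : \forall z \near (0 : 'rV[R]_2), g (phi z) = a (phi z) * (f (phi z) * h (phi z)).
    apply: (@near_continuous _ _ phi 0 (fun w => g w = a w * (f w * h w))).
      exact: diffeo_germ_continuous dphi.
    by rewrite phi0.
  by apply: filterS2 n1 A3 => z e <-; rewrite e mulrA.
have F0 : f (phi 0) = 0 by rewrite phi0.
have H0 : h (phi 0) = 0 by rewrite phi0.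
have sAF : smooth_near 0 (fun z => a (phi z) * f (phi z)) by smooth.
have AF0 : a (phi 0) * f (phi 0) = 0 by rewrite F0 mulr0.
have n01 : (0 : 'I_2) != 1 by [].
have s0 : (-1) ^+ b != 0 :> R by rewrite signr_eq0.
have := A3_factor_jet n01 s0 sAF sH AF0 H0 e0.
have pAF k : pd k (fun z => a (phi z) * f (phi z)) 0 = a 0 * pd k (fun z => f (phi z)) 0.
  by rewrite pdM ?F0 ?phi0 ?mulr0 ?add0r; smooth.
rewrite !pAF => -[].
rewrite !mulf_eq0 !negb_or a0 /= => p0 q0 /eqP; rewrite mulf_eq0 (negbTE a0) /= => /eqP p1 q1.
rewrite pd2M // F0 phi0 p1 => contact.
apply: (@simple_contact_chart 0 1 phi) => //; split => //.
apply: contra contact => /eqP e; apply/eqP.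
rewrite -[RHS](mulr0 (a 0)) -[in RHS]e; ring.
Qed.

End Tacnode.

(** * The resultant of the two fundamental forms and the null curvatures *)

Section QuadraticForms.
Context {R : realType}.

Definition resultant2 (E F G l m n : R) : R :=
  (E * n - G * l) ^+ 2 - 4 * (F * n - G * m) * (E * m - F * l).

(* (D, - E) and (- G, D) are the null vectors of E du^2 + 2F du dv + G dv^2 when
   D is a root of D^2 - 2FD + EG. *)
Lemma resultant2_null (E F G l m n D : R) : D ^+ 2 - 2 * F * D + E * G = 0 ->
  D ^+ 2 * resultant2 E F G l m n =
  (l * D ^+ 2 - 2 * m * D * E + n * E ^+ 2) * (n * D ^+ 2 - 2 * m * D * G + l * G ^+ 2).
Proof.
move=> rD; apply/eqP; rewrite -subr_eq0 /resultant2.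
rewrite (_ : _ - _ = - (D ^+ 2 - 2 * F * D + E * G) *
   (l * n * (D ^+ 2 + E * G + 2 * F * D) - 2 * m * D * (l * G + n * E))); last by ring.
by rewrite rD oppr0 mul0r.
Qed.

Lemma null_root (s E F G : R) : s ^+ 2 = 1 -> 0 <= F ^+ 2 - E * G ->
  let D := F + s * Num.sqrt (F ^+ 2 - E * G) in D ^+ 2 - 2 * F * D + E * G = 0.
Proof.
move=> s2 d0 /=; set r := Num.sqrt _; have r2 : r ^+ 2 = F ^+ 2 - E * G by rewrite sqr_sqrtr.
transitivity (s ^+ 2 * r ^+ 2 - (F ^+ 2 - E * G)); first by ring.
by rewrite s2 mul1r r2 subrr.
Qed.

(** The resultant of two binary quadratic forms has weight four under linear substitutions and
    degree two in the second form, which here also carries one factor of the determinant: in total a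
    sixth power. *)
Lemma resultant2_change (E F G l m n p q r t : R) :
  resultant2 (E * p ^+ 2 + 2 * F * p * q + G * q ^+ 2)
    (E * p * r + F * (p * t + q * r) + G * q * t)
    (E * r ^+ 2 + 2 * F * r * t + G * t ^+ 2)
    ((p * t - q * r) * (l * p ^+ 2 + 2 * m * p * q + n * q ^+ 2))
    ((p * t - q * r) * (l * p * r + m * (p * t + q * r) + n * q * t))
    ((p * t - q * r) * (l * r ^+ 2 + 2 * m * r * t + n * t ^+ 2)) =
  (p * t - q * r) ^+ 6 * resultant2 E F G l m n.
Proof. rewrite /resultant2; ring. Qed.

End QuadraticForms.

Section Forms.
Context {R : realType} {n : nat}.
Implicit Types (x y z : 'rV[R]_n.+1 -> R) (w : 'rV[R]_n.+1) (a b : 'I_n.+1).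

(** The number of variables is arbitrary and the two surface directions are chosen among them, so
    the same formulas serve a single surface and a family whose third variable is the time. *)
Definition form1 x y z a b w : R :=
  pd a x w * pd b x w + pd a y w * pd b y w - pd a z w * pd b z w.

(** A component of the Euclidean cross product. The minus sign in [mcross] cancels the one in
    [mink], so [form2] is a plain determinant. *)
Definition normal x y a b w : R := pd a x w * pd b y w - pd a y w * pd b x w.

Definition form2 x y z a b c d w : R :=
  normal y z a b w * pd c (pd d x) w + normal z x a b w * pd c (pd d y) w
  + normal x y a b w * pd c (pd d z) w.

Definition disc x y z a b w : R :=
  form1 x y z a b w ^+ 2 - form1 x y z a a w * form1 x y z b b w.

Definition nullD (s : R) x y z a b w : R := form1 x y z a b w + s * Num.sqrt (disc x y z a b w).

(* the second fundamental form on the null vectors (D, - E) and (- G, D) *)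
Definition nullP (s : R) x y z a b w : R :=
  form2 x y z a b a a w * nullD s x y z a b w ^+ 2
  - 2 * form2 x y z a b a b w * nullD s x y z a b w * form1 x y z a a w
  + form2 x y z a b b b w * form1 x y z a a w ^+ 2.

Definition nullM (s : R) x y z a b w : R :=
  form2 x y z a b b b w * nullD s x y z a b w ^+ 2
  - 2 * form2 x y z a b a b w * nullD s x y z a b w * form1 x y z b b w
  + form2 x y z a b a a w * form1 x y z b b w ^+ 2.

Definition lpl x y z a b w : R :=
  resultant2 (form1 x y z a a w) (form1 x y z a b w) (form1 x y z b b w)
    (form2 x y z a b a a w) (form2 x y z a b a b w) (form2 x y z a b b b w).

Lemma lpl_factor s x y z a b w : s ^+ 2 = 1 -> 0 < disc x y z a b w ->
  nullD s x y z a b w != 0 ->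
  lpl x y z a b w = (nullD s x y z a b w ^+ 2)^-1 * (nullP s x y z a b w * nullM s x y z a b w).
Proof.
move=> s2 d0 D0; have := null_root s2 (ltW d0); rewrite -/(nullD s x y z a b w) => rD.
by rewrite /nullP /nullM -(resultant2_null _ _ _ rD) mulKf // expf_neq0.
Qed.

Section Smooth.
Variables (p : 'rV[R]_n.+1) (x y z : 'rV[R]_n.+1 -> R) (s : R) (a b : 'I_n.+1).
Hypotheses (sx : smooth_near p x) (sy : smooth_near p y) (sz : smooth_near p z).

Lemma smooth_form1 c d : smooth_near p (form1 x y z c d).
Proof. by rewrite /form1; smooth. Qed.

Lemma smooth_form2 c d : smooth_near p (form2 x y z a b c d).
Proof. by rewrite /form2 /normal; smooth. Qed.

Lemma smooth_disc : smooth_near p (disc x y z a b).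
Proof.
have e1 := smooth_form1 a a; have e2 := smooth_form1 a b; have e3 := smooth_form1 b b.
by rewrite /disc; smooth.
Qed.

Lemma smooth_nullD : 0 < disc x y z a b p -> smooth_near p (nullD s x y z a b).
Proof.
move=> d0; have sd := smooth_near_sqrt smooth_disc d0; have e := smooth_form1 a b.
by rewrite /nullD; apply: smooth_nearD e _; smooth.
Qed.

Lemma smooth_nullP : 0 < disc x y z a b p -> smooth_near p (nullP s x y z a b).
Proof.
move=> d0; have sD := smooth_nullD d0.
have e := smooth_form1 a a; have e1 := smooth_form2 a a; have e2 := smooth_form2 a b.
by have e3 := smooth_form2 b b; rewrite /nullP; smooth.
Qed.

Lemma smooth_nullM : 0 < disc x y z a b p -> smooth_near p (nullM s x y z a b).
Proof.
move=> d0; have sD := smooth_nullD d0.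
have e := smooth_form1 b b; have e1 := smooth_form2 a a; have e2 := smooth_form2 a b.
by have e3 := smooth_form2 b b; rewrite /nullM; smooth.
Qed.

Lemma lpl_factor_near : s ^+ 2 = 1 -> 0 < disc x y z a b p -> nullD s x y z a b p != 0 ->
  \forall w \near p, lpl x y z a b w =
    (nullD s x y z a b w ^+ 2)^-1 * (nullP s x y z a b w * nullM s x y z a b w).
Proof.
move=> s2 d0 D0.
have n1 := near_gt0 (smooth_near_continuous smooth_disc) d0.
have n2 := near_neq0 (smooth_near_continuous (smooth_nullD d0)) D0.
by apply: filterS2 n1 n2 => w; exact: lpl_factor.
Qed.

End Smooth.

Definition umbilic_form x y z a b w : Prop :=
  0 < disc x y z a b w /\
  exists k : R, [/\ form2 x y z a b a a w = k * form1 x y z a a w,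
    form2 x y z a b a b w = k * form1 x y z a b w
    & form2 x y z a b b b w = k * form1 x y z b b w].

(** At an umbilic the second form is [k] times the first, which is zero on its own null vectors. *)
Lemma umbilic_null s x y z a b w : s ^+ 2 = 1 -> umbilic_form x y z a b w ->
  nullP s x y z a b w = 0 /\ nullM s x y z a b w = 0.
Proof.
move=> s2 [d0 [k [ka kb kc]]]; have := null_root s2 (ltW d0).
rewrite -/(nullD s x y z a b w) /nullP /nullM ka kb kc.
move: (nullD _ _ _ _ _ _ _) (form1 x y z a a w) (form1 x y z a b w) (form1 x y z b b w).
move=> D E F G rD; split.
  by transitivity (k * E * (D ^+ 2 - 2 * F * D + E * G)); [ring|rewrite rD mulr0].
by transitivity (k * G * (D ^+ 2 - 2 * F * D + E * G)); [ring|rewrite rD mulr0].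
Qed.

(** The sign of F: adding the square root of the discriminant with this sign excludes cancellation
    in [nullD]. *)
Definition null_sign x y z a b w : R := if 0 <= form1 x y z a b w then 1 else -1.

Lemma null_sign_sqr x y z a b w : null_sign x y z a b w ^+ 2 = 1.
Proof. by rewrite /null_sign; case: ifP; rewrite ?expr1n ?sqrrN ?expr1n. Qed.

Lemma nullD_neq0 x y z a b w : 0 < disc x y z a b w ->
  nullD (null_sign x y z a b w) x y z a b w != 0.
Proof.
rewrite /nullD /null_sign -sqrtr_gt0; move: (Num.sqrt _) => r r0.
case: leP => F0; first by rewrite mul1r gt_eqF // ltr_wpDl.
by rewrite mulN1r lt_eqF // subr_lt0 (lt_trans F0).
Qed.

(* D^2 - EG, the determinant of the two null vectors, is 2 s sqrt(disc) D *)
Lemma null_det_neq0 s x y z a b w : s ^+ 2 = 1 -> 0 < disc x y z a b w ->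
  nullD s x y z a b w != 0 ->
  nullD s x y z a b w ^+ 2 - form1 x y z a a w * form1 x y z b b w != 0.
Proof.
move=> s2 d0 D0; have s0 : s != 0.
  by apply/eqP => s0; move/eqP: s2; rewrite s0 expr0n /= eq_sym oner_eq0.
have := null_root s2 (ltW d0); rewrite -/(nullD s x y z a b w) => rD.
have r0 : Num.sqrt (disc x y z a b w) != 0 by rewrite gt_eqF // sqrtr_gt0.
suff -> : nullD s x y z a b w ^+ 2 - form1 x y z a a w * form1 x y z b b w =
    2 * s * Num.sqrt (disc x y z a b w) * nullD s x y z a b w.
  by rewrite !mulf_neq0 ?pnatr_eq0.
have sr : s * Num.sqrt (disc x y z a b w) = nullD s x y z a b w - form1 x y z a b w.
  by rewrite /nullD; ring.
move: rD sr; rewrite -(mulrA 2) => rD ->.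
move: (nullD _ _ _ _ _ _ _) (form1 x y z a a w) (form1 x y z a b w) (form1 x y z b b w) rD.
by move=> D E F G rD; apply/eqP; rewrite -subr_eq0 -oppr_eq0 -rD; apply/eqP; ring.
Qed.

End Forms.

Lemma det_mx2 {R : comRingType} (A : 'M[R]_2) : \det A = A 0 0 * A 1 1 - A 0 1 * A 1 0.
Proof.
rewrite (expand_det_row _ 0) !big_ord_recl big_ord0 /cofactor !det_mx11 !mxE /=.
pose m r k := A (inord r) (inord k).
have mE (j k : 'I_2) : A j k = m j k by rewrite /m !inord_val.
by rewrite !mE /= /bump /= ?add0n ?addn0 expr0 expr1; ring.
Qed.

Lemma pd2_comp {R : realType} {m n : nat} (f : 'rV[R]_n.+1 -> R) (g : 'rV[R]_m.+1 -> 'rV[R]_n.+1) p i j :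
  (forall j, smooth_near p (fun w => g w 0 j)) -> smooth_near (g p) f ->
  pd i (pd j (fun w => f (g w))) p =
  \sum_b ((\sum_a pd a (pd b f) (g p) * pd i (fun w => g w 0 a) p) * pd j (fun w => g w 0 b) p
    + pd b f (g p) * pd i (pd j (fun w => g w 0 b)) p).
Proof.
move=> sg sf; rewrite (near_eq_pd i (pd_comp_near j sg sf)).
have sfg b : smooth_near p (fun w => pd b f (g w)).
  by apply: (@smooth_near_comp _ _ _ p (pd b f) g sg); exact: smooth_near_pd.
rewrite pd_sum; last by move=> b; have h1 := sfg b; have h2 := smooth_near_pd i (smooth_near_pd j (sg b)); have h3 := sg b; smooth.
apply: eq_bigr => b _; rewrite pdM; [|have h := sfg b; smooth|have h := sg b; smooth].
congr (_ * _ + _); apply: pd_comp; last by move=> a; have h := sg a; smooth.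
by have h := smooth_near_pd b sf; smooth.
Qed.

(** * Hessian of a product of two functions at a common zero *)

Section HessianProduct.
Context {R : realType}.
Implicit Types (f g h a : 'rV[R]_2 -> R) (p : 'rV[R]_2).

Lemma smooth_near_partialsE p f (s : seq 'I_2) : smooth_near p f ->
  \forall w \near p, partials s f w = foldr (fun i g => pd i g) f s w.
Proof.
move=> sf; elim: s => [|i s IH] /=; first by near=> w.
by have := near_eq_pd_near i IH; apply: filterS => w <-; rewrite pdE.
Unshelve. all: by end_near. Qed.

Lemma pd_product_zero p g a f h i :
  smooth_near p a -> smooth_near p f -> smooth_near p h -> f p = 0 -> h p = 0 ->
  (\forall w \near p, g w = a w * (f w * h w)) -> pd i g p = 0.
Proof.
move=> sa sf sh f0 h0 gE; rewrite (near_eq_pd i gE) pdM; [|smooth|smooth].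
by rewrite pdM; [rewrite f0 h0; ring|smooth|smooth].
Qed.

(** At a common zero the Hessian of a f h is a times the symmetrized product of df and dh, whose
    determinant is minus the square of the Jacobian. Being Morse thus means that the two curves are
    transversal. *)
Lemma det_hessian_product p g a f h :
  smooth_near p a -> smooth_near p f -> smooth_near p h -> f p = 0 -> h p = 0 ->
  (\forall w \near p, g w = a w * (f w * h w)) ->
  \det (hessian g p) = - (a p * jac f h p) ^+ 2.
Proof.
move=> sa sf sh f0 h0 gE.
have sfh : smooth_near p (fun w => f w * h w) by smooth.
have sg : smooth_near p g.
  apply: (@smooth_near_eq _ _ p (fun w => a w * (f w * h w))); last by smooth.
  by apply: filterS gE => w ->.
have H i j : hessian g p i j = a p * (pd j f p * pd i h p + pd i f p * pd j h p).
  rewrite mxE (nbhs_singleton (smooth_near_partialsE [:: i; j] sg)) /=.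
  rewrite (near_eq_pd i (near_eq_pd_near j gE)) pd2M // pd2M //.
  by rewrite !pdM; [rewrite f0 h0; ring|smooth..].
rewrite det_mx2 !H /jac; ring.
Qed.

End HessianProduct.

(** * Coordinate formulas for the geometric definitions *)

Section Interface.
Context {R : realType}.
Implicit Types (X : 'rV[R]_2 -> 'rV[R]_3) (w : 'rV[R]_2).

Local Notation "X `_ k" := (fun w => X w 0 k).

Definition vec3 (a b c : R) : 'rV[R]_3 := \row_k (if k == 0 then a else if k == 1 then b else c).

Lemma vec3E (u : 'rV[R]_3) : u = vec3 (u 0 0) (u 0 1) (u 0 2).
Proof.
apply/rowP => k; rewrite mxE; case: k => [[|[|[|//]]] ?] /=;
  by congr (u 0 _); exact: val_inj.
Qed.

Lemma mink_vec3 a b c a' b' c' : mink (vec3 a b c) (vec3 a' b' c') = a * a' + b * b' - c * c'.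
Proof. by rewrite /mink !mxE. Qed.

Lemma det3_vec3 a b c a' b' c' a2 b2 c2 :
  det3 (vec3 a b c) (vec3 a' b' c') (vec3 a2 b2 c2) =
  (b * c' - c * b') * a2 + (c * a' - a * c') * b2 + (a * b' - b * a') * c2.
Proof. by rewrite det3E !mxE /=; ring. Qed.

Lemma partial_vec3 X w i : smooth_near w X ->
  partial i X w = vec3 (pd i (fun w => X w 0 0) w) (pd i (fun w => X w 0 1) w)
    (pd i (fun w => X w 0 2) w).
Proof. by move=> sX; rewrite [LHS]vec3E !pdE; congr vec3; exact: partial_row. Qed.

Lemma partials_vec3 X w i j : smooth_near w X ->
  partials [:: i; j] X w = vec3 (pd i (pd j (fun w => X w 0 0)) w)
    (pd i (pd j (fun w => X w 0 1)) w) (pd i (pd j (fun w => X w 0 2)) w).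
Proof.
move=> sX; have /smooth_near_row sk := sX; rewrite [LHS]vec3E.
by congr vec3; rewrite partials_row // (nbhs_singleton (smooth_near_partialsE [:: i; j] (sk _))).
Qed.

Lemma mink_form1 X w i j : smooth_near w X ->
  mink (partial i X w) (partial j X w) =
  form1 (fun w => X w 0 0) (fun w => X w 0 1) (fun w => X w 0 2) i j w.
Proof.
by move=> sX; rewrite (partial_vec3 i sX) (partial_vec3 j sX) mink_vec3.
Qed.

Lemma mink_form2 X w i j : smooth_near w X ->
  mink (cross_uv X w) (partials [:: i; j] X w) =
  form2 (fun w => X w 0 0) (fun w => X w 0 1) (fun w => X w 0 2) 0 1 i j w.
Proof.
move=> sX; rewrite /cross_uv mink_mcross (partials_vec3 i j sX).
by rewrite (partial_vec3 0 sX) (partial_vec3 1 sX) det3_vec3.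
Qed.

Lemma tdelta_lpl X w : smooth_near w X ->
  tdelta X w = lpl (fun w => X w 0 0) (fun w => X w 0 1) (fun w => X w 0 2) 0 1 w.
Proof.
move=> sX; rewrite /tdelta.
have e1 : E_ X w = _ := mink_form1 0 0 sX; have e2 : F_ X w = _ := mink_form1 0 1 sX.
have e3 : G_ X w = _ := mink_form1 1 1 sX; have e4 : lbar X w = _ := mink_form2 0 0 sX.
have e5 : mbar X w = _ := mink_form2 0 1 sX; have e6 : nbar X w = _ := mink_form2 1 1 sX.
by rewrite e1 e2 e3 e4 e5 e6.
Qed.

Lemma delta_disc X w : smooth_near w X ->
  delta X w = disc (fun w => X w 0 0) (fun w => X w 0 1) (fun w => X w 0 2) 0 1 w.
Proof. move=> sX; rewrite /delta.
have e1 : E_ X w = _ := mink_form1 0 0 sX; have e2 : F_ X w = _ := mink_form1 0 1 sX.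
have e3 : G_ X w = _ := mink_form1 1 1 sX.
by rewrite e1 e2 e3.
Qed.

End Interface.

(* [ring] compares atoms up to conversion, which is slow for derivatives *)
Ltac gen_pd :=
  repeat match goal with
  | |- context [@pd ?R ?n ?i ?f ?p] => let v := fresh "v" in generalize (@pd R n i f p); intro v
  end.

(** * Behaviour under a change of parameters *)

Section Reparametrization.
Context {R : realType}.
Implicit Types (x y z : 'rV[R]_2 -> R) (phi : 'rV[R]_2 -> 'rV[R]_2) (w : 'rV[R]_2).

Section At.
Variables (x y z : 'rV[R]_2 -> R) (phi : 'rV[R]_2 -> 'rV[R]_2) (w : 'rV[R]_2).
Hypotheses (sx : smooth_near (phi w) x) (sy : smooth_near (phi w) y)
  (sz : smooth_near (phi w) z) (sphi : forall k, smooth_near w (fun w => phi w 0 k)).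

Let x' v := x (phi v).
Let y' v := y (phi v).
Let z' v := z (phi v).
Let M c i := pd i (fun v => phi v 0 c) w.
Let J := M 0 0 * M 1 1 - M 1 0 * M 0 1.

Let chain f i : smooth_near (phi w) f ->
  pd i (fun v => f (phi v)) w = pd 0 f (phi w) * M 0 i + pd 1 f (phi w) * M 1 i.
Proof.
have n01 : (0 : 'I_2) != 1 by [].
by move=> sf; rewrite pd_comp; [rewrite (sum_ord2 _ n01)|smooth|move=> k; smooth].
Qed.

Let chain2 f i j : smooth_near (phi w) f ->
  pd i (pd j (fun v => f (phi v))) w =
  pd 0 (pd 0 f) (phi w) * M 0 i * M 0 j + pd 0 (pd 1 f) (phi w) * (M 0 i * M 1 j + M 1 i * M 0 j)
  + pd 1 (pd 1 f) (phi w) * M 1 i * M 1 j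
  + pd 0 f (phi w) * pd i (pd j (fun v => phi v 0 0)) w
  + pd 1 f (phi w) * pd i (pd j (fun v => phi v 0 1)) w.
Proof.
have n01 : (0 : 'I_2) != 1 by [].
move=> sf; rewrite pd2_comp // !(sum_ord2 _ n01) (pdC 1 0 sf) /M; gen_pd; ring.
Qed.

Lemma form1_change i j : form1 x' y' z' i j w =
  form1 x y z 0 0 (phi w) * M 0 i * M 0 j
  + form1 x y z 0 1 (phi w) * (M 0 i * M 1 j + M 1 i * M 0 j)
  + form1 x y z 1 1 (phi w) * M 1 i * M 1 j.
Proof.
rewrite /form1 /x' /y' /z' !(chain _ sx) !(chain _ sy) !(chain _ sz) /M; gen_pd; ring.
Qed.

(** Second derivatives of the change of parameters come multiplied by tangent vectors and vanish
    against the normal. The factor [J] is due to the normal not being normalized. *)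
Lemma form2_change i j : form2 x' y' z' 0 1 i j w = J *
  (form2 x y z 0 1 0 0 (phi w) * M 0 i * M 0 j
  + form2 x y z 0 1 0 1 (phi w) * (M 0 i * M 1 j + M 1 i * M 0 j)
  + form2 x y z 0 1 1 1 (phi w) * M 1 i * M 1 j).
Proof.
rewrite /form2 /normal /x' /y' /z' !(chain _ sx) !(chain _ sy) !(chain _ sz).
rewrite !(chain2 _ _ sx) !(chain2 _ _ sy) !(chain2 _ _ sz) /J /M; gen_pd; ring.
Qed.

Lemma disc_change : disc x' y' z' 0 1 w = J ^+ 2 * disc x y z 0 1 (phi w).
Proof. rewrite /disc !form1_change /J; ring. Qed.

Lemma lpl_change : lpl x' y' z' 0 1 w = J ^+ 6 * lpl x y z 0 1 (phi w).
Proof.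
rewrite /lpl !form1_change !form2_change /J -(resultant2_change _ _ _ _ _ _ (M 0 0) (M 1 0)).
by congr resultant2; ring.
Qed.

Lemma umbilic_change : J != 0 -> umbilic_form x y z 0 1 (phi w) -> umbilic_form x' y' z' 0 1 w.
Proof.
move=> J0 [d0 [k [ka kb kc]]]; split.
  by rewrite disc_change mulr_gt0 // exprn_even_gt0.
by exists (J * k); rewrite !form1_change !form2_change ka kb kc; split; ring.
Qed.

End At.
End Reparametrization.

(** * Equality of finite jets, and jets of the null curvatures under a perturbation *)

Section JetEquality.
Context {R : realType} {n : nat}.
Implicit Types (f g h c : 'rV[R]_n.+1 -> R).

(* f and g have the same partial derivatives of order < r at 0 *)
Fixpoint jeq r f g : Prop :=
  if r is r'.+1 then f 0 = g 0 /\ forall i, jeq r' (pd i f) (pd i g) else True.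

Lemma jeq_near r f f' g g' : (\forall w \near (0 : 'rV[R]_n.+1), f w = f' w) ->
  (\forall w \near (0 : 'rV[R]_n.+1), g w = g' w) -> jeq r f g -> jeq r f' g'.
Proof.
elim: r f f' g g' => [//|r IH] f f' g g' ff' gg' [e0 ei].
split=> [|i]; first by rewrite -(nbhs_singleton ff') -(nbhs_singleton gg').
by apply: IH (ei i); exact: near_eq_pd_near.
Qed.

Lemma jeq_refl r f : jeq r f f.
Proof. by elim: r f => [//|r IH] f; split. Qed.

Lemma jeqS r f g : jeq r.+1 f g -> jeq r f g.
Proof.
elim: r f g => [//|r IH] f g [e ei]; split=> // i; apply: IH; exact: ei.
Qed.

Lemma jeq_le r s f g : (r <= s)%N -> jeq s f g -> jeq r f g.
Proof.
by elim: s => [|s IH]; rewrite leq_eqVlt => /orP[/eqP ->//|//] rs /jeqS; exact: IH.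
Qed.

Lemma jeqD r f f' g g' : smooth_near 0 f -> smooth_near 0 f' -> smooth_near 0 g ->
  smooth_near 0 g' -> jeq r f f' -> jeq r g g' -> jeq r (fun w => f w + g w) (fun w => f' w + g' w).
Proof.
elim: r f f' g g' => [//|r IH] f f' g g' sf sf' sg sg' [e ei] [d di].
split=> [|i]; first by rewrite e d.
apply: (@jeq_near r (fun w => pd i f w + pd i g w) _ (fun w => pd i f' w + pd i g' w)).
- by apply: filterS (pdD_near i sf sg) => w ->.
- by apply: filterS (pdD_near i sf' sg') => w ->.
- by apply: IH (ei i) (di i); smooth.
Qed.

Lemma jeqM r f f' g g' : smooth_near 0 f -> smooth_near 0 f' -> smooth_near 0 g ->
  smooth_near 0 g' -> jeq r f f' -> jeq r g g' -> jeq r (fun w => f w * g w) (fun w => f' w * g' w).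
Proof.
elim: r f f' g g' => [//|r IH] f f' g g' sf sf' sg sg' jf jg.
have [[e ei] [d di]] := (jf, jg); split=> [|i]; first by rewrite e d.
apply: (@jeq_near r (fun w => pd i f w * g w + f w * pd i g w) _
  (fun w => pd i f' w * g' w + f' w * pd i g' w)).
- by apply: filterS (pdM_near i sf sg) => w ->.
- by apply: filterS (pdM_near i sf' sg') => w ->.
- have jf' := jeqS jf; have jg' := jeqS jg.
  apply: jeqD; [smooth|smooth|smooth|smooth| |].
    by apply: IH (ei i) jg'; smooth.
  by apply: IH jf' (di i); smooth.
Qed.

Lemma jeqN r f f' : smooth_near 0 f -> smooth_near 0 f' -> jeq r f f' ->
  jeq r (fun w => - f w) (fun w => - f' w).
Proof.
move=> sf sf' jf; have m1 := @smooth_near_cst R n 0 (-1).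
have := jeqM m1 m1 sf sf' (jeq_refl r (fun=> -1)) jf.
by apply: jeq_near; near=> w; rewrite mulN1r.
Unshelve. all: by end_near. Qed.

Lemma jeqX r f f' k : smooth_near 0 f -> smooth_near 0 f' -> jeq r f f' ->
  jeq r (fun w => f w ^+ k) (fun w => f' w ^+ k).
Proof.
move=> sf sf' jf; elim: k => [|k IH].
  by apply: jeq_near (jeq_refl r (fun=> 1)); near=> w; rewrite expr0.
have := jeqM sf sf' (smooth_nearX k sf) (smooth_nearX k sf') jf IH.
by apply: jeq_near; near=> w; rewrite exprS.
Unshelve. all: by end_near. Qed.

Lemma jeqV r f f' : smooth_near 0 f -> smooth_near 0 f' -> f 0 != 0 -> jeq r f f' ->
  jeq r (fun w => (f w)^-1) (fun w => (f' w)^-1).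
Proof.
elim: r => [//|r IH] sf sf' f0 jf; have [e ei] := jf.
have f'0 : f' 0 != 0 by rewrite -e.
split=> [|i]; first by rewrite e.
have pV g : smooth_near 0 g -> g 0 != 0 -> \forall w \near (0 : 'rV[R]_n.+1),
    - (pd i g w) * (g w)^-1 ^+ 2 = pd i (fun w => (g w)^-1) w.
  move=> sg g0; have n1 := near_neq0 (smooth_near_continuous sg) g0.
  by apply: filterS2 n1 (smooth_near_near sg) => w g1 sgw; rewrite pdV //; smooth.
apply: jeq_near (pV _ sf f0) (pV _ sf' f'0) _.
have sV := smooth_nearV sf f0; have sV' := smooth_nearV sf' f'0.
have jV := IH sf sf' f0 (jeqS jf).
apply: jeqM; [smooth|smooth|smooth|smooth| |exact: jeqX].
by apply: jeqN; [smooth|smooth|exact: ei].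
Qed.

Lemma jeq_sqrt r f f' : smooth_near 0 f -> smooth_near 0 f' -> 0 < f 0 -> jeq r f f' ->
  jeq r (fun w => Num.sqrt (f w)) (fun w => Num.sqrt (f' w)).
Proof.
elim: r => [//|r IH] sf sf' f0 jf; have [e ei] := jf.
have f'0 : 0 < f' 0 by rewrite -e.
split=> [|i]; first by rewrite e.
have pS g : smooth_near 0 g -> 0 < g 0 -> \forall w \near (0 : 'rV[R]_n.+1),
    pd i g w * (2 * Num.sqrt (g w))^-1 = pd i (fun w => Num.sqrt (g w)) w.
  move=> sg g0; have n1 := near_gt0 (smooth_near_continuous sg) g0.
  by apply: filterS2 n1 (smooth_near_near sg) => w g1 sgw; rewrite pd_sqrt //; smooth.
apply: jeq_near (pS _ sf f0) (pS _ sf' f'0) _.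
have s1 := smooth_near_sqrt sf f0; have s1' := smooth_near_sqrt sf' f'0.
have jV := IH sf sf' f0 (jeqS jf).
have s2 : smooth_near 0 (fun w => 2 * Num.sqrt (f w)) by smooth.
have s2' : smooth_near 0 (fun w => 2 * Num.sqrt (f' w)) by smooth.
have nz g : 0 < g 0 -> 2 * Num.sqrt (g 0) != 0.
  by move=> g0; rewrite mulf_neq0 ?pnatr_eq0 // gt_eqF // sqrtr_gt0.
have s3 := smooth_nearV s2 (nz f f0); have s3' := smooth_nearV s2' (nz f' f'0).
apply: jeqM; [smooth|smooth|smooth|smooth|exact: ei|].
apply: (jeqV s2 s2' (nz f f0)).
by apply: jeqM jV; [smooth|smooth|smooth|smooth|exact: jeq_refl].
Qed.

(** In the derivative of the product, the term with the constant derivative of [l] is covered by the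
    hypothesis on [f], and the term with [pd i f] by induction: one order of vanishing is gained. *)
Lemma jeq0M_linear r (L : 'I_n.+1 -> R) f (l : 'rV[R]_n.+1 -> R) :
  smooth_near 0 l -> smooth_near 0 f -> l 0 = 0 -> (forall i w, pd i l w = L i) ->
  jeq r f (fun=> 0) -> jeq r.+1 (fun w => l w * f w) (fun=> 0).
Proof.
move=> sl + l0 pl; have pd0 i : pd i (fun _ : 'rV[R]_n.+1 => 0 : R) = fun=> 0.
  by apply/funext => w; rewrite pd_cst.
have z0 := @smooth_near_cst R n 0 0.
elim: r f => [|r IH] f sf jf; first by split; first by rewrite l0 mul0r.
split=> [|i]; first by rewrite l0 mul0r.
apply: (@jeq_near r.+1 (fun w => L i * f w + l w * pd i f w) _ (fun w => L i * 0 + 0)).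
- by apply: filterS (pdM_near i sl sf) => w ->; rewrite pl.
- by near=> w; rewrite pd0 mulr0 addr0.
- apply: jeqD; [smooth|smooth|smooth|smooth| |].
    by apply: jeqM jf; [smooth|smooth|smooth|smooth|exact: jeq_refl].
  by have := jf.2 i; rewrite pd0; apply: IH; smooth.
Unshelve. all: by end_near. Qed.

Lemma jeq_pd r f g i : jeq r.+1 f g -> jeq r (pd i f) (pd i g).
Proof. by move=> [_ H]; exact: H. Qed.

Lemma jeqB r f f' g g' : smooth_near 0 f -> smooth_near 0 f' -> smooth_near 0 g ->
  smooth_near 0 g' -> jeq r f f' -> jeq r g g' -> jeq r (fun w => f w - g w) (fun w => f' w - g' w).
Proof. by move=> sf sf' sg sg' jf jg; apply: jeqD (jeqN sg sg' jg); [smooth..|exact: jf]. Qed.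

End JetEquality.

Ltac jets :=
  match goal with
  | H : jeq ?r ?f ?g |- jeq ?r ?f ?g => exact H
  | |- jeq _ ?f ?f => exact: jeq_refl
  | |- jeq _ (fun w => @GRing.add _ (@?f w) (@GRing.opp _ (@?g w))) _ =>
    apply: jeqB; [smooth|smooth|smooth|smooth|jets|jets]
  | |- jeq _ (fun w => @GRing.add _ (@?f w) (@?g w)) _ =>
    apply: jeqD; [smooth|smooth|smooth|smooth|jets|jets]
  | |- jeq _ (fun w => @GRing.mul _ (@?f w) (@?g w)) _ =>
    apply: jeqM; [smooth|smooth|smooth|smooth|jets|jets]
  | |- jeq _ (fun w => @GRing.exp _ (@?f w) _) _ => apply: jeqX; [smooth|smooth|jets]
  | |- jeq _ (fun w => ?f w) (fun w => ?g w) => change (fun w => f w) with f; change (fun w => g w) with g; jets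
  | _ => idtac
  end.

Section JetForms.
Context {R : realType} {n : nat}.
Implicit Types (x y z c : 'rV[R]_n.+1 -> R) (a b : 'I_n.+1).

Section Congruence.
Variables (x y z x' y' z' : 'rV[R]_n.+1 -> R) (a b : 'I_n.+1) (r : nat).
Hypotheses (sx : smooth_near 0 x) (sy : smooth_near 0 y) (sz : smooth_near 0 z).
Hypotheses (sx' : smooth_near 0 x') (sy' : smooth_near 0 y') (sz' : smooth_near 0 z').
Hypotheses (jx : jeq r.+1 x' x) (jy : jeq r.+1 y' y) (jz : jeq r.+1 z' z).

Lemma jeq_normal : jeq r (normal x' y' a b) (normal x y a b).
Proof.
have [jxa jxb] := (jeq_pd a jx, jeq_pd b jx); have [jya jyb] := (jeq_pd a jy, jeq_pd b jy).
by rewrite /normal; jets.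
Qed.

Lemma jeq_form1 : jeq r (form1 x' y' z' a b) (form1 x y z a b).
Proof.
have [jxa jxb] := (jeq_pd a jx, jeq_pd b jx); have [jya jyb] := (jeq_pd a jy, jeq_pd b jy).
have [jza jzb] := (jeq_pd a jz, jeq_pd b jz).
by rewrite /form1; jets.
Qed.

End Congruence.

Section Congruence2.
Variables (x y z x' y' z' : 'rV[R]_n.+1 -> R) (a b : 'I_n.+1) (r : nat).
Hypotheses (sx : smooth_near 0 x) (sy : smooth_near 0 y) (sz : smooth_near 0 z).
Hypotheses (sx' : smooth_near 0 x') (sy' : smooth_near 0 y') (sz' : smooth_near 0 z').
Hypotheses (jx : jeq r.+1 x' x) (jy : jeq r.+1 y' y) (jz : jeq r.+1 z' z).

Lemma jeq_disc : jeq r (disc x' y' z' a b) (disc x y z a b).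
Proof.
have e1 := smooth_form1 sx sy sz a a; have e2 := smooth_form1 sx sy sz a b.
have e3 := smooth_form1 sx sy sz b b; have e1' := smooth_form1 sx' sy' sz' a a.
have e2' := smooth_form1 sx' sy' sz' a b; have e3' := smooth_form1 sx' sy' sz' b b.
have j1 := jeq_form1 a a sx sy sz sx' sy' sz' jx jy jz.
have j2 := jeq_form1 a b sx sy sz sx' sy' sz' jx jy jz.
have j3 := jeq_form1 b b sx sy sz sx' sy' sz' jx jy jz.
by rewrite /disc; jets.
Qed.

Lemma jeq_nullD s : 0 < disc x y z a b 0 -> 0 < disc x' y' z' a b 0 ->
  jeq r (nullD s x' y' z' a b) (nullD s x y z a b).
Proof.
move=> d0 d0'; have e1 := smooth_form1 sx sy sz a b; have e2 := smooth_form1 sx' sy' sz' a b.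
have s1 := smooth_disc a b sx sy sz; have s2 := smooth_disc a b sx' sy' sz'.
have q1 := smooth_near_sqrt s1 d0; have q2 := smooth_near_sqrt s2 d0'.
apply: jeqD; [exact: e2|exact: e1|smooth|smooth| |].
  exact: jeq_form1.
apply: jeqM; [smooth|smooth|smooth|smooth|exact: jeq_refl|].
by apply: jeq_sqrt; [exact: s2|exact: s1|exact: d0'|exact: jeq_disc].
Qed.

End Congruence2.

Section Perturbation.
Variables (x y z x' y' z' c : 'rV[R]_n.+1 -> R) (a b : 'I_n.+1) (r : nat) (e0 e1 e2 s : R).
Hypotheses (sx : smooth_near 0 x) (sy : smooth_near 0 y) (sz : smooth_near 0 z).
Hypotheses (sx' : smooth_near 0 x') (sy' : smooth_near 0 y') (sz' : smooth_near 0 z').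
Hypothesis sc : smooth_near 0 c.
Hypotheses (x'E : \forall w \near (0 : 'rV[R]_n.+1), x' w = x w + e0 * c w)
  (y'E : \forall w \near (0 : 'rV[R]_n.+1), y' w = y w + e1 * c w)
  (z'E : \forall w \near (0 : 'rV[R]_n.+1), z' w = z w + e2 * c w).
Hypothesis jc : jeq r.+2 c (fun=> 0).
Hypothesis d0 : 0 < disc x y z a b 0.

(** The determinant of the two tangent vectors and the direction [(e0, e1, e2)] of the perturbation:
    the part of this direction seen by the second fundamental form. *)
Let nu w := normal y z a b w * e0 + normal z x a b w * e1 + normal x y a b w * e2.

Let jpert (f f' : 'rV[R]_n.+1 -> R) e : smooth_near 0 f -> smooth_near 0 f' ->
  (\forall w \near (0 : 'rV[R]_n.+1), f' w = f w + e * c w) -> jeq r.+2 f' f.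
Proof.
move=> sf sf' f'E; have z0 := @smooth_near_cst R n 0 0.
apply: (@jeq_near _ _ r.+2 (fun w => f w + e * c w) _ (fun w => f w + e * 0)).
- by apply: filterS f'E => w ->.
- by near=> w; rewrite mulr0 addr0.
- apply: jeqD; [smooth|smooth|smooth|smooth|exact: jeq_refl|].
  by apply: jeqM jc; [smooth|smooth|smooth|smooth|exact: jeq_refl].
Unshelve. all: by end_near. Qed.

Lemma disc_perturb : disc x' y' z' a b 0 = disc x y z a b 0.
Proof.
have jx := jpert sx sx' x'E; have jy := jpert sy sy' y'E; have jz := jpert sz sz' z'E.
exact: (jeq_disc a b sx sy sz sx' sy' sz' jx jy jz).1.
Qed.

Lemma nullD_perturb : jeq r.+1 (nullD s x' y' z' a b) (nullD s x y z a b).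
Proof.
have jx := jpert sx sx' x'E; have jy := jpert sy sy' y'E; have jz := jpert sz sz' z'E.
by apply: jeq_nullD; rewrite ?disc_perturb.
Qed.

Let sN (f g : 'rV[R]_n.+1 -> R) : smooth_near 0 f -> smooth_near 0 g -> smooth_near 0 (normal f g a b).
Proof. by move=> sf sg; rewrite /normal; smooth. Qed.

Let jterm (f f' g g' h h' : 'rV[R]_n.+1 -> R) e i j : smooth_near 0 f -> smooth_near 0 f' ->
  smooth_near 0 g -> smooth_near 0 g' -> smooth_near 0 h -> smooth_near 0 h' ->
  jeq r.+2 f' f -> jeq r.+2 g' g ->
  (\forall w \near (0 : 'rV[R]_n.+1), h' w = h w + e * c w) ->
  jeq r.+1 (fun w => normal f' g' a b w * pd i (pd j h') w)
    (fun w => normal f g a b w * (pd i (pd j h) w + e * pd i (pd j c) w)).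
Proof.
move=> sf sf' sg sg' sh sh' jf jg h'E.
have m1 := sN sf sg; have m2 := sN sf' sg'.
have jN := jeq_normal a b sf sg sf' sg' jf jg.
have jh : jeq r.+1 (pd i (pd j h')) (fun w => pd i (pd j h) w + e * pd i (pd j c) w).
  have st : smooth_near 0 (fun w => e * c w) by smooth.
  apply: (@jeq_near _ _ r.+1 (pd i (pd j h')) _ (pd i (pd j h'))); last exact: jeq_refl.
    by near=> w.
  apply: filterS3 (near_eq_pd_near i (near_eq_pd_near j h'E)) (smooth_near_near sh)
    (smooth_near_near sc) => w -> shw scw.
  have stw : smooth_near w (fun w => e * c w) by smooth.
  rewrite pd2D; [congr (_ + _)|exact: shw|exact: stw].
  have ez := smooth_near_near scw.
  rewrite (near_eq_pd i (g := fun w => e * pd j c w)); first by rewrite pdZ; smooth.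
  by apply: filterS ez => v scv; rewrite pdZ; smooth.
by jets.
Unshelve. all: by end_near. Qed.

(** The derivatives of [c] of order at most [r.+1] vanish at 0, so the first derivatives of the map,
    hence the normal, are unchanged up to order [r]. The second derivatives of [c] may be nonzero at
    order [r], and they give the only new term. *)
Lemma form2_perturb i j : jeq r.+1 (form2 x' y' z' a b i j)
  (fun w => form2 x y z a b i j w + nu w * pd i (pd j c) w).
Proof.
have jx := jpert sx sx' x'E; have jy := jpert sy sy' y'E; have jz := jpert sz sz' z'E.
have t1 := jterm i j sy sy' sz sz' sx sx' jy jz x'E.
have t2 := jterm i j sz sz' sx sx' sy sy' jz jx y'E.
have t3 := jterm i j sx sx' sy sy' sz sz' jx jy z'E.
have n1 := sN sy sz; have n2 := sN sz sx; have n3 := sN sx sy.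
have n1' := sN sy' sz'; have n2' := sN sz' sx'; have n3' := sN sx' sy'.
have s1 : smooth_near 0 (fun w => normal y' z' a b w * pd i (pd j x') w) by smooth.
have s2 : smooth_near 0 (fun w => normal z' x' a b w * pd i (pd j y') w) by smooth.
have s3 : smooth_near 0 (fun w => normal x' y' a b w * pd i (pd j z') w) by smooth.
have s4 : smooth_near 0 (fun w => normal y z a b w * (pd i (pd j x) w + e0 * pd i (pd j c) w)) by smooth.
have s5 : smooth_near 0 (fun w => normal z x a b w * (pd i (pd j y) w + e1 * pd i (pd j c) w)) by smooth.
have s6 : smooth_near 0 (fun w => normal x y a b w * (pd i (pd j z) w + e2 * pd i (pd j c) w)) by smooth.
have := jeqD (smooth_nearD s1 s2) (smooth_nearD s4 s5) s3 s6 (jeqD s1 s4 s2 s5 t1 t2) t3.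
apply: jeq_near; first by near=> w.
by near=> w; rewrite /form2 /nu; ring.
Unshelve. all: by end_near. Qed.

Let snu : smooth_near 0 nu.
Proof. by have n1 := sN sy sz; have n2 := sN sz sx; have n3 := sN sx sy; rewrite /nu; smooth. Qed.

Let d0' : 0 < disc x' y' z' a b 0. Proof. by rewrite disc_perturb. Qed.

(** To this order D and E do not change, so the increment is [nu] times the Hessian of [c] evaluated
    on the null vector (D, - E). *)
Lemma nullP_perturb : jeq r.+1 (nullP s x' y' z' a b)
  (fun w => nullP s x y z a b w + nu w *
    (pd a (pd a c) w * nullD s x y z a b w ^+ 2
     - 2 * pd a (pd b c) w * nullD s x y z a b w * form1 x y z a a w
     + pd b (pd b c) w * form1 x y z a a w ^+ 2)).
Proof.
have jx := jpert sx sx' x'E; have jy := jpert sy sy' y'E; have jz := jpert sz sz' z'E.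
have t1 := form2_perturb a a; have t2 := form2_perturb a b; have t3 := form2_perturb b b.
have t4 := nullD_perturb; have t5 := jeq_form1 a a sx sy sz sx' sy' sz' jx jy jz.
have s1 := smooth_form2 a b sx sy sz a a; have s2 := smooth_form2 a b sx sy sz a b.
have s3 := smooth_form2 a b sx sy sz b b; have s4 := smooth_form1 sx sy sz a a.
have s1' := smooth_form2 a b sx' sy' sz' a a; have s2' := smooth_form2 a b sx' sy' sz' a b.
have s3' := smooth_form2 a b sx' sy' sz' b b; have s4' := smooth_form1 sx' sy' sz' a a.
have s5 := smooth_nullD s sx sy sz d0; have s5' := smooth_nullD s sx' sy' sz' d0'.
have q0 := snu.
rewrite /nullP; set F := fun w => _ + nu w * _.
apply: (@jeq_near _ _ r.+1 (nullP s x' y' z' a b) _ (fun w =>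
  (form2 x y z a b a a w + nu w * pd a (pd a c) w) * nullD s x y z a b w ^+ 2
  - 2 * (form2 x y z a b a b w + nu w * pd a (pd b c) w) * nullD s x y z a b w * form1 x y z a a w
  + (form2 x y z a b b b w + nu w * pd b (pd b c) w) * form1 x y z a a w ^+ 2)).
- by near=> w.
- by near=> w; rewrite /F; ring.
- by rewrite /nullP; jets.
Unshelve. all: by end_near. Qed.

Lemma nullM_perturb : jeq r.+1 (nullM s x' y' z' a b)
  (fun w => nullM s x y z a b w + nu w *
    (pd b (pd b c) w * nullD s x y z a b w ^+ 2
     - 2 * pd a (pd b c) w * nullD s x y z a b w * form1 x y z b b w
     + pd a (pd a c) w * form1 x y z b b w ^+ 2)).
Proof.
have jx := jpert sx sx' x'E; have jy := jpert sy sy' y'E; have jz := jpert sz sz' z'E.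
have t1 := form2_perturb a a; have t2 := form2_perturb a b; have t3 := form2_perturb b b.
have t4 := nullD_perturb; have t5 := jeq_form1 b b sx sy sz sx' sy' sz' jx jy jz.
have s1 := smooth_form2 a b sx sy sz a a; have s2 := smooth_form2 a b sx sy sz a b.
have s3 := smooth_form2 a b sx sy sz b b; have s4 := smooth_form1 sx sy sz b b.
have s1' := smooth_form2 a b sx' sy' sz' a a; have s2' := smooth_form2 a b sx' sy' sz' a b.
have s3' := smooth_form2 a b sx' sy' sz' b b; have s4' := smooth_form1 sx' sy' sz' b b.
have s5 := smooth_nullD s sx sy sz d0; have s5' := smooth_nullD s sx' sy' sz' d0'.
have q0 := snu.
rewrite /nullM; set F := fun w => _ + nu w * _.
apply: (@jeq_near _ _ r.+1 (nullM s x' y' z' a b) _ (fun w =>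
  (form2 x y z a b b b w + nu w * pd b (pd b c) w) * nullD s x y z a b w ^+ 2
  - 2 * (form2 x y z a b a b w + nu w * pd a (pd b c) w) * nullD s x y z a b w * form1 x y z b b w
  + (form2 x y z a b a a w + nu w * pd a (pd a c) w) * form1 x y z b b w ^+ 2)).
- by near=> w.
- by near=> w; rewrite /F; ring.
- by rewrite /nullM; jets.
Unshelve. all: by end_near. Qed.

End Perturbation.
End JetForms.

Lemma smooth_near_near_row {R : realType} {n m : nat} (X : 'rV[R]_n.+1 -> 'rV[R]_m.+1) p :
  smooth_near p X -> \forall w \near p, smooth_near w X.
Proof. exact: nbhs_interior. Qed.

Lemma smooth_normal {R : realType} {n : nat} (x y : 'rV[R]_n.+1 -> R) a b p :
  smooth_near p x -> smooth_near p y -> smooth_near p (normal x y a b).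
Proof. by move=> sx sy; rewrite /normal; smooth. Qed.

(** * The unit normal and umbilic points *)

Section UnitNormal.
Context {R : realType}.
Implicit Types (x y z : 'rV[R]_2 -> R) (X : 'rV[R]_2 -> 'rV[R]_3) (i j : 'I_2) (w : 'rV[R]_2).

(** [disc] is the Minkowski square of the cross product and is positive over the Lorentzian region,
    so the absolute value of [mnorm] disappears. *)
Definition nscale x y z w : R := (Num.sqrt (disc x y z 0 1 w))^-1.

Lemma smooth_nscale p x y z : smooth_near p x -> smooth_near p y -> smooth_near p z ->
  0 < disc x y z 0 1 p -> smooth_near p (nscale x y z).
Proof.
move=> sx sy sz d0; apply: smooth_nearV; last by rewrite gt_eqF // sqrtr_gt0.
by apply: smooth_near_sqrt d0; exact: smooth_disc.
Qed.

Lemma jeq_nscale r x y z x' y' z' :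
  smooth_near 0 x -> smooth_near 0 y -> smooth_near 0 z ->
  smooth_near 0 x' -> smooth_near 0 y' -> smooth_near 0 z' ->
  jeq r.+1 x' x -> jeq r.+1 y' y -> jeq r.+1 z' z ->
  0 < disc x y z 0 1 0 -> 0 < disc x' y' z' 0 1 0 ->
  jeq r (nscale x' y' z') (nscale x y z).
Proof.
move=> sx sy sz sx' sy' sz' jx jy jz d0 d0'.
have s1 := smooth_disc 0 1 sx sy sz; have s2 := smooth_disc 0 1 sx' sy' sz'.
have q1 := smooth_near_sqrt s1 d0; have q2 := smooth_near_sqrt s2 d0'.
apply: (jeqV q2 q1); first by rewrite gt_eqF // sqrtr_gt0.
by apply: (jeq_sqrt s2 s1 d0'); exact: jeq_disc.
Qed.

Let Uk x y z w := vec3 (nscale x y z w * normal y z 0 1 w) (nscale x y z w * normal z x 0 1 w)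
  (- (nscale x y z w * normal x y 0 1 w)).

Lemma unit_normalE X w : smooth_near w X ->
  let x v := X v 0 0 in let y v := X v 0 1 in let z v := X v 0 2 in
  0 < disc x y z 0 1 w -> unit_normal X w = Uk x y z w.
Proof.
move=> sX x y z d0; rewrite /unit_normal /cross_uv.
rewrite (partial_vec3 0 sX) (partial_vec3 1 sX) -/x -/y -/z.
have -> : mcross (vec3 (pd 0 x w) (pd 0 y w) (pd 0 z w)) (vec3 (pd 1 x w) (pd 1 y w) (pd 1 z w))
    = vec3 (normal y z 0 1 w) (normal z x 0 1 w) (- normal x y 0 1 w).
  rewrite [LHS]vec3E /normal; congr vec3; rewrite mxE det3E !mxE /=; gen_pd; ring.
rewrite /mnorm mink_vec3.
rewrite (_ : _ - _ = disc x y z 0 1 w); last first.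
  by rewrite /disc /form1 /normal; gen_pd; ring.
rewrite gtr0_norm // -/(nscale x y z w) [LHS]vec3E /Uk; congr vec3; rewrite !mxE //=.
by rewrite mulrN.
Qed.

(** The opposite sign of the third equation is that of the third component of the Minkowski cross
    product. In this form the condition visibly involves derivatives at 0 of order at most two. *)
Lemma timelike_umbilicE X : smooth_near 0 X ->
  let x v := X v 0 0 in let y v := X v 0 1 in let z v := X v 0 2 in
  timelike_umbilic X 0 <-> 0 < disc x y z 0 1 0 /\ exists k : R, forall i,
    [/\ - pd i (fun w => nscale x y z w * normal y z 0 1 w) 0 = k * pd i x 0,
      - pd i (fun w => nscale x y z w * normal z x 0 1 w) 0 = k * pd i y 0
      & pd i (fun w => nscale x y z w * normal x y 0 1 w) 0 = k * pd i z 0].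
Proof.
move=> sX x y z; rewrite /timelike_umbilic (delta_disc sX) -/x -/y -/z.
have /smooth_near_row sk := sX.
have sx : smooth_near 0 x := sk 0; have sy : smooth_near 0 y := sk 1.
have sz : smooth_near 0 z := sk 2.
suff H : 0 < disc x y z 0 1 0 -> forall k i, - partial i (unit_normal X) 0 = k *: partial i X 0 <->
    [/\ - pd i (fun w => nscale x y z w * normal y z 0 1 w) 0 = k * pd i x 0,
      - pd i (fun w => nscale x y z w * normal z x 0 1 w) 0 = k * pd i y 0
      & pd i (fun w => nscale x y z w * normal x y 0 1 w) 0 = k * pd i z 0].
  by split=> -[d0 [k E]]; split=> //; exists k => i; apply/(H d0).
move=> d0 k i.
have s0 := smooth_nscale sx sy sz d0.
have n1 := smooth_normal 0 1 sy sz; have n2 := smooth_normal 0 1 sz sx; have n3 := smooth_normal 0 1 sx sy.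
have sU : smooth_near 0 (Uk x y z).
  apply/smooth_near_row => l; rewrite /Uk.
  have : [\/ l = 0, l = 1 | l = 2].
    by case: l => [[|[|[|//]]] ?]; [constructor 1|constructor 2|constructor 3]; exact: val_inj.
  have c0 : smooth_near 0 (fun w => nscale x y z w * normal y z 0 1 w) by smooth.
  have c1 : smooth_near 0 (fun w => nscale x y z w * normal z x 0 1 w) by smooth.
  have c2 : smooth_near 0 (fun w => - (nscale x y z w * normal x y 0 1 w)) by smooth.
  by case=> ->; [apply: smooth_near_eq c0|apply: smooth_near_eq c1|apply: smooth_near_eq c2];
    near=> w; rewrite mxE.
have -> : partial i (unit_normal X) 0 = partial i (Uk x y z) 0.
  have nd := near_gt0 (smooth_near_continuous (smooth_disc 0 1 sx sy sz)) d0.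
  have eU : \forall w \near (0 : 'rV[R]_2), unit_normal X w = Uk x y z w.
    by apply: filterS2 nd (smooth_near_near_row sX) => w d1 sXw; exact: unit_normalE.
  exact: near_eq_partial eU.
rewrite (partial_vec3 i sU) (partial_vec3 i sX) -/x -/y -/z.
have -> : pd i (fun w => Uk x y z w 0 0) 0 = pd i (fun w => nscale x y z w * normal y z 0 1 w) 0.
  by congr (pd i _ 0); apply/funext => w; rewrite mxE.
have -> : pd i (fun w => Uk x y z w 0 1) 0 = pd i (fun w => nscale x y z w * normal z x 0 1 w) 0.
  by congr (pd i _ 0); apply/funext => w; rewrite mxE.
have -> : pd i (fun w => Uk x y z w 0 2) 0 = - pd i (fun w => nscale x y z w * normal x y 0 1 w) 0.
  rewrite -pdN; last by smooth.
  by congr (pd i _ 0); apply/funext => w; rewrite mxE.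
split=> [/rowP E|[E0 E1 E2]].
  by move: (E 0) (E 1) (E 2); rewrite !mxE /= opprK.
by rewrite [LHS]vec3E [RHS]vec3E !mxE /= opprK E0 E1 E2.
Unshelve. all: by end_near. Qed.

(** Differentiating the orthogonality of the normal to the tangent vectors trades derivatives of the
    unit normal for the second fundamental form; the normalizing factor goes into the constant
    [k]. *)
Lemma timelike_umbilic_form X : smooth_near 0 X -> timelike_umbilic X 0 ->
  umbilic_form (fun v => X v 0 0) (fun v => X v 0 1) (fun v => X v 0 2) 0 1 0.
Proof.
move=> sX /(timelike_umbilicE sX); set x := fun v => X v 0 0; set y := fun v => X v 0 1.
set z := fun v => X v 0 2 => -[d0 [k E]].
have /smooth_near_row sk := sX.
have sx : smooth_near 0 x := sk 0; have sy : smooth_near 0 y := sk 1.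
have sz : smooth_near 0 z := sk 2.
have s0 := smooth_nscale sx sy sz d0.
have n1 := smooth_normal 0 1 sy sz; have n2 := smooth_normal 0 1 sz sx; have n3 := smooth_normal 0 1 sx sy.
set U0 := fun w => nscale x y z w * normal y z 0 1 w in E.
set U1 := fun w => nscale x y z w * normal z x 0 1 w in E.
set U2 := fun w => nscale x y z w * normal x y 0 1 w in E.
have t0 : smooth_near 0 U0 by rewrite /U0; smooth.
have t1 : smooth_near 0 U1 by rewrite /U1; smooth.
have t2 : smooth_near 0 U2 by rewrite /U2; smooth.
have r0 : Num.sqrt (disc x y z 0 1 0) != 0 by rewrite gt_eqF // sqrtr_gt0.
have orth i j : nscale x y z 0 * form2 x y z 0 1 i j 0 = k * form1 x y z i j 0.
  have j01 : (j = 0) \/ (j = 1).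
    by case: j => [[|[|//]] ?]; [left|right]; exact: val_inj.
  have o : pd i (fun w => U0 w * pd j x w + U1 w * pd j y w + U2 w * pd j z w) 0 = 0.
    rewrite -(pd_cst 0 (0 : 'rV[R]_2) i); congr (pd i _ 0); apply/funext => w.
    by rewrite /U0 /U1 /U2 /normal; case: j01 => ->; gen_pd; ring.
  have [e0 e1 e2] := E i.
  have u0 : U0 0 = nscale x y z 0 * normal y z 0 1 0 by [].
  have u1 : U1 0 = nscale x y z 0 * normal z x 0 1 0 by [].
  have u2 : U2 0 = nscale x y z 0 * normal x y 0 1 0 by [].
  clearbody U0 U1 U2; move: o; rewrite pdD; [|smooth|smooth]; rewrite pdD; [|smooth|smooth].
  rewrite !pdM; [|smooth..]; move/eqP; rewrite addrC => /eqP o.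
  rewrite /form1 /form2.
  transitivity (- pd i U0 0 * pd j x 0 + - pd i U1 0 * pd j y 0 - pd i U2 0 * pd j z 0).
    apply/eqP; rewrite -subr_eq0 -o u0 u1 u2; apply/eqP; gen_pd.
    by move: (nscale _ _ _ _) (normal y z _ _ _) (normal x y _ _ _) (normal z x _ _ _) => *; ring.
  by rewrite e0 e1 e2; gen_pd; ring.
split=> //; exists (Num.sqrt (disc x y z 0 1 0) * k).
by split; rewrite -mulrA -orth /nscale mulrA mulfV // mul1r.
Qed.

(** [jeq 3] compares derivatives of order at most two, which is all that [timelike_umbilicE]
    involves. This keeps the umbilic under cubic and quartic perturbations. *)
Lemma timelike_umbilic_jet X X' : smooth_near 0 X -> smooth_near 0 X' ->
  (forall k, jeq 3 (fun w => X' w 0 k) (fun w => X w 0 k)) ->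
  timelike_umbilic X 0 -> timelike_umbilic X' 0.
Proof.
move=> sX sX' jX /(timelike_umbilicE sX)[d0 [k E]]; apply/(timelike_umbilicE sX').
have /smooth_near_row sk := sX; have /smooth_near_row sk' := sX'.
have [sx sy sz] := And3 (sk 0) (sk 1) (sk 2); have [sx' sy' sz'] := And3 (sk' 0) (sk' 1) (sk' 2).
have [jx jy jz] := And3 (jX 0) (jX 1) (jX 2).
have d0' := d0; rewrite -(jeq_disc 0 1 sx sy sz sx' sy' sz' jx jy jz).1 in d0'.
split=> //; exists k => i.
have js := jeq_nscale sx sy sz sx' sy' sz' jx jy jz d0 d0'.
have s0 := smooth_nscale sx sy sz d0; have s0' := smooth_nscale sx' sy' sz' d0'.
have n1 := smooth_normal 0 1 sy sz; have n2 := smooth_normal 0 1 sz sx; have n3 := smooth_normal 0 1 sx sy.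
have n1' := smooth_normal 0 1 sy' sz'; have n2' := smooth_normal 0 1 sz' sx'; have n3' := smooth_normal 0 1 sx' sy'.
have j1 := jeq_normal 0 1 sy sz sy' sz' jy jz; have j2 := jeq_normal 0 1 sz sx sz' sx' jz jx.
have j3 := jeq_normal 0 1 sx sy sx' sy' jx jy.
have [E0 E1 E2] := E i.
have p0 := (jeq_pd i (jeqM s0' s0 n1' n1 js j1)).1.
have p1 := (jeq_pd i (jeqM s0' s0 n2' n2 js j2)).1.
have p2 := (jeq_pd i (jeqM s0' s0 n3' n3 js j3)).1.
have q l := (jeq_pd i (jX l)).1.
by split; rewrite q ?p0 ?p1 ?p2.
Qed.

End UnitNormal.

(** * Continuous dependence of jets on a parameter in a topological space *)

Section JetContinuity.
Context {R : realType} {T : topologicalType} {n : nat}.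
Implicit Types (F G : T -> 'rV[R]_n.+1 -> R) (t : T).

(* the partial derivatives of F t of order at most r at 0 depend continuously on t *)
Fixpoint jetc r F t : Prop :=
  {for t, continuous (fun u => F u 0)} /\
  (if r is r'.+1 then forall i, jetc r' (fun u => pd i (F u)) t else True).

Definition smooth_family F t : Prop := \forall u \near t, smooth_near 0 (F u).

Lemma jetc_near r F F' t :
  (\forall u \near t, \forall w \near (0 : 'rV[R]_n.+1), F u w = F' u w) ->
  jetc r F t -> jetc r F' t.
Proof.
elim: r F F' => [|r IH] F F' FF' [c0 ci].
  split=> //; apply: near_eq_continuous c0.
  by apply: filterS FF' => u e; exact: (nbhs_singleton e).
split=> [|i].
  apply: near_eq_continuous c0.
  by apply: filterS FF' => u e; exact: (nbhs_singleton e).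
apply: IH (ci i); apply: filterS FF' => u; exact: near_eq_pd_near.
Qed.

Lemma jetc_continuous r F t : jetc r F t -> {for t, continuous (fun u => F u 0)}.
Proof. by case: r => [|r] []. Qed.

Lemma jetcS r F t : jetc r.+1 F t -> jetc r F t.
Proof.
elim: r F => [|r IH] F [c ci]; split=> // i; apply: IH; exact: ci.
Qed.

Lemma jetc_cst r (f : 'rV[R]_n.+1 -> R) t : jetc r (fun=> f) t.
Proof. by elim: r f => [|r IH] f; split=> //; exact: cst_continuous. Qed.

Lemma jetcD r F G t : smooth_family F t -> smooth_family G t -> jetc r F t -> jetc r G t ->
  jetc r (fun u w => F u w + G u w) t.
Proof.
elim: r F G => [|r IH] F G sF sG [c ci] [d di]; split=> //; try exact: continuousD.
move=> i; apply: (@jetc_near r (fun u w => pd i (F u) w + pd i (G u) w)).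
  by apply: filterS2 sF sG => u sFu sGu; apply: filterS (pdD_near i sFu sGu) => w ->.
apply: IH (ci i) (di i); [apply: filterS sF|apply: filterS sG] => u; exact: smooth_near_pd.
Qed.

Lemma smooth_familyM F G t : smooth_family F t -> smooth_family G t ->
  smooth_family (fun u w => F u w * G u w) t.
Proof. by apply: filterS2 => u sf sg; smooth. Qed.

Lemma smooth_familyD F G t : smooth_family F t -> smooth_family G t ->
  smooth_family (fun u w => F u w + G u w) t.
Proof. by apply: filterS2 => u sf sg; smooth. Qed.

Lemma smooth_family_pd F t i : smooth_family F t -> smooth_family (fun u => pd i (F u)) t.
Proof. by apply: filterS => u; exact: smooth_near_pd. Qed.

Lemma smooth_family_cst (f : 'rV[R]_n.+1 -> R) t : smooth_near 0 f -> smooth_family (fun=> f) t.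
Proof. by move=> sf; near=> u. Unshelve. all: by end_near. Qed.

Lemma smooth_familyX F t k : smooth_family F t -> smooth_family (fun u w => F u w ^+ k) t.
Proof. by apply: filterS => u sf; smooth. Qed.

Lemma smooth_familyN F t : smooth_family F t -> smooth_family (fun u w => - F u w) t.
Proof. by apply: filterS => u sf; smooth. Qed.

Lemma smooth_familyV F t : {for t, continuous (fun u => F u 0)} -> F t 0 != 0 ->
  smooth_family F t -> smooth_family (fun u w => (F u w)^-1) t.
Proof.
move=> cF F0; have n0 := near_neq0 cF F0.
by apply: filterS2 n0 => u u0 sf; exact: smooth_nearV.
Qed.

Lemma smooth_family_sqrt F t : {for t, continuous (fun u => F u 0)} -> 0 < F t 0 ->
  smooth_family F t -> smooth_family (fun u w => Num.sqrt (F u w)) t.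
Proof.
move=> cF F0; have n0 := near_gt0 cF F0.
by apply: filterS2 n0 => u u0 sf; exact: smooth_near_sqrt.
Qed.

Lemma jetcM r F G t : smooth_family F t -> smooth_family G t -> jetc r F t -> jetc r G t ->
  jetc r (fun u w => F u w * G u w) t.
Proof.
elim: r F G => [|r IH] F G sF sG jF jG; have [[c ci] [d di]] := (jF, jG).
  by split=> //; exact: continuousM.
split=> [|i]; first exact: continuousM.
apply: (@jetc_near r (fun u w => pd i (F u) w * G u w + F u w * pd i (G u) w)).
  by apply: filterS2 sF sG => u sFu sGu; apply: filterS (pdM_near i sFu sGu) => w ->.
have sFi := smooth_family_pd i sF; have sGi := smooth_family_pd i sG.
exact: (jetcD (smooth_familyM sFi sG) (smooth_familyM sF sGi)
  (IH _ _ sFi sG (ci i) (jetcS jG)) (IH _ _ sF sGi (jetcS jF) (di i))).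
Qed.

Lemma jetcN r F t : smooth_family F t -> jetc r F t -> jetc r (fun u w => - F u w) t.
Proof.
move=> sF jF; have m1 := smooth_family_cst t (@smooth_near_cst R n 0 (-1)).
apply: jetc_near (jetcM m1 sF (jetc_cst r (fun=> -1) t) jF).
by near=> u; near=> w; rewrite mulN1r.
Unshelve. all: by end_near. Qed.

Lemma jetcX r F t k : smooth_family F t -> jetc r F t -> jetc r (fun u w => F u w ^+ k) t.
Proof.
move=> sF jF; elim: k => [|k IH].
  apply: jetc_near (jetc_cst r (fun=> 1) t); near=> u; near=> w; by rewrite expr0.
apply: jetc_near (jetcM sF (smooth_familyX k sF) jF IH).
by near=> u; near=> w; rewrite exprS.
Unshelve. all: by end_near. Qed.

Lemma jetcV r F t : smooth_family F t -> F t 0 != 0 -> jetc r F t ->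
  jetc r (fun u w => (F u w)^-1) t.
Proof.
move=> sF F0; elim: r => [|r IH] jF; have [c ci] := jF.
  by split=> //; exact: continuousV.
split=> [|i]; first exact: continuousV.
have sV := smooth_familyV c F0 sF; have sFi := smooth_family_pd i sF.
apply: (@jetc_near r (fun u w => - pd i (F u) w * (F u w)^-1 ^+ 2)).
  apply: filterS2 sF (near_neq0 c F0) => u su u0.
  have n1 := near_neq0 (smooth_near_continuous su) u0.
  by apply: filterS2 n1 (smooth_near_near su) => w g1 sgw; rewrite pdV //; smooth.
have jV := IH (jetcS jF).
by apply: jetcM; [exact: smooth_familyN|exact: smooth_familyX|exact: (jetcN sFi (ci i))|exact: jetcX].
Qed.

Lemma jetc_sqrt r F t : smooth_family F t -> 0 < F t 0 -> jetc r F t ->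
  jetc r (fun u w => Num.sqrt (F u w)) t.
Proof.
move=> sF F0; elim: r => [|r IH] jF; have [c ci] := jF.
  by split=> //; apply: (continuous_comp c); exact: sqrt_continuous.
split=> [|i]; first by apply: (continuous_comp c); exact: sqrt_continuous.
have sS := smooth_family_sqrt c F0 sF; have sFi := smooth_family_pd i sF.
have s2 := smooth_familyM (smooth_family_cst t (@smooth_near_cst R n 0 2)) sS.
have jS := jetcM (smooth_family_cst t (@smooth_near_cst R n 0 2)) sS (jetc_cst r (fun=> 2) t)
  (IH (jetcS jF)).
have nz : 2 * Num.sqrt (F t 0) != 0 by rewrite mulf_neq0 ?pnatr_eq0 // gt_eqF // sqrtr_gt0.
apply: (@jetc_near r (fun u w => pd i (F u) w * (2 * Num.sqrt (F u w))^-1)).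
  apply: filterS2 sF (near_gt0 c F0) => u su u0.
  have n1 := near_gt0 (smooth_near_continuous su) u0.
  by apply: filterS2 n1 (smooth_near_near su) => w g1 sgw; rewrite pd_sqrt //; smooth.
have sV := smooth_familyV (jetc_continuous jS) nz s2.
by apply: (jetcM sFi sV (ci i)); exact: (jetcV s2 nz jS).
Qed.

End JetContinuity.

Section SmoothJets.
Context {R : realType} {T : topologicalType} {n : nat}.
Implicit Types (F G x y z : T -> 'rV[R]_n.+1 -> R) (t : T).

Definition jets_at r F t : Prop := smooth_family F t /\ jetc r F t.

Lemma jets_cst r (f : 'rV[R]_n.+1 -> R) t : smooth_near 0 f -> jets_at r (fun=> f) t.
Proof. by move=> sf; split; [exact: smooth_family_cst|exact: jetc_cst]. Qed.

Lemma jetsD r F G t : jets_at r F t -> jets_at r G t -> jets_at r (fun u w => F u w + G u w) t.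
Proof. by move=> [sF jF] [sG jG]; split; [exact: smooth_familyD|exact: jetcD]. Qed.

Lemma jetsM r F G t : jets_at r F t -> jets_at r G t -> jets_at r (fun u w => F u w * G u w) t.
Proof. by move=> [sF jF] [sG jG]; split; [exact: smooth_familyM|exact: jetcM]. Qed.

Lemma jetsN r F t : jets_at r F t -> jets_at r (fun u w => - F u w) t.
Proof. by move=> [sF jF]; split; [exact: smooth_familyN|exact: jetcN]. Qed.

Lemma jetsX r F t k : jets_at r F t -> jets_at r (fun u w => F u w ^+ k) t.
Proof. by move=> [sF jF]; split; [exact: smooth_familyX|exact: jetcX]. Qed.

Lemma jets_pd r F t i : jets_at r.+1 F t -> jets_at r (fun u => pd i (F u)) t.
Proof. by move=> [sF [_ jF]]; split; [exact: smooth_family_pd|exact: jF]. Qed.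

Lemma jetsS r F t : jets_at r.+1 F t -> jets_at r F t.
Proof. by move=> [sF jF]; split=> //; exact: jetcS. Qed.

Lemma jets_sqrt r F t : 0 < F t 0 -> jets_at r F t -> jets_at r (fun u w => Num.sqrt (F u w)) t.
Proof.
move=> F0 [sF jF]; split; last exact: jetc_sqrt.
by apply: smooth_family_sqrt; [exact: jetc_continuous jF| |].
Qed.

Lemma jets_near r F F' t :
  (\forall u \near t, \forall w \near (0 : 'rV[R]_n.+1), F u w = F' u w) ->
  jets_at r F t -> jets_at r F' t.
Proof.
move=> FF' [sF jF]; split; last exact: jetc_near jF.
by apply: filterS2 FF' sF => u; exact: smooth_near_eq.
Qed.

Lemma jets_continuous r F t : jets_at r F t -> {for t, continuous (fun u => F u 0)}.
Proof. by move=> [_]; exact: jetc_continuous. Qed.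

End SmoothJets.

Ltac jetst :=
  match goal with
  | H : jets_at ?r ?F ?t |- jets_at ?r ?F ?t => exact H
  | |- jets_at _ (fun u w => @GRing.add _ (@?F u w) (@?G u w)) _ => apply: jetsD; jetst
  | |- jets_at _ (fun u w => @GRing.opp _ (@?F u w)) _ => apply: jetsN; jetst
  | |- jets_at _ (fun u w => @GRing.mul _ (@?F u w) (@?G u w)) _ => apply: jetsM; jetst
  | |- jets_at _ (fun u w => @GRing.exp _ (@?F u w) _) _ => apply: jetsX; jetst
  | |- jets_at _ (fun u w => pd ?i (@?F u) w) _ => apply: (@jets_pd _ _ _ _ F); jetst
  | |- jets_at _ (fun u => pd ?i (@?F u)) _ => apply: (@jets_pd _ _ _ _ F); jetst
  | |- jets_at _ (fun u w => ?c) _ => apply: jets_cst; smooth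
  | _ => idtac
  end.

Section JetsForms.
Context {R : realType} {T : topologicalType} {n : nat}.
Variables (x y z : T -> 'rV[R]_n.+1 -> R) (t : T) (r : nat) (a b : 'I_n.+1).
Hypotheses (jx : jets_at r.+2 x t) (jy : jets_at r.+2 y t) (jz : jets_at r.+2 z t).

Lemma jets_form1 c d : jets_at r.+1 (fun u => form1 (x u) (y u) (z u) c d) t.
Proof. by rewrite /form1; jetst. Qed.

Lemma jets_form2 c d : jets_at r (fun u => form2 (x u) (y u) (z u) a b c d) t.
Proof.
have jx' := jetsS jx; have jy' := jetsS jy; have jz' := jetsS jz.
by rewrite /form2 /normal; jetst.
Qed.

Lemma jets_disc : jets_at r.+1 (fun u => disc (x u) (y u) (z u) a b) t.
Proof.
have e1 := jets_form1 a a; have e2 := jets_form1 a b; have e3 := jets_form1 b b.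
by rewrite /disc; jetst.
Qed.

Hypothesis d0 : 0 < disc (x t) (y t) (z t) a b 0.

Lemma jets_nullD s : jets_at r.+1 (fun u => nullD s (x u) (y u) (z u) a b) t.
Proof. by have e2 := jets_form1 a b; have q := jets_sqrt d0 jets_disc; rewrite /nullD; jetst. Qed.

Lemma jets_nullP s : jets_at r (fun u => nullP s (x u) (y u) (z u) a b) t.
Proof.
have e1 := jetsS (jets_form1 a a); have e2 := jetsS (jets_nullD s).
have f1 := jets_form2 a a; have f2 := jets_form2 a b; have f3 := jets_form2 b b.
by rewrite /nullP; jetst.
Qed.

Lemma jets_nullM s : jets_at r (fun u => nullM s (x u) (y u) (z u) a b) t.
Proof.
have e1 := jetsS (jets_form1 b b); have e2 := jetsS (jets_nullD s).
have f1 := jets_form2 a a; have f2 := jets_form2 a b; have f3 := jets_form2 b b.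
by rewrite /nullM; jetst.
Qed.

End JetsForms.

Lemma jets_sum {R : realType} {T : topologicalType} {n m : nat}
    (F : 'I_m -> T -> 'rV[R]_n.+1 -> R) r t :
  (forall j, jets_at r (F j) t) -> jets_at r (fun u w => \sum_j F j u w) t.
Proof.
elim: m F => [|m IH] F jF.
  apply: jets_near (jets_cst r t (@smooth_near_cst R n 0 0)).
  by near=> u; near=> w; rewrite big_ord0.
apply: jets_near (jetsD (jF ord0) (IH (fun j => F (lift ord0 j)) (fun j => jF _))).
by near=> u; near=> w; rewrite big_ord_recl.
Unshelve. all: by end_near. Qed.

(** The inner map is fixed, so by the chain rule the derivatives of the composite are sums of jets
    of [F] times fixed smooth functions. It serves to let a surface vary while a change of
    parameters is held fixed. *)
Lemma jets_comp {R : realType} {T : topologicalType} {n m : nat}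
    (F : T -> 'rV[R]_n.+1 -> R) (g : 'rV[R]_m.+1 -> 'rV[R]_n.+1) r t :
  (forall j, smooth_near 0 (fun w => g w 0 j)) -> g 0 = 0 ->
  jets_at r F t -> jets_at r (fun u w => F u (g w)) t.
Proof.
move=> sg g0 [sF jF]; split.
  apply: filterS sF => u sFu; apply: (@smooth_near_comp _ _ _ 0 (F u) g sg).
  by rewrite g0.
elim: r F sF jF => [|r IH] F sF [c ci]; split=> //.
- by rewrite g0.
- by rewrite g0.
- move=> i; suff [] : jets_at r (fun u w => \sum_j pd j (F u) (g w) * pd i (fun w => g w 0 j) w) t.
    move=> _; apply: jetc_near; apply: filterS sF => u sFu.
    have sFu' : smooth_near (g 0) (F u) by rewrite g0.
    by apply: filterS (pd_comp_near i sg sFu') => w ->.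
  apply: jets_sum => j; apply: jetsM; last by apply: jets_cst; smooth.
  have sFj := smooth_family_pd j sF; split; last exact: IH (ci j).
  apply: filterS sFj => u sFu; apply: (@smooth_near_comp _ _ _ 0 _ g sg).
  by rewrite g0.
Qed.

Lemma partials_pd {R : realType} {n : nat} (s : seq 'I_n.+1) (f : 'rV[R]_n.+1 -> R) :
  partials s f = foldr (fun i g => pd i g) f s.
Proof. by elim: s => [//|i s IH] /=; rewrite -IH pdE_fun. Qed.

Section Coordinates.
Context {R : realType}.

Lemma jet_continuous {n : nat} {W : normedModType R} (s : seq 'I_n.+1) :
  continuous (fun j : prod_topology (fun _ : seq 'I_n.+1 => W) => j s).
Proof. exact: (@proj_continuous _ (fun _ : seq 'I_n.+1 => W) s). Qed.

Lemma param_jet_continuous (s : seq 'I_2) : continuous (fun x : param R => partials s x 0).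
Proof.
move=> x; apply: (@continuous_comp _ _ _ (fun x : param R => jet x)
  (fun j : prod_topology (fun _ : seq 'I_2 => 'rV[R]_3) => j s)).
  exact: initial_continuous.
exact: jet_continuous.
Qed.

Lemma deform_jet_continuous (s : seq 'I_3) : continuous (fun h : deformation R => partials s h 0).
Proof.
move=> x; apply: (@continuous_comp _ _ _ (fun x : deformation R => jet x)
  (fun j : prod_topology (fun _ : seq 'I_3 => R) => j s)).
  exact: initial_continuous.
exact: jet_continuous.
Qed.

(** The topology of [param] is initial for the infinite jet, so each iterated partial derivative at
    0 is a continuous function of the parametrization. The induction needs the claim for all lists
    of directions at once. *)
Lemma jets_param r k (x : param R) : jets_at r (fun (y : param R) w => y w 0 k) x.
Proof.
split; first by near=> y; have /smooth_near_row := param_smooth y.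
suff H s : jetc r (fun (y : param R) => foldr (fun i f => pd i f) (fun w => y w 0 k) s) x.
  exact: (H [::]).
have c s' : {for x, continuous (fun y : param R => foldr (fun i f => pd i f) (fun w => y w 0 k) s' 0)}.
  rewrite (_ : (fun y : param R => _) = fun y => partials s' y 0 0 k).
    apply: (@continuous_comp _ _ _ (fun y : param R => partials s' y 0) (fun v : 'rV[R]_3 => v 0 k)); first exact: param_jet_continuous.
    exact: coord_continuous.
  apply/funext => y; rewrite partials_row; last exact: param_smooth.
  by rewrite partials_pd.
elim: r s => [|r IH] s; split=> // i; exact: (IH (i :: s)).
Unshelve. all: by end_near. Qed.

Lemma jets_deformation r (h : deformation R) : jets_at r (fun (g : deformation R) => g : _ -> R) h.
Proof.
split; first by near=> g; exact: deform_smooth.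
suff H s : jetc r (fun (g : deformation R) => foldr (fun i f => pd i f) g s) h.
  exact: (H [::]).
have c s' : {for h, continuous (fun g : deformation R => foldr (fun i f => pd i f) g s' 0)}.
  rewrite (_ : (fun y : deformation R => _) = fun y => partials s' y 0).
    exact: deform_jet_continuous.
  by apply/funext => g; rewrite partials_pd.
elim: r s => [|r IH] s; split=> // i; exact: (IH (i :: s)).
Unshelve. all: by end_near. Qed.

End Coordinates.

Section NearForms.
Context {R : realType} {n : nat}.
Variables (p : 'rV[R]_n.+1) (x y z x' y' z' : 'rV[R]_n.+1 -> R).
Hypotheses (ex : \forall w \near p, x w = x' w) (ey : \forall w \near p, y w = y' w)
  (ez : \forall w \near p, z w = z' w).

Lemma near_eq_form1 a b : form1 x y z a b p = form1 x' y' z' a b p.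
Proof.
by rewrite /form1 !(near_eq_pd _ ex) !(near_eq_pd _ ey) !(near_eq_pd _ ez).
Qed.

Lemma near_eq_form2 a b c d : form2 x y z a b c d p = form2 x' y' z' a b c d p.
Proof.
have e f f' (ff : \forall w \near p, f w = f' w) : pd c (pd d f) p = pd c (pd d f') p.
  by apply: near_eq_pd; exact: near_eq_pd_near.
by rewrite /form2 /normal (e _ _ ex) (e _ _ ey) (e _ _ ez)
  !(near_eq_pd _ ex) !(near_eq_pd _ ey) !(near_eq_pd _ ez).
Qed.

Lemma near_eq_umbilic a b : umbilic_form x y z a b p -> umbilic_form x' y' z' a b p.
Proof. by rewrite /umbilic_form /disc !near_eq_form1 !near_eq_form2. Qed.

Lemma near_eq_lpl a b : lpl x y z a b p = lpl x' y' z' a b p.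
Proof. by rewrite /lpl !near_eq_form1 !near_eq_form2. Qed.

End NearForms.

(** * Germs of surfaces: independence of the parametrization *)

Section Germs.
Context {R : realType}.
Implicit Types (X Y : 'rV[R]_2 -> 'rV[R]_3) (x y : param R) (M : surface_germ R) (i : 'I_2) (s : R).

Definition disc0 X := disc (fun w => X w 0 0) (fun w => X w 0 1) (fun w => X w 0 2) 0 1.
Definition D0 s X := nullD s (fun w => X w 0 0) (fun w => X w 0 1) (fun w => X w 0 2) 0 1.
Definition P0 s X := nullP s (fun w => X w 0 0) (fun w => X w 0 1) (fun w => X w 0 2) 0 1.
Definition M0 s X := nullM s (fun w => X w 0 0) (fun w => X w 0 1) (fun w => X w 0 2) 0 1.
Definition umbilic0 X := umbilic_form (fun w => X w 0 0) (fun w => X w 0 1) (fun w => X w 0 2) 0 1 0.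

(* along each null direction the normal curvature vanishes on a curve, and the two curves have
   a contact of order exactly one *)
Definition contact s i X : Prop :=
  [/\ 0 < disc0 X 0, D0 s X 0 != 0 & simple_contact i (P0 s X) (M0 s X) 0].

Section Factor.
Variables (X : 'rV[R]_2 -> 'rV[R]_3) (s : R).
Hypotheses (sX : smooth_near 0 X) (s2 : s ^+ 2 = 1) (d0 : 0 < disc0 X 0) (D00 : D0 s X 0 != 0).

Let sk := let: conj h _ := smooth_near_row 0 X in h sX.

Lemma smooth_P0 : smooth_near 0 (P0 s X).
Proof. exact: smooth_nullP. Qed.

Lemma smooth_M0 : smooth_near 0 (M0 s X).
Proof. exact: smooth_nullM. Qed.

Lemma smooth_DV : smooth_near 0 (fun w => (D0 s X w ^+ 2)^-1).
Proof.
have sD : smooth_near 0 (D0 s X) by exact: smooth_nullD.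
by apply: smooth_nearV; [smooth|rewrite expf_neq0].
Qed.

Lemma tdelta_factor : \forall w \near (0 : 'rV[R]_2),
  tdelta X w = (D0 s X w ^+ 2)^-1 * (P0 s X w * M0 s X w).
Proof.
have n1 := lpl_factor_near (sk 0) (sk 1) (sk 2) s2 d0 D00.
apply: filterS2 n1 (smooth_near_near_row sX) => w <- sXw; exact: tdelta_lpl.
Qed.

End Factor.

Lemma reparam_refl x : reparam x x.
Proof. by exists idfun; [exact: diffeo_germ_id|near=> w]. Unshelve. all: by end_near. Qed.

Lemma reparam_sym x y : reparam x y -> reparam y x.
Proof.
move=> [phi dphi yE]; have [psi [dpsi _ e]] := diffeo_germ_inv dphi.
exists psi => //; have p0 : psi 0 = 0 by case: dpsi => ? [].
have yE' : \forall w \near psi 0, y w = x (phi w) by rewrite p0.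
have n1 := near_continuous (diffeo_germ_continuous dpsi) yE'.
by apply: filterS2 e n1 => w e1 ->; rewrite e1.
Qed.

Lemma reparam_trans x y z : reparam x y -> reparam y z -> reparam x z.
Proof.
move=> [phi dphi yE] [psi dpsi zE]; exists (phi \o psi); first exact: diffeo_germ_comp dphi.
have p0 : psi 0 = 0 by case: dpsi => ? [].
have yE' : \forall w \near psi 0, y w = x (phi w) by rewrite p0.
by apply: filterS2 (near_continuous (diffeo_germ_continuous dpsi) yE') zE => w <-.
Qed.

Lemma local_param_reparam M x y : local_param M x -> local_param M y -> reparam x y.
Proof.
have [x0 ->] := surface_germP M => x0x x0y.
exact: reparam_trans (reparam_sym x0x) x0y.
Qed.

Lemma local_param_trans M x y : local_param M x -> reparam x y -> local_param M y.
Proof. by have [x0 ->] := surface_germP M; exact: reparam_trans. Qed.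

Lemma germ_of_local M x : local_param M x -> germ_of x = M.
Proof.
move=> Mx; have E : local_param (germ_of x) = local_param M.
  apply/funext => y; apply/propext; split; first exact: local_param_trans.
  exact: local_param_reparam.
case: M Mx E => l pl /= Mx; rewrite /germ_of => E.
by subst l; congr SurfaceGerm; exact: Prop_irrelevance.
Qed.

Section Reparam.
Variables (x y : param R) (phi : 'rV[R]_2 -> 'rV[R]_2).
Hypotheses (dphi : diffeo_germ 0 0 phi) (yE : \forall w \near (0 : 'rV[R]_2), y w = x (phi w)).

Let p0 : phi 0 = 0. Proof. by case: dphi => ? []. Qed.
Let sphi k : smooth_near 0 (fun w => phi w 0 k). Proof. exact: diffeo_germ_smooth dphi. Qed.
Let sx k : smooth_near 0 (fun w => x w 0 k).
Proof. by have /smooth_near_row := param_smooth x. Qed.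
Let yEk k : \forall w \near (0 : 'rV[R]_2), x (phi w) 0 k = y w 0 k.
Proof. by apply: filterS yE => w ->. Qed.
Let J w := pd 0 (fun v => phi v 0 0) w * pd 1 (fun v => phi v 0 1) w
  - pd 0 (fun v => phi v 0 1) w * pd 1 (fun v => phi v 0 0) w.

Let J0 : J 0 != 0.
Proof. by have := diffeo_germ_jac dphi; rewrite /jac /J [X in _ - X]mulrC. Qed.

Lemma umbilic_reparam : umbilic0 x -> umbilic0 y.
Proof.
move=> ux; apply: (near_eq_umbilic (yEk 0) (yEk 1) (yEk 2)).
apply: (@umbilic_change _ (fun w => x w 0 0) (fun w => x w 0 1) (fun w => x w 0 2)).
- by rewrite p0.
- by rewrite p0.
- by rewrite p0.
- exact: sphi.
- by apply: contra J0; rewrite /J mulrC [X in _ - X]mulrC => /eqP <-; apply/eqP; gen_pd; ring.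
- by rewrite p0.
Qed.

Lemma tdelta_reparam : \forall w \near (0 : 'rV[R]_2), tdelta y w = J w ^+ 6 * tdelta x (phi w).
Proof.
have nphi := near_continuous (diffeo_germ_continuous dphi).
have sxp : \forall w \near phi 0, smooth_near w x.
  by rewrite p0; exact: smooth_near_near_row (param_smooth x).
have sphin : \forall w \near (0 : 'rV[R]_2), smooth_near w phi.
  by apply: smooth_near_near_row; apply/smooth_near_row.
have yEn0 : \forall w \near (0 : 'rV[R]_2), \forall v \near w, x (phi v) = y v.
  by apply: nbhs_interior; apply: filterS yE => w ->.
apply: filterS2 (filterI (nphi _ sxp) sphin) (filterI yEn0 (smooth_near_near_row (param_smooth y))).
move=> w [sxw spw] [yw syw].
rewrite (tdelta_lpl syw) (tdelta_lpl sxw).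
have e k : \forall v \near w, y v 0 k = x (phi v) 0 k by apply: filterS yw => v ->.
rewrite (near_eq_lpl (e 0) (e 1) (e 2)).
have /smooth_near_row sxk := sxw; have /smooth_near_row spk := spw.
by rewrite (lpl_change (sxk 0) (sxk 1) (sxk 2) spk); congr (_ ^+ 6 * _).
Qed.

(** The unit is [J^6 / D^2]: the sixth power of the Jacobian from the change of parameters, the
    denominator from the factorization for [x]. Conclusions about one parametrization thus pass to
    all others without recomputing null curvatures. *)
Lemma tdelta_factor_reparam s : s ^+ 2 = 1 -> 0 < disc0 x 0 -> D0 s x 0 != 0 ->
  exists a : 'rV[R]_2 -> R, [/\ smooth_near 0 a, a 0 != 0 & \forall w \near (0 : 'rV[R]_2),
    tdelta y w = a w * (P0 s x (phi w) * M0 s x (phi w))].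
Proof.
move=> s2 d0 D00; have sDV := smooth_DV (param_smooth x) d0 D00.
exists (fun w => J w ^+ 6 * (D0 s x (phi w) ^+ 2)^-1); split.
- have sJ : smooth_near 0 J by rewrite /J; smooth.
  have := @smooth_near_comp _ _ _ 0 _ phi sphi; rewrite p0 => /(_ _ sDV) sD.
  by smooth.
- by rewrite p0 mulf_neq0 ?invr_neq0 // ?expf_neq0 // J0.
- have nx : \forall v \near phi 0, tdelta x v = (D0 s x v ^+ 2)^-1 * (P0 s x v * M0 s x v).
    by rewrite p0; exact: tdelta_factor (param_smooth x) s2 d0 D00.
  have nphi := near_continuous (diffeo_germ_continuous dphi) nx.
  by apply: filterS2 tdelta_reparam nphi => w -> ->; rewrite -mulrA.
Qed.

End Reparam.

Lemma jac_comp (f h : 'rV[R]_2 -> R) (phi : 'rV[R]_2 -> 'rV[R]_2) p :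
  (forall k, smooth_near p (fun w => phi w 0 k)) ->
  smooth_near (phi p) f -> smooth_near (phi p) h ->
  jac (fun w => f (phi w)) (fun w => h (phi w)) p =
  jac f h (phi p) * jac (fun w => phi w 0 0) (fun w => phi w 0 1) p.
Proof.
have n01 : (0 : 'I_2) != 1 by [].
move=> sphi sf sh; have c g i : smooth_near (phi p) g -> pd i (fun w => g (phi w)) p =
    pd 0 g (phi p) * pd i (fun w => phi w 0 0) p + pd 1 g (phi p) * pd i (fun w => phi w 0 1) p.
  by move=> sg; rewrite pd_comp; [rewrite (sum_ord2 _ n01)|smooth|move=> k; smooth].
by rewrite /jac !(c _ _ sf) !(c _ _ sh); gen_pd; ring.
Qed.

Lemma umbilic_nullsign X : umbilic0 X -> let s := null_sign (fun w => X w 0 0) (fun w => X w 0 1)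
  (fun w => X w 0 2) 0 1 0 in [/\ s ^+ 2 = 1, 0 < disc0 X 0 & D0 s X 0 != 0].
Proof.
by move=> [d0 _] s; split=> //; [exact: null_sign_sqr|exact: nullD_neq0].
Qed.

Lemma G3_umbilic M x : G3 M -> local_param M x -> umbilic0 x.
Proof.
move=> [y My [uy _ _]] Mx; have [phi dphi xE] := local_param_reparam My Mx.
exact: umbilic_reparam dphi xE (timelike_umbilic_form (param_smooth y) uy).
Qed.

(** [G3] offers some parametrization [y] with a singular Hessian. There [tdelta] is a unit times the
    null curvatures of [x] composed with the change of parameters; their Jacobian vanishes by
    [det_hessian_product], and Jacobians are multiplicative. *)
Lemma G3_jac M x s : G3 M -> local_param M x -> s ^+ 2 = 1 -> D0 s x 0 != 0 ->
  jac (P0 s x) (M0 s x) 0 = 0.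
Proof.
move=> G3M Mx s2 D00; have ux := G3_umbilic G3M Mx; have [d0 _] := ux.
have [y My [_ sing nm]] := G3M; have [phi dphi yE] := local_param_reparam Mx My.
have p0 : phi 0 = 0 by case: dphi => ? [].
have [a [sa a0 fE]] := tdelta_factor_reparam dphi yE s2 d0 D00.
have sphi k : smooth_near 0 (fun w => phi w 0 k) by exact: diffeo_germ_smooth dphi.
have sP := smooth_P0 s (param_smooth x) d0; have sM := smooth_M0 s (param_smooth x) d0.
rewrite -{1}p0 in sP; rewrite -{1}p0 in sM.
have [P00 M00] := umbilic_null s2 ux.
have h : \det (hessian (tdelta y) 0) = 0.
  by apply/eqP; apply: contrapT => /negP nh; apply: nm.
have e := det_hessian_product sa (smooth_near_comp sphi sP) (smooth_near_comp sphi sM) _ _ fE.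
move: h; rewrite e ?p0 // => /eqP.
rewrite oppr_eq0 expf_eq0 /= mulf_eq0 (negbTE a0) /= (jac_comp sphi sP sM) mulf_eq0.
by rewrite (negbTE (diffeo_germ_jac dphi)) orbF p0 => /eqP.
Qed.

(** The sign [null_sign] makes D nonzero, and [A3_converse] then reads the contact off the
    factorization in the same parametrization. *)
Lemma A_minus_contact x : umbilic0 x -> A_minus 3 x 0 ->
  exists s i, s ^+ 2 = 1 /\ contact s i x.
Proof.
move=> ux [phi [b [dphi E]]]; have [s2 d0 D00] := umbilic_nullsign ux.
set s := null_sign _ _ _ _ _ _ in s2 D00.
have [P00 M00] := umbilic_null s2 ux.
have K0 : (D0 s x 0 ^+ 2)^-1 != 0 by rewrite invr_neq0 // expf_neq0.
have sx := param_smooth x.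
have [_ [i ci]] := A3_converse (smooth_DV sx d0 D00) (smooth_P0 s sx d0) (smooth_M0 s sx d0)
  K0 P00 M00 dphi (tdelta_factor sx s2 d0 D00) E.
by exists s, i.
Qed.

(** [tdelta x] is pulled back to the source of [y] by the inverse change of parameters, where it is
    a unit times the two null curvatures; the chart of [A3_normal_form] is then composed with that
    inverse. Together with [A_minus_contact], contact in one parametrization gives contact in all of
    them. *)
Lemma contact_A_minus x y s i : umbilic0 y -> s ^+ 2 = 1 -> jac (P0 s y) (M0 s y) 0 = 0 ->
  contact s i y -> reparam y x -> A_minus 3 x 0.
Proof.
move=> uy s2 J [d0 D00 ci] [phi dphi xE]; have [psi [dpsi h1 h2]] := diffeo_germ_inv dphi.
have [a [sa a0 fE]] := tdelta_factor_reparam dphi xE s2 d0 D00.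
have [P00 M00] := umbilic_null s2 uy.
have p0 : psi 0 = 0 by case: dpsi => ? [].
have spsi k : smooth_near 0 (fun w => psi w 0 k) by exact: diffeo_germ_smooth dpsi.
have sa' : smooth_near 0 (fun w => a (psi w)) by apply: smooth_near_comp spsi _; rewrite p0.
have sy := param_smooth y.
have a0' : a (psi 0) != 0 by rewrite p0.
have gE : \forall v \near (0 : 'rV[R]_2), tdelta x (psi v) = a (psi v) * (P0 s y v * M0 s y v).
  rewrite -{1}p0 in fE.
  have n := near_continuous (diffeo_germ_continuous dpsi) fE.
  by apply: filterS2 n h2 => v -> ->.
have [chi [b [dchi bE]]] := A3_normal_form sa' (smooth_P0 s sy d0) (smooth_M0 s sy d0)
  a0' P00 M00 J ci gE.
by exists (psi \o chi), b; split=> //; exact: diffeo_germ_comp dpsi.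
Qed.

End Germs.

(** * Openness of the contact condition *)

Section Openness.
Context {R : realType}.
Implicit Types (X Y : 'rV[R]_2 -> 'rV[R]_3) (x y : param R) (M : surface_germ R) (i j : 'I_2) (s : R).

Lemma near_eq_simple_contact i p (f h f' h' : 'rV[R]_2 -> R) :
  (\forall w \near p, f w = f' w) -> (\forall w \near p, h w = h' w) ->
  simple_contact i f h p -> simple_contact i f' h' p.
Proof.
move=> ef eh [f1 h1 c]; have [e3 e4] := (near_eq_pd i ef, near_eq_pd i eh).
rewrite /simple_contact -!(near_eq_pd _ ef) -(near_eq_pd _ eh).
split=> //; apply: contra c => /eqP <-; apply/eqP; rewrite /hess2.
have kE k : kerv f p 0 k = kerv f' p 0 k by rewrite !mxE !(near_eq_pd _ ef).
have tE : \forall w \near p, theta i f h p w = theta i f' h' p w.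
  by apply: filterS2 ef eh => w e1 e2; rewrite /theta e1 e2 e3 e4.
apply: eq_bigr => b _; rewrite kE; congr (_ * _); apply: eq_bigr => a _; rewrite kE; congr (_ * _).
by apply: near_eq_pd; exact: near_eq_pd_near.
Qed.

Section NearEq.
Variables (s : R) (X Y : 'rV[R]_2 -> 'rV[R]_3) (p : 'rV[R]_2).
Hypothesis XY : \forall w \near p, X w = Y w.

Let e (w : 'rV[R]_2) k : (\forall v \near w, X v = Y v) -> \forall v \near w, X v 0 k = Y v 0 k.
Proof. by apply: filterS => v ->. Qed.

Let XYn : \forall w \near p, \forall v \near w, X v = Y v.
Proof. exact: nbhs_interior. Qed.

Let DE w : (\forall v \near w, X v = Y v) -> D0 s X w = D0 s Y w.
Proof. by move=> h; rewrite /D0 /nullD /disc !(near_eq_form1 (e 0 h) (e 1 h) (e 2 h)). Qed.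

Lemma near_eq_disc0 : disc0 X p = disc0 Y p.
Proof. by rewrite /disc0 /disc !(near_eq_form1 (e 0 XY) (e 1 XY) (e 2 XY)). Qed.

Lemma near_eq_D0 : D0 s X p = D0 s Y p. Proof. exact: DE. Qed.

Lemma near_eq_P0 : \forall w \near p, P0 s X w = P0 s Y w.
Proof.
apply: filterS XYn => w h; rewrite /P0 /nullP !(near_eq_form1 (e 0 h) (e 1 h) (e 2 h)).
by rewrite !(near_eq_form2 (e 0 h) (e 1 h) (e 2 h)); have := DE h; rewrite /D0 => ->.
Qed.

Lemma near_eq_M0 : \forall w \near p, M0 s X w = M0 s Y w.
Proof.
apply: filterS XYn => w h; rewrite /M0 /nullM !(near_eq_form1 (e 0 h) (e 1 h) (e 2 h)).
by rewrite !(near_eq_form2 (e 0 h) (e 1 h) (e 2 h)); have := DE h; rewrite /D0 => ->.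
Qed.

End NearEq.

Lemma near_eq_contact s i X Y : (\forall w \near (0 : 'rV[R]_2), X w = Y w) ->
  contact s i X -> contact s i Y.
Proof.
move=> XY; rewrite /contact (near_eq_disc0 XY) (near_eq_D0 s XY) => -[d0 D00 c]; split=> //.
exact: near_eq_simple_contact (near_eq_P0 s XY) (near_eq_M0 s XY) c.
Qed.

(** [disc0] is a signed sum of squares of the 2 by 2 minors of the tangent vectors, and all of these
    vanish if the vectors are dependent. It turns nearby maps into elements of [param]. *)
Lemma disc_row_free X : smooth_near 0 X -> 0 < disc0 X 0 ->
  row_free (col_mx (partial 0 X 0) (partial 1 X 0)).
Proof.
move=> sX d0; rewrite (partial_vec3 0 sX) (partial_vec3 1 sX).
apply: inj_row_free => v; rewrite -[v]hsubmxK; move: (lsubmx v) (rsubmx v) => a b.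
rewrite mul_row_col => /rowP E.
have [E0 E1 E2] := And3 (E 0) (E 1) (E 2); move: E0 E1 E2.
rewrite !mxE !big_ord1 !mxE /= => E0 E1 E2.
set x := fun w => X w 0 0 in E0; set y := fun w => X w 0 1 in E1; set z := fun w => X w 0 2 in E2.
have dE : disc0 X 0 = normal y z 0 1 0 ^+ 2 + normal z x 0 1 0 ^+ 2 - normal x y 0 1 0 ^+ 2.
  by rewrite /disc0 /disc /form1 /normal -/x -/y -/z; gen_pd; ring.
have H (t : R) : t ^+ 2 * disc0 X 0 = 0 -> t = 0.
  by move=> /eqP; rewrite mulf_eq0 (gt_eqF d0) orbF sqrf_eq0 => /eqP.
have ab : a 0 0 = 0 /\ b 0 0 = 0.
  move: E0 E1 E2 dE; rewrite /normal.
  move: (pd 0 x 0) (pd 1 x 0) (pd 0 y 0) (pd 1 y 0) (pd 0 z 0) (pd 1 z 0).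
  move=> xu xv yu yv zu zv /eqP; rewrite addr_eq0 => /eqP E0 /eqP; rewrite addr_eq0 => /eqP E1.
  move=> /eqP; rewrite addr_eq0 => /eqP E2 dE; split; apply: H; rewrite dE.
    transitivity ((a 0 0 * yu * zv - a 0 0 * zu * yv) ^+ 2 + (a 0 0 * zu * xv - a 0 0 * xu * zv) ^+ 2
      - (a 0 0 * xu * yv - a 0 0 * yu * xv) ^+ 2); first by ring.
    by rewrite E0 E1 E2; ring.
  transitivity ((yu * - - (b 0 0 * zv) - zu * - - (b 0 0 * yv)) ^+ 2
    + (zu * - - (b 0 0 * xv) - xu * - - (b 0 0 * zv)) ^+ 2
    - (xu * - - (b 0 0 * yv) - yu * - - (b 0 0 * xv)) ^+ 2); first by ring.
  by rewrite -E0 -E1 -E2; ring.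
have z1 (m : 'M[R]_1) : m 0 0 = 0 -> m = 0 by move=> m0; apply/matrixP => k l; rewrite !ord1 mxE.
by rewrite (z1 _ ab.1) (z1 _ ab.2) row_mx0.
Qed.

Lemma hess2_theta i j p (f h : 'rV[R]_2 -> R) : i != j -> smooth_near p f -> smooth_near p h ->
  let H a b := pd i f p * pd a (pd b h) p - pd i h p * pd a (pd b f) p in
  hess2 (theta i f h p) (kerv f p) p =
  H i i * pd j f p ^+ 2 - (H i j + H j i) * (pd i f p * pd j f p) + H j j * pd i f p ^+ 2.
Proof. by move=> ij sf sh; rewrite (hess2_kerv _ _ _ ij) /theta !pd2_linear. Qed.

(** The condition is a list of inequations in the 4-jet: the null curvatures contain second
    derivatives of the map and the contact number takes two more. The number is rewritten as the
    polynomial [K], whose dependence on the parameter is continuous. *)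
Lemma contact_near (T : topologicalType) (X : T -> 'rV[R]_2 -> 'rV[R]_3) t s i :
  (forall k, jets_at 4 (fun u w => X u w 0 k) t) -> contact s i (X t) ->
  \forall u \near t, contact s i (X u).
Proof.
move=> jX [d0 D00 [f0 h0 c]].
have jd : jets_at 3 (fun u => disc0 (X u)) t := jets_disc 0 1 (jX 0) (jX 1) (jX 2).
have jD : jets_at 3 (fun u => D0 s (X u)) t := jets_nullD (jX 0) (jX 1) (jX 2) d0 s.
have jP : jets_at 2 (fun u => P0 s (X u)) t := jets_nullP (jX 0) (jX 1) (jX 2) d0 s.
have jM : jets_at 2 (fun u => M0 s (X u)) t := jets_nullM (jX 0) (jX 1) (jX 2) d0 s.
have [j ij] := ord2_other i.
pose H a b u w := pd i (P0 s (X u)) w * pd a (pd b (M0 s (X u))) w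
  - pd i (M0 s (X u)) w * pd a (pd b (P0 s (X u))) w.
pose K u w := H i i u w * pd j (P0 s (X u)) w ^+ 2
  - (H i j u w + H j i u w) * (pd i (P0 s (X u)) w * pd j (P0 s (X u)) w)
  + H j j u w * pd i (P0 s (X u)) w ^+ 2.
have [jP1 jM1] := (jetsS jP, jetsS jM).
have qP a : jets_at 0 (fun u => pd a (P0 s (X u))) t := jets_pd a jP1.
have qM a : jets_at 0 (fun u => pd a (M0 s (X u))) t := jets_pd a jM1.
have qP2 a b : jets_at 0 (fun u => pd a (pd b (P0 s (X u)))) t := jets_pd a (jets_pd b jP).
have qM2 a b : jets_at 0 (fun u => pd a (pd b (M0 s (X u)))) t := jets_pd a (jets_pd b jM).
have jH a b : jets_at 0 (H a b) t.
  by apply: jetsD; [exact: jetsM|apply: jetsN; exact: jetsM].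
have jK : jets_at 0 K t.
  apply: jetsD; [apply: jetsD; [|apply: jetsN]|].
  - by apply: jetsM; [exact: jH|exact: jetsX].
  - by apply: jetsM; [apply: jetsD; exact: jH|exact: jetsM].
  - by apply: jetsM; [exact: jH|exact: jetsX].
have KE u : smooth_near 0 (P0 s (X u)) -> smooth_near 0 (M0 s (X u)) ->
    hess2 (theta i (P0 s (X u)) (M0 s (X u)) 0) (kerv (P0 s (X u)) 0) 0 = K u 0.
  by move=> sP sM; rewrite (hess2_theta ij).
have sP := jP.1; have sM := jM.1.
have K0 : K t 0 != 0 by rewrite -KE // ; [exact: nbhs_singleton sP|exact: nbhs_singleton sM].
have n1 := near_gt0 (jets_continuous jd) d0; have n2 := near_neq0 (jets_continuous jD) D00.
have n3 := near_neq0 (jets_continuous (qP i)) f0; have n4 := near_neq0 (jets_continuous (qM i)) h0.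
have n5 := near_neq0 (jets_continuous jK) K0.
apply: filterS3 (filterI sP sM) (filterI n1 n2) (filterI n3 (filterI n4 n5)) => u [sPu sMu] [a1 a2] [a3 [a4 a5]].
by split=> //; split=> //; rewrite KE.
Qed.

(** In the quotient topology one has to move an arbitrary parametrization [x], while contact is
    known for some other [y]. The change of parameters [phi] from [x] to [y] is kept fixed, and [u]
    composed with [phi] still has contact for [u] near [x]. *)
Lemma contact_open : open [set M : surface_germ R | exists y s i,
  [/\ local_param M y, s ^+ 2 = 1 & contact s i y]].
Proof.
set O := [set M | _]; suff : surface_germ_open O by [].
rewrite /surface_germ_open openE => x [y [s [i [[phi dphi yE] s2 cy]]]].
have p0 : phi 0 = 0 by case: dphi => ? [].
have sphi k : smooth_near 0 (fun w => phi w 0 k) by exact: diffeo_germ_smooth dphi.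
have jX k : jets_at 4 (fun (u : param R) w => u (phi w) 0 k) x.
  exact: jets_comp sphi p0 (jets_param 4 k x).
have cx : contact s i (fun w => x (phi w)) by apply: near_eq_contact cy.
apply: filterS (contact_near jX cx) => u cu.
have su : smooth_near 0 (fun w => u (phi w)).
  apply/smooth_near_row => k; apply: (smooth_near_comp (f := fun v => u v 0 k) sphi).
  by rewrite p0; have /smooth_near_row := param_smooth u.
have [d0 _ _] := cu.
exists (Param su (disc_row_free su d0)), s, i; split=> //.
by exists phi => //; near=> w.
Unshelve. all: by end_near. Qed.

End Openness.

Lemma pointwise_continuous {I : Type} {K : I -> topologicalType} {X : topologicalType}
    (f : X -> prod_topology K) : (forall i, continuous (fun x => f x i)) -> continuous f.
Proof.
move=> cf x; apply/cvg_sup => i; move: x.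
apply/(@continuousP _ (initial_topology (fun g : forall i, K i => g i))) => A [B oB <-].
exact: (@continuousP _ _ (fun x => f x i)).1 (cf i) B oB.
Qed.

(** * Affine paths of parametrizations and deformations *)

Section Paths.
Context {R : realType}.

Lemma pds_affine {n : nat} (f c : 'rV[R]_n.+1 -> R) e p (s : seq 'I_n.+1) :
  smooth_near p f -> smooth_near p c ->
  \forall w \near p, foldr (fun i g => pd i g) (fun w => f w + e * c w) s w =
    foldr (fun i g => pd i g) f s w + e * foldr (fun i g => pd i g) c s w.
Proof.
move=> sf sc; elim: s => [|i s IH] /=; first by near=> w.
have sfs : smooth_near p (foldr (fun i g => pd i g) f s).
  by elim: s {IH} => [|j s IH]; [exact: sf|rewrite /=; smooth].
have scs : smooth_near p (foldr (fun i g => pd i g) c s).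
  by elim: s {IH sfs} => [|j s IH]; [exact: sc|rewrite /=; smooth].
apply: filterS3 (near_eq_pd_near i IH) (smooth_near_near sfs) (smooth_near_near scs) => w -> s1 s2.
by rewrite pdD ?pdZ //; smooth.
Unshelve. all: by end_near. Qed.

Lemma affine_continuous {W : normedModType R} (a b : W) : continuous (fun e : R => a + e *: b).
Proof.
by move=> e; apply: cvgD; [exact: cvg_cst|apply: cvgZr_tmp; exact: cvg_id].
Qed.

Lemma param_eq (x y : param R) : (x : _ -> _) = y -> x = y.
Proof.
case: x y => [f sf rf] [g sg rg] /= E; subst g.
by congr Param; exact: Prop_irrelevance.
Qed.

(** Each iterated partial derivative at 0 is affine in [t], hence the path is continuous for the jet
    topology. The vanishing 1-jet of [c] keeps the tangent vectors at 0, so every member is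
    immersive. *)
Lemma param_path (x : param R) (c : 'rV[R]_2 -> R) (e : 'rV[R]_3) :
  smooth_near 0 c -> jeq 2 c (fun=> 0) ->
  exists xe : R -> param R, (forall t w, xe t w = x w + t * c w *: e) /\
    forall A, nbhs x A -> \forall t \near (0 : R), A (xe t).
Proof.
move=> sc jc; have /smooth_near_row sx := param_smooth x.
pose X t w := x w + t * c w *: e.
have Xk t k : (fun w => X t w 0 k) = fun w => x w 0 k + (t * e 0 k) * c w.
  by apply/funext => w; rewrite !mxE; ring.
have sX t : smooth_near 0 (X t) by apply/smooth_near_row => k; rewrite Xk; have h := sx k; smooth.
have iX t : row_free (col_mx (partial 0 (X t) 0) (partial 1 (X t) 0)).
  have e1 i : partial i (X t) 0 = partial i x 0.
    rewrite (partial_vec3 i (sX t)) (partial_vec3 i (param_smooth x)) !Xk.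
    have ci : pd i c 0 = 0 by rewrite (jc.2 i).1 pd_cst.
    by congr vec3; rewrite pdD ?pdZ ?ci ?mulr0 ?addr0 //; have h := sx; smooth.
  by rewrite !e1; exact: param_immersive.
pose xe t := Param (sX t) (iX t); exists xe; split=> // A xA.
have x0 : xe 0 = x by apply: param_eq; apply/funext => w; rewrite /= /X mul0r scale0r addr0.
rewrite -x0 in xA; suff cxe : continuous xe by exact: cxe xA.
apply: continuous_comp_initial; apply: pointwise_continuous => s.
rewrite (_ : (fun t : R => _) = fun t => partials s x 0 + t *: (partials s c 0 *: e)).
  exact: affine_continuous.
apply/funext => t; apply/rowP => k; rewrite /jet /= !mxE.
rewrite partials_row // Xk !partials_pd (nbhs_singleton (pds_affine _ _ (sx k) sc)).
rewrite partials_row; last exact: param_smooth.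
by rewrite !partials_pd; ring.
Qed.

Lemma deform_eq (x y : deformation R) : (x : _ -> _) = y -> x = y.
Proof.
case: x y => [f sf rf] [g sg rg] /= E; subst g.
by congr Deformation; exact: Prop_irrelevance.
Qed.

Lemma deformation_path (h : deformation R) (c : 'rV[R]_3 -> R) :
  smooth_near 0 c -> (\forall w \near (0 : 'rV[R]_2), c (uvt w 0) = 0) ->
  exists he : R -> deformation R, (forall t w, he t w = h w + t * c w) /\
    forall A, nbhs h A -> \forall t \near (0 : R), A (he t).
Proof.
move=> sc c0; have sh := deform_smooth h.
pose H t w := h w + t * c w.
have sH t : smooth_near 0 (H t) by rewrite /H; smooth.
have H0 t : \forall w \near (0 : 'rV[R]_2), H t (uvt w 0) = 0.
  by apply: filterS2 c0 (deform0 h) => w cw hw; rewrite /H cw hw mulr0 addr0.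
pose he t := Deformation (sH t) (H0 t); exists he; split=> // A hA.
have h0 : he 0 = h by apply: deform_eq; apply/funext => w; rewrite /= /H mul0r addr0.
rewrite -h0 in hA; suff che : continuous he by exact: che hA.
apply: continuous_comp_initial; apply: pointwise_continuous => s.
rewrite (_ : (fun t : R => _) = fun t => partials s h 0 + t *: partials s c 0).
  exact: affine_continuous.
apply/funext => t; rewrite /jet /= !partials_pd (nbhs_singleton (pds_affine _ _ sh sc)).
by [].
Qed.

End Paths.

Section Power.
Context {R : realType}.

Definition lform (l0 l1 : R) : 'rV[R]_2 -> R := fun w => l0 * w 0 0 + l1 * w 0 1.

Lemma smooth_lform l0 l1 p : smooth_near p (lform l0 l1).
Proof. by rewrite /lform; smooth. Qed.

Lemma lform0 l0 l1 : lform l0 l1 0 = 0.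
Proof. by rewrite /lform !mxE !mulr0 addr0. Qed.

Lemma pd_lform l0 l1 i w : pd i (lform l0 l1) w = if i == 0 then l0 else l1.
Proof.
rewrite /lform pdD ?pdZ ?pd_coord; [|smooth..].
by case: i => [[|[|//]] ?]; rewrite /= ?mulr0 ?mulr1 ?addr0 ?add0r.
Qed.

Lemma pd_power (c l0 l1 : R) k i :
  pd i (fun w => c * lform l0 l1 w ^+ k.+1) =
  fun w => (c * k.+1%:R * (if i == 0 then l0 else l1)) * lform l0 l1 w ^+ k.
Proof.
apply/funext => w; have sl := smooth_lform l0 l1 w.
by rewrite pdZ ?pdX ?pd_lform; [ring|smooth..].
Qed.

Lemma jeq_power (c l0 l1 : R) k : jeq k (fun w => c * lform l0 l1 w ^+ k) (fun=> 0).
Proof.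
elim: k c => [//|k IH] c; split=> [|i]; first by rewrite lform0 expr0n mulr0.
by rewrite pd_power (_ : pd i _ = fun=> 0); [exact: IH|apply/funext => w; rewrite pd_cst].
Qed.

End Power.

(** * Perturbation by powers of linear forms, and density of the contact condition *)

Section Density.
Context {R : realType}.
Implicit Types (x y : param R) (M : surface_germ R) (i j : 'I_2) (s t : R).

Lemma pd2_power_sum (c l0 l1 d m0 m1 : R) k a b :
  pd a (pd b (fun w => c * lform l0 l1 w ^+ k.+2 + d * lform m0 m1 w ^+ k.+2)) =
  fun w => c * (k.+2%:R * k.+1%:R) * ((if a == 0 then l0 else l1) * (if b == 0 then l0 else l1))
      * lform l0 l1 w ^+ k
    + d * (k.+2%:R * k.+1%:R) * ((if a == 0 then m0 else m1) * (if b == 0 then m0 else m1))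
      * lform m0 m1 w ^+ k.
Proof.
have e c' d' l : pd a (fun w => c' * lform l0 l1 w ^+ l.+1 + d' * lform m0 m1 w ^+ l.+1) =
   fun w => c' * l.+1%:R * (if a == 0 then l0 else l1) * lform l0 l1 w ^+ l
     + d' * l.+1%:R * (if a == 0 then m0 else m1) * lform m0 m1 w ^+ l.
  apply/funext => w; have s1 := smooth_lform l0 l1 w; have s2 := smooth_lform m0 m1 w.
  by rewrite pdD; [rewrite !pd_power|smooth|smooth].
have -> : pd b (fun w => c * lform l0 l1 w ^+ k.+2 + d * lform m0 m1 w ^+ k.+2) =
   fun w => c * k.+2%:R * (if b == 0 then l0 else l1) * lform l0 l1 w ^+ k.+1
     + d * k.+2%:R * (if b == 0 then m0 else m1) * lform m0 m1 w ^+ k.+1.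
  apply/funext => w; have s1 := smooth_lform l0 l1 w; have s2 := smooth_lform m0 m1 w.
  by rewrite pdD; [rewrite !pd_power|smooth|smooth].
by rewrite e; apply/funext => w; ring.
Qed.

Definition E0 (X : 'rV[R]_2 -> 'rV[R]_3) :=
  form1 (fun w => X w 0 0) (fun w => X w 0 1) (fun w => X w 0 2) 0 0.
Definition G0 (X : 'rV[R]_2 -> 'rV[R]_3) :=
  form1 (fun w => X w 0 0) (fun w => X w 0 1) (fun w => X w 0 2) 1 1.

(* Adding multiples of the powers of two linear forms, in the direction of the Euclidean
   normal at 0, changes each null curvature by multiples of lower powers of the same forms. *)
Lemma power_path x s k (c l0 l1 d m0 m1 : R) : (0 < k)%N -> s ^+ 2 = 1 ->
  0 < disc0 x 0 ->
  exists (nu : 'rV[R]_2 -> R) (xe : R -> param R), [/\ smooth_near 0 nu, nu 0 != 0,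
    forall A, nbhs x A -> \forall t \near (0 : R), A (xe t) &
    forall t, [/\ timelike_umbilic x 0 -> timelike_umbilic (xe t) 0,
      D0 s (xe t) 0 = D0 s x 0,
      jeq k.+1 (P0 s (xe t)) (fun w => P0 s x w + t * nu w *
        (c * (l0 * D0 s x w - l1 * E0 x w) ^+ 2 * lform l0 l1 w ^+ k
         + d * (m0 * D0 s x w - m1 * E0 x w) ^+ 2 * lform m0 m1 w ^+ k)) &
      jeq k.+1 (M0 s (xe t)) (fun w => M0 s x w + t * nu w *
        (c * (l1 * D0 s x w - l0 * G0 x w) ^+ 2 * lform l0 l1 w ^+ k
         + d * (m1 * D0 s x w - m0 * G0 x w) ^+ 2 * lform m0 m1 w ^+ k))]].
Proof.
move=> k0 s2 d0; have /smooth_near_row sx := param_smooth x.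
pose X0 w := x w 0 0; pose X1 w := x w 0 1; pose X2 w := x w 0 2.
pose n0 := normal X1 X2 0 1 0; pose n1 := normal X2 X0 0 1 0; pose n2 := normal X0 X1 0 1 0.
(* Two differentiations of a power of exponent [k.+2] produce this factor; dividing by it beforehand
   makes [c] and [d] the coefficients of the second derivatives. *)
pose kap : R := (k.+2%:R * k.+1%:R)^-1.
have kap1 : kap * (k.+2%:R * k.+1%:R) = 1 by rewrite mulVf // mulf_neq0 ?pnatr_eq0.
pose q w : R := (c * kap) * lform l0 l1 w ^+ k.+2 + (d * kap) * lform m0 m1 w ^+ k.+2.
have sl0 := smooth_lform l0 l1 (0 : 'rV[R]_2); have sl1 := smooth_lform m0 m1 (0 : 'rV[R]_2).
have sq : smooth_near 0 q by rewrite /q; smooth.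
have z0 := @smooth_near_cst R 1 0 0.
have jq : jeq k.+2 q (fun=> 0).
  apply: (@jeq_near _ _ k.+2 q _ (fun=> 0 + 0)); [by near=> w|by near=> w; rewrite addr0|].
  by apply: jeqD; [smooth|smooth|smooth|smooth|exact: jeq_power|exact: jeq_power].
have [xe [xeE xeA]] := param_path x (vec3 n0 n1 n2) sq (jeq_le (isT : (2 <= k.+2)%N) jq).
pose nu w := normal X1 X2 0 1 w * n0 + normal X2 X0 0 1 w * n1 + normal X0 X1 0 1 w * n2.
exists nu, xe; split.
- have h1 := smooth_normal 0 1 (sx 1) (sx 2); have h2 := smooth_normal 0 1 (sx 2) (sx 0).
  have h3 := smooth_normal 0 1 (sx 0) (sx 1); rewrite /nu.
  have g1 : smooth_near 0 (normal X1 X2 0 1) := h1; have g2 : smooth_near 0 (normal X2 X0 0 1) := h2.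
  have g3 : smooth_near 0 (normal X0 X1 0 1) := h3; smooth.
- have e : disc0 x 0 = n0 ^+ 2 + n1 ^+ 2 - n2 ^+ 2.
    by rewrite /disc0 /disc /form1 /n0 /n1 /n2 /normal -/X0 -/X1 -/X2; gen_pd; ring.
  (* [nu 0] is the Euclidean square of the normal, [disc0 x 0] its Minkowski square; they differ in
     the sign of the third term. *)
  have e' : nu 0 = disc0 x 0 + 2 * n2 ^+ 2 by rewrite e /nu -/n0 -/n1 -/n2; ring.
  by rewrite gt_eqF // e' ltr_wpDr // mulr_ge0 // sqr_ge0.
- exact: xeA.
move=> t; have /smooth_near_row sy := param_smooth (xe t).
have yE (j : 'I_3) : \forall w \near (0 : 'rV[R]_2), xe t w 0 j = x w 0 j + (t * vec3 n0 n1 n2 0 j) * q w.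
  by near=> w; rewrite xeE [in LHS]mxE [in X in _ + X]mxE; ring.
have q2 a b : pd a (pd b q) = fun w => c * ((if a == 0 then l0 else l1) * (if b == 0 then l0 else l1))
      * lform l0 l1 w ^+ k
    + d * ((if a == 0 then m0 else m1) * (if b == 0 then m0 else m1)) * lform m0 m1 w ^+ k.
  rewrite /q pd2_power_sum; apply/funext => w.
  by rewrite -(mulrA c) -(mulrA d) kap1 !mulr1.
split.
- apply: (timelike_umbilic_jet (param_smooth x) (param_smooth (xe t))) => j.
  have k3 : (3 <= k.+2)%N by [].
  apply: (jeq_le k3); have sxj := sx j.
  apply: (@jeq_near _ _ k.+2 (fun w => x w 0 j + (t * vec3 n0 n1 n2 0 j) * q w) _
    (fun w => x w 0 j + (t * vec3 n0 n1 n2 0 j) * 0)).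
  + by apply: filterS (yE j) => w ->.
  + by near=> w; rewrite mulr0 addr0.
  + apply: jeqD; [smooth|smooth|smooth|smooth|exact: jeq_refl|].
    by apply: jeqM jq; [smooth|smooth|smooth|smooth|exact: jeq_refl].
- exact: (nullD_perturb s (sx 0) (sx 1) (sx 2) (sy 0) (sy 1) (sy 2) sq (yE 0) (yE 1) (yE 2) jq d0).1.
- have := nullP_perturb s (sx 0) (sx 1) (sx 2) (sy 0) (sy 1) (sy 2) sq (yE 0) (yE 1) (yE 2) jq d0.
  apply: jeq_near; first by near=> w.
  near=> w; rewrite !q2 /= -/X0 -/X1 -/X2 !mxE /= /nu /P0 -/X0 -/X1 -/X2 /E0 /D0 -/X0 -/X1 -/X2.
  move: (nullP _ _ _ _ _ _ _) (nullD _ _ _ _ _ _ _) (form1 _ _ _ _ _ _) (normal _ _ _ _ _)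
    (normal _ _ _ _ _) (normal _ _ _ _ _) (lform _ _ _ ^+ k) (lform _ _ _ ^+ k).
  by move=> *; ring.
- have := nullM_perturb s (sx 0) (sx 1) (sx 2) (sy 0) (sy 1) (sy 2) sq (yE 0) (yE 1) (yE 2) jq d0.
  apply: jeq_near; first by near=> w.
  near=> w; rewrite !q2 /= -/X0 -/X1 -/X2 !mxE /= /nu /M0 -/X0 -/X1 -/X2 /G0 /D0 -/X0 -/X1 -/X2.
  move: (nullM _ _ _ _ _ _ _) (nullD _ _ _ _ _ _ _) (form1 _ _ _ _ _ _) (normal _ _ _ _ _)
    (normal _ _ _ _ _) (normal _ _ _ _ _) (lform _ _ _ ^+ k) (lform _ _ _ ^+ k).
  by move=> *; ring.
Unshelve. all: by end_near. Qed.

End Density.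

Section DenseContact.
Context {R : realType}.
Implicit Types (x y : param R) (M : surface_germ R) (i j : 'I_2) (s t : R).

(** Both null curvatures vanish at the umbilic, so their product is critical there, and its Hessian
    determinant is minus the square of a multiple of the Jacobian. *)
Lemma G3_intro x s : timelike_umbilic x 0 -> s ^+ 2 = 1 -> D0 s x 0 != 0 ->
  jac (P0 s x) (M0 s x) 0 = 0 ->
  [/\ timelike_umbilic x 0, LPL_singularity x 0 & ~ morse_singularity x 0].
Proof.
move=> tx s2 D00 J; have sx := param_smooth x; have ux := timelike_umbilic_form sx tx.
have [d0 _] := ux; have [P00 M00] := umbilic_null s2 ux.
have fE := tdelta_factor sx s2 d0 D00.
have sP := smooth_P0 s sx d0; have sM := smooth_M0 s sx d0; have sD := smooth_DV sx d0 D00.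
split=> //.
  split; first by rewrite /LPL /= (nbhs_singleton fE) [P0 s x 0]P00 mul0r mulr0.
  by move=> i; rewrite -pdE; exact: pd_product_zero sD sP sM P00 M00 fE.
move=> [_]; rewrite (det_hessian_product sD sP sM P00 M00 fE) J mulr0 expr0n oppr0.
by rewrite eqxx.
Qed.

Lemma pd_power1 (nu f h : 'rV[R]_2 -> R) (t l0 l1 m0 m1 : R) i :
  smooth_near 0 nu -> smooth_near 0 f -> smooth_near 0 h ->
  pd i (fun w => t * nu w * (f w * lform l0 l1 w ^+ 1 + h w * lform m0 m1 w ^+ 1)) 0 =
  t * nu 0 * (f 0 * (if i == 0 then l0 else l1) + h 0 * (if i == 0 then m0 else m1)).
Proof.
move=> sn sf sh; have s1 := smooth_lform l0 l1 (0 : 'rV[R]_2).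
have s2 := smooth_lform m0 m1 (0 : 'rV[R]_2).
rewrite pdM; [|smooth|smooth]; rewrite pdD; [|smooth|smooth]; rewrite !pdM; [|smooth..].
rewrite (_ : pd i (fun w => lform l0 l1 w ^+ 1) 0 = if i == 0 then l0 else l1); last first.
  by rewrite -[LHS]/(pd i (lform l0 l1) 0) pd_lform.
rewrite (_ : pd i (fun w => lform m0 m1 w ^+ 1) 0 = if i == 0 then m0 else m1); last first.
  by rewrite -[LHS]/(pd i (lform m0 m1) 0) pd_lform.
by rewrite !lform0 !expr1 !mulr0 addr0 mulr0 !add0r.
Qed.

Lemma pd_quadratic (k f h u v : 'rV[R]_2 -> R) a b :
  smooth_near 0 k -> smooth_near 0 f -> smooth_near 0 h -> smooth_near 0 u -> smooth_near 0 v ->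
  u 0 = 0 -> v 0 = 0 -> (forall c, pd c u 0 = 0) -> (forall c, pd c v 0 = 0) ->
  let g w := k w * (f w * u w + h w * v w) in
  pd a g 0 = 0 /\ pd a (pd b g) 0 = k 0 * (f 0 * pd a (pd b u) 0 + h 0 * pd a (pd b v) 0).
Proof.
move=> sk sf sh su sv u0 v0 pu pv /=.
have pg c : pd c (fun w => f w * u w + h w * v w) 0 = 0.
  rewrite pdD; [|smooth|smooth]; rewrite !pdM; [|smooth..].
  by rewrite u0 v0 pu pv; ring.
split; first by rewrite pdM; [rewrite pg u0 v0; ring|smooth|smooth].
rewrite pd2M; [|smooth|smooth]; rewrite !pg pd2D; [|smooth|smooth].
rewrite !pd2M; [|smooth..]; rewrite !pu !pv u0 v0; ring.
Qed.

Lemma pd_square l0 l1 a b :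
  [/\ lform l0 l1 0 ^+ 2 = 0 :> R, forall c, pd c (fun w => lform l0 l1 w ^+ 2) 0 = 0 &
  pd a (pd b (fun w => lform l0 l1 w ^+ 2)) 0 =
    2 * ((if a == 0 then l0 else l1) * (if b == 0 then l0 else l1))].
Proof.
have s1 := smooth_lform l0 l1 (0 : 'rV[R]_2); split; first by rewrite lform0 expr0n.
  by move=> c; rewrite pdX; [rewrite lform0 expr1 mulr0 mul0r|smooth].
have := congr1 (fun f => f 0) (pd2_power_sum 1 l0 l1 0 l0 l1 0 a b) => /=.
rewrite !mul0r addr0 expr0 !mulr1 mul1r => <-; congr (pd a (pd b _) 0).
by apply/funext => w; rewrite mul0r addr0 mul1r.
Qed.

(* For D^2 <> EG the sums and differences of D u + G v and E u + D v span the linear forms,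
   and their values on both null vectors are equal up to sign. *)
Lemma G3_first_step x s (A : set (param R)) : timelike_umbilic x 0 -> s ^+ 2 = 1 ->
  D0 s x 0 != 0 -> jac (P0 s x) (M0 s x) 0 = 0 -> nbhs x A ->
  exists y i, [/\ A y, timelike_umbilic y 0 & D0 s y 0 != 0] /\
    [/\ jac (P0 s y) (M0 s y) 0 = 0, pd i (P0 s y) 0 != 0 & pd i (M0 s y) 0 != 0].
Proof.
move=> tx s2 D00 J xA; have sx := param_smooth x; have ux := timelike_umbilic_form sx tx.
have [d0 _] := ux.
(* Both gradients are multiples [sg] and [ta] of one nonzero covector [(om0, om1)], which is
   arbitrary if both vanish. The perturbation will move both along it, so that they stay
   dependent. *)
have [sg [ta [om0 [om1 [om [p0 p1 m0 m1]]]]]] : exists sg ta om0 om1 : R,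
    ((om0 != 0) || (om1 != 0)) /\ [/\ pd 0 (P0 s x) 0 = sg * om0, pd 1 (P0 s x) 0 = sg * om1,
    pd 0 (M0 s x) 0 = ta * om0 & pd 1 (M0 s x) 0 = ta * om1].
  move: J; rewrite /jac; move: (pd 0 (P0 s x) 0) (pd 1 (P0 s x) 0) (pd 0 (M0 s x) 0) (pd 1 (M0 s x) 0).
  move=> p0 p1 m0 m1 /eqP; rewrite subr_eq0 => /eqP J.
  have [p00|p00] := eqVneq p0 0; last first.
    exists 1, (m0 / p0), p0, p1; rewrite p00; split=> //; split; rewrite ?mul1r //.
      by rewrite divfK.
    by apply: (mulfI p00); rewrite J; field.
  have [p10|p10] := eqVneq p1 0; last first.
    exists 1, (m1 / p1), p0, p1; rewrite p10 orbT; split=> //; split; rewrite ?mul1r ?divfK //.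
    rewrite p00 mulr0; apply: (mulfI p10); rewrite -J p00 mul0r mulr0 //.
  have [m00|m00] := eqVneq m0 0; last by exists 0, 1, m0, m1; rewrite m00 p00 p10 !mul0r !mul1r.
  have [m10|m10] := eqVneq m1 0; last by exists 0, 1, m0, m1; rewrite m10 orbT p00 p10 !mul0r !mul1r.
  by exists 0, 0, 1, 0; rewrite oner_eq0 p00 p10 m00 m10 !mul0r.
have /smooth_near_row sk := sx.
set D := D0 s x 0 in D00; set E := E0 x 0; set G := G0 x 0.
have De : D ^+ 2 - E * G != 0.
  exact: (null_det_neq0 (x := fun w => x w 0 0) (y := fun w => x w 0 1) (z := fun w => x w 0 2) s2 d0 D00).
set De_ := D ^+ 2 - E * G in De.
(* Cramer's rule for [al (D, G) + be (E, D) = (om0, om1)]. The sum and the difference of (D, G) and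
   (E, D) are the two linear forms of the path, and their coefficients [(al + be) / 2] and
   [(al - be) / 2] recombine to this covector. *)
pose al := (om0 * D - om1 * E) / De_; pose be := (om1 * D - om0 * G) / De_.
have [nu [xe [snu nu0 xeA xeP]]] :
    exists (nu : 'rV[R]_2 -> R) (xe : R -> param R), [/\ smooth_near 0 nu, nu 0 != 0,
    forall A, nbhs x A -> \forall t \near (0 : R), A (xe t) &
    forall t, [/\ timelike_umbilic x 0 -> timelike_umbilic (xe t) 0, D0 s (xe t) 0 = D0 s x 0, _ & _]] :=
  power_path ((al + be) / 2) (D + E) (G + D) ((al - be) / 2) (D - E) (G - D) (isT : (0 < 1)%N) s2 d0.
have sD : smooth_near 0 (D0 s x) := smooth_nullD s (sk 0) (sk 1) (sk 2) d0.
have sE : smooth_near 0 (E0 x) := smooth_form1 (sk 0) (sk 1) (sk 2) 0 0.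
have sG : smooth_near 0 (G0 x) := smooth_form1 (sk 0) (sk 1) (sk 2) 1 1.
have sP := smooth_P0 s sx d0; have sM := smooth_M0 s sx d0.
have h0 : al * D + be * E = om0 by rewrite /al /be /De_; field.
have h1 : al * G + be * D = om1 by rewrite /al /be /De_; field.
have eP t i : pd i (P0 s (xe t)) 0 = (sg + t * (nu 0 * De_ ^+ 2)) * (if i == 0 then om0 else om1).
  have [_ _ jP _] := xeP t; rewrite (jeq_pd i jP).1.
  have sl0 := smooth_lform (D + E) (G + D) (0 : 'rV[R]_2).
  have sl1 := smooth_lform (D - E) (G - D) (0 : 'rV[R]_2).
  rewrite pdD; [|smooth|smooth].
  rewrite pd_power1; [|exact: snu|smooth|smooth]; rewrite -/D -/E -/G.
  rewrite (_ : (D + E) * D - (G + D) * E = De_); last by rewrite /De_; ring.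
  rewrite (_ : (D - E) * D - (G - D) * E = De_); last by rewrite /De_; ring.
  rewrite -h0 -h1; have [->|i0] := eqVneq i 0; rewrite ?p0.
    by rewrite -h0; field.
  have -> : i = 1 by apply/val_inj; move: i i0 => [[|[|//]] ?].
  by rewrite p1 -h1; field.
have eM t i : pd i (M0 s (xe t)) 0 = (ta + t * (nu 0 * De_ ^+ 2)) * (if i == 0 then om0 else om1).
  have [_ _ _ jM] := xeP t; rewrite (jeq_pd i jM).1.
  have sl0 := smooth_lform (D + E) (G + D) (0 : 'rV[R]_2).
  have sl1 := smooth_lform (D - E) (G - D) (0 : 'rV[R]_2).
  rewrite pdD; [|smooth|smooth].
  rewrite pd_power1; [|exact: snu|smooth|smooth]; rewrite -/D -/E -/G.
  rewrite (_ : (G + D) * D - (D + E) * G = De_); last by rewrite /De_; ring.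
  rewrite (_ : (G - D) * D - (D - E) * G = - De_); last by rewrite /De_; ring.
  rewrite sqrrN -h0 -h1; have [->|i0] := eqVneq i 0; rewrite ?m0.
    by rewrite -h0; field.
  have -> : i = 1 by apply/val_inj; move: i i0 => [[|[|//]] ?].
  by rewrite m1 -h1; field.
set ka := nu 0 * De_ ^+ 2 in eP eM; have ka0 : ka != 0 by rewrite mulf_neq0 // expf_neq0.
(* For small nonzero [t] the multiplier is nonzero whether or not the gradient vanished
   initially. *)
have gen (c : R) : \forall t \near 0^', c + t * ka != 0.
  have [c0|c0] := eqVneq c 0.
    by near=> t; rewrite c0 add0r mulf_neq0 //; near: t; exact: nbhs_dnbhs_neq.
  apply: nbhs_dnbhs; apply: (@near_neq0 R R 0 (fun t => c + t * ka)).
    exact: affine_continuous.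
  by rewrite mul0r addr0.
near (0 : R)^' => t.
have g1 : sg + t * ka != 0 by near: t; exact: gen.
have g2 : ta + t * ka != 0 by near: t; exact: gen.
have g3 : A (xe t) by near: t; apply: nbhs_dnbhs; exact: xeA.
have [te De' _ _] := xeP t.
have Jt : jac (P0 s (xe t)) (M0 s (xe t)) 0 = 0 by rewrite /jac !eP !eM /=; ring.
exists (xe t).
case/orP: om => om; [exists 0|exists 1]; (split; first by split; [|exact: te|rewrite De']);
  by split=> //; rewrite ?eP ?eM /= mulf_neq0.
Unshelve. all: by end_near. Qed.

(** The fourth power of a linear form fixes all first derivatives of the null curvatures at 0, so
    the germ stays in [G3], and changes the contact number affinely in [t]. The linear form is
    chosen to vanish on one of the two null vectors, so the changes in the two curvatures cannot
    cancel, and not to vanish on the common tangent, so that the slope is nonzero. *)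
Lemma G3_second_step x s i (A : set (param R)) : timelike_umbilic x 0 -> s ^+ 2 = 1 ->
  D0 s x 0 != 0 -> jac (P0 s x) (M0 s x) 0 = 0 -> pd i (P0 s x) 0 != 0 -> pd i (M0 s x) 0 != 0 ->
  nbhs x A ->
  exists y, [/\ A y, timelike_umbilic y 0, D0 s y 0 != 0, jac (P0 s y) (M0 s y) 0 = 0
    & contact s i y].
Proof.
move=> tx s2 D00 J Pi Mi xA; have sx := param_smooth x; have ux := timelike_umbilic_form sx tx.
have [d0 _] := ux; have /smooth_near_row sk := sx; have [j ij] := ord2_other i.
set D := D0 s x 0 in D00; set E := E0 x 0; set G := G0 x 0.
have De : D ^+ 2 - E * G != 0.
  exact: (null_det_neq0 (x := fun w => x w 0 0) (y := fun w => x w 0 1) (z := fun w => x w 0 2) s2 d0 D00).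
set De_ := D ^+ 2 - E * G in De.
pose f0 := pd 0 (P0 s x) 0; pose f1 := pd 1 (P0 s x) 0.
(* a null direction transversal to the common tangent of the two curves *)
have [l0 [l1 [nl al]]] : exists l0 l1, l1 * f0 - l0 * f1 != 0 /\
   ((l0 * D - l1 * E != 0 /\ l1 * D - l0 * G = 0) \/ (l0 * D - l1 * E = 0 /\ l1 * D - l0 * G != 0)).
  have [z|nz] := eqVneq (G * f0 - D * f1) 0; last first.
    by exists D, G; split=> //; left; split; [rewrite -expr2 [G * E]mulrC|rewrite [G * D]mulrC subrr].
  exists E, D; split; last by right; split; [rewrite [E * D]mulrC subrr|rewrite -expr2].
  apply/eqP => z'; have e0 : De_ * f0 = 0.
    by transitivity (D * (D * f0 - E * f1) - E * (G * f0 - D * f1)); [rewrite /De_; ring|rewrite z z'; ring].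
  have e1 : De_ * f1 = 0.
    by transitivity (G * (D * f0 - E * f1) - D * (G * f0 - D * f1)); [rewrite /De_; ring|rewrite z z'; ring].
  move/eqP: e0 e1; rewrite mulf_eq0 (negbTE De) /= => /eqP f00 /eqP.
  rewrite mulf_eq0 (negbTE De) /= => /eqP f10.
  move: Pi; have [[-> _]|[-> _]] := ord2_cases ij; rewrite -/f0 -/f1 ?f00 ?f10 eqxx //.
have [nu [xe [snu nu0 xeA xeP]]] := power_path 1 l0 l1 0 0 0 (isT : (0 < 2)%N) s2 d0.
have sD : smooth_near 0 (D0 s x) := smooth_nullD s (sk 0) (sk 1) (sk 2) d0.
have sE : smooth_near 0 (E0 x) := smooth_form1 (sk 0) (sk 1) (sk 2) 0 0.
have sG : smooth_near 0 (G0 x) := smooth_form1 (sk 0) (sk 1) (sk 2) 1 1.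
have sP := smooth_P0 s sx d0; have sM := smooth_M0 s sx d0.
have [_ pl _] := pd_square l0 l1 0 0; have [_ pl' _] := pd_square 0 0 0 0.
have sl := smooth_lform l0 l1 (0 : 'rV[R]_2); have sl' := smooth_lform 0 0 (0 : 'rV[R]_2).
have ql : lform l0 l1 0 ^+ 2 = 0 by rewrite lform0 expr0n.
have ql' : lform 0 0 (0 : 'rV[R]_2) ^+ 2 = 0 :> R by rewrite lform0 expr0n.
pose L (a : 'I_2) := if a == 0 then l0 else l1.
have key (Q Q' d1 d2 : 'rV[R]_2 -> R) t a b :
    smooth_near 0 Q -> smooth_near 0 d1 -> smooth_near 0 d2 ->
    jeq 3 Q' (fun w => Q w + t * nu w * (1 * d1 w ^+ 2 * lform l0 l1 w ^+ 2
      + 0 * d2 w ^+ 2 * lform 0 0 w ^+ 2)) ->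
    pd a Q' 0 = pd a Q 0 /\
    pd a (pd b Q') 0 = pd a (pd b Q) 0 + t * (2 * nu 0 * d1 0 ^+ 2 * (L a * L b)).
  move=> sQ sd1 sd2 jQ; pose g w := t * nu w * (1 * d1 w ^+ 2 * lform l0 l1 w ^+ 2
      + 0 * d2 w ^+ 2 * lform 0 0 w ^+ 2).
  have sg : smooth_near 0 g by rewrite /g; smooth.
  have {}jQ : jeq 3 Q' (fun w => Q w + g w) by exact: jQ.
  have [q1 q2] : pd a g 0 = 0 /\ pd a (pd b g) 0 = (t * nu 0) * (1 * d1 0 ^+ 2 *
      pd a (pd b (fun w => lform l0 l1 w ^+ 2)) 0
      + 0 * d2 0 ^+ 2 * pd a (pd b (fun w => lform 0 0 w ^+ 2)) 0).
    apply: (@pd_quadratic (fun w => t * nu w) (fun w => 1 * d1 w ^+ 2) (fun w => 0 * d2 w ^+ 2)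
      (fun w => lform l0 l1 w ^+ 2) (fun w => lform 0 0 w ^+ 2));
    [smooth|smooth|smooth|smooth|smooth|exact: ql|exact: ql'|exact: pl|exact: pl'].
  have [_ _ p2] := pd_square l0 l1 a b.
  rewrite (jeq_pd a jQ).1 (jeq_pd a (jeq_pd b jQ)).1 pdD; [|smooth|smooth].
  rewrite pd2D; [|smooth|smooth]; rewrite q1 q2 p2 addr0; split=> //.
  by congr (_ + _); rewrite /L !mul0r addr0 mul1r; move: (d1 0) (nu 0) (if a == 0 then _ else _)
    (if b == 0 then _ else _) => *; ring.
have eP t a b : pd a (P0 s (xe t)) 0 = pd a (P0 s x) 0 /\ pd a (pd b (P0 s (xe t))) 0 =
    pd a (pd b (P0 s x)) 0 + t * (2 * nu 0 * (l0 * D - l1 * E) ^+ 2 * (L a * L b)).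
  have [_ _ jP _] := xeP t.
  apply: (@key (P0 s x) _ (fun w => l0 * D0 s x w - l1 * E0 x w)
    (fun w => 0 * D0 s x w - 0 * E0 x w) ); [smooth|smooth|smooth|exact: jP].
have eM t a b : pd a (M0 s (xe t)) 0 = pd a (M0 s x) 0 /\ pd a (pd b (M0 s (xe t))) 0 =
    pd a (pd b (M0 s x)) 0 + t * (2 * nu 0 * (l1 * D - l0 * G) ^+ 2 * (L a * L b)).
  have [_ _ _ jM] := xeP t.
  apply: (@key (M0 s x) _ (fun w => l1 * D0 s x w - l0 * G0 x w)
    (fun w => 0 * D0 s x w - 0 * G0 x w) ); [smooth|smooth|smooth|exact: jM].
set aP := l0 * D - l1 * E in eP al; set aM := l1 * D - l0 * G in eM al.
(* The slope of the contact number in [t]. Its last square is that of the linear form on the tangent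
   vector [kerv], and exactly one of [aP], [aM] is zero in the first factor. *)
pose kap := (pd i (P0 s x) 0 * aM ^+ 2 - pd i (M0 s x) 0 * aP ^+ 2) * (2 * nu 0)
  * (L i * pd j (P0 s x) 0 - L j * pd i (P0 s x) 0) ^+ 2.
have kap0 : kap != 0.
  rewrite /kap mulf_neq0 //; last first.
    rewrite expf_neq0 //; move: nl; rewrite /f0 /f1 /L.
    have [[-> ->]|[-> ->]] := ord2_cases ij => /=; last by [].
    by rewrite -oppr_eq0 opprB.
  rewrite mulf_neq0 //; last by rewrite mulf_neq0 ?pnatr_eq0.
  case: al => -[a1 a2].
    by rewrite a2 expr0n /= mulr0 sub0r oppr_eq0 mulf_neq0 ?expf_neq0.
  by rewrite a1 expr0n /= mulr0 subr0 mulf_neq0 ?expf_neq0.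
pose H0 := hess2 (theta i (P0 s x) (M0 s x) 0) (kerv (P0 s x) 0) 0.
have gen : \forall t \near (0 : R)^', H0 + t * kap != 0.
  have [c0|c0] := eqVneq H0 0.
    near=> t; rewrite c0 add0r mulf_neq0 //; near: t; exact: nbhs_dnbhs_neq.
  apply: nbhs_dnbhs; apply: (@near_neq0 R R 0 (fun t => H0 + t * kap)).
    exact: affine_continuous.
  by rewrite mul0r addr0.
near (0 : R)^' => t.
have g1 : H0 + t * kap != 0 by near: t; exact: gen.
have g3 : A (xe t) by near: t; apply: nbhs_dnbhs; exact: xeA.
have [te De' _ _] := xeP t.
exists (xe t); split; [exact: g3|exact: te|by rewrite De'| |].
  by rewrite /jac !(eP t _ 0).1 !(eM t _ 0).1.
have txe := te tx; have ue := timelike_umbilic_form (param_smooth (xe t)) txe.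
split; [exact: ue.1|by rewrite De'|split; rewrite ?(eP t _ 0).1 ?(eM t _ 0).1 //].
have [de _] := ue; rewrite (hess2_theta ij (smooth_P0 s (param_smooth (xe t)) de)
  (smooth_M0 s (param_smooth (xe t)) de)).
rewrite !(eP t _ 0).1 !(eM t _ 0).1 !(eP t _ _).2 !(eM t _ _).2.
apply: contra g1 => /eqP <-; apply/eqP.
rewrite /H0 (hess2_theta ij sP sM) /kap; move: (pd i (P0 s x) 0) => *; ring.
Unshelve. all: by end_near. Qed.

(** Both perturbations take place among parametrizations, inside the open preimage of a
    neighbourhood of [M], and are then projected to germs. *)
Lemma G3_dense_contact M (B : set (surface_germ R)) : G3 M -> nbhs M B ->
  exists M', [/\ B M', G3 M' & exists y s i, [/\ local_param M' y, s ^+ 2 = 1 & contact s i y]].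
Proof.
move=> G3M /near_openP[B' [oB' B'M B'B]]; have [x Mx [tx _ _]] := G3M.
have gx : germ_of x = M := germ_of_local Mx.
have oA : open (germ_of @^-1` B') by exact: oB'.
have xA : nbhs x (germ_of @^-1` B').
  by apply: open_nbhs_nbhs; split=> //; rewrite /= gx.
have ux := timelike_umbilic_form (param_smooth x) tx.
have [s2 d0 D00] := umbilic_nullsign ux; set s := null_sign _ _ _ _ _ _ in s2 D00.
have J := G3_jac G3M Mx s2 D00.
have [y [i [[Ay ty Dy] [Jy Py My]]]] := G3_first_step tx s2 D00 J xA.
have yA : nbhs y (germ_of @^-1` B') by apply: open_nbhs_nbhs; split.
have [z [Az tz Dz Jz cz]] := G3_second_step ty s2 Dy Jy Py My yA.
exists (germ_of z); split; first exact: B'B.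
  by exists z; [exact: reparam_refl|exact: G3_intro tz s2 Dz Jz].
by exists z, s, i; split=> //; exact: reparam_refl.
Qed.

End DenseContact.

(** * Zeros of a strictly convex function, and unfolding of a fold *)

Section OneVariable.
Context {R : realType}.
Variables (f f' : R -> R) (r : R).
Hypotheses (r0 : 0 < r) (df : forall v, - r <= v <= r -> is_derive v (1 : R) f (f' v))
  (incr : forall u v, - r <= u -> u < v -> v <= r -> f' u < f' v).

Let mvt a b : - r <= a -> a < b -> b <= r ->
  exists2 c, a < c < b & f b - f a = f' c * (b - a).
Proof.
move=> ra ab br; have [| |c cab E] := @MVT _ f f' a b ab; last by exists c; rewrite ?(itvP cab).
  move=> c cab; apply: df; rewrite (le_trans ra) ?(itvP cab) //=.
  by rewrite (le_trans _ br) // (itvP cab).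
apply: continuous_in_subspaceT => c; rewrite inE /= in_itv /= => /andP[ac cb].
apply/differentiable_continuous/derivable1_diffP.
have h : - r <= c <= r by rewrite (le_trans ra) //= (le_trans _ br).
exact: (@ex_derive _ _ _ _ _ _ _ (df h)).
Qed.

Lemma convex_min : f' 0 = 0 -> forall v, - r <= v <= r -> v != 0 -> f 0 < f v.
Proof.
move=> f0 v /andP[rv vr] v0; have nr : - r <= 0 by rewrite oppr_le0 ltW.
have [vp|vn] := ltP 0 v.
  have [c /andP[c0 cv] E] := mvt nr vp vr; rewrite -subr_gt0 E subr0 mulr_gt0 //.
  by rewrite -f0 incr // (le_trans (ltW cv)).
have vlt : v < 0 by rewrite lt_neqAle v0.
have [c /andP[vc c0] E] := mvt rv vlt (ltW r0).
rewrite -subr_lt0 E sub0r pmulr_llt0 ?oppr_gt0 //.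
by rewrite -f0 incr // ?(ltW r0) // (le_trans rv) // ltW.
Qed.

(** The intermediate value theorem gives a zero on each side of 0. By the mean value theorem the
    derivative is negative at the first and positive at the second; a further zero would force the
    strictly increasing [f'] to vanish left of the first, right of the second, or twice in
    between. *)
Lemma convex_two_zeros : f 0 < 0 -> 0 < f (- r) -> 0 < f r ->
  exists v1 v2, [/\ - r < v1, v1 < v2, v2 < r, f' v1 != 0 /\ f' v2 != 0 &
    forall v, - r < v < r -> f v = 0 <-> v = v1 \/ v = v2].
Proof.
move=> f0 fl fr; have nr : - r < 0 by rewrite oppr_lt0.
have cf a b : - r <= a -> b <= r -> {within `[a, b], continuous f}.
  move=> ra br; apply: continuous_in_subspaceT => c; rewrite inE /= in_itv /= => /andP[ac cb].
  apply/differentiable_continuous/derivable1_diffP.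
  have h : - r <= c <= r by rewrite (le_trans ra) //= (le_trans _ br).
  exact: (@ex_derive _ _ _ _ _ _ _ (df h)).
have [|v1 v1i f1] := @IVT _ f (- r) 0 0 (ltW nr) (cf _ _ (lexx _) (ltW r0)).
  by rewrite ge_min le_max (ltW f0) (ltW fl) orbT.
have [|v2 v2i f2] := @IVT _ f 0 r 0 (ltW r0) (cf _ _ (ltW nr) (lexx _)).
  by rewrite ge_min le_max (ltW f0) (ltW fr) orbT.
move: v1i v2i; rewrite !in_itv /= => /andP[rv1 v10] /andP[v20 v2r].
have {}rv1 : - r < v1.
  by rewrite lt_neqAle rv1 andbT; apply/eqP => e; move: fl; rewrite e f1 ltxx.
have {}v10 : v1 < 0.
  by rewrite lt_neqAle v10 andbT; apply/eqP => e; move: f1 f0; rewrite e => ->; rewrite ltxx.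
have {}v20 : 0 < v2.
  by rewrite lt_neqAle v20 andbT; apply/eqP => e; move: f2 f0; rewrite -e => ->; rewrite ltxx.
have {}v2r : v2 < r.
  by rewrite lt_neqAle v2r andbT; apply/eqP => e; move: fr; rewrite -e f2 ltxx.
have d1 : f' v1 < 0.
  have [c /andP[vc c0] E] := mvt (ltW rv1) v10 (ltW r0).
  have c1 : f' c < 0.
    have : f' c * (0 - v1) < 0 by rewrite -E f1 subr0.
    by rewrite sub0r pmulr_llt0 ?oppr_gt0.
  by apply: lt_trans c1; rewrite incr // ?ltW // (lt_trans c0).
have d2 : 0 < f' v2.
  have [c /andP[c0 cv] E] := mvt (ltW nr) v20 (ltW v2r).
  have c1 : 0 < f' c.
    have : 0 < f' c * (v2 - 0) by rewrite -E f2 sub0r oppr_gt0.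
    by rewrite subr0 pmulr_lgt0.
  by apply: lt_trans c1 _; rewrite incr // ?ltW // (lt_trans nr).
exists v1, v2; split=> //; first exact: lt_trans v20.
  by rewrite lt_eqF // gt_eqF.
move=> v /andP[rv vr]; split; last by case=> ->.
move=> fv; have [vl|vg|->] := ltgtP v v1; last by left.
  have [c /andP[vc cv] E] := mvt (ltW rv) vl (ltW (lt_trans v10 r0)).
  have : f' c < 0 by apply: lt_trans d1; rewrite incr // ?(ltW (lt_trans v10 r0)) // (le_trans (ltW rv)) // ltW.
  move/eqP: E; rewrite f1 fv subrr eq_sym mulf_eq0 subr_eq0 (gt_eqF vl) orbF => /eqP ->.
  by rewrite ltxx.
have [ul|ug|->] := ltgtP v v2; last by right.
  have [c /andP[vc cv] E] := mvt (ltW rv1) vg (ltW vr).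
  have [d /andP[vd dv] E'] := mvt (ltW rv) ul (ltW v2r).
  have : f' c < f' d.
    by rewrite incr ?(le_trans (ltW rv1) (ltW vc)) ?(lt_trans cv) // (le_trans (ltW dv)) // ltW.
  move/eqP: E; rewrite f1 fv subrr eq_sym mulf_eq0 subr_eq0 (gt_eqF vg) orbF => /eqP ->.
  move/eqP: E'; rewrite f2 fv subrr eq_sym mulf_eq0 subr_eq0 (gt_eqF ul) orbF => /eqP ->.
  by rewrite ltxx.
have [c /andP[vc cv] E] := mvt (ltW (lt_trans nr v20)) ug (ltW vr).
have : 0 < f' c.
  by apply: lt_trans d2 _; rewrite incr ?(ltW (lt_trans nr v20)) // (le_trans (ltW cv)) // ltW.
move/eqP: E; rewrite f2 fv subrr eq_sym mulf_eq0 subr_eq0 (gt_eqF ug) orbF => /eqP ->.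
by rewrite ltxx.
Qed.

End OneVariable.

Section Fold.
Context {R : realType}.
Implicit Types (F : 'rV[R]_2 -> R) (v t : R).

Definition vt v t : 'rV[R]_2 := \row_l (if l == 0 then v else t).

Lemma vt00 : vt 0 0 = 0.
Proof. by apply/rowP => l; rewrite !mxE; case: ifP. Qed.

Lemma vtE (y : 'rV[R]_2) : y = vt (y 0 0) (y 0 1).
Proof.
apply/rowP => l; rewrite !mxE; case: eqVneq => [->//|l0].
by congr (y 0 _); apply/val_inj; move: l l0 => [[|[|//]] ?].
Qed.

Lemma vt_upd v u t : vt v t = upd 0 v (vt u t).
Proof. by apply/rowP => l; rewrite !mxE; case: ifP. Qed.

Lemma near_vt (Q : 'rV[R]_2 -> Prop) : (\forall y \near (0 : 'rV[R]_2), Q y) ->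
  exists2 e : R, 0 < e & forall v t, `|v| < e -> `|t| < e -> Q (vt v t).
Proof.
move=> /nbhs_ballP[e /= e0 eQ]; exists e => // v t ve te; apply: eQ; apply/ball_rowP => // l.
by rewrite !mxE sub0r normrN; case: ifP.
Qed.

Lemma is_derive_vt F v t : differentiable F (vt v t) ->
  is_derive v (1 : R) (fun u => F (vt u t)) (pd 0 F (vt v t)).
Proof.
have E u : vt u t = u *: 'e_0 + vt 0 t.
  by apply/rowP => l; rewrite !mxE eqxx /=; case: eqVneq => _; rewrite ?mulr1 ?addr0 ?mulr0 ?add0r.
move=> dF; rewrite pdE /partial (_ : (fun u => F (vt u t)) = fun u => F (u *: 'e_0 + vt 0 t)).
  have h := @is_derive_line _ _ _ F (vt 0 t) 'e_0 v; rewrite (E v); apply: h.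
  by rewrite -(E v); exact: diff_derivable.
by apply/funext => u; rewrite E.
Qed.

(** At time 0 the function is strictly convex in the first variable with minimum value 0 at 0. For
    one sign of [t] it drops below 0 at the origin while its values at the ends [- r] and [r] stay
    positive; for the other sign it rises everywhere. The radius [r] is fixed before [t], as the
    bifurcation statement requires. *)
Lemma fold_zeros F (b : bool) : smooth_near 0 F -> F 0 = 0 -> pd 0 F 0 = 0 ->
  0 < pd 0 (pd 0 F) 0 -> (-1) ^+ b * pd 1 F 0 < 0 -> forall e : R, 0 < e ->
  exists2 r : R, 0 < r < e & \forall t \near (0 : R),
    (0 < (-1) ^+ b * t -> exists v1 v2, [/\ - r < v1, v1 < v2, v2 < r,
      pd 0 F (vt v1 t) != 0 /\ pd 0 F (vt v2 t) != 0 &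
      forall v, - r < v < r -> F (vt v t) = 0 <-> v = v1 \/ v = v2]) /\
    ((-1) ^+ b * t < 0 -> forall v, - r < v < r -> F (vt v t) != 0).
Proof.
set sg : R := (-1) ^+ b; have sg2 : sg * sg = 1 by rewrite -expr2 sqrr_sign.
move=> sF F0 Fv Fvv Ft e e0.
have nvv := near_gt0 (smooth_near_continuous (smooth_near_pd 0 (smooth_near_pd 0 sF))) Fvv.
have sFt : smooth_near 0 (fun y => - (sg * pd 1 F y)) by smooth.
have nt : \forall y \near (0 : 'rV[R]_2), 0 < - (sg * pd 1 F y).
  by apply: near_gt0; [exact: smooth_near_continuous|rewrite oppr_gt0].
have [r1 r10 B] := near_vt (filterI (smooth_near_near sF) (filterI nvv nt)).
pose r := Num.min r1 e / 2.
have m0 : 0 < Num.min r1 e by rewrite lt_min r10.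
have r0 : 0 < r by rewrite divr_gt0.
have rm : r < Num.min r1 e by rewrite ltr_pdivrMr // ltr_pMr // ltr1n.
have rr1 : r < r1 by rewrite (lt_le_trans rm) // ge_min lexx.
have re : r < e by rewrite (lt_le_trans rm) // ge_min lexx orbT.
exists r; first by rewrite r0.
have inr v : - r <= v <= r -> `|v| < r1 by rewrite -ler_norml => /le_lt_trans; apply.
have D t : `|t| < r1 -> forall v, - r <= v <= r -> is_derive v (1 : R) (fun u => F (vt u t)) (pd 0 F (vt v t)).
  move=> tr v /inr vr; have [sFv _] := B v t vr tr.
  by apply: is_derive_vt; exact: smooth_near_differentiable.
have I t : `|t| < r1 -> forall u v, - r <= u -> u < v -> v <= r -> pd 0 F (vt u t) < pd 0 F (vt v t).
  move=> tr u v ru uv vr; rewrite (vt_upd u 0) (vt_upd v 0); apply: lt_coord => // c /andP[uc cv].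
  have cr : `|c| < r1 by apply: inr; rewrite (le_trans ru) //= (le_trans cv).
  have [sFv [p _]] := B c t cr tr; rewrite -vt_upd -pdE; split=> //.
  by have h := smooth_near_pd 0 sFv; smooth.
have z1 : `|(0 : R)| < r1 by rewrite normr0.
have min0 v : - r <= v <= r -> v != 0 -> 0 < F (vt v 0).
  move=> vr v0; have := convex_min r0 (D 0 z1) (I 0 z1); rewrite vt00 F0 Fv.
  by move=> /(_ erefl v vr v0).
(* The mean value theorem in time: [d] is minus [sg] times the time derivative at an intermediate
   time, positive throughout the box. *)
have slope t v : `|t| < r1 -> - r <= v <= r -> exists2 d, 0 < d & F (vt v t) = F (vt v 0) - (sg * t) * d.
  move=> tr vr; have E u : vt v u = u *: 'e_1 + vt v 0.
    by apply/rowP => l; rewrite !mxE eqxx /=; case: l => [[|[|//]] ?] /=; rewrite ?mulr1 ?addr0 ?mulr0 ?add0r.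
  have [s st|s st Es] := @mvt_line _ _ F (vt v 0) 'e_1 t.
    rewrite -E; apply: diff_derivable; apply: smooth_near_differentiable.
    by have [] := B v s (inr _ vr) (le_lt_trans st tr).
  have [_ [_ ds]] := B v s (inr _ vr) (le_lt_trans st tr).
  exists (- (sg * pd 1 F (vt v s))) => //.
  move/eqP: Es; rewrite -!E subr_eq => /eqP ->; rewrite pdE /partial.
  transitivity (F (vt v 0) + (sg * sg) * t * 'D_('e_1) F (vt v s)); first by rewrite sg2; ring.
  by ring.
have nl : \forall t \near (0 : R), 0 < F (vt (- r) t) /\ 0 < F (vt r t).
  have c v : - r <= v <= r -> {for 0, continuous (fun t => F (vt v t))}.
    move=> vr; have [sFv _] := B v 0 (inr _ vr) z1.
    apply: (@continuous_comp _ _ _ (vt v) F); last exact: smooth_near_continuous.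
    apply/row_continuous => l; rewrite (_ : (fun t => _) = fun t => if l == 0 then v else t).
      by case: (l == 0); [exact: cst_continuous|exact: cvg_id].
    by apply/funext => t; rewrite mxE.
  have h1 : - r <= - r <= r by rewrite lexx ge0_cp // ltW.
  have h2 : - r <= r <= r by rewrite lexx andbT ge0_cp // ltW.
  have rn : r != 0 by rewrite gt_eqF.
  have m1 : 0 < F (vt (- r) 0) by apply: min0; rewrite ?oppr_eq0.
  exact: filterI (near_gt0 (c _ h1) m1) (near_gt0 (c _ h2) (min0 _ h2 rn)).
have nt1 : \forall t \near (0 : R), `|t| < r1.
  by have /nbhs_ballP : exists2 e : R, 0 < e & ball (0 : R) e `<=` [set t | `|t| < r1]
    by exists r1 => // u; rewrite /ball /= sub0r normrN.
apply: filterS2 nl nt1 => t [fl fr] tr; split=> ts.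
  have h0 : - r <= 0 <= r by rewrite oppr_le0 ltW.
  have f0 : F (vt 0 t) < 0.
    by have [d d0 ->] := slope t 0 tr h0; rewrite vt00 F0 sub0r oppr_lt0 mulr_gt0.
  exact: convex_two_zeros r0 (D t tr) (I t tr) f0 fl fr.
move=> v /andP[rv vr]; have h : - r <= v <= r by rewrite !ltW.
have [d d0 ->] := slope t v tr h; rewrite gt_eqF // ltr_wpDl //.
  by have [->|v0] := eqVneq v 0; [rewrite vt00 F0|rewrite ltW // min0].
by rewrite oppr_gt0 pmulr_llt0.
Qed.

End Fold.

(** * Graphs as regular curves in a box *)

Section GraphCurve.
Context {R : realType}.
Local Notation I := (`]-1, 1[%classic : set R).

Lemma itv1E (s : R) : I s = (`|s| < 1) :> Prop.
Proof. by rewrite /= in_itv /= ltr_norml. Qed.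

Lemma near_itv1 (s : R) : I s -> \forall u \near s, I u.
Proof. by move=> Is; apply: open_nbhs_nbhs; split=> //; exact: interval_open. Qed.

Section Line.
Variable G : 'rV[R]_2 -> 'rV[R]_2.
Hypothesis sG : forall s, I s -> smooth_near (s *: 'e_0 + 0) G.

(** A curve of the form [G (u *: 'e_0 + 0)] inherits all its derivatives from the iterated partial
    derivatives of a map of the plane, so smoothness of curves reduces to [smooth_near]. *)
Lemma derive1n_line n s : I s ->
  is_derive s (1 : R) (derive1n n (fun u => G (u *: 'e_0 + 0))) (partials (nseq n.+1 0) G (s *: 'e_0 + 0)).
Proof.
elim: n s => [|n IH] s Is.
  have [d _] := nbhs_singleton (sG Is) [::].
  exact: (is_derive_line (d 0)).
have [d _] := nbhs_singleton (sG Is) (nseq n.+1 0).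
have dl := is_derive_line (d 0).
apply: near_eq_is_derive dl; near=> u; rewrite derive1nS derive1E.
have Iu : I u by near: u; exact: near_itv1.
by have [_ ->] := IH u Iu.
Unshelve. all: by end_near. Qed.

End Line.

Definition pt (k : 'I_2) (a v : R) : 'rV[R]_2 := \row_l (if l == k then a else v).

Section Graph.
Variables (k j : 'I_2) (psi : 'rV[R]_2 -> R) (r t al : R).
Hypotheses (kj : k != j) (r0 : 0 < r).
Hypothesis psiP : forall v, `|v| < r -> smooth_near (vt v t) psi /\ `|psi (vt v t)| < al.

(** The parameter is scaled by [r] because [regular_curve] is stated on the fixed interval from -1
    to 1. *)
Definition graph_curve (s : R) : 'rV[R]_2 := pt k (psi (vt (r * s) t)) (r * s).

Definition graph_box : set 'rV[R]_2 := [set w | `|w 0 k| < al /\ `|w 0 j| < r].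

Let Gm (y : 'rV[R]_2) : 'rV[R]_2 := pt k (psi (vt (r * y 0 0) t)) (r * y 0 0).

Let rs (s : R) : I s -> `|r * s| < r.
Proof. by rewrite itv1E => s1; rewrite normrM gtr0_norm // gtr_pMr. Qed.

Lemma ptk a v : pt k a v 0 k = a. Proof. by rewrite mxE eqxx. Qed.

Lemma ptj a v : pt k a v 0 j = v. Proof. by rewrite mxE eq_sym (negbTE kj). Qed.

Lemma ptE (w : 'rV[R]_2) : w = pt k (w 0 k) (w 0 j).
Proof.
apply/rowP => l; rewrite mxE; case: eqVneq => [->//|lk].
by have := ord2_neq l kj; rewrite (negbTE lk) /= => /eqP ->.
Qed.

Lemma graph_curveE : graph_curve = fun u : R => Gm (u *: 'e_0 + 0).
Proof. by apply/funext => u; rewrite /graph_curve /Gm !mxE eqxx mulr1 addr0. Qed.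

Let sGm s : I s -> smooth_near (s *: 'e_0 + 0) Gm.
Proof.
move=> Is; apply/smooth_near_row => l.
have e0 : (s *: 'e_0 + 0 : 'rV[R]_2) 0 0 = s by rewrite !mxE eqxx mulr1 addr0.
rewrite (_ : (fun w => _) = if l == k then (fun y : 'rV[R]_2 => psi (vt (r * y 0 0) t))
    else (fun y : 'rV[R]_2 => r * y 0 0)).
  case: ifP => _; last by smooth.
  apply: (@smooth_near_comp _ _ _ _ psi (fun y : 'rV[R]_2 => vt (r * y 0 0) t)); last first.
    by rewrite e0; have [] := psiP (rs Is).
  move=> m; rewrite (_ : (fun w => _) = if m == 0 then (fun y : 'rV[R]_2 => r * y 0 0) else (fun=> t)).
    by case: ifP => _; smooth.
  by apply/funext => y; rewrite mxE; case: ifP.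
by apply/funext => y; rewrite mxE; case: ifP.
Qed.

Lemma derive1_graph s : I s -> derive1 graph_curve s = pt k (r * pd 0 psi (vt (r * s) t)) r.
Proof.
move=> Is; have e0 : (s *: 'e_0 + 0 : 'rV[R]_2) 0 0 = s by rewrite !mxE eqxx mulr1 addr0.
have [_ d1] := derive1n_line sGm 0 Is; rewrite derive1E graph_curveE d1 /=.
apply/rowP => l; rewrite partial_row; last exact: sGm.
rewrite -pdE mxE; case: ifP => lk; last first.
  rewrite (_ : (fun w => _) = fun y : 'rV[R]_2 => r * y 0 0).
    by rewrite pdZ; [rewrite pd_coord eqxx mulr1|smooth].
  by apply/funext => y; rewrite mxE lk.
rewrite (_ : (fun w => _) = fun y : 'rV[R]_2 => psi (vt (r * y 0 0) t)); last first.
  by apply/funext => y; rewrite mxE lk.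
have n01 : (0 : 'I_2) != 1 by [].
have c0 : (fun y : 'rV[R]_2 => vt (r * y 0 0) t 0 0) = fun y => r * y 0 0 by apply/funext => y; rewrite mxE.
have c1 : (fun y : 'rV[R]_2 => vt (r * y 0 0) t 0 1) = fun y => t by apply/funext => y; rewrite mxE.
rewrite (@pd_comp _ _ _ psi (fun y : 'rV[R]_2 => vt (r * y 0 0) t)).
- rewrite (sum_ord2 _ n01) c0 c1 pd_cst mulr0 addr0 e0 pdZ; last by smooth.
  by rewrite pd_coord eqxx mulr1 mulrC.
- by rewrite e0; apply: smooth_near_differentiable; have [] := psiP (rs Is).
- move=> m; have [->|m0] := eqVneq m 0; first by rewrite c0; smooth.
  rewrite (_ : (fun w => _) = fun=> t); first by smooth.
  by apply/funext => y; rewrite mxE (negbTE m0).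
Qed.

Lemma graph_image : graph_curve @` I = graph_box `&` [set w | w 0 k = psi (vt (w 0 j) t)].
Proof.
apply/seteqP; split=> [w [s Is <-]|w [[wk wj] wE]].
  by have := rs Is; rewrite /graph_box /graph_curve /= ptk ptj => h; split=> //; split=> //;
    have [] := psiP h.
exists (w 0 j / r); first by rewrite itv1E normrM normfV (gtr0_norm r0) ltr_pdivrMr // mul1r.
by rewrite /graph_curve mulrCA mulfV ?mulr1 ?gt_eqF //= -wE -ptE.
Qed.

Lemma open_graph_box : open graph_box.
Proof.
have op (l : 'I_2) (a : R) : open [set w : 'rV[R]_2 | `|w 0 l| < a].
  rewrite (_ : [set _ | _] = (fun w : 'rV[R]_2 => `|w 0 l|) @^-1` [set y | y < a]) //.
  apply: open_comp; last exact: open_lt.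
  move=> w _; apply: (@continuous_comp _ _ _ (fun w : 'rV[R]_2 => w 0 l) (fun y : R => `|y|)).
    exact: coord_continuous.
  exact: norm_continuous.
exact: openI (op k al) (op j r).
Qed.

Lemma regular_graph : regular_curve graph_box graph_curve.
Proof.
split.
- move=> n s Is; rewrite graph_curveE; have h := derive1n_line sGm n Is.
  exact: (@ex_derive _ _ _ _ _ _ _ h).
- move=> s Is; rewrite derive1_graph //; apply/eqP => /rowP /(_ j); rewrite ptj mxE => /eqP.
  by rewrite gt_eqF.
- move=> s u; rewrite !inE => Is Iu /rowP /(_ j); rewrite !ptj => /(mulfI _) -> //.
  by rewrite gt_eqF.
(* The parameter of a point of the graph is its j-th coordinate divided by [r], a continuous
   function of the point; hence the curve is a homeomorphism onto its image. *)
- move=> s A Is As; have As' : \forall u \near graph_curve s 0 j / r, A u.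
    by rewrite ptj mulrAC mulfV ?mul1r ?gt_eqF.
  have cw : {for graph_curve s, continuous (fun w : 'rV[R]_2 => w 0 j / r)}.
    by apply: continuousM; [exact: coord_continuous|exact: cst_continuous].
  apply: filterS (near_continuous cw As') => w + [u Iu uw].
  rewrite -uw ptj mulrAC mulfV ?mul1r ?gt_eqF // => Au.
  by exists u.
- apply/seteqP; split=> [w gw|w [bw cw]].
    by split; [have := gw; rewrite graph_image => -[]|exact: subset_closure].
  (* If the graph equation failed at a limit point inside the box it would fail on a neighbourhood
     of it, which contains points of the graph. *)
  rewrite graph_image; split=> //; apply/eqP; rewrite -subr_eq0; apply: contrapT => /negP q0.
  have [wk wj] := bw; have [sp _] := psiP wj.
  have c2 : {for w, continuous (fun v : 'rV[R]_2 => vt (v 0 j) t)}.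
    apply/row_continuous => l.
    rewrite (_ : (fun v => _) = if l == 0 then (fun v : 'rV[R]_2 => v 0 j) else (fun=> t)).
      by case: ifP => _; [exact: coord_continuous|exact: cst_continuous].
    by apply/funext => v; rewrite mxE; case: ifP.
  have c1 : {for w, continuous (fun v : 'rV[R]_2 => v 0 k - psi (vt (v 0 j) t))}.
    apply: continuousB; first exact: coord_continuous.
    apply: (@continuous_comp _ _ _ (fun v : 'rV[R]_2 => vt (v 0 j) t) psi); first exact: c2.
    exact: smooth_near_continuous.
  have [v [gv nv]] := cw _ (near_neq0 c1 q0).
  by move: gv; rewrite graph_image => -[_ /= e]; move: nv; rewrite /= e subrr eqxx.
Qed.

End Graph.

(** Two graphs over the same axis meet only at equal parameters, and there their tangents are
    independent as soon as the slopes differ. *)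
Lemma graph_transversal k j (psi psi' : 'rV[R]_2 -> R) (r t al : R) : k != j -> 0 < r ->
  (forall v, `|v| < r -> smooth_near (vt v t) psi /\ `|psi (vt v t)| < al) ->
  (forall v, `|v| < r -> smooth_near (vt v t) psi' /\ `|psi' (vt v t)| < al) ->
  (forall v, `|v| < r -> psi (vt v t) = psi' (vt v t) -> pd 0 psi (vt v t) != pd 0 psi' (vt v t)) ->
  Defs.transversal (graph_curve k psi r t) (graph_curve k psi' r t).
Proof.
move=> kj r0 h h' ne s u Is Iu e; have rn : r != 0 by rewrite gt_eqF.
have su : s = u by move/rowP: (e) => /(_ j); rewrite !(ptj kj) => /(mulfI rn).
subst u; move/rowP: e => /(_ k); rewrite !ptk => e.
rewrite (derive1_graph k r0 h Is) (derive1_graph k r0 h' Is).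
have rs : `|r * s| < r by move: Is; rewrite itv1E => s1; rewrite normrM gtr0_norm // gtr_pMr.
have := ne _ rs e; rewrite -subr_eq0; set a := pd 0 psi _; set b := pd 0 psi' _ => ab.
apply: inj_row_free => v; rewrite -[v]hsubmxK; move: (lsubmx v) (rsubmx v) => x y.
rewrite mul_row_col => /rowP E; move: (E k) (E j).
rewrite !mxE !big_ord1 !mxE eqxx eq_sym (negbTE kj) => E1 E2.
have xy : x 0 0 = - y 0 0.
  by apply/eqP; rewrite -addr_eq0; move/eqP: E2; rewrite -mulrDl mulf_eq0 (negbTE rn) orbF.
have y0 : y 0 0 = 0.
  move/eqP: E1; rewrite xy (_ : _ + _ = - (r * y 0 0 * (a - b))); last by ring.
  by rewrite oppr_eq0 mulf_eq0 (negbTE ab) orbF mulf_eq0 (negbTE rn) => /eqP.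
have z1 (m : 'M[R]_1) : m 0 0 = 0 -> m = 0 by move=> m0; apply/matrixP => i l; rewrite !ord1 mxE.
by rewrite (z1 y y0) (z1 x) ?row_mx0 // xy y0 oppr0.
Qed.

End GraphCurve.

(** * Functions of two space variables and time, and their restriction to one time *)

Section Slices.
Context {R : realType}.
Implicit Types (F : 'rV[R]_3 -> R) (w : 'rV[R]_2) (t : R) (W : 'rV[R]_3).

(** [sp] and [tm] follow the block structure of [row_mx] in [uvt], so that coordinates of [uvt w t]
    compute. *)
Definition sp (i : 'I_2) : 'I_3 := @lshift 2 1 i.
Definition tm : 'I_3 := @rshift 2 1 ord0.

Lemma uvt_sp w t i : uvt w t 0 (sp i) = w 0 i.
Proof. by rewrite /uvt (row_mxEl w). Qed.

Lemma uvt_tm w t : uvt w t 0 tm = t.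
Proof. by rewrite /uvt (row_mxEr w) mxE. Qed.

Lemma sp_tm (l : 'I_3) : (exists i, l = sp i) \/ l = tm.
Proof. by case: (@split_ordP 2 1 l) => m ->; [left; exists m|right; rewrite ord1]. Qed.

Lemma row3P W W' : (forall i, W 0 (sp i) = W' 0 (sp i)) -> W 0 tm = W' 0 tm -> W = W'.
Proof. by move=> h h'; apply/rowP => l; have [[i ->]|->] := sp_tm l. Qed.

Lemma uvt00 : uvt (0 : 'rV[R]_2) 0 = 0.
Proof. by apply: row3P => [i|]; rewrite ?uvt_sp ?uvt_tm !mxE. Qed.

Lemma uvtE W : W = uvt (\row_i W 0 (sp i)) (W 0 tm).
Proof. by apply: row3P => [i|]; rewrite ?uvt_sp ?uvt_tm ?mxE. Qed.

Lemma sum_ord3 k j (F : 'I_3 -> R) : k != j -> \sum_l F l = F (sp k) + F (sp j) + F tm.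
Proof.
move=> kj; rewrite (@big_split_ord _ _ _ 2 1) /= big_ord1.
by rewrite (sum_ord2 (fun i => F (@lshift 2 1 i)) kj).
Qed.

Lemma near_uvt (Q : 'rV[R]_3 -> Prop) : (\forall W \near (0 : 'rV[R]_3), Q W) ->
  exists2 e : R, 0 < e & forall w t, (forall l, `|w 0 l| < e) -> `|t| < e -> Q (uvt w t).
Proof.
move=> /nbhs_ballP[e /= e0 eQ]; exists e => // w t we te; apply: eQ; apply/ball_rowP => // l.
by rewrite mxE sub0r normrN; have [[i ->]|->] := sp_tm l; rewrite ?uvt_sp ?uvt_tm.
Qed.

Lemma sp_neq_tm i : (sp i == tm) = false.
Proof. by apply/negbTE; rewrite neq_ltn /=; case: i => [[|[|//]] ?]. Qed.

Lemma smooth_uvt w t l : smooth_near w (fun v => uvt v t 0 l).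
Proof.
have [[i ->]|->] := sp_tm l.
  by rewrite (_ : (fun v => _) = fun v : 'rV[R]_2 => v 0 i); [smooth|apply/funext => v; rewrite uvt_sp].
by rewrite (_ : (fun v => _) = fun=> t); [smooth|apply/funext => v; rewrite uvt_tm].
Qed.

Lemma smooth_slice F w t : smooth_near (uvt w t) F -> smooth_near w (fun v => F (uvt v t)).
Proof. exact: smooth_near_comp (smooth_uvt w t). Qed.

Lemma uvt_continuous w t : {for w, continuous (uvt ^~ t)}.
Proof. by apply: row_smooth_continuous => l; exact: smooth_uvt. Qed.

Lemma pd_slice F w t i : smooth_near (uvt w t) F ->
  pd i (fun v => F (uvt v t)) w = pd (sp i) F (uvt w t).
Proof.
have n01 : (0 : 'I_2) != 1 by [].
move=> sF; rewrite (@pd_comp _ _ _ F (uvt ^~ t)); [|smooth|]; last first.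
  by move=> l; apply: smooth_near_differentiable; exact: smooth_uvt.
have e l : (fun v => uvt v t 0 (sp l)) = fun v : 'rV[R]_2 => v 0 l by apply/funext => v; rewrite uvt_sp.
have e' : (fun v => uvt v t 0 tm) = fun=> t by apply/funext => v; rewrite uvt_tm.
have [j ij] := ord2_other i; rewrite (sum_ord3 _ ij) !e e' pd_cst !pd_coord eqxx (negbTE ij).
by rewrite mulr1 !mulr0 !addr0.
Qed.

Lemma pd2_slice F w t i j : smooth_near (uvt w t) F ->
  pd i (pd j (fun v => F (uvt v t))) w = pd (sp i) (pd (sp j) F) (uvt w t).
Proof.
move=> sF; have n : \forall v \near w, pd j (fun v => F (uvt v t)) v = pd (sp j) F (uvt v t).
  apply: filterS (near_continuous (uvt_continuous (w := w) (t := t)) (smooth_near_near sF)) => v.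
  exact: pd_slice.
by rewrite (near_eq_pd i n) (pd_slice i (smooth_near_pd (sp j) sF)).
Qed.

End Slices.

Section ImplicitGraph.
Context {R : realType}.
Variables (k j : 'I_2).
Hypothesis kj : k != j.
Implicit Types (F : 'rV[R]_3 -> R) (y : 'rV[R]_2).

(** The parametrization of the surface [W_k = psi] in space-time by the remaining space coordinate
    and the time. *)
Definition emb (psi : 'rV[R]_2 -> R) y : 'rV[R]_3 := uvt (pt k (psi y) (y 0 0)) (y 0 1).

Section Emb.
Variable psi : 'rV[R]_2 -> R.

Let e_k : (fun y => emb psi y 0 (sp k)) = psi.
Proof. by apply/funext => y; rewrite /emb uvt_sp ptk. Qed.
Let e_j : (fun y => emb psi y 0 (sp j)) = fun y => y 0 0.
Proof. by apply/funext => y; rewrite /emb uvt_sp (ptj kj). Qed.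
Let e_t : (fun y => emb psi y 0 tm) = fun y => y 0 1.
Proof. by apply/funext => y; rewrite /emb uvt_tm. Qed.

Lemma smooth_emb y l : smooth_near y psi -> smooth_near y (fun y => emb psi y 0 l).
Proof.
move=> sp0; have [[i ->]|->] := sp_tm l; last by rewrite e_t; smooth.
by have /orP[/eqP ->|/eqP ->] := ord2_neq i kj; [rewrite e_k|rewrite e_j; smooth].
Qed.

Lemma emb0 : psi 0 = 0 -> emb psi 0 = 0.
Proof.
move=> p0; rewrite /emb p0 (_ : pt k 0 _ = 0) ?mxE ?uvt00 //.
by apply/rowP => l; rewrite !mxE; case: ifP.
Qed.

Lemma emb_continuous y : smooth_near y psi -> {for y, continuous (emb psi)}.
Proof. by move=> s0; apply: row_smooth_continuous => l; exact: smooth_emb. Qed.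

Lemma smooth_comp_emb F y : smooth_near y psi -> smooth_near (emb psi y) F ->
  smooth_near y (fun y => F (emb psi y)).
Proof. by move=> s0; apply: smooth_near_comp => l; exact: smooth_emb. Qed.

Lemma pd_emb F y i : smooth_near y psi -> smooth_near (emb psi y) F ->
  pd i (fun y => F (emb psi y)) y =
  pd (sp k) F (emb psi y) * pd i psi y + (if i == 0 then pd (sp j) F (emb psi y) else pd tm F (emb psi y)).
Proof.
move=> s0 sF; rewrite (@pd_comp _ _ _ F (emb psi)); [|smooth|]; last first.
  by move=> l; apply: smooth_near_differentiable; exact: smooth_emb.
rewrite (sum_ord3 _ kj) e_k e_j e_t !pd_coord -addrA; congr (_ + _).
by case: i => [[|[|//]] ?]; rewrite /= ?mulr1 ?mulr0 ?addr0 ?add0r.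
Qed.

Lemma pd00_emb F y : smooth_near y psi -> smooth_near (emb psi y) F ->
  let: k := sp k in let: j := sp j in let p := emb psi y in
  pd 0 (pd 0 (fun y => F (emb psi y))) y =
  (pd k (pd k F) p * pd 0 psi y + pd j (pd k F) p) * pd 0 psi y
  + pd k F p * pd 0 (pd 0 psi) y + (pd k (pd j F) p * pd 0 psi y + pd j (pd j F) p).
Proof.
move=> s0 sF /=; have cF := near_continuous (emb_continuous s0) (smooth_near_near sF).
have n : \forall v \near y, pd 0 (fun y => F (emb psi y)) v =
    pd (sp k) F (emb psi v) * pd 0 psi v + pd (sp j) F (emb psi v).
  by apply: filterS2 cF (smooth_near_near s0) => v sFv sv; rewrite pd_emb.
have q l : smooth_near (emb psi y) (pd l F) by exact: smooth_near_pd.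
have q' l := smooth_comp_emb s0 (q l).
rewrite (near_eq_pd 0 n).
have q1 := q' (sp k); have q2 := q' (sp j).
rewrite pdD; [|smooth|smooth]; rewrite pdM; [|smooth|smooth].
by rewrite (pd_emb 0 s0 (q (sp k))) (pd_emb 0 s0 (q (sp j))).
Qed.

End Emb.

(** The elementary chart with [F] as coordinate [sp k] is inverted, and its inverse is restricted to
    the hyperplane where that coordinate, the value of [F], is 0. *)
Lemma implicit_graph F : smooth_near 0 F -> F 0 = 0 -> pd (sp k) F 0 != 0 ->
  exists psi : 'rV[R]_2 -> R, [/\ smooth_near 0 psi, psi 0 = 0,
    \forall W \near (0 : 'rV[R]_3), F W = 0 <->
      (W : 'rV[R]_3) 0 (sp k) = psi (vt ((W : 'rV[R]_3) 0 (sp j)) ((W : 'rV[R]_3) 0 tm)) &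
    \forall y \near (0 : 'rV[R]_2), F (emb psi y) = 0].
Proof.
move=> sF F0 Fk; have [u []] := pd_coordinate_inverse sF Fk; rewrite F0.
have -> : upd (sp k) 0 (0 : 'rV[R]_3) = 0 by apply/rowP => l; rewrite !mxE; case: ifP.
move=> su h1 h2; pose z (y : 'rV[R]_2) := emb (fun=> 0) y.
have zE (W : 'rV[R]_3) : z (vt (W 0 (sp j)) (W 0 tm)) = upd (sp k) 0 W.
  apply: row3P => [i|]; rewrite /z /emb ?uvt_sp ?uvt_tm !mxE /= ?(eq_sym tm) ?sp_neq_tm //.
  have e : (sp i == sp k) = (i == k) by rewrite (inj_eq (@lshift_inj 2 1)).
  by rewrite e; have /orP[/eqP ->|/eqP ->] := ord2_neq i kj; rewrite ?eqxx // eq_sym (negbTE kj).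
have s00 : smooth_near 0 (fun _ : 'rV[R]_2 => 0 : R) by smooth.
have z0 : z 0 = 0 by exact: emb0.
have spsi : smooth_near 0 (fun y => u (z y)) by apply: smooth_comp_emb; rewrite ?[emb _ _]z0.
have u0 : u 0 = 0.
  have := nbhs_singleton h2; rewrite F0 mxE (_ : upd _ _ _ = 0) //.
  by apply/rowP => l; rewrite !mxE; case: ifP.
have E : \forall W \near (0 : 'rV[R]_3), F W = 0 <->
      (W : 'rV[R]_3) 0 (sp k) = u (z (vt ((W : 'rV[R]_3) 0 (sp j)) ((W : 'rV[R]_3) 0 tm))).
  have c0 : {for (0 : 'rV[R]_3), continuous (fun W : 'rV[R]_3 => upd (sp k) 0 W)}.
    apply: row_smooth_continuous => l.
    exact: (@smooth_near_upd _ _ (sp k) (fun=> 0) 0 (smooth_near_cst 0 0)).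
  have h1' : \forall W \near upd (sp k) 0 (0 : 'rV[R]_3), F (upd (sp k) (u W) W) = (W : 'rV[R]_3) 0 (sp k).
    by rewrite (_ : upd _ _ _ = 0) //; apply/rowP => l; rewrite !mxE; case: ifP.
  apply: filterS2 (near_continuous c0 h1') h2 => W e1 e2; rewrite zE; split=> [FW|We].
    by rewrite -e2 FW.
  by move: e1; rewrite upd_upd -We upd_id upd_same.
exists (fun y => u (z y)); split=> //; first by rewrite z0.
have ce : {for (0 : 'rV[R]_2), continuous (emb (fun y => u (z y)))} by exact: emb_continuous.
have E' : \forall W \near emb (fun y => u (z y)) 0, F W = 0 <->
      (W : 'rV[R]_3) 0 (sp k) = u (z (vt ((W : 'rV[R]_3) 0 (sp j)) ((W : 'rV[R]_3) 0 tm))).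
  by rewrite emb0 // z0.
apply: filterS (near_continuous ce E') => y; rewrite /emb !uvt_sp uvt_tm ptk (ptj kj) -vtE => e.
exact/e.
Qed.

End ImplicitGraph.

Lemma near_and {T : topologicalType} (p : T) (A B : set T) :
  nbhs p A -> nbhs p B -> nbhs p (A `&` B).
Proof. exact: filterI. Qed.

(** * Bifurcation of a product of two functions with a simple contact *)

Section LocalBifurcation.
Context {R : realType}.
Variables (P M K : 'rV[R]_3 -> R) (x_ : R -> 'rV[R]_2 -> 'rV[R]_3) (k : 'I_2).
Hypotheses (sP : smooth_near 0 P) (sM : smooth_near 0 M) (sK : smooth_near 0 K).
Hypotheses (K0 : K 0 != 0) (P0 : P 0 = 0) (M0 : M 0 = 0).
Hypothesis J0 : jac (fun w => P (uvt w 0)) (fun w => M (uvt w 0)) 0 = 0.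
Hypothesis contact0 : simple_contact k (fun w => P (uvt w 0)) (fun w => M (uvt w 0)) 0.
Hypothesis velocity : pd (sp k) P 0 * pd tm M 0 - pd (sp k) M 0 * pd tm P 0 != 0.
Hypothesis tdeltaE : \forall W \near (0 : 'rV[R]_3),
  tdelta (x_ ((W : 'rV[R]_3) 0 tm)) (\row_i (W : 'rV[R]_3) 0 (sp i)) = K W * (P W * M W).

Let sl (F : 'rV[R]_3 -> R) : smooth_near 0 F -> forall i, pd i (fun w => F (uvt w 0)) 0 = pd (sp i) F 0.
Proof. by move=> sF i; rewrite pd_slice uvt00. Qed.

Let sl2 (F : 'rV[R]_3 -> R) : smooth_near 0 F -> forall i l,
  pd i (pd l (fun w => F (uvt w 0))) 0 = pd (sp i) (pd (sp l) F) 0.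
Proof. by move=> sF i l; rewrite pd2_slice uvt00. Qed.

Let Pk : pd (sp k) P 0 != 0. Proof. by have [h _ _] := contact0; rewrite -sl. Qed.
Let Mk : pd (sp k) M 0 != 0. Proof. by have [_ h _] := contact0; rewrite -sl. Qed.

(* the zero set of P is the graph of psi, and M restricted to it unfolds a fold *)
Lemma intersection_fold j (psi : 'rV[R]_2 -> R) : k != j -> smooth_near 0 psi -> psi 0 = 0 ->
  (\forall y \near (0 : 'rV[R]_2), P (emb k psi y) = 0) ->
  let chi y := M (emb k psi y) in
  [/\ smooth_near 0 chi, chi 0 = 0, pd 0 chi 0 = 0, pd 0 (pd 0 chi) 0 != 0 & pd 1 chi 0 != 0].
Proof.
move=> kj spsi psi0 Pe chi; have e0 := emb0 k psi0.
have sPe : smooth_near (emb k psi 0) P by rewrite e0.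
have sMe : smooth_near (emb k psi 0) M by rewrite e0.
have pz : pd 0 (fun y => P (emb k psi y)) 0 = 0 by rewrite (near_eq_pd 0 Pe) pd_cst.
have pz1 : pd 1 (fun y => P (emb k psi y)) 0 = 0 by rewrite (near_eq_pd 1 Pe) pd_cst.
have pz2 : pd 0 (pd 0 (fun y => P (emb k psi y))) 0 = 0.
  rewrite (near_eq_pd 0 (near_eq_pd_near 0 Pe)) -(pd_cst 0 (0 : 'rV[R]_2) 0).
  by congr (pd 0 _ 0); apply/funext => y; rewrite pd_cst.
have := pz; rewrite (pd_emb kj 0 spsi sPe) e0 /= => r0.
have := pz1; rewrite (pd_emb kj 1 spsi sPe) e0 /= => r1.
have := pz2; rewrite (pd00_emb kj spsi sPe) e0 => r2.
have sS (F : 'rV[R]_3 -> R) : smooth_near 0 F -> smooth_near 0 (fun w : 'rV[R]_2 => F (uvt w 0)).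
  by move=> sF; apply: (@smooth_slice _ F 0 0); rewrite uvt00.
have [_ _] := contact0; rewrite (hess2_theta kj (sS _ sP) (sS _ sM)).
rewrite !(sl sP) !(sl sM) !(sl2 sP) !(sl2 sM) => h.
have J := jac_eq0 kj J0; rewrite !(sl sP) !(sl sM) in J.
have c0 : pd 0 chi 0 = 0.
  rewrite /chi (pd_emb kj 0 spsi sMe) e0 /=; apply: (mulfI Pk); rewrite mulr0 mulrDr J.
  have -> : pd (sp j) P 0 = - (pd (sp k) P 0 * pd 0 psi 0).
    by apply/eqP; rewrite -addr_eq0 addrC r0.
  ring.
split.
- exact: (smooth_comp_emb kj spsi sMe).
- by rewrite /chi e0.
- exact: c0.
- apply: contra h => /eqP c2; move: c2; rewrite /chi (pd00_emb kj spsi sMe) e0 => c2; apply/eqP.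
  have jP : pd (sp j) P 0 = - (pd (sp k) P 0 * pd 0 psi 0).
    by apply/eqP; rewrite -addr_eq0 addrC r0.
  rewrite jP; move: r2 c2.
  move: (pd (sp k) P 0) (pd (sp k) M 0) (pd (sp k) (pd (sp k) P) 0) (pd (sp k) (pd (sp k) M) 0)
   (pd (sp j) (pd (sp k) P) 0) (pd (sp j) (pd (sp k) M) 0) (pd (sp k) (pd (sp j) P) 0)
   (pd (sp k) (pd (sp j) M) 0) (pd (sp j) (pd (sp j) P) 0) (pd (sp j) (pd (sp j) M) 0) (pd 0 psi 0) (pd 0 (pd 0 psi) 0).
  move=> p m pkk mkk pjk mjk pkj mkj pjj mjj v vv r2 c2.
  (* Combining the second derivatives of [M] and of [P] along the graph with weights [p] and [- m]
     eliminates the second derivative [vv] of [psi]; what remains is the contact number divided by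
     [p ^+ 2]. *)
  transitivity (p ^+ 2 * (p * ((mkk * v + mjk) * v + m * vv + (mkj * v + mjj))
     - m * ((pkk * v + pjk) * v + p * vv + (pkj * v + pjj)))); first by ring.
  by rewrite r2 c2; ring.
- apply: contra velocity => /eqP; rewrite /chi (pd_emb kj 1 spsi sMe) e0 /= => c1; apply/eqP.
  (* The same elimination for the time derivative: that of [psi] cancels and leaves [velocity]. *)
  transitivity (pd (sp k) P 0 * (pd (sp k) M 0 * pd 1 psi 0 + pd tm M 0)
    - pd (sp k) M 0 * (pd (sp k) P 0 * pd 1 psi 0 + pd tm P 0)); first by gen_pd; ring.
  by rewrite c1 r1; ring.
Qed.

Section Slice.
Variables (j : 'I_2) (psi psi' : 'rV[R]_2 -> R) (r al t : R).
Hypotheses (kj : k != j) (r0 : 0 < r) (al0 : 0 < al).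
Hypothesis psiP : forall v, `|v| < r -> smooth_near (vt v t) psi /\ `|psi (vt v t)| < al.
Hypothesis psiP' : forall v, `|v| < r -> smooth_near (vt v t) psi' /\ `|psi' (vt v t)| < al.
Local Notation U := (graph_box k j r al).
Local Notation I := (`]-1, 1[%classic : set R).
Local Notation Pt := (fun w => P (uvt w t)).
Local Notation Mt := (fun w => M (uvt w t)).
Hypothesis smU : forall w, U w ->
  [/\ smooth_near (uvt w t) P, smooth_near (uvt w t) M & smooth_near (uvt w t) K].
Hypothesis nzU : forall w, U w ->
  [/\ K (uvt w t) != 0, pd (sp k) P (uvt w t) != 0 & pd (sp k) M (uvt w t) != 0].
Hypothesis zU : forall w, U w -> (P (uvt w t) = 0 <-> w 0 k = psi (vt (w 0 j) t)) /\
  (M (uvt w t) = 0 <-> w 0 k = psi' (vt (w 0 j) t)).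
Hypothesis tU : forall w, U w -> tdelta (x_ t) w = K (uvt w t) * (P (uvt w t) * M (uvt w t)).
Hypothesis rel : forall v, `|v| < r -> pd (sp k) P (emb k psi (vt v t)) * pd 0 psi (vt v t)
    + pd (sp j) P (emb k psi (vt v t)) = 0 /\
  pd 0 (fun y => M (emb k psi y)) (vt v t) = pd (sp k) M (emb k psi (vt v t)) * pd 0 psi (vt v t)
    + pd (sp j) M (emb k psi (vt v t)).
Hypothesis rel' : forall v, `|v| < r -> pd (sp k) M (emb k psi' (vt v t)) * pd 0 psi' (vt v t)
    + pd (sp j) M (emb k psi' (vt v t)) = 0.

Let tnear w : U w -> \forall v \near w, tdelta (x_ t) v = K (uvt v t) * (P (uvt v t) * M (uvt v t)).
Proof.
move=> Uw; have n : \forall v \near w, U v by apply: open_nbhs_nbhs; split=> //; exact: open_graph_box.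
by apply: filterS n => v; exact: tU.
Qed.

Let lplE w : U w -> LPL (x_ t) w <-> P (uvt w t) = 0 \/ M (uvt w t) = 0.
Proof.
move=> Uw; rewrite /LPL /= tU //; have [k0 _ _] := nzU Uw; split.
  by move/eqP; rewrite !mulf_eq0 (negbTE k0) /= => /orP[/eqP|/eqP]; [left|right].
by case=> ->; rewrite ?mul0r ?mulr0.
Qed.

(** Where only one factor vanishes, the derivative of the product in direction [k] is the derivative
    of that factor times nonzero quantities; both factors have a nonzero k-derivative throughout the
    box. *)
Let singE w : U w -> LPL_singularity (x_ t) w <-> P (uvt w t) = 0 /\ M (uvt w t) = 0.
Proof.
move=> Uw; have [sPw sMw sKw] := smU Uw; have [k0 p0 m0] := nzU Uw.
have s1 := smooth_slice sPw; have s2 := smooth_slice sMw; have s3 := smooth_slice sKw.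
split=> [[/(lplE Uw) PM sing]|[Pw Mw]]; last first.
  split; first by apply/(lplE Uw); left.
  by move=> i; rewrite -pdE; exact: (pd_product_zero i s3 s1 s2 Pw Mw (tnear Uw)).
have := sing k; rewrite -pdE (near_eq_pd k (tnear Uw)) pdM; [|smooth|smooth].
rewrite pdM; [|smooth|smooth]; rewrite !pd_slice //.
case: PM => E; rewrite E ?mul0r ?mulr0 ?add0r ?addr0 => /eqP; rewrite ?mulr0 ?add0r !mulf_eq0 (negbTE k0) /=.
  by rewrite (negbTE p0) /= => /eqP.
by rewrite (negbTE m0) orbF => /eqP.
Qed.

Let imP : graph_curve k psi r t @` I = [set w | U w /\ P (uvt w t) = 0].
Proof.
rewrite (graph_image kj r0 psiP); apply/seteqP; split=> w [Uw E]; split=> //.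
  by apply/(zU Uw).1.
by apply/(zU Uw).1.
Qed.

Let imM : graph_curve k psi' r t @` I = [set w | U w /\ M (uvt w t) = 0].
Proof.
rewrite (graph_image kj r0 psiP'); apply/seteqP; split=> w [Uw E]; split=> //.
  by apply/(zU Uw).2.
by apply/(zU Uw).2.
Qed.

Lemma slice_LPL : U `&` LPL (x_ t) = graph_curve k psi r t @` I `|` graph_curve k psi' r t @` I.
Proof.
rewrite imP imM; apply/seteqP; split=> w.
  by move=> [Uw /(lplE Uw)[]]; [left|right].
by case=> -[Uw E]; split=> //; apply/(lplE Uw); [left|right].
Qed.

Lemma slice_meet : graph_curve k psi r t @` I `&` graph_curve k psi' r t @` I =
  U `&` LPL_singularity (x_ t).
Proof.
rewrite imP imM; apply/seteqP; split=> w.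
  by move=> [[Uw P0w] [_ M0w]]; split=> //; apply/(singE Uw).
by move=> [Uw /(singE Uw)[P0w M0w]]; split.
Qed.

Let Upt v : `|v| < r -> U (pt k (psi (vt v t)) v).
Proof. by move=> vr; rewrite /graph_box /= ptk (ptj kj); have [] := psiP vr. Qed.

Let embE v : emb k psi (vt v t) = uvt (pt k (psi (vt v t)) v) t.
Proof. by rewrite /emb !mxE. Qed.

Lemma slice_singular : U `&` LPL_singularity (x_ t) =
  [set w | exists v, [/\ `|v| < r, M (emb k psi (vt v t)) = 0 & w = pt k (psi (vt v t)) v]].
Proof.
apply/seteqP; split=> w.
  move=> [Uw /(singE Uw)[/(zU Uw).1 E M0w]]; have [wk wj] := Uw; exists (w 0 j); split=> //.
    by rewrite embE -E -(ptE kj).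
  by rewrite -E -(ptE kj).
move=> [v [vr M0v ->]]; have Uw := Upt vr; split=> //; apply/(singE Uw); split.
  by apply/(zU Uw).1; rewrite ptk (ptj kj).
by rewrite -embE.
Qed.

(** The tangent vector of the graph P = 0 annihilates dP, and the derivative of [M] along the graph
    is dM on it; if dP and dM were dependent it would vanish too. *)
Lemma slice_jac v : `|v| < r -> pd 0 (fun y => M (emb k psi y)) (vt v t) != 0 ->
  jac Pt Mt (pt k (psi (vt v t)) v) != 0.
Proof.
move=> vr; have [] := rel vr; rewrite embE; have Uw := Upt vr; set w := pt k _ _ in Uw *.
have [sPw sMw _] := smU Uw; have [_ p0 _] := nzU Uw => r1 ->; apply: contra => /eqP Jw; apply/eqP.
have := jac_eq0 kj Jw; rewrite !pd_slice // => J; apply: (mulfI p0); rewrite mulr0 mulrDr J.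
have -> : pd (sp j) P (uvt w t) = - (pd (sp k) P (uvt w t) * pd 0 psi (vt v t)).
  by apply/eqP; rewrite -addr_eq0 addrC r1.
ring.
Qed.

Lemma slice_A1 v : `|v| < r -> M (emb k psi (vt v t)) = 0 ->
  pd 0 (fun y => M (emb k psi y)) (vt v t) != 0 -> A_minus 1 (x_ t) (pt k (psi (vt v t)) v).
Proof.
move=> vr M0v c; have Jw := slice_jac vr c; have Uw := Upt vr; set w := pt k _ _ in Uw Jw *.
have [sPw sMw sKw] := smU Uw; have [k0 _ _] := nzU Uw.
have Pw : P (uvt w t) = 0 by apply/(zU Uw).1; rewrite ptk (ptj kj).
have Mw : M (uvt w t) = 0 by rewrite -embE.
have [phi dphi E] := A1_normal_form (smooth_slice sKw) (smooth_slice sPw) (smooth_slice sMw)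
  k0 Pw Mw Jw (tnear Uw).
by exists phi, false; split=> //; apply: filterS E => z ->; rewrite expr0 mul1r.
Qed.

(** At a common point, equal slopes of the two graphs would make the derivative of [M] along P = 0
    equal to its derivative along M = 0, which is 0. *)
Lemma slice_transversal :
  (forall v, `|v| < r -> M (emb k psi (vt v t)) = 0 -> pd 0 (fun y => M (emb k psi y)) (vt v t) != 0) ->
  Defs.transversal (graph_curve k psi r t) (graph_curve k psi' r t).
Proof.
move=> cn; apply: (graph_transversal kj r0 psiP psiP') => v vr e; have Uw := Upt vr.
have Mw : M (uvt (pt k (psi (vt v t)) v) t) = 0 by apply/(zU Uw).2; rewrite ptk (ptj kj).
have c := cn v vr; rewrite embE in c; have {}c := c Mw.
have [r1 r2] := rel vr; have r3 := rel' vr; rewrite r2 in c; apply: contra c => /eqP pe; apply/eqP.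
have ee : emb k psi' (vt v t) = emb k psi (vt v t) by rewrite /emb e.
by rewrite pe -{1}ee -r3 ee.
Qed.

Lemma slice_two_crossing v1 v2 : - r < v1 -> v1 < v2 -> v2 < r ->
  (forall v, - r < v < r -> M (emb k psi (vt v t)) = 0 <-> v = v1 \/ v = v2) ->
  pd 0 (fun y => M (emb k psi y)) (vt v1 t) != 0 -> pd 0 (fun y => M (emb k psi y)) (vt v2 t) != 0 ->
  two_crossing_curves U (x_ t).
Proof.
move=> rv1 v12 v2r z c1 c2; have v1r := lt_trans v12 v2r; have rv2 := lt_trans rv1 v12.
have n1 : `|v1| < r by rewrite ltr_norml rv1.
have n2 : `|v2| < r by rewrite ltr_norml rv2.
have z1 : M (emb k psi (vt v1 t)) = 0 by apply/z; [rewrite rv1|left].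
have z2 : M (emb k psi (vt v2 t)) = 0 by apply/z; [rewrite rv2|right].
have sE : U `&` LPL_singularity (x_ t) = [set pt k (psi (vt v1 t)) v1; pt k (psi (vt v2 t)) v2].
  rewrite slice_singular; apply/seteqP; split=> w.
    by move=> [v [vr M0v ->]]; move: vr; rewrite ltr_norml => /z /iffLR /(_ M0v)[->|->]; [left|right].
  by case=> ->; [exists v1|exists v2].
exists (graph_curve k psi r t), (graph_curve k psi' r t), (pt k (psi (vt v1 t)) v1), (pt k (psi (vt v2 t)) v2).
split.
- by split; [exact: regular_graph|exact: regular_graph].
- exact: slice_LPL.
- split; last by rewrite slice_meet.
  by apply/eqP => /rowP/(_ j); rewrite !(ptj kj) => e; move: v12; rewrite e ltxx.
- apply: slice_transversal => v; rewrite ltr_norml => vr /(z v vr)[->|->] //.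
- by split=> //; exact: slice_A1.
Qed.

Lemma slice_two_disjoint : (forall v, - r < v < r -> M (emb k psi (vt v t)) != 0) ->
  two_disjoint_curves U (x_ t).
Proof.
move=> z; have sE : U `&` LPL_singularity (x_ t) = set0.
  rewrite slice_singular; apply/seteqP; split=> w // [v [vr M0v _]].
  by move: vr; rewrite ltr_norml => /z; rewrite M0v eqxx.
exists (graph_curve k psi r t), (graph_curve k psi' r t); split=> //.
- by split; [exact: regular_graph|exact: regular_graph].
- exact: slice_LPL.
- by rewrite slice_meet.
Qed.

End Slice.

Lemma near_norm_lt (psi : 'rV[R]_2 -> R) (a : R) : smooth_near 0 psi -> psi 0 = 0 -> 0 < a ->
  \forall y \near (0 : 'rV[R]_2), `|psi y| < a.
Proof.
move=> spsi p0 a0; apply: filterS (continuous_dist (smooth_near_continuous spsi) a0) => y.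
by rewrite p0 sub0r normrN.
Qed.

Lemma near_emb_relation F j (psi : 'rV[R]_2 -> R) : k != j -> smooth_near 0 psi -> psi 0 = 0 ->
  smooth_near 0 F -> \forall y \near (0 : 'rV[R]_2), pd 0 (fun y => F (emb k psi y)) y =
    pd (sp k) F (emb k psi y) * pd 0 psi y + pd (sp j) F (emb k psi y).
Proof.
move=> kj spsi p0 sF; have sFe : \forall W \near emb k psi 0, smooth_near W F.
  by rewrite emb0 //; exact: smooth_near_near.
apply: filterS2 (near_continuous (emb_continuous kj spsi) sFe) (smooth_near_near spsi) => y sFy sy.
by rewrite (pd_emb kj 0 sy sFy).
Qed.

Lemma local_bifurcation : LPL_bifurcation x_.
Proof.
have [j kj] := ord2_other k.
have [psi [spsi psi0 zP Pe]] := implicit_graph kj sP P0 Pk.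
have [psi' [spsi' psi0' zM Me]] := implicit_graph kj sM M0 Mk.
have := intersection_fold kj spsi psi0 Pe; set chi := fun y => M (emb k psi y).
move=> /= [schi chi0 c0 c2 c1]; set vv := pd 0 (pd 0 chi) 0 in c2.
(* Multiplying by [vv], its own second derivative at 0, keeps the zeros and makes the fold convex,
   whatever the sign of [vv]. *)
pose F y := vv * chi y.
have sF : smooth_near 0 F by rewrite /F; smooth.
have nF i : \forall y \near (0 : 'rV[R]_2), pd i F y = vv * pd i chi y.
  by apply: filterS (smooth_near_near schi) => y sy; rewrite /F pdZ //; smooth.
have F0 : F 0 = 0 by rewrite /F chi0 mulr0.
have Fv : pd 0 F 0 = 0 by rewrite (nbhs_singleton (nF 0)) c0 mulr0.
have Fvv : 0 < pd 0 (pd 0 F) 0.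
  rewrite (near_eq_pd 0 (nF 0)) pdZ -/vv; last by smooth.
  by rewrite -expr2 exprn_even_gt0.
(* The sign of [t] with two intersection points depends on derivatives at the origin only, so it is
   chosen before the neighbourhood [V]. *)
have [b hb] : exists b : bool, (-1) ^+ b * pd 1 F 0 < 0.
  have F1 : pd 1 F 0 != 0 by rewrite (nbhs_singleton (nF 1)) mulf_neq0.
  have [h|h] := ltP (pd 1 F 0) 0; first by exists false; rewrite expr0 mul1r.
  by exists true; rewrite expr1 mulN1r oppr_lt0 lt_neqAle eq_sym F1.
exists b => V /nbhs_ballP[eV /= eV0 VP].
have n1 := near_and (smooth_near_near sP) (near_and (smooth_near_near sM) (smooth_near_near sK)).
have n2 := near_and (near_neq0 (smooth_near_continuous sK) K0)
  (near_and (near_neq0 (smooth_near_continuous (smooth_near_pd (sp k) sP)) Pk)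
    (near_neq0 (smooth_near_continuous (smooth_near_pd (sp k) sM)) Mk)).
have [e3 e30 C3] := near_uvt (near_and (near_and n1 n2) (near_and (near_and zP zM) tdeltaE)).
(* The half-width [al] in direction [k] keeps the box in [V] and in the domain of the factorization.
   It is fixed first; [e2] is then small enough for both graphs to stay within height [al], and [r]
   is taken below [e2] and [al]. *)
pose al := Num.min e3 eV; have al0 : 0 < al by rewrite lt_min e30.
have m1 := near_and (near_and (smooth_near_near spsi) (smooth_near_near spsi'))
  (near_and (near_norm_lt spsi psi0 al0) (near_norm_lt spsi' psi0' al0)).
have m2 := near_and (near_emb_relation kj spsi psi0 sP) (near_emb_relation kj spsi psi0 sM).
have m3 := near_and (near_eq_pd_near 0 Pe)
  (near_and (near_emb_relation kj spsi' psi0' sM) (near_eq_pd_near 0 Me)).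
have [e2 e20 C2] := near_vt (near_and m1 (near_and (near_and m2 m3) (nF 0))).
have al3 : al <= e3 by rewrite ge_min lexx.
pose e := Num.min e2 al; have e0 : 0 < e by rewrite lt_min e20.
have [r /andP[r0 re] fz] := fold_zeros sF F0 Fv Fvv hb e0.
have re2 : r < e2 by rewrite (lt_le_trans re) // ge_min lexx.
have ral : r < al by rewrite (lt_le_trans re) // ge_min lexx orbT.
have Ual w : graph_box k j r al w -> forall l, `|w 0 l| < al.
  by move=> [wk wj] l; have /orP[/eqP ->|/eqP ->] := ord2_neq l kj => //; exact: lt_trans wj ral.
exists (graph_box k j r al); split.
- exact: open_graph_box.
- by rewrite /graph_box /= !mxE normr0.
- move=> w Uw; apply: VP; apply/ball_rowP => // l; rewrite mxE sub0r normrN.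
  by apply: lt_le_trans (Ual w Uw l) _; rewrite ge_min lexx orbT.
have nt : \forall t \near (0 : R), `|t| < e.
  by have /nbhs_ballP : exists2 d : R, 0 < d & ball (0 : R) d `<=` [set t | `|t| < e]
    by exists e => // u; rewrite /ball /= sub0r normrN.
apply: filterS2 fz nt => t [f1 f2] te.
have te2 : `|t| < e2 by rewrite (lt_le_trans te) // ge_min lexx.
have te3 : `|t| < e3 by rewrite (lt_le_trans te) // !ge_min lexx orbT.
have D3 w : graph_box k j r al w -> _ := fun Uw => C3 w t
  (fun l => lt_le_trans (Ual w Uw l) al3) te3.
have D2 v : `|v| < r -> _ := fun vr => C2 v t (lt_trans vr re2) te2.
have H1 v : `|v| < r -> smooth_near (vt v t) psi /\ `|psi (vt v t)| < al.
  by move=> vr; have [[[s1 s2] [a1 a2]] _] := D2 v vr.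
have H2 v : `|v| < r -> smooth_near (vt v t) psi' /\ `|psi' (vt v t)| < al.
  by move=> vr; have [[[s1 s2] [a1 a2]] _] := D2 v vr.
have H3 w : graph_box k j r al w ->
  [/\ smooth_near (uvt w t) P, smooth_near (uvt w t) M & smooth_near (uvt w t) K].
  by move=> Uw; have [[[s1 [s2 s3]] _] _] := D3 w Uw.
have H4 w : graph_box k j r al w ->
  [/\ K (uvt w t) != 0, pd (sp k) P (uvt w t) != 0 & pd (sp k) M (uvt w t) != 0].
  by move=> Uw; have [[_ [s1 [s2 s3]]] _] := D3 w Uw.
have H5 w : graph_box k j r al w -> (P (uvt w t) = 0 <-> w 0 k = psi (vt (w 0 j) t)) /\
  (M (uvt w t) = 0 <-> w 0 k = psi' (vt (w 0 j) t)).
  by move=> Uw; have [_ [[]]] := D3 w Uw; rewrite !uvt_sp !uvt_tm.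
have H6 w : graph_box k j r al w ->
    tdelta (x_ t) w = K (uvt w t) * (P (uvt w t) * M (uvt w t)).
  move=> Uw; have [_ [_]] := D3 w Uw; rewrite uvt_tm => <-; congr (tdelta _ _).
  by apply/rowP => i; rewrite mxE uvt_sp.
have H7 v : `|v| < r -> pd (sp k) P (emb k psi (vt v t)) * pd 0 psi (vt v t)
    + pd (sp j) P (emb k psi (vt v t)) = 0 /\
  pd 0 (fun y => M (emb k psi y)) (vt v t) = pd (sp k) M (emb k psi (vt v t)) * pd 0 psi (vt v t)
    + pd (sp j) M (emb k psi (vt v t)).
  by move=> vr; have [_ [[[<- ->] [-> _]] _]] := D2 v vr; rewrite pd_cst.
have H8 v : `|v| < r -> pd (sp k) M (emb k psi' (vt v t)) * pd 0 psi' (vt v t)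
    + pd (sp j) M (emb k psi' (vt v t)) = 0.
  by move=> vr; have [_ [[_ [_ [<- ->]]] _]] := D2 v vr; rewrite pd_cst.
have H9 v : `|v| < r -> pd 0 F (vt v t) = vv * pd 0 chi (vt v t).
  by move=> vr; have [_ [_]] := D2 v vr.
have Fz v : F (vt v t) = 0 <-> chi (vt v t) = 0.
  rewrite /F; split=> [/eqP|->]; last by rewrite mulr0.
  by rewrite mulf_eq0 (negbTE c2) => /eqP.
split=> ts.
  have [v1 [v2 [rv1 v12 v2r [d1 d2] z]]] := f1 ts.
  have n v : - r < v < r -> `|v| < r by rewrite ltr_norml.
  have cv v : - r < v < r -> pd 0 F (vt v t) != 0 -> pd 0 chi (vt v t) != 0.
    by move=> /n vr; rewrite H9 // mulf_eq0 negb_or => /andP[].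
  apply: (slice_two_crossing kj r0 H1 H2 H3 H4 H5 H6 H7 H8 rv1 v12 v2r).
  - by move=> v vr; split=> [/(Fz v).2/(z v vr).1|/(z v vr).2/(Fz v).1].
  - have i1 : - r < v1 < r by rewrite rv1 (lt_trans v12).
    exact: (cv v1 i1 d1).
  - have i2 : - r < v2 < r by rewrite v2r (lt_trans rv1).
    exact: (cv v2 i2 d2).
apply: (slice_two_disjoint kj r0 H1 H2 H3 H4 H5 H6) => v vr.
by apply: contra (f2 ts v vr) => /eqP h; apply/eqP/Fz.
Qed.

End LocalBifurcation.

(** * Null curvatures of a family of graphs in Monge form *)

Section SliceForms.
Context {R : realType}.
Variables (x y z : 'rV[R]_3 -> R) (w : 'rV[R]_2) (t : R).
Hypotheses (sx : smooth_near (uvt w t) x) (sy : smooth_near (uvt w t) y)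
  (sz : smooth_near (uvt w t) z).

Let xt v := x (uvt v t).
Let yt v := y (uvt v t).
Let zt v := z (uvt v t).

Lemma slice_form1 a b : form1 xt yt zt a b w = form1 x y z (sp a) (sp b) (uvt w t).
Proof. by rewrite /form1 /xt /yt /zt !pd_slice. Qed.

Lemma slice_form2 a b : form2 xt yt zt 0 1 a b w = form2 x y z (sp 0) (sp 1) (sp a) (sp b) (uvt w t).
Proof. by rewrite /form2 /normal /xt /yt /zt !pd2_slice // !pd_slice. Qed.

Lemma slice_disc : disc xt yt zt 0 1 w = disc x y z (sp 0) (sp 1) (uvt w t).
Proof. by rewrite /disc !slice_form1. Qed.

Lemma slice_nullD s : nullD s xt yt zt 0 1 w = nullD s x y z (sp 0) (sp 1) (uvt w t).
Proof. by rewrite /nullD slice_disc slice_form1. Qed.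

Lemma slice_nullP s : nullP s xt yt zt 0 1 w = nullP s x y z (sp 0) (sp 1) (uvt w t).
Proof. by rewrite /nullP slice_nullD !slice_form1 !slice_form2. Qed.

Lemma slice_nullM s : nullM s xt yt zt 0 1 w = nullM s x y z (sp 0) (sp 1) (uvt w t).
Proof. by rewrite /nullM slice_nullD !slice_form1 !slice_form2. Qed.

Lemma slice_lpl : lpl xt yt zt 0 1 w = lpl x y z (sp 0) (sp 1) (uvt w t).
Proof. by rewrite /lpl !slice_form1 !slice_form2. Qed.

End SliceForms.

Section MongeFamily.
Context {R : realType}.
Variables (i : 'I_3) (p : 'rV[R]_3) (f : 'rV[R]_2 -> R).
Hypothesis sf : smooth_near 0 f.
Implicit Types (h c : 'rV[R]_3 -> R) (l : 'I_3) (W : 'rV[R]_3).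

Let space W : 'rV[R]_2 := \row_m W 0 (sp m).

Definition graph3 h l W : R :=
  p 0 l + (if unlift i l is Some j then W 0 (sp j) else f (space W) + h W).

Let space0 : space 0 = 0. Proof. by apply/rowP => m; rewrite !mxE. Qed.

Let sspace : smooth_near 0 (fun W => f (space W)).
Proof.
apply: smooth_near_comp; last by rewrite space0.
move=> m; rewrite (_ : (fun w => _) = fun W : 'rV[R]_3 => W 0 (sp m)); first by smooth.
by apply/funext => W; rewrite mxE.
Qed.

Lemma smooth_graph3 h l : smooth_near 0 h -> smooth_near 0 (graph3 h l).
Proof. by move=> sh; rewrite /graph3; case: (unlift i l) => [j|]; smooth. Qed.

Lemma monge_graph3 h t w l : monge i p (deform f h t) w 0 l = graph3 h l (uvt w t).
Proof.
rewrite /monge /graph3 !mxE; case: (unlift i l) => [j|]; first by rewrite uvt_sp.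
by rewrite /deform (_ : space _ = w) //; apply/rowP => m; rewrite mxE uvt_sp.
Qed.

Definition nullP3 s h := nullP s (graph3 h 0) (graph3 h 1) (graph3 h 2) (sp 0) (sp 1).
Definition nullM3 s h := nullM s (graph3 h 0) (graph3 h 1) (graph3 h 2) (sp 0) (sp 1).
Definition disc3 h := disc (graph3 h 0) (graph3 h 1) (graph3 h 2) (sp 0) (sp 1).
Definition nullD3 s h := nullD s (graph3 h 0) (graph3 h 1) (graph3 h 2) (sp 0) (sp 1).

(* nonzero when the zero curves of the two null curvatures move apart with nonzero velocity *)
Definition drift s k h : R :=
  pd (sp k) (nullP3 s h) 0 * pd tm (nullM3 s h) 0 - pd (sp k) (nullM3 s h) 0 * pd tm (nullP3 s h) 0.

Section Deformation.
Variables (s : R) (k : 'I_2) (x : 'rV[R]_2 -> 'rV[R]_3) (h : 'rV[R]_3 -> R).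
Hypotheses (s2 : s ^+ 2 = 1) (sx : smooth_near 0 x)
  (xE : \forall w \near (0 : 'rV[R]_2), x w = monge i p f w).
Hypotheses (ux : umbilic0 x) (Jx : jac (P0 s x) (M0 s x) 0 = 0) (cx : contact s k x).
Hypotheses (sh : smooth_near 0 h) (h0 : \forall w \near (0 : 'rV[R]_2), h (uvt w 0) = 0).

Let Y (w : 'rV[R]_2) : 'rV[R]_3 := \row_l graph3 h l (uvt w 0).

Let xY : \forall w \near (0 : 'rV[R]_2), x w = Y w.
Proof.
apply: filterS2 xE h0 => w -> hw; apply/rowP => l; rewrite !mxE /graph3.
case: (unlift i l) => [j|]; first by rewrite uvt_sp.
by rewrite hw addr0 (_ : space _ = w) //; apply/rowP => m; rewrite mxE uvt_sp.
Qed.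

Let sg l : smooth_near 0 (graph3 h l). Proof. exact: smooth_graph3. Qed.

Let Yk : [/\ (fun w => Y w 0 0) = fun w => graph3 h 0 (uvt w 0),
  (fun w => Y w 0 1) = fun w => graph3 h 1 (uvt w 0) &
  (fun w => Y w 0 2) = fun w => graph3 h 2 (uvt w 0)].
Proof. by split; apply/funext => w; rewrite mxE. Qed.

Let nsg : \forall w \near (0 : 'rV[R]_2), forall l, smooth_near (uvt w 0) (graph3 h l).
Proof.
have n l : \forall w \near (0 : 'rV[R]_2), smooth_near (uvt w 0) (graph3 h l).
  have sl : \forall W \near uvt (0 : 'rV[R]_2) 0, smooth_near W (graph3 h l).
    by rewrite uvt00; exact: smooth_near_near (sg l).
  exact: near_continuous (uvt_continuous (w := 0) (t := 0)) sl.
apply: filterS3 (n 0) (n 1) (n 2) => w s0 s1 s2' l.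
have [->//|->//|->//] : [\/ l = 0, l = 1 | l = 2].
by case: l => [[|[|[|//]]] ?]; [constructor 1|constructor 2|constructor 3]; exact: val_inj.
Qed.

Let PY : \forall w \near (0 : 'rV[R]_2), P0 s x w = nullP3 s h (uvt w 0).
Proof.
have [e0 e1 e2] := Yk; apply: filterS2 (near_eq_P0 s xY) nsg => w -> sl.
by rewrite /P0 e0 e1 e2 (slice_nullP (sl 0) (sl 1) (sl 2)).
Qed.

Let MY : \forall w \near (0 : 'rV[R]_2), M0 s x w = nullM3 s h (uvt w 0).
Proof.
have [e0 e1 e2] := Yk; apply: filterS2 (near_eq_M0 s xY) nsg => w -> sl.
by rewrite /M0 e0 e1 e2 (slice_nullM (sl 0) (sl 1) (sl 2)).
Qed.

Lemma disc3_gt0 : 0 < disc3 h 0.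
Proof.
have [d0 _ _] := cx; have [e0 e1 e2] := Yk; have sl := nbhs_singleton nsg.
by move: d0; rewrite (near_eq_disc0 xY) /disc0 e0 e1 e2 (slice_disc (sl 0) (sl 1) (sl 2)) uvt00.
Qed.

Lemma nullD3_neq0 : nullD3 s h 0 != 0.
Proof.
have [_ D00 _] := cx; have [e0 e1 e2] := Yk; have sl := nbhs_singleton nsg.
by move: D00; rewrite (near_eq_D0 s xY) /D0 e0 e1 e2 (slice_nullD (sl 0) (sl 1) (sl 2)) uvt00.
Qed.

Lemma smooth_nullP3 : smooth_near 0 (nullP3 s h).
Proof. exact: (smooth_nullP s (sg 0) (sg 1) (sg 2) disc3_gt0). Qed.

Lemma smooth_nullM3 : smooth_near 0 (nullM3 s h).
Proof. exact: (smooth_nullM s (sg 0) (sg 1) (sg 2) disc3_gt0). Qed.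

Lemma pd_nullM3_neq0 : pd (sp k) (nullM3 s h) 0 != 0.
Proof.
have [_ _ [_ m _]] := cx; move: m; have sM := smooth_nullM3; rewrite -uvt00 in sM.
by rewrite (near_eq_pd k MY) (pd_slice k sM) uvt00.
Qed.

(** The null curvatures of the family, as functions of space and time, restrict at time 0 to those
    of [x]; this supplies the contact and the vanishing Jacobian, while [drift] is the velocity
    required by [local_bifurcation]. *)
Lemma monge_bifurcation : drift s k h != 0 ->
  LPL_bifurcation (fun t : R => monge i p (deform f h t)).
Proof.
move=> dr; have [_ _ c] := cx; have sP := smooth_nullP3; have sM := smooth_nullM3.
have sD : smooth_near 0 (nullD3 s h) := smooth_nullD s (sg 0) (sg 1) (sg 2) disc3_gt0.
have K0 : (nullD3 s h 0 ^+ 2)^-1 != 0 by rewrite invr_neq0 // expf_neq0 //; exact: nullD3_neq0.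
have sK : smooth_near 0 (fun W => (nullD3 s h W ^+ 2)^-1).
  apply: smooth_nearV; [smooth|rewrite expf_neq0 //; exact: nullD3_neq0].
have [Px Mx] := umbilic_null s2 ux.
have P00 : nullP3 s h 0 = 0 by rewrite -uvt00 -(nbhs_singleton PY).
have M00 : nullM3 s h 0 = 0 by rewrite -uvt00 -(nbhs_singleton MY).
have J0 : jac (fun w => nullP3 s h (uvt w 0)) (fun w => nullM3 s h (uvt w 0)) 0 = 0.
  by move: Jx; rewrite /jac !(near_eq_pd _ PY) !(near_eq_pd _ MY).
have c0 := near_eq_simple_contact PY MY c.
apply: (local_bifurcation sP sM sK K0 P00 M00 J0 c0 dr).
have n := lpl_factor_near (sg 0) (sg 1) (sg 2) s2 disc3_gt0 nullD3_neq0.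
have ns l := smooth_near_near (sg l).
apply: filterS3 n (ns 0) (filterI (ns 1) (ns 2)) => W <- s0 [s1 s3].
have E : W = uvt (space W) (W 0 tm) := uvtE W.
have e l : (fun w => monge i p (deform f h (W 0 tm)) w 0 l) = fun w => graph3 h l (uvt w (W 0 tm)).
  by apply/funext => w; exact: monge_graph3.
have sl l : smooth_near (uvt (space W) (W 0 tm)) (graph3 h l).
  rewrite -E; have [->//|->//|->//] : [\/ l = 0, l = 1 | l = 2].
  by case: l => [[|[|[|//]]] ?]; [constructor 1|constructor 2|constructor 3]; exact: val_inj.
rewrite tdelta_lpl.
  by rewrite !e (slice_lpl (sl 0) (sl 1) (sl 2)) -E.
apply/smooth_near_row => l; rewrite e; exact: smooth_slice (sl l).
Qed.

End Deformation.

(** [drift] is a function of the 3-jet of the deformation: second derivatives for the null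
    curvatures and one more for their gradients. *)
Lemma drift_continuous s k (h : deformation R) : 0 < disc3 h 0 ->
  {for h, continuous (fun g : deformation R => drift s k g)}.
Proof.
move=> d0; have jh := jets_deformation 3 h.
have jg l : jets_at 3 (fun (g : deformation R) => graph3 g l) h.
  rewrite /graph3; case: (unlift i l) => [j|].
    by apply: jets_cst; smooth.
  apply: jetsD; first by apply: jets_cst; smooth.
  by apply: jetsD jh; apply: jets_cst; exact: sspace.
have jP := jets_nullP (jg 0) (jg 1) (jg 2) d0 s; have jM := jets_nullM (jg 0) (jg 1) (jg 2) d0 s.
have j0 := jetsD (jetsM (jets_pd (sp k) jP) (jets_pd tm jM))
  (jetsN (jetsM (jets_pd (sp k) jM) (jets_pd tm jP))).
exact: jets_continuous j0.
Qed.

Lemma normal_graph3 h W : normal (graph3 h (lift i 0)) (graph3 h (lift i 1)) (sp 0) (sp 1) W = 1.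
Proof.
have e j : graph3 h (lift i j) = fun W => p 0 (lift i j) + W 0 (sp j).
  by apply/funext => V; rewrite /graph3 liftK.
have d a j : pd (sp a) (graph3 h (lift i j)) W = (a == j)%:R.
  rewrite e pdD; [|smooth|smooth]; rewrite pd_cst pd_coord add0r.
  by rewrite (inj_eq (@lshift_inj 2 1)).
by rewrite /normal !d /=; ring.
Qed.

(** A graph over a coordinate plane is transversal to the remaining axis: the corresponding
    component of the normal is 1 or -1. *)
Lemma graph_direction_normal h W :
  normal (graph3 h 1) (graph3 h 2) (sp 0) (sp 1) W * (i == 0)%:R
  + normal (graph3 h 2) (graph3 h 0) (sp 0) (sp 1) W * (i == 1)%:R
  + normal (graph3 h 0) (graph3 h 1) (sp 0) (sp 1) W * (i == 2)%:R != 0.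
Proof.
have nN x y : normal y x (sp 0) (sp 1) W = - normal x y (sp 0) (sp 1) W by rewrite /normal; gen_pd; ring.
have := normal_graph3 h W; have : [\/ i = 0, i = 1 | i = 2].
  by case: i => [[|[|[|//]]] ?]; [constructor 1|constructor 2|constructor 3]; exact: val_inj.
case=> -> /=; rewrite ?mulr1 ?mulr0 ?addr0 ?add0r.
- have -> : lift 0 0 = 1 :> 'I_3 by exact: val_inj.
  have -> : lift 0 1 = 2 :> 'I_3 by exact: val_inj.
  by move=> ->; rewrite oner_eq0.
- have -> : lift 1 0 = 0 :> 'I_3 by exact: val_inj.
  have -> : lift 1 1 = 2 :> 'I_3 by exact: val_inj.
  by move=> e; rewrite nN e oppr_eq0 oner_eq0.
- have -> : lift 2 0 = 0 :> 'I_3 by exact: val_inj.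
  have -> : lift 2 1 = 1 :> 'I_3 by exact: val_inj.
  by move=> ->; rewrite oner_eq0.
Qed.

Section DriftPerturbation.
Variables (l0 l1 : R).

Let ell W : R := l0 * W 0 (sp 0) + l1 * W 0 (sp 1).
Let c W : R := W 0 tm * ell W ^+ 2.
Let L (l : 'I_3) : R := l0 * (l == sp 0)%:R + l1 * (l == sp 1)%:R.

Let sell W : smooth_near W ell. Proof. by rewrite /ell; smooth. Qed.
Let stm W : smooth_near W (fun W : 'rV[R]_3 => W 0 tm). Proof. by smooth. Qed.
Let sc W : smooth_near W c. Proof. by have := sell W; rewrite /c => ?; smooth. Qed.

Let pell l W : pd l ell W = L l.
Proof. by rewrite /ell pdD ?pdZ ?pd_coord //; smooth. Qed.

Let Lsp (a : 'I_2) : L (sp a) = if a == 0 then l0 else l1.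
Proof.
rewrite /L !(inj_eq (@lshift_inj 2 1)).
by case: a => [[|[|//]] ?] /=; rewrite ?mulr1 ?mulr0 ?addr0 ?add0r.
Qed.

Let jc : jeq 3 c (fun=> 0).
Proof.
apply: (@jeq0M_linear _ _ 2 (fun l => (l == tm)%:R) (fun W => ell W ^+ 2)).
- exact: stm.
- by have := sell 0 => ?; smooth.
- by rewrite mxE.
- by move=> l W; rewrite pd_coord.
- apply: (@jeq_near _ _ 2 (fun W => ell W * ell W) _ (fun=> 0)); [by near=> W; rewrite expr2|by near=> W|].
  apply: (@jeq0M_linear _ _ 1 L ell ell (sell 0) (sell 0) _ pell).
    by rewrite /ell !mxE !mulr0 addr0.
  by split=> //; rewrite /ell !mxE !mulr0 addr0.
Unshelve. all: by end_near. Qed.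

Let pc2 (a b : 'I_2) W : pd (sp a) (pd (sp b) c) W = 2 * W 0 tm * (L (sp a) * L (sp b)).
Proof.
have e : pd (sp b) c = fun W => (2 * L (sp b)) * (W 0 tm * ell W).
  apply/funext => V; have sV := sell V; rewrite /c pdM; [|smooth|smooth].
  by rewrite pd_coord sp_neq_tm mul0r add0r pdX ?pell; [rewrite expr1; ring|smooth].
rewrite e; have sW := sell W; rewrite pdZ; last by smooth.
by rewrite pdM ?pd_coord ?pell; [rewrite sp_neq_tm mul0r add0r; ring|smooth|smooth].
Qed.

(** The added function is the time multiplied by the square of a linear form in the space variables.
    The increments of the null curvatures carry the factor time, so at 0 only their time derivatives
    change, by 2 times the normal component times the squared value of the form on the respective
    null vector. *)
Lemma drift_perturb s k h (t : R) : smooth_near 0 h -> 0 < disc3 h 0 ->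
  let E := form1 (graph3 h 0) (graph3 h 1) (graph3 h 2) (sp 0) (sp 0) 0 in
  let G := form1 (graph3 h 0) (graph3 h 1) (graph3 h 2) (sp 1) (sp 1) 0 in
  let D := nullD3 s h 0 in
  let n := normal (graph3 h 1) (graph3 h 2) (sp 0) (sp 1) 0 * (i == 0)%:R
    + normal (graph3 h 2) (graph3 h 0) (sp 0) (sp 1) 0 * (i == 1)%:R
    + normal (graph3 h 0) (graph3 h 1) (sp 0) (sp 1) 0 * (i == 2)%:R in
  drift s k (fun W => h W + t * (W 0 tm * (l0 * W 0 (sp 0) + l1 * W 0 (sp 1)) ^+ 2)) = drift s k h +
    t * (2 * n) * (pd (sp k) (nullP3 s h) 0 * (l1 * D - l0 * G) ^+ 2
      - pd (sp k) (nullM3 s h) 0 * (l0 * D - l1 * E) ^+ 2).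
Proof.
move=> sh d0 E G D n; set h' := fun W => h W + _.
have sc0 := sc 0; have sh' : smooth_near 0 h' by rewrite /h' -/(ell _) -/(c _); smooth.
have sg l := smooth_graph3 l sh; have sg' l := smooth_graph3 l sh'.
have gE l : \forall W \near (0 : 'rV[R]_3), graph3 h' l W = graph3 h l W + (t * (i == l)%:R) * c W.
  near=> W; rewrite /graph3; have [->|il] := eqVneq i l.
    by rewrite unlift_none /h' mulr1 !addrA.
  by have [j _ ->] := unlift_some il; rewrite mulr0 mul0r addr0.
have jP := nullP_perturb s (sg 0) (sg 1) (sg 2) (sg' 0) (sg' 1) (sg' 2) sc0 (gE 0) (gE 1) (gE 2) jc d0.
have jM := nullM_perturb s (sg 0) (sg 1) (sg 2) (sg' 0) (sg' 1) (sg' 2) sc0 (gE 0) (gE 1) (gE 2) jc d0.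
have sD : smooth_near 0 (nullD3 s h) := smooth_nullD s (sg 0) (sg 1) (sg 2) d0.
have sP : smooth_near 0 (nullP3 s h) := smooth_nullP s (sg 0) (sg 1) (sg 2) d0.
have sM : smooth_near 0 (nullM3 s h) := smooth_nullM s (sg 0) (sg 1) (sg 2) d0.
have sE := smooth_form1 (sg 0) (sg 1) (sg 2) (sp 0) (sp 0).
have sG := smooth_form1 (sg 0) (sg 1) (sg 2) (sp 1) (sp 1).
have n1 := smooth_normal (sp 0) (sp 1) (sg 1) (sg 2).
have n2 := smooth_normal (sp 0) (sp 1) (sg 2) (sg 0).
have n3 := smooth_normal (sp 0) (sp 1) (sg 0) (sg 1).
have key (Q Q' T al : 'rV[R]_3 -> R) l : smooth_near 0 Q -> smooth_near 0 al ->
    jeq 2 Q' (fun W => Q W + T W) ->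
    (forall W, T W = t * (normal (graph3 h 1) (graph3 h 2) (sp 0) (sp 1) W * (i == 0)%:R
      + normal (graph3 h 2) (graph3 h 0) (sp 0) (sp 1) W * (i == 1)%:R
      + normal (graph3 h 0) (graph3 h 1) (sp 0) (sp 1) W * (i == 2)%:R) * (2 * al W ^+ 2) * W 0 tm) ->
    pd l Q' 0 = pd l Q 0 + t * (2 * n) * al 0 ^+ 2 * (l == tm)%:R.
  move=> sQ sal jQ /funext TE; rewrite (jeq_pd l jQ).1 TE pdD; [|smooth|smooth].
  congr (_ + _); rewrite pdM; [|smooth|smooth].
  by rewrite pd_coord mxE mulr0 add0r -/n; ring.
have kP l : pd l (nullP3 s h') 0 = pd l (nullP3 s h) 0 + t * (2 * n) * (l0 * D - l1 * E) ^+ 2 * (l == tm)%:R.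
  apply: (key _ _ _ (fun W => l0 * nullD3 s h W - l1 *
    form1 (graph3 h 0) (graph3 h 1) (graph3 h 2) (sp 0) (sp 0) W) l sP _ jP); first by smooth.
  move=> W; rewrite !pc2 !Lsp /= -/(nullD3 s h W).
  move: (normal _ _ _ _ _) (normal _ _ _ _ _) (normal _ _ _ _ _) (nullD3 _ _ _) (form1 _ _ _ _ _ _).
  by move=> *; ring.
have kM l : pd l (nullM3 s h') 0 = pd l (nullM3 s h) 0 + t * (2 * n) * (l1 * D - l0 * G) ^+ 2 * (l == tm)%:R.
  apply: (key _ _ _ (fun W => l1 * nullD3 s h W - l0 *
    form1 (graph3 h 0) (graph3 h 1) (graph3 h 2) (sp 1) (sp 1) W) l sM _ jM); first by smooth.
  move=> W; rewrite !pc2 !Lsp /= -/(nullD3 s h W).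
  move: (normal _ _ _ _ _) (normal _ _ _ _ _) (normal _ _ _ _ _) (nullD3 _ _ _) (form1 _ _ _ _ _ _).
  by move=> *; ring.
by rewrite /drift !kP !kM eqxx sp_neq_tm /=; ring.
Unshelve. all: by end_near. Qed.

End DriftPerturbation.

End MongeFamily.

(** * Generic deformations and the conclusion *)

Section Generic.
Context {R : realType}.
Variables (i : 'I_3) (p : 'rV[R]_3) (f : 'rV[R]_2 -> R) (x : 'rV[R]_2 -> 'rV[R]_3) (s : R) (k : 'I_2).
Hypotheses (sf : smooth_near 0 f) (s2 : s ^+ 2 = 1)
  (xE : \forall w \near (0 : 'rV[R]_2), x w = monge i p f w) (cx : contact s k x).

Let disc_gt0 (h : deformation R) : 0 < disc3 i p f h 0.
Proof. exact: (disc3_gt0 sf xE cx (deform_smooth h) (deform0 h)). Qed.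

Lemma open_drift : open [set h : deformation R | drift i p f s k h != 0].
Proof.
rewrite openE => h /= hd; rewrite /interior.
exact: (near_neq0 (drift_continuous sf (disc_gt0 h)) hd).
Qed.

(** The linear form (D, G) vanishes on the null vector (- G, D) and takes the value D^2 - EG on the
    other one. A multiple of the time times its square therefore moves P = 0 and leaves M = 0 at
    rest to first order, so a zero drift becomes nonzero. *)
Lemma dense_drift : dense [set h : deformation R | drift i p f s k h != 0].
Proof.
move=> U [h Uh] oU; have nU : nbhs h U by apply: open_nbhs_nbhs.
have [dh|dh] := eqVneq (drift i p f s k h) 0; last by exists h.
have sh := deform_smooth h; have dc := disc_gt0 h.
set D := nullD3 i p f s h 0; set E := form1 (graph3 i p f h 0) (graph3 i p f h 1) (graph3 i p f h 2) (sp 0) (sp 0) 0.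
set G := form1 (graph3 i p f h 0) (graph3 i p f h 1) (graph3 i p f h 2) (sp 1) (sp 1) 0.
pose c (W : 'rV[R]_3) := W 0 tm * (D * W 0 (sp 0) + G * W 0 (sp 1)) ^+ 2.
have sc : smooth_near 0 c by rewrite /c; smooth.
have c0 : \forall w \near (0 : 'rV[R]_2), c (uvt w 0) = 0.
  by near=> w; rewrite /c uvt_tm mul0r.
have [he [heE heU]] := deformation_path h sc c0.
have mk := pd_nullM3_neq0 sf xE cx sh (deform0 h).
have D0n := nullD3_neq0 sf xE cx sh (deform0 h).
have De := null_det_neq0 s2 dc D0n.
near (0 : R)^' => t.
have t0 : t != 0 by near: t; exact: nbhs_dnbhs_neq.
exists (he t); split; first by near: t; apply: nbhs_dnbhs; exact: heU.
rewrite /= (_ : (he t : _ -> _) = fun W => h W + t * c W); last by apply/funext => W; rewrite heE.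
rewrite (drift_perturb sf D G s k t sh dc) dh add0r -/D -/E -/G.
rewrite (_ : G * D - D * G = 0); last by ring.
rewrite expr0n /= mulr0 sub0r mulrN oppr_eq0 !mulf_neq0 ?pnatr_eq0 //.
  exact: graph_direction_normal.
all: by rewrite -expr2 [G * E]mulrC.
Unshelve. all: by end_near. Qed.

End Generic.

Lemma monge_smooth {R : realType} (i : 'I_3) (p : 'rV[R]_3) (f : 'rV[R]_2 -> R) x :
  smooth_near 0 x -> (\forall w \near (0 : 'rV[R]_2), x w = monge i p f w) -> smooth_near 0 f.
Proof.
move=> /smooth_near_row /(_ i) sx xE.
apply: (@smooth_near_eq _ _ 0 (fun w => x w 0 i - p 0 i)); last by smooth.
by apply: filterS xE => w ->; rewrite !mxE unlift_none addrAC subrr add0r.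
Qed.

Theorem theorem4p5 (R : realType) :
  generic_in (@G3 R)
    [set M : surface_germ R |
      (forall x : param R, local_param M x -> A_minus 3 x 0) /\
      (forall (i : 'I_3) (p : 'rV[R]_3) (f : 'rV[R]_2 -> R),
         monge_form M i p f ->
         exists2 O : set (deformation R), open O /\ dense O &
           forall h : deformation R, O h ->
             LPL_bifurcation (fun t : R => monge i p (deform f h t)))].
Proof.
set Q := [set M : surface_germ R | _].
have OQ M : G3 M -> (exists y s i, [/\ local_param M y, s ^+ 2 = 1 & contact s i y]) -> Q M.
  move=> G3M [y [s [i [My s2 cy]]]].
  have A3 x : local_param M x -> A_minus 3 x 0.
    move=> Mx; have [_ D00 _] := cy.
    exact: contact_A_minus (G3_umbilic G3M My) s2 (G3_jac G3M My s2 D00) cy (local_param_reparam My Mx).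
  split=> // l p f [_ [x Mx xE]]; have ux := G3_umbilic G3M Mx.
  (* The Monge parametrization [x] need not be the [y] with known contact; type A_3 holds in every
     parametrization and returns contact for [x], with its own sign and direction. *)
  have [s' [k [s'2 cx]]] := A_minus_contact ux (A3 x Mx); have [_ D00 _] := cx.
  have sx := param_smooth x; have sf := monge_smooth sx xE.
  exists [set h : deformation R | drift l p f s' k h != 0].
    by split; [exact: open_drift sf xE cx|exact: dense_drift sf s'2 xE cx].
  move=> h; exact: (monge_bifurcation sf s'2 xE ux (G3_jac G3M Mx s'2 D00) cx (deform_smooth h) (deform0 h)).
split.
  exists [set M : surface_germ R | exists y s i, [/\ local_param M y, s ^+ 2 = 1 & contact s i y]].
    exact: contact_open.
  (* Inside [G3] the property and the open condition define the same set: [OQ] is one inclusion, and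
     the other uses only the A_3 part of the property. *)
  apply/seteqP; split=> M [G3M]; last by move=> c; split=> //; exact: OQ.
  have [x Mx _] := G3M; move=> [A3 _]; split=> //.
  have [s [i [s2 cx]]] := A_minus_contact (G3_umbilic G3M Mx) (A3 x Mx).
  by exists x, s, i.
move=> M G3M B nB; have [M' [BM' G3M' c]] := G3_dense_contact G3M nB.
by exists M'; split=> //; split=> //; exact: OQ.
Qed.
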